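(* Let $K$ be a field of characteristic zero and let $X\subset\mathbb P^4_K$ be a $10$-nodal cubic threefold over $K$ with smooth locus $X^0$. Then every universal torsor $T$ over $X^0$ is $K$-birational to a line bundle over a twist (a $K$-form) of the Grassmannian $Gr=Gr(2,6)$.
   Context: A $10$-nodal cubic threefold over $K$ is a cubic hypersurface $X\subset\mathbb P^4_K$ such that the singular locus of $X\otimes\overline K$ consists of exactly ten points, each an ordinary node. Universal torsors (Colliot-Thélène--Sansuc): let $V$ be a smooth geometrically integral $K$-variety with $\overline K[V]^*=\overline K^*$ and $\operatorname{Pic}(V_{\overline K})$ finitely generated and torsion-free, and let $S_0$ be the $K$-torus whose character module $\hat S_0$ is the $\operatorname{Gal}_K$-module $\operatorname{Pic}(V_{\overline K})$. There is an exact sequence $0\to H^1(K,S_0)\to H^1(V,S_0)\xrightarrow{\chi}\operatorname{Hom}_{\operatorname{Gal}_K}(\hat S_0,\operatorname{Pic}(V_{\overline K}))$; a torsor over $V$ under $S_0$ is universal if the image of its class under $\chi$ is the identity. *)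

(* Defs.v *)
From HB Require Import structures.
From mathcomp Require Import all_boot all_order all_algebra all_field.
From mathcomp Require Import mpoly.
From mathcomp Require Import boolp.

Set Implicit Arguments.
Unset Strict Implicit.
Unset Printing Implicit Defensive.

Import GRing.Theory.
Local Open Scope ring_scope.
Local Open Scope quotient_scope.

(* L is an algebraic closure of the field K of characteristic 0, embedded by  *)
(* iota.  A reduced quasi-projective K-scheme is identified with its set of    *)
(* L-points, a subset of some P^n x A^r that is locally closed for the         *)
(* K-Zariski topology; forms of Gr(2,6), line bundles on them, and torsors     *)
(* under tori over the smooth locus of a cubic are all of this kind (the last  *)
(* ones are smooth, and affine over the base).  The factor A^r makes products  *)
(* with affine spaces available without Segre embeddings.  Notions depending   *)
(* on a morphism j : k -> L are relative to k: one takes j = iota for notions  *)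
(* over K and j = idfun for notions over L.                                    *)

(* Each point of P^n(L) has a unique representative whose first nonzero        *)
(* coordinate is 1; equality of points is then equality of representatives.    *)
Definition normalized (L : fieldType) n (v : 'rV[L]_n) :=
  [exists i, (v 0 i == 1) && [forall j : 'I_n, (j < i)%N ==> (v 0 j == 0)]].

Definition proj (L : fieldType) n := {v : 'rV[L]_n.+1 | normalized v}.

Definition amb (L : fieldType) n r := (proj L n * 'rV[L]_r)%type.

Definition coords (L : fieldType) n r (x : amb L n r) : 'rV[L]_(n.+1 + r) :=
  row_mx (val x.1) x.2.

Definition ext (L : fieldType) n r l (x : amb L n r) (a : 'rV[L]_l) :
  amb L n (r + l) := (x.1, row_mx x.2 a).

Definition base (L : fieldType) n r l (x : amb L n (r + l)) : amb L n r :=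
  (x.1, lsubmx x.2).

Definition pdeg n r (m : 'X_{1..n + r}) : nat := (\sum_(i < n) m (lshift r i))%N.

Fact pdeg0 n r : @pdeg n r 0%MM = 0%N.
Proof. by rewrite /pdeg big1 // => i _; rewrite mnm0E. Qed.

Fact pdegD n r : {morph @pdeg n r : m1 m2 / (m1 + m2)%MM >-> (m1 + m2)%N}.
Proof.
by move=> m1 m2; rewrite /pdeg -big_split; apply: eq_bigr => i _; rewrite mnmDE.
Qed.

HB.instance Definition _ n r := isMeasure.Build (n + r) (@pdeg n r) (@pdeg0 n r) (@pdegD n r).

Definition form (k : fieldType) n r d (F : {mpoly k[n.+1 + r]}) : bool :=
  F \is d.-homog for (Measure.clone _ (@pdeg n.+1 r) _).

Definition ev (k L : fieldType) (j : {rmorphism k -> L}) n r (F : {mpoly k[n.+1 + r]})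
  (x : amb L n r) : L := mmap j (coords x 0) F.

Section Geometry.

Variables (k L : fieldType) (j : {rmorphism k -> L}).

Definition loc_closed n r (X : amb L n r -> Prop) : Prop :=
  exists Z U : seq {mpoly k[n.+1 + r]},
    [/\ {in Z, forall F, exists d, form d F}, {in U, forall F, exists d, form d F}
      & forall x, X x <-> {in Z, forall F, ev j F x = 0} /\
                          exists2 F, F \in U & ev j F x != 0].

(* U is open in X (only U :&: X matters).                                      *)
Definition open_in n r (X U : amb L n r -> Prop) : Prop :=
  forall x, X x -> U x -> exists d (G : {mpoly k[n.+1 + r]}),
    [/\ form d G, ev j G x != 0 & forall y, X y -> ev j G y != 0 -> U y].

Definition reg_fun n r (X : amb L n r -> Prop) (g : amb L n r -> L) : Prop :=
  forall x, X x -> exists d (G H : {mpoly k[n.+1 + r]}),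
    [/\ form d G, form d H, ev j H x != 0
      & forall y, X y -> ev j H y != 0 -> g y = ev j G y / ev j H y].

Definition reg_map n r n' r' (X : amb L n r -> Prop) (Y : amb L n' r' -> Prop)
    (f : amb L n r -> amb L n' r') : Prop :=
  [/\ forall x, X x -> Y (f x),
      forall x, X x -> exists d (F : 'I_n'.+1 -> {mpoly k[n.+1 + r]}),
        [/\ forall i, form d (F i), exists i, ev j (F i) x != 0
          & forall y, X y -> (exists i, ev j (F i) y != 0) ->
              exists c, forall i, ev j (F i) y = c * val (f y).1 0 i]
    & forall i, reg_fun X (fun x => (f x).2 0 i)].

Definition is_iso n r n' r' (X : amb L n r -> Prop) (Y : amb L n' r' -> Prop)
    (f : amb L n r -> amb L n' r') : Prop :=
  reg_map X Y f /\ exists g, [/\ reg_map Y X g,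
    forall x, X x -> g (f x) = x & forall y, Y y -> f (g y) = y].

Definition prod_affine n r l (X : amb L n r -> Prop) : amb L n (r + l) -> Prop :=
  fun z => X (base z).

Lemma evM n r (F G : {mpoly k[n.+1 + r]}) (x : amb L n r) :
  ev j (F * G) x = ev j F x * ev j G x.
Proof. exact: rmorphM. Qed.

Lemma formM n r d e (F G : {mpoly k[n.+1 + r]}) :
  form d F -> form e G -> form (d + e) (F * G).
Proof. exact: dhomogM. Qed.

Lemma form1 n r : form 0 (1 : {mpoly k[n.+1 + r]}).
Proof. exact: dhomog1. Qed.

Lemma ev1 n r (x : amb L n r) : ev j 1 x = 1.
Proof. exact: rmorph1. Qed.

Lemma open_inT n r (X : amb L n r -> Prop) : open_in X (fun=> True).
Proof.
by move=> x _ _; exists 0%N, 1; split; rewrite ?ev1 ?oner_neq0 //; apply: form1.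
Qed.

Lemma open_inI n r (X U V : amb L n r -> Prop) :
  open_in X U -> open_in X V -> open_in X (fun x => U x /\ V x).
Proof.
move=> oU oV x Xx [Ux Vx].
have [d [G [fG Gx GU]]] := oU x Xx Ux; have [e [H [fH Hx HV]]] := oV x Xx Vx.
exists (d + e)%N, (G * H); split; first exact: formM.
  by rewrite evM mulf_neq0.
move=> y Xy; rewrite evM mulf_eq0 negb_or => /andP[Gy Hy].
by split; [apply: GU | apply: HV].
Qed.

Lemma reg_fun1 n r (X : amb L n r -> Prop) : reg_fun X (fun=> 1).
Proof.
move=> x _; exists 0%N, 1, 1; split; rewrite ?ev1 ?oner_neq0 //; try exact: form1.
by move=> y _ _; rewrite ev1 divr1.
Qed.

Lemma reg_funM n r (X : amb L n r -> Prop) g h :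
  reg_fun X g -> reg_fun X h -> reg_fun X (fun x => g x * h x).
Proof.
move=> rg rh x Xx; have [d [G [H [fG fH Hx gE]]]] := rg x Xx.
have [e [G' [H' [fG' fH' Hx' hE]]]] := rh x Xx.
exists (d + e)%N, (G * G'), (H * H'); split; try exact: formM.
  by rewrite evM mulf_neq0.
move=> y Xy; rewrite !evM mulf_eq0 negb_or => /andP[Hy Hy'].
by rewrite gE // hE // mulf_div.
Qed.

Lemma reg_funV n r (X : amb L n r -> Prop) g :
  (forall x, X x -> g x != 0) -> reg_fun X g -> reg_fun X (fun x => (g x)^-1).
Proof.
move=> g0 rg x Xx; have [d [G [H [fG fH Hx gE]]]] := rg x Xx.
have Gx : ev j G x != 0.
  by have:= g0 x Xx; rewrite gE // mulf_eq0 invr_eq0 negb_or => /andP[].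
exists (d + d)%N, (H * H), (G * H); split; try exact: formM.
  by rewrite evM mulf_neq0.
move=> y Xy; rewrite !evM mulf_eq0 negb_or => /andP[Gy Hy].
by rewrite gE // invf_div -mulf_div divff // mulr1.
Qed.

Lemma reg_funS n r (X Y : amb L n r -> Prop) g :
  (forall x, Y x -> X x) -> reg_fun X g -> reg_fun Y g.
Proof.
move=> YX rg x Yx; have [d [G [H [fG fH Hx gE]]]] := rg x (YX x Yx).
by exists d, G, H; split=> // y Yy; apply/gE/YX.
Qed.

End Geometry.

(* Pic (X_L) = H^1(X_L, O^* ): a Cech class is given on a Zariski open         *)
(* cover indexed by the points of X, x lying in nbh x; up to refinement every  *)
(* open cover is of this form.  The associated line bundle has local           *)
(* coordinates zeta_x over nbh x related by zeta_y = trf x y * zeta_x.         *)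

Section Picard.

Variables (L : fieldType) (n r : nat) (X : amb L n r -> Prop).
Local Notation pt := (amb L n r).

Record cocycle := Cocycle {
  nbh : pt -> pt -> Prop;
  trf : pt -> pt -> pt -> L;
  nbh_open : forall x, X x -> open_in idfun X (nbh x);
  nbh_self : forall x, X x -> nbh x x;
  trf_reg : forall x y, X x -> X y ->
    reg_fun idfun (fun z => [/\ X z, nbh x z & nbh y z]) (trf x y);
  trf_neq0 : forall x y z, X x -> X y -> X z -> nbh x z -> nbh y z ->
    trf x y z != 0;
  trf_cocycle : forall x y w z, X x -> X y -> X w -> X z ->
    nbh x z -> nbh y z -> nbh w z -> trf x w z = trf y w z * trf x y z
}.

Definition cohomologous (c d : cocycle) : Prop :=
  exists (V : pt -> pt -> Prop) (h : pt -> pt -> L),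
    (forall x, X x ->
       [/\ open_in idfun X (V x), V x x,
           forall z, X z -> V x z -> nbh c x z /\ nbh d x z,
           reg_fun idfun (fun z => X z /\ V x z) (h x)
         & forall z, X z -> V x z -> h x z != 0]) /\
    (forall x y z, X x -> X y -> X z -> V x z -> V y z ->
       trf d x y z * h x z = h y z * trf c x y z).

Lemma cohomologous_of_eq (c d : cocycle) :
  (forall x y z, X x -> X y -> X z -> nbh c x z -> nbh c y z ->
     nbh d x z -> nbh d y z -> trf d x y z = trf c x y z) -> cohomologous c d.
Proof.
move=> E; exists (fun x z => nbh c x z /\ nbh d x z), (fun _ _ => 1); split.
  move=> x Xx; split; last by move=> *; apply: oner_neq0.
  - by apply: open_inI; apply: nbh_open.
  - by split; apply: nbh_self.
  - by [].
  - exact: reg_fun1.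
by move=> x y z Xx Xy Xz [? ?] [? ?]; rewrite mulr1 mul1r E.
Qed.

Lemma cohomologous_refl c : cohomologous c c.
Proof. exact: cohomologous_of_eq. Qed.

Lemma cohomologous_sym c d : cohomologous c d -> cohomologous d c.
Proof.
case=> V [h [H E]]; exists V, (fun x z => (h x z)^-1); split.
  move=> x Xx; have [oV Vx VS rh h0] := H x Xx; split=> //.
  - by move=> z Xz /(VS z Xz)[].
  - by apply: reg_funV rh => z [Xz /(h0 z Xz)].
  - by move=> z Xz Vz; rewrite invr_eq0 h0.
move=> x y z Xx Xy Xz Vx Vy.
have [_ _ _ _ /(_ z Xz Vx) hx] := H x Xx; have [_ _ _ _ /(_ z Xz Vy) hy] := H y Xy.
by apply: (mulfI hy); rewrite mulrA -E // mulfK // mulVKf.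
Qed.

Lemma cohomologous_trans c d e :
  cohomologous c d -> cohomologous d e -> cohomologous c e.
Proof.
case=> V [h [H E]] [V' [h' [H' E']]].
exists (fun x z => V x z /\ V' x z), (fun x z => h' x z * h x z); split.
  move=> x Xx; have [oV Vx VS rh h0] := H x Xx.
  have [oV' Vx' VS' rh' h0'] := H' x Xx; split=> //.
  - exact: open_inI.
  - by move=> z Xz [Vz Vz']; split; [case: (VS z Xz Vz) | case: (VS' z Xz Vz')].
  - by apply: reg_funM; [apply: reg_funS rh' | apply: reg_funS rh]; move=> z [? []].
  - by move=> z Xz [Vz Vz']; rewrite mulf_neq0 ?h0 ?h0'.
move=> x y z Xx Xy Xz [Vx Vx'] [Vy Vy'].
by rewrite mulrA E' // -mulrA E // mulrA.
Qed.

HB.instance Definition _ := gen_eqMixin cocycle.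
HB.instance Definition _ := gen_choiceMixin cocycle.

Definition cohomologousb (c d : cocycle) : bool := `[< cohomologous c d >].

Fact cohomologousb_refl : reflexive cohomologousb.
Proof. by move=> c; apply/asboolP/cohomologous_refl. Qed.

Fact cohomologousb_sym c d : cohomologousb c d = cohomologousb d c.
Proof. by apply/asboolP/asboolP => /cohomologous_sym. Qed.

Fact cohomologousb_trans : transitive cohomologousb.
Proof.
move=> c d e /asboolP dc /asboolP ce; apply/asboolP.
exact: cohomologous_trans dc ce.
Qed.

Canonical cohomologous_equiv :=
  EquivRel cohomologousb cohomologousb_refl cohomologousb_sym cohomologousb_trans.

Definition Pic := {eq_quot cohomologousb}.

HB.instance Definition _ := Choice.on Pic.

Definition cl (c : cocycle) : Pic := \pi_Pic c.

Lemma clP c d : cl c = cl d <-> cohomologous c d.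
Proof.
split=> [/eqmodP/asboolP // | cd]; apply/eqmodP; exact/asboolP.
Qed.

Lemma cl_repr (a : Pic) : cl (repr a) = a.
Proof. exact: reprK. Qed.

Program Definition cocycle1 : cocycle :=
  @Cocycle (fun _ _ => True) (fun _ _ _ => 1) _ _ _ _ _.
Next Obligation. exact: open_inT. Qed.
Next Obligation. exact: reg_fun1. Qed.
Next Obligation. exact: oner_neq0. Qed.
Next Obligation. by rewrite mulr1. Qed.

Program Definition cocycleV (c : cocycle) : cocycle :=
  @Cocycle (nbh c) (fun x y z => (trf c x y z)^-1) _ _ _ _ _.
Next Obligation. exact: nbh_open. Qed.
Next Obligation. exact: nbh_self. Qed.
Next Obligation.
by apply: reg_funV; [move=> z [? ? ?]; apply: trf_neq0 | apply: trf_reg].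
Qed.
Next Obligation. by rewrite invr_eq0 trf_neq0. Qed.
Next Obligation. by rewrite (@trf_cocycle c x y w z) // invfM. Qed.

Program Definition cocycleM (c d : cocycle) : cocycle :=
  @Cocycle (fun x z => nbh c x z /\ nbh d x z)
           (fun x y z => trf c x y z * trf d x y z) _ _ _ _ _.
Next Obligation. by apply: open_inI; apply: nbh_open. Qed.
Next Obligation. by split; apply: nbh_self. Qed.
Next Obligation.
by apply: reg_funM;
  [apply: (reg_funS (X := fun z => [/\ X z, nbh c x z & nbh c y z]))
  |apply: (reg_funS (X := fun z => [/\ X z, nbh d x z & nbh d y z]))];
  try exact: trf_reg; move=> z [? [? ?] [? ?]].
Qed.
Next Obligation. by rewrite mulf_neq0 ?trf_neq0. Qed.
Next Obligation.
by rewrite (@trf_cocycle c x y w z) // (@trf_cocycle d x y w z) // mulrACA.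
Qed.

Definition pic_zero : Pic := cl cocycle1.
Definition pic_opp (a : Pic) : Pic := cl (cocycleV (repr a)).
Definition pic_add (a b : Pic) : Pic := cl (cocycleM (repr a) (repr b)).

Lemma cohomologousM c c' d d' :
  cohomologous c c' -> cohomologous d d' -> cohomologous (cocycleM c d) (cocycleM c' d').
Proof.
case=> V [h [H E]] [V' [h' [H' E']]].
exists (fun x z => V x z /\ V' x z), (fun x z => h x z * h' x z); split.
  move=> x Xx; have [oV Vx VS rh h0] := H x Xx.
  have [oV' Vx' VS' rh' h0'] := H' x Xx; split=> //.
  - exact: open_inI.
  - by move=> z Xz [/(VS z Xz)[? ?] /(VS' z Xz)[? ?]].
  - by apply: reg_funM; [apply: reg_funS rh | apply: reg_funS rh']; move=> z [? []].
  - by move=> z Xz [Vz Vz']; rewrite mulf_neq0 ?h0 ?h0'.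
by move=> x y z Xx Xy Xz [Vx Vx'] [Vy Vy'] /=; rewrite mulrACA E // E' // mulrACA.
Qed.

Lemma cohomologousV c d : cohomologous c d -> cohomologous (cocycleV c) (cocycleV d).
Proof.
case=> V [h [H E]]; exists V, (fun x z => (h x z)^-1); split.
  move=> x Xx; have [oV Vx VS rh h0] := H x Xx; split=> //.
  - by apply: reg_funV rh => z [Xz /(h0 z Xz)].
  - by move=> z Xz Vz; rewrite invr_eq0 h0.
by move=> x y z Xx Xy Xz Vx Vy /=; rewrite -!invfM E.
Qed.

Lemma clM c d : cl (cocycleM c d) = pic_add (cl c) (cl d).
Proof. by apply/clP/cohomologousM; apply/clP; rewrite cl_repr. Qed.

Lemma clV c : cl (cocycleV c) = pic_opp (cl c).
Proof. by apply/clP/cohomologousV/clP; rewrite cl_repr. Qed.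

Fact pic_addA : associative pic_add.
Proof.
move=> a b c; rewrite -[a]cl_repr -[b]cl_repr -[c]cl_repr -!clM.
by apply/clP/cohomologous_of_eq => x y z *; rewrite /= mulrA.
Qed.

Fact pic_addC : commutative pic_add.
Proof.
move=> a b; rewrite -[a]cl_repr -[b]cl_repr -!clM.
by apply/clP/cohomologous_of_eq => x y z *; rewrite /= mulrC.
Qed.

Fact pic_add0 : left_id pic_zero pic_add.
Proof.
move=> a; rewrite -[a]cl_repr -clM.
by apply/clP/cohomologous_of_eq => x y z *; rewrite /= mul1r.
Qed.

Fact pic_addN : left_inverse pic_zero pic_opp pic_add.
Proof.
move=> a; rewrite -[a]cl_repr -clV -clM.
apply/clP/cohomologous_of_eq => x y z Xx Xy Xz [? ?] [? ?] *.
by rewrite /= mulVf // trf_neq0.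
Qed.

HB.instance Definition _ :=
  GRing.isZmodule.Build Pic pic_addA pic_addC pic_add0 pic_addN.

End Picard.

Section OverK.

Variables (K : fieldType) (L : closedFieldType) (iota : {rmorphism K -> L}).

Record variety := Variety {
  vn : nat;
  vr : nat;
  pts :> amb L vn vr -> Prop;
  pts_loc_closed : loc_closed iota pts
}.

Record galois := Galois {
  gal :> {rmorphism L -> L};
  gal_inv : {rmorphism L -> L};
  galK : cancel gal gal_inv;
  gal_invK : cancel gal_inv gal;
  gal_iota : forall a, gal (iota a) = iota a
}.

Fact galV_iota (s : galois) a : gal_inv s (iota a) = iota a.
Proof. by apply: (can_inj (galK s)); rewrite gal_invK gal_iota. Qed.

Definition galV (s : galois) : galois :=
  @Galois (gal_inv s) s (gal_invK s) (galK s) (galV_iota s).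

Fact normalized_gal (s : galois) n (v : 'rV[L]_n) :
  normalized v -> normalized (map_mx s v).
Proof.
case/existsP=> i /andP[/eqP vi /forallP vj]; apply/existsP; exists i.
rewrite mxE vi rmorph1 eqxx; apply/forallP => l; apply/implyP => li.
by have /implyP/(_ li)/eqP := vj l; rewrite mxE => ->; rewrite rmorph0.
Qed.

Definition gal_pt (s : galois) n r (x : amb L n r) : amb L n r :=
  (exist _ (map_mx s (val x.1)) (normalized_gal s (valP x.1)), map_mx s x.2).

Lemma coords_gal (s : galois) n r (x : amb L n r) i :
  coords (gal_pt s x) 0 i = s (coords x 0 i).
Proof. by rewrite !mxE; case: split => l; rewrite mxE. Qed.

Lemma gal_ptK (s : galois) n r (x : amb L n r) : gal_pt (galV s) (gal_pt s x) = x.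
Proof.
case: x => [[v Hv] w]; congr pair; first apply: val_inj;
  by apply/rowP => i; rewrite !mxE /= galK.
Qed.

Lemma gal_ptVK (s : galois) n r (x : amb L n r) : gal_pt s (gal_pt (galV s) x) = x.
Proof.
case: x => [[v Hv] w]; congr pair; first apply: val_inj;
  by apply/rowP => i; rewrite !mxE /= gal_invK.
Qed.

Lemma ev_gal (s : galois) n r (F : {mpoly K[n.+1 + r]}) (x : amb L n r) :
  ev iota F (gal_pt s x) = s (ev iota F x).
Proof.
rewrite /ev /mmap rmorph_sum; apply: eq_bigr => m _.
rewrite rmorphM gal_iota; congr (_ * _).
by rewrite /mmap1 rmorph_prod; apply: eq_bigr => i _; rewrite rmorphXn coords_gal.
Qed.

Lemma ev_map_gal (s : galois) n r (F : {mpoly L[n.+1 + r]}) (x : amb L n r) :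
  ev idfun (map_mpoly s F) (gal_pt s x) = s (ev idfun F x).
Proof.
rewrite /ev /mmap rmorph_sum (perm_big _ (msupp_map_mpoly _ (fmorph_inj s))) /=.
apply: eq_bigr => m _; rewrite rmorphM mcoeff_map_mpoly; congr (_ * _).
by rewrite /mmap1 rmorph_prod; apply: eq_bigr => i _; rewrite rmorphXn coords_gal.
Qed.

Lemma form_map_gal (s : galois) n r d (F : {mpoly L[n.+1 + r]}) :
  form d F -> form d (map_mpoly s F).
Proof.
move=> /dhomogP fF; apply/dhomogP => m.
by rewrite (perm_mem (msupp_map_mpoly _ (fmorph_inj s))) => /fF.
Qed.

Lemma gal_stable (s : galois) (X : variety) x : X x -> X (gal_pt s x).
Proof.
have [Z [U [_ _ XE]]] := pts_loc_closed X.
move=> /XE[Zx [F FU Fx]]; apply/XE; split.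
  by move=> G GZ; rewrite ev_gal Zx // rmorph0.
by exists F => //; rewrite ev_gal fmorph_eq0.
Qed.

Lemma open_gal (s : galois) (X : variety) (U : amb L (vn X) (vr X) -> Prop) :
  open_in idfun X U -> open_in idfun X (fun x => U (gal_pt (galV s) x)).
Proof.
move=> oU x Xx Ux; have [d [G [fG Gx GU]]] := oU _ (gal_stable (galV s) Xx) Ux.
exists d, (map_mpoly s G); split; first exact: form_map_gal.
  by rewrite -[x](gal_ptVK s) ev_map_gal fmorph_eq0.
move=> y Xy Gy; apply: GU; first exact: gal_stable.
by move: Gy; rewrite -{1}[y](gal_ptVK s) ev_map_gal fmorph_eq0.
Qed.

Lemma reg_fun_gal (s : galois) n r (X Y : amb L n r -> Prop) g :
  (forall x, Y x -> X (gal_pt (galV s) x)) -> reg_fun idfun X g ->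
  reg_fun idfun Y (fun x => s (g (gal_pt (galV s) x))).
Proof.
move=> YX rg x Yx; have [d [G [H [fG fH Hx gE]]]] := rg _ (YX x Yx).
exists d, (map_mpoly s G), (map_mpoly s H); split; try exact: form_map_gal.
  by rewrite -[x](gal_ptVK s) ev_map_gal fmorph_eq0.
move=> y Yy; rewrite -{1 3 4}[y](gal_ptVK s) !ev_map_gal fmorph_eq0 => Hy.
by rewrite -fmorph_div gE //; apply: YX.
Qed.

Program Definition gal_cocycle (s : galois) (X : variety) (c : cocycle X) : cocycle X :=
  let t := galV s in
  @Cocycle _ _ _ X (fun x z => nbh c (gal_pt t x) (gal_pt t z))
    (fun x y z => s (trf c (gal_pt t x) (gal_pt t y) (gal_pt t z))) _ _ _ _ _.
Next Obligation. by apply/open_gal/nbh_open/gal_stable. Qed.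
Next Obligation. by apply/nbh_self/gal_stable. Qed.
Next Obligation.
pose Z := fun z => [/\ X z, nbh c (gal_pt (galV s) x) z & nbh c (gal_pt (galV s) y) z].
apply: (@reg_fun_gal s _ _ Z); last by apply: trf_reg; apply: gal_stable.
by move=> z [? ? ?]; split=> //; apply: gal_stable.
Qed.
Next Obligation. by rewrite fmorph_eq0 trf_neq0 //; apply: gal_stable. Qed.
Next Obligation.
by rewrite -rmorphM (trf_cocycle (y := gal_pt (galV s) y)) //; apply: gal_stable.
Qed.

Definition gal_pic (s : galois) (X : variety) (a : Pic X) : Pic X :=
  cl (gal_cocycle s (repr a)).

Lemma gal_pic_cl (s : galois) (X : variety) (c : cocycle X) :
  gal_pic s (cl c) = cl (gal_cocycle s c).
Proof.
have /clP[V [h [H E]]] := cl_repr (cl c).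
apply/clP; pose t := galV s.
exists (fun x z => V (gal_pt t x) (gal_pt t z)), (fun x z => s (h (gal_pt t x) (gal_pt t z))).
split.
  move=> x Xx; have [oV Vx VS rh h0] := H _ (gal_stable t Xx); split=> //.
  - exact: open_gal.
  - by move=> z Xz /VS; apply; apply: gal_stable.
  - apply: reg_fun_gal rh => z [Xz Vz]; split=> //; exact: gal_stable.
  - by move=> z Xz Vz; rewrite fmorph_eq0 h0 //; apply: gal_stable.
move=> x y z Xx Xy Xz Vx Vy /=; rewrite -!rmorphM E //; exact: gal_stable.
Qed.

(* L-points of the K-torus whose character module is the Galois module M.      *)
Definition torus_point (M : zmodType) (t : M -> L) : Prop :=
  (forall a, t a != 0) /\ (forall a b, t (a + b) = t a * t b).

Definition gal_torus (s : galois) (X : variety) (t : Pic X -> L) : Pic X -> L :=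
  fun a => s (t (gal_pic (galV s) a)).

(* Morphisms over L from (torus) x W to Y: those which factor as a regular     *)
(* map through finitely many characters of the torus.                          *)
Definition torus_reg_map (M : zmodType) n r n' r'
    (W : amb L n r -> Prop) (Y : amb L n' r' -> Prop)
    (f : (M -> L) -> amb L n r -> amb L n' r') : Prop :=
  exists l (a : 'I_l -> M) (g : amb L n (r + l) -> amb L n' r'),
    reg_map idfun
      (fun z => exists t w, [/\ torus_point t, W w & z = ext w (\row_i t (a i))]) Y g /\
    (forall t w, torus_point t -> W w -> g (ext w (\row_i t (a i))) = f t w).

(* Standard etale V-schemes: the locus P = 0, dP/dy != 0, Q != 0 in V x A^1,   *)
(* y being the coordinate on A^1.                                              *)
Definition std_etale n r (V : amb L n r -> Prop) (P Q : {mpoly L[n.+1 + (r + 1)]}) :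
    amb L n (r + 1) -> Prop :=
  fun w => [/\ V (base w), ev idfun P w = 0,
    ev idfun P^`M(rshift n.+1 (rshift r ord0)) w != 0 & ev idfun Q w != 0].

Section Torsor.

Variables (V T : variety).
Variable p : amb L (vn T) (vr T) -> amb L (vn V) (vr V).
Variable act : (Pic V -> L) -> amb L (vn T) (vr T) -> amb L (vn T) (vr T).

Definition pullback_pt (z : amb L (vn T) (vr T + 1)) : amb L (vn V) (vr V + 1) :=
  ext (p (base z)) (rsubmx z.2).

(* T x_V W for W over V contained in V x A^1.                                  *)
Definition pullback (W : amb L (vn V) (vr V + 1) -> Prop) :
    amb L (vn T) (vr T + 1) -> Prop :=
  fun z => T (base z) /\ W (pullback_pt z).

(* A section tau of the pullback of T to W such that (t, w) |-> t . tau w has  *)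
(* a regular inverse z |-> (delta z, pullback_pt z).                           *)
Definition trivial_over (W : amb L (vn V) (vr V + 1) -> Prop) : Prop :=
  exists (tau : amb L (vn V) (vr V + 1) -> amb L (vn T) (vr T))
         (delta : amb L (vn T) (vr T + 1) -> Pic V -> L),
    [/\ reg_map idfun W T tau,
        forall w, W w -> p (tau w) = base w,
        forall a, reg_fun idfun (pullback W) (delta^~ a),
        forall z, pullback W z ->
          torus_point (delta z) /\ act (delta z) (tau (pullback_pt z)) = base z
      & forall t w, torus_point t -> W w ->
          delta (ext (act t (tau w)) (rsubmx w.2)) =1 t].

(* p : T -> V is a torsor under the K-torus S_0 with character module Pic(V_L):*)
(* S_0 acts on T over V by a K-morphism (a Galois-equivariant L-morphism), and *)
(* T is trivial locally for the etale topology.  Standard etale neighbourhoods *)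
(* over L suffice for the latter: one trivializing T_L is defined over a       *)
(* finite extension of K, hence gives one that is etale over V.                *)
Record is_torsor : Prop := IsTorsor {
  torsor_reg : reg_map iota T V p;
  torsor_act_reg : torus_reg_map T T act;
  torsor_act_over : forall t x, torus_point t -> T x -> p (act t x) = p x;
  torsor_act1 : forall x, T x -> act (fun=> 1) x = x;
  torsor_actM : forall t u x, torus_point t -> torus_point u -> T x ->
    act (fun a => t a * u a) x = act t (act u x);
  torsor_act_gal : forall (s : galois) t x, torus_point t -> T x ->
    gal_pt s (act t x) = act (gal_torus s t) (gal_pt s x);
  torsor_loc_trivial : forall v, V v ->
    exists d e (P Q : {mpoly L[(vn V).+1 + (vr V + 1)]}),
      [/\ form d P, form e Q, exists y, std_etale V P Q (ext v y)
        & trivial_over (std_etale V P Q)]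
}.

(* The pushforward of T along the character a of S_0 is the G_m-torsor of the  *)
(* line bundle of c: there is an a-equivariant morphism over V from T to it,   *)
(* with local coordinates f x over nbh c x.                                    *)
Definition pushforward_is (a : Pic V) (c : cocycle V) : Prop :=
  exists f : amb L (vn V) (vr V) -> amb L (vn T) (vr T) -> L,
    (forall x, V x -> let Tx := fun z => T z /\ nbh c x (p z) in
       [/\ reg_fun idfun Tx (f x),
           forall z, Tx z -> f x z != 0
         & forall t z, torus_point t -> Tx z -> f x (act t z) = t a * f x z]) /\
    (forall x y z, V x -> V y -> T z -> nbh c x (p z) -> nbh c y (p z) ->
       f y z = trf c x y (p z) * f x z).

(* chi maps the class of T to the homomorphism sending a to b.                 *)
Definition chi_maps (a b : Pic V) : Prop := exists2 c, cl c = b & pushforward_is a c.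

Definition universal_torsor : Prop := is_torsor /\ forall a, chi_maps a a.

End Torsor.

Definition line_bundle (Y E : variety)
    (pi : amb L (vn E) (vr E) -> amb L (vn Y) (vr Y)) : Prop :=
  reg_map iota E Y pi /\
  exists (I : Type) (U : I -> amb L (vn Y) (vr Y) -> Prop)
         (phi : I -> amb L (vn E) (vr E) -> L),
    [/\ forall i, open_in iota Y (U i),
        forall y, Y y -> exists i, U i y,
        forall i, is_iso iota (fun e => E e /\ U i (pi e))
                    (prod_affine (l := 1) (fun y => Y y /\ U i y))
                    (fun e => ext (pi e) (const_mx (phi i e)))
      & forall i i', exists g : amb L (vn Y) (vr Y) -> L,
          forall e, E e -> U i (pi e) -> U i' (pi e) ->
            phi i' e = g (pi e) * phi i e].

Definition dense_in n r (X U : amb L n r -> Prop) : Prop :=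
  forall d (G : {mpoly L[n.+1 + r]}), form d G ->
    (exists2 x, X x & ev idfun G x != 0) ->
    exists x, [/\ X x, U x & ev idfun G x != 0].

Definition birational (X Y : variety) : Prop :=
  exists (U : amb L (vn X) (vr X) -> Prop) (W : amb L (vn Y) (vr Y) -> Prop) f,
    [/\ open_in iota X U, dense_in X U, open_in iota Y W, dense_in Y W
      & is_iso iota (fun x => X x /\ U x) (fun y => Y y /\ W y) f].

(* The Plucker image of Gr(2,6), in the projective space of 6 x 6 matrices:    *)
(* the plane spanned by u and v goes to the matrix of all its 2 x 2 minors     *)
(* u_i v_j - u_j v_i.                                                          *)
Definition grass26 : amb L 35 0 -> Prop :=
  fun x => exists u v : 'rV[L]_6, val x.1 = mxvec (u^T *m v - v^T *m u) :> 'rV_(6 * 6).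

Definition grass26_form (Y : variety) : Prop := exists g, is_iso idfun Y grass26 g.

Section Cubic.

Variable F : {mpoly K[5]}.

Definition on_cubic (x : amb L 4 0) : Prop := @ev K L iota 4 0 F x = 0.

Definition grad (x : amb L 4 0) : 'rV[L]_5 := \row_i @ev K L iota 4 0 F^`M(i) x.

Definition hess (x : amb L 4 0) : 'M[L]_5 :=
  \matrix_(i, l) @ev K L iota 4 0 F^`M(i)^`M(l) x.

Definition singular_pt (x : amb L 4 0) : Prop := on_cubic x /\ grad x = 0.

(* Nondegeneracy of the Hessian of the local equation in each standard affine  *)
(* chart containing x.                                                         *)
Definition ordinary_node (x : amb L 4 0) : Prop :=
  singular_pt x /\
  forall i : 'I_5, val x.1 0 i != 0 -> \det (row' i (col' i (hess x))) != 0.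

End Cubic.

Record ten_nodal_cubic := TenNodalCubic {
  cubic_form : {mpoly K[5]};
  cubic_homog : cubic_form \is 3.-homog;
  cubic_sing : exists s : seq (amb L 4 0),
    [/\ uniq s, size s = 10%N & forall x, x \in s <-> singular_pt cubic_form x];
  cubic_nodes : forall x, singular_pt cubic_form x -> ordinary_node cubic_form x
}.

Fact form_homog (F : {mpoly K[5]}) d : F \is d.-homog -> @form K 4 0 d F.
Proof.
move=> /dhomogP hF; apply/dhomogP => m /hF <-.
change (@pdeg 5 0 m = mdeg (m : 'X_{1..5})); rewrite mdegE /pdeg.
by apply: eq_bigr => i _; congr (m _); apply: val_inj.
Qed.

Fact deriv_homog (F : {mpoly K[5]}) d i : F \is d.+1.-homog -> F^`M(i) \is d.-homog.
Proof.
move=> /dhomogP hF; apply/dhomogP => m.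
rewrite mcoeff_msupp mcoeff_deriv => Fm.
have /hF : (m + U_(i))%MM \in msupp F.
  by rewrite mcoeff_msupp; apply: contraNneq Fm => ->; rewrite mul0rn.
by rewrite /= mdegD mdeg1 addn1 => -[].
Qed.

Fact smooth_locus_loc_closed (X : ten_nodal_cubic) :
  loc_closed iota (fun x => on_cubic (cubic_form X) x /\ ~ singular_pt (cubic_form X) x).
Proof.
set F := cubic_form X; have hF := cubic_homog X.
exists [:: F], [seq F^`M(i) | i <- enum 'I_5]; split.
- by move=> G; rewrite inE => /eqP ->; exists 3%N; apply: form_homog.
- move=> G /mapP[i _ ->]; exists 2%N; exact/form_homog/deriv_homog.
move=> x; split=> [[Fx Sx] | [Fx [G /mapP[i _ ->] Gx]]].
  split; first by move=> G; rewrite inE => /eqP ->.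
  have [i Fi | F0] := pickP (fun i : 'I_5 => grad F x 0 i != 0).
    by exists F^`M(i); [apply/map_f; rewrite mem_enum | move: Fi; rewrite mxE].
  case: Sx; split=> //; apply/rowP => i; rewrite [RHS]mxE.
  by apply/eqP/negbFE/F0.
split; first by apply: Fx; rewrite inE.
case=> _ /rowP/(_ i); rewrite !mxE => Fi0; move/eqP: Gx; exact.
Qed.

Definition smooth_locus (X : ten_nodal_cubic) : variety :=
  Variety (smooth_locus_loc_closed X).

End OverK.

(* Main.v *)
(* Projecting from a node turns the nodes into nine points of a (3,3)-curve on a quadric, so the curve is a
   union of lines, and over L the cubic takes the Perazzo-Segre form X1 X2 X3 = Y1 Y2 Y3 with
   X1 + X2 + X3 = Y1 + Y2 + Y3. Suitable monomials in the 2x2 minors p_ab of a 2x6 matrix parametrize it: they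
   map an open subset O of A^12, with complement of codimension at least 2, onto the smooth locus X^0. As A^12 is
   factorial, the pullback of a universal torsor T to O has a section, which gives a map Psi : O -> T. The
   fifteen planes of the cubic yield functions phi_ab on T with phi_ab o Psi = p_ab, so Psi is constant on
   SL_2-orbits and (phi_ab) embeds an open part of T in the affine cone over Gr(2,6). Galois permutes the
   fifteen planes, hence the phi_ab up to scalars, and the coordinates obtained from them by descent are
   defined over K: they identify T birationally with the cone over a K-form Y of Gr(2,6), that is, with a
   line bundle over Y. *)

From HB Require Import structures.
From mathcomp Require Import all_boot all_order all_algebra all_field.
From mathcomp Require Import mpoly.
From mathcomp Require Import boolp.
From mathcomp Require classical_sets.
From mathcomp Require Import ring zify.
Require Import Defs.

Set Implicit Arguments.
Unset Strict Implicit.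
Unset Printing Implicit Defensive.

Import GRing.Theory.
Local Open Scope ring_scope.

(** The Picard group of X^0 is never computed. Since the complement of [Oo] has codimension at least
    two, a nowhere vanishing function on [Oo] is constant; hence the torus scaling the six columns
    acts on the trivialized pullback of each class by a character, and a class is determined by its
    six integer weights. Their sum is even, because a scalar matrix acts both as a column scaling
    and through its determinant, and the plane of p_ab has weights -(e_a + e_b). These generate the
    even vectors, so the column torus surjects onto the torus of T and [Psi] is onto. The main
    obstacle is that T is trivial only etale locally: what is built on [Oo] is at first only
    etale-locally regular, and must be shown rational, then polynomial. The planes are Weil
    divisors, each cut out by two linear forms A, B, and enter through a relation s A + t B = 0 with
    s, t quadratic. Descent avoids cocycles: the K-components of a finite family of polynomials over
    L are linear combinations of its conjugates. *)

Lemma mulf_nz (R : idomainType) (x y : R) : (x * y != 0) = (x != 0) && (y != 0).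
Proof. by rewrite mulf_eq0 negb_or. Qed.

(** * Unique factorization in polynomial rings *)

Section Divisibility.
Variable R : idomainType.
Implicit Types a b c p q : R.

Definition rdvd a b := exists c, b = c * a.
Definition rprime p :=
  [/\ p != 0, ~ rdvd p 1 & forall a b, rdvd p (a * b) -> rdvd p a \/ rdvd p b].
Definition primes_list (s : seq R) := forall p, p \in s -> rprime p.
Definition factored a :=
  exists (u : R) (s : seq R), [/\ u \is a GRing.unit, primes_list s & a = u * \prod_(p <- s) p].

Lemma rdvd_refl a : rdvd a a. Proof. by exists 1; rewrite mul1r. Qed.
Lemma rdvd_mull a b c : rdvd a b -> rdvd a (c * b).
Proof. by case=> d ->; exists (c * d); rewrite mulrA. Qed.
Lemma rdvd_mulr a b c : rdvd a b -> rdvd a (b * c).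
Proof. by rewrite mulrC; apply: rdvd_mull. Qed.
Lemma rdvdD a b c : rdvd a b -> rdvd a c -> rdvd a (b + c).
Proof. by case=> d -> [e ->]; exists (d + e); rewrite mulrDl. Qed.
Lemma rdvd0 a : rdvd a 0. Proof. by exists 0; rewrite mul0r. Qed.
Lemma rdvd_sum a I (r : seq I) (P : pred I) F :
  (forall i, P i -> rdvd a (F i)) -> rdvd a (\sum_(i <- r | P i) F i).
Proof. by move=> H; elim/big_rec: _ => [|i b Pi]; [apply: rdvd0|apply/rdvdD/H]. Qed.

Lemma primes_list_cons p s : primes_list (p :: s) <-> rprime p /\ primes_list s.
Proof.
split=> [H|[pp H] q]; last by rewrite inE => /orP[/eqP->|/H].
by split; [apply: H; rewrite inE eqxx|move=> q qs; apply: H; rewrite inE qs orbT].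
Qed.

Lemma rprime_unit p u : rprime p -> u \is a GRing.unit -> ~ rdvd p u.
Proof. by case=> _ p1 _ uu [c E]; apply: p1; exists (u^-1 * c); rewrite -mulrA -E mulVr. Qed.

Lemma rprime_prod p s : rprime p -> rdvd p (\prod_(q <- s) q) -> exists2 q, q \in s & rdvd p q.
Proof.
move=> pp; elim: s => [|q s IH]; first by rewrite big_nil; case: pp => _ p1 _ /p1.
rewrite big_cons; case: (pp) => _ _ /[apply] -[H|/IH[r rs H]].
  by exists q; rewrite ?inE ?eqxx.
by exists r; rewrite ?inE ?rs ?orbT.
Qed.

Lemma rprime_assoc p q : rprime p -> rprime q -> rdvd p q ->
  exists2 u, u \is a GRing.unit & q = u * p.
Proof.
move=> [p0 p1 _] [q0 q1 qq] [c E]; exists c => //.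
have: rdvd q (c * p) by rewrite -E; apply: rdvd_refl.
case/qq=> -[d Ed].
  have: (1 - d * p) * c = 0 by rewrite mulrBl mul1r {1}Ed E; ring.
  move/eqP; rewrite mulf_eq0 => /orP[|/eqP c0]; last by move: q0; rewrite E c0 mul0r eqxx.
  by rewrite subr_eq0 => /eqP dp; case: p1; exists d.
have: (1 - d * c) * p = 0 by rewrite mulrBl mul1r {1}Ed E; ring.
move/eqP; rewrite mulf_eq0 (negbTE p0) orbF subr_eq0 => /eqP dc.
by apply/unitrP; exists d; rewrite [c * d]mulrC -dc.
Qed.

Lemma factoredM a b : factored a -> factored b -> factored (a * b).
Proof.
case=> u [s [uu ps ->]] [v [t [vv pt ->]]]; exists (u * v), (s ++ t); split.
- by rewrite unitrM uu vv.
- by move=> p; rewrite mem_cat => /orP[/ps|/pt].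
- by rewrite big_cat /=; ring.
Qed.

Lemma factored_prime p : rprime p -> factored p.
Proof.
move=> pp; exists 1, [:: p]; split; rewrite ?unitr1 ?big_seq1 ?mul1r //.
by move=> q; rewrite inE => /eqP->.
Qed.

End Divisibility.

Definition ufd (R : idomainType) := forall a : R, a != 0 -> factored a.

(** * Gauss's lemma: factoriality passes from [R] to [{poly R}] *)

Section Gauss.
Variable R : idomainType.
Hypothesis ufdR : ufd R.
Implicit Types (f g h k d : {poly R}) (c p : R).

Lemma scale_polyI p f g : p != 0 -> p *: f = p *: g -> f = g.
Proof. by move=> p0; rewrite -!mul_polyC; apply: mulfI; rewrite polyC_eq0. Qed.

Lemma rdvd_polyC p f : rdvd p%:P f <-> forall i, rdvd p f`_i.
Proof.
split=> [[g ->] i|H]; first by rewrite coefMC; exists g`_i.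
pose g := \poly_(i < size f) projT1 (cid (H i)); exists g.
apply/polyP=> i; rewrite coefMC coef_poly; case: ltnP => [_|Hi].
  by case: (cid (H i)) => c /= ->.
by rewrite mul0r nth_default.
Qed.

(** Gauss's argument: let [i] and [j] be the least indices at which [p] fails to divide the
    coefficients of [f] and [g]. In the coefficient of index [i + j] of the product every other term
    is divisible by [p], so the product of these two coefficients would be too. *)
Lemma rprime_polyC p : rprime p -> rprime p%:P.
Proof.
move=> [p0 p1 pp]; split; first by rewrite polyC_eq0.
  by move=> /rdvd_polyC/(_ 0%N); rewrite coef1.
move=> f g /rdvd_polyC H; apply: contrapT => /not_orP[/rdvd_polyC/existsNP nf /rdvd_polyC/existsNP ng].
have nf' : exists i, ~~ `[< rdvd p f`_i >] by case: nf => i /asboolPn; exists i.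
have ng' : exists i, ~~ `[< rdvd p g`_i >] by case: ng => i /asboolPn; exists i.
have [i /asboolPn Hi mi] := ex_minnP nf'; have [j /asboolPn Hj mj] := ex_minnP ng'.
have {mi}mi l : (l < i)%N -> rdvd p f`_l.
  by move=> li; apply: contrapT => /asboolPn/mi; rewrite leqNgt li.
have {mj}mj l : (l < j)%N -> rdvd p g`_l.
  by move=> li; apply: contrapT => /asboolPn/mj; rewrite leqNgt li.
have := H (i + j)%N; rewrite coefM.
have ij : (i < (i + j).+1)%N by rewrite ltnS leq_addr.
rewrite (bigD1 (Ordinal ij)) //= addKn => D.
have: rdvd p (f`_i * g`_j).
  rewrite -[_ * _](addrK (\sum_(l < (i + j).+1 | l != Ordinal ij) f`_l * g`_(i + j - l))).
  apply: rdvdD => //; rewrite -mulN1r; apply: rdvd_mull; apply: rdvd_sum => l nl.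
  have [li|li|E] := ltngtP l i; last by rewrite -val_eqE /= E eqxx in nl.
    by apply: rdvd_mulr; apply: mi.
  by apply: rdvd_mull; apply: mj; move: (ltn_ord l) li; lia.
by case/pp.
Qed.

(** Pseudo-division only gives [c *: f = k * d]. Each prime factor of [c] stays prime in [{poly R}],
    so it divides [k] or [d] and can be removed there; degrees are unchanged, and the identity
    becomes a factorization of [f] itself. *)
Lemma cancel_const c f k d : c != 0 -> c *: f = k * d ->
  exists k' d', [/\ f = k' * d', size k' = size k & size d' = size d].
Proof.
move=> /ufdR[u [s [uu ps ->]]]; elim: s f k d ps => [|p s IH] f k d.
  move=> _; rewrite big_nil mulr1 => E; exists (u^-1 *: k), d; split=> //.
    by rewrite -scalerAl -E scalerA mulVr // scale1r.
  by rewrite size_scale // invr_eq0; apply: contraTneq uu => ->; rewrite unitr0.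
case/primes_list_cons=> pp ps; rewrite big_cons mulrCA => E.
have p0 : p != 0 by case: pp.
have : rdvd p%:P (k * d).
  by rewrite -E; exists ((u * \prod_(q <- s) q) *: f); rewrite -!mul_polyC; ring.
case: (rprime_polyC pp) => _ _ /[apply] -[[k' Ek]|[d' Ed]].
  have [] := IH f k' d ps.
    by apply: (scale_polyI p0); rewrite scalerA E Ek -mul_polyC; ring.
  move=> k2 [d2 [H1 H2 H3]]; exists k2, d2; split=> //.
  by rewrite H2 Ek mulrC mul_polyC size_scale.
have [] := IH f k d' ps.
  by apply: (scale_polyI p0); rewrite scalerA E Ed -mul_polyC; ring.
move=> k2 [d2 [H1 H2 H3]]; exists k2, d2; split=> //.
by rewrite H3 Ed mulrC mul_polyC size_scale.
Qed.

Definition primitive f := forall p, rprime p -> ~ rdvd p%:P f.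

(** As in [cancel_const], except that no prime of [c] can divide the primitive [f], so all of [c] is
    absorbed by [k]. *)
Lemma cancel_primitive c f h k : primitive f -> c != 0 -> c *: h = k * f -> rdvd f h.
Proof.
move=> pf /ufdR[u [s [uu ps ->]]]; elim: s h k ps => [|p s IH] h k.
  move=> _; rewrite big_nil mulr1 => E; exists (u^-1 *: k).
  by rewrite -scalerAl -E scalerA mulVr // scale1r.
case/primes_list_cons=> pp ps; rewrite big_cons mulrCA => E.
have p0 : p != 0 by case: pp.
have : rdvd p%:P (k * f).
  by rewrite -E; exists ((u * \prod_(q <- s) q) *: h); rewrite -!mul_polyC; ring.
case: (rprime_polyC pp) => _ _ /[apply] -[[k' Ek]|/(pf _ pp)//].
by apply: (IH h k') => //; apply: (scale_polyI p0); rewrite scalerA E Ek -mul_polyC; ring.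
Qed.

(** Induction on the number of prime factors of the leading coefficient: a prime dividing [f]
    divides it, and dividing [f] by that prime removes one factor. *)
Lemma primitive_part f : f != 0 -> exists c g, [/\ c != 0, primitive g & f = c *: g].
Proof.
move=> f0; have := ufdR (a := lead_coef f); rewrite lead_coef_eq0 => /(_ f0)[u [s [uu ps Es]]].
elim: {s}(size s) {-2}s (leqnn (size s)) u f f0 uu ps Es => [|n IH] s Hs u f f0 uu ps Es.
all: have [pf|] := pselect (primitive f); first by exists 1, f; rewrite oner_neq0 scale1r.
all: move=> /existsNP[p /not_implyP[pp /contrapT[g Eg]]].
all: have pl : rdvd p (u * \prod_(q <- s) q)
  by rewrite -Es Eg lead_coefM lead_coefC; exists (lead_coef g).
all: case: (pp) => p0 _ /(_ _ _ pl)[/(rprime_unit pp uu)//|/(rprime_prod pp)[q qs pq]].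
  by case: s Hs qs {ps Es pl}.
have [v vv Eq] := rprime_assoc pp (ps _ qs) pq.
have g0 : g != 0 by apply: contraNneq f0 => g0; rewrite Eg g0 mul0r.
have [||||c [h [c0 ph Eh]]] := IH (rem q s) _ (u * v) g g0.
- by rewrite size_rem //; case: (s) Hs.
- by rewrite unitrM uu.
- by move=> r /mem_rem/ps.
- apply: (mulIf p0); have := Es; rewrite Eg lead_coefM lead_coefC => ->.
  by rewrite (perm_big _ (perm_to_rem qs)) /= big_cons Eq; ring.
exists (p * c), h; split; rewrite ?mulf_neq0 //.
by rewrite Eg Eh mulrC mul_polyC scalerA.
Qed.

Lemma factored_polyC c : c != 0 -> factored c%:P.
Proof.
move=> /ufdR[u [s [uu ps ->]]]; exists u%:P, (map polyC s); split.
- exact: (rmorph_unit (@polyC R)).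
- by move=> ? /mapP[p /ps pp ->]; apply: rprime_polyC.
- by rewrite big_map rmorphM rmorph_prod.
Qed.

(** Bezout over the fraction field with denominators cleared. A constant gcd of [f] and [g] makes a
    constant multiple of [h] divisible by [f], a gcd of full degree does the same for [g], and
    primitivity removes the constants. A gcd of intermediate degree would factor [f]. *)
Lemma rprime_poly f : (1 < size f)%N -> primitive f ->
  (forall g h, f = g * h -> (size g < size f)%N -> (size h < size f)%N -> False) -> rprime f.
Proof.
move=> sf pf irr; have f0 : f != 0 by rewrite -size_poly_gt0 (leq_trans _ sf).
split=> //.
  case=> g E; have g0 : g != 0 by apply/eqP => g0; move/eqP: E; rewrite g0 mul0r oner_eq0.
  have := size_mul g0 f0; rewrite -E size_poly1; move: sf; rewrite -size_poly_gt0 in g0.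
  by move: g0; lia.
move=> g h [k Ek]; set d := gcdp f g.
have [/andP[s1 s2]|] := boolP ((1 < size d)%N && (size d <= size f)%N); last first.
  have sd0 : (0 < size d)%N by rewrite size_poly_gt0 gcdp_eq0 negb_and f0.
  have sdf : (size d <= size f)%N by apply: dvdp_leq (dvdp_gcdl _ _).
  rewrite sdf andbT -leqNgt => sd1; right.
  have /size_poly1P[c c0 Ec] : size d == 1%N by rewrite eqn_leq sd1 sd0.
  have [[a b] /= /eqpP[[c1 c2] /= /andP[c10 c20] E]] := Bezoutp f g.
  apply: (@cancel_primitive (c2 * c) f h (c1 *: (a * h + b * k)) pf); first by rewrite mulf_neq0.
  have -> : c1 *: (a * h + b * k) * f = (c1 *: (a * f + b * g)) * h.
    by rewrite -!scalerAl; congr (_ *: _); rewrite !mulrDl -mulrA -(mulrA b k) -Ek; ring.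
  by rewrite E -/d Ec -mul_polyC -mul_polyC rmorphM.
have /Pdiv.Idomain.dvdpP[[c k1] /= c0 E1] : d %| f by apply: dvdp_gcdl.
have /Pdiv.Idomain.dvdpP[[c' k2] /= c'0 E2] : d %| g by apply: dvdp_gcdr.
have d0 : d != 0 by rewrite -size_poly_gt0 (leq_trans _ s1).
have k10 : k1 != 0.
  by apply/eqP => k0; move/eqP: E1; rewrite k0 mul0r -mul_polyC mulf_eq0 polyC_eq0 (negbTE c0) (negbTE f0).
have sE : size f = (size k1 + size d).-1 by rewrite -(size_scale f c0) E1 size_mul.
move: s2; rewrite leq_eqVlt => /orP[/eqP s2|s2].
  have /size_poly1P[e e0 Ee] : size k1 == 1%N.
    by move: sE sf k10; rewrite s2 -size_poly_gt0; lia.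
  left; apply: (@cancel_primitive (e * c') f g (c *: k2) pf); first by rewrite mulf_neq0.
  have E2' : c'%:P * g = k2 * d by rewrite mul_polyC.
  have E1' : c%:P * f = e%:P * d by rewrite mul_polyC E1 Ee.
  transitivity (e%:P * (c'%:P * g)); first by rewrite -!mul_polyC polyCM mulrA.
  by rewrite E2' mulrCA -E1' -mul_polyC; ring.
have [k' [d' [H1 H2 H3]]] := cancel_const c0 E1.
case: (irr _ _ H1); rewrite ?H2 ?H3 // sE.
by move: s1 s2 sE sf; rewrite -size_poly_gt0 in k10; lia.
Qed.

Lemma ufd_poly : ufd {poly R}.
Proof.
move=> f; elim: {f}(size f) {-2}f (leqnn (size f)) => [|n IH] f sf f0.
  by move: sf; rewrite leqn0 size_poly_eq0 (negbTE f0).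
have [s1|s1] := leqP (size f) 1.
  have [c Ec] : exists c, f = c%:P by exists f`_0; apply: size1_polyC.
  by rewrite Ec; apply: factored_polyC; rewrite Ec polyC_eq0 in f0.
have [[g [h [E sg sh]]]|irr] := pselect (exists g h, [/\ f = g * h, (size g < size f)%N & (size h < size f)%N]).
  have [g0 h0] : g != 0 /\ h != 0 by apply/andP; rewrite -negb_or -mulf_eq0 -E.
  by rewrite E; apply: factoredM; apply: IH => //; rewrite -ltnS (leq_trans _ sf).
have [c [g [c0 pg E]]] := primitive_part f0.
rewrite E -mul_polyC; apply: factoredM; first exact: factored_polyC.
apply: factored_prime; have sE : size f = size g by rewrite E size_scale.
apply: rprime_poly => //; rewrite -?sE // => k h Eg s2 s3; apply: irr.
by exists (c *: k), h; rewrite -scalerAl -Eg size_scale.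
Qed.

End Gauss.

Local Notation widen := (widen_ord (leqnSn _)).

(** * Polynomials in n + 1 variables as univariate polynomials over n variables *)

Section MpolyInduction.
Variables (n : nat) (R : idomainType).

(** The inverse of [muni]: the indeterminate becomes the last variable. *)
Definition mmult (p : {poly {mpoly R[n]}}) : {mpoly R[n.+1]} :=
  (map_poly (@mwiden n R) p).['X_ord_max].

Lemma mmult_is_zmod_morphism : zmod_morphism mmult.
Proof. by move=> p q; rewrite /mmult rmorphB hornerD hornerN. Qed.
HB.instance Definition _ := GRing.isZmodMorphism.Build _ _ mmult mmult_is_zmod_morphism.
Lemma mmult_is_monoid_morphism : monoid_morphism mmult.
Proof. by split=> [|p q]; rewrite /mmult ?rmorph1 ?hornerC // rmorphM hornerM. Qed.
HB.instance Definition _ := GRing.isMonoidMorphism.Build _ _ mmult mmult_is_monoid_morphism.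

Lemma mmultD p q : mmult (p + q) = mmult p + mmult q. Proof. exact: (rmorphD mmult). Qed.
Lemma mmultM p q : mmult (p * q) = mmult p * mmult q. Proof. exact: (rmorphM mmult). Qed.
Lemma mmultC c : mmult c%:P = mwiden c. Proof. by rewrite /mmult map_polyC hornerC. Qed.
Lemma mmultX : mmult 'X = 'X_ord_max. Proof. by rewrite /mmult map_polyX hornerX. Qed.

Lemma muniX_max : muni ('X_ord_max : {mpoly R[n.+1]}) = 'X.
Proof.
rewrite muniE msuppX big_seq1 mcoeffX eqxx scale1r mnm1E eqxx expr1.
rewrite (_ : [multinom _ | _ < n] = 0%MM) ?mpolyX0 ?scale1r //.
by apply/mnmP=> i; rewrite !mnmE -val_eqE /= gtn_eqF.
Qed.

Lemma muniX_widen (i : 'I_n) : muni ('X_(widen i) : {mpoly R[n.+1]}) = ('X_i)%:P.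
Proof.
rewrite muniE msuppX big_seq1 mcoeffX eqxx scale1r mnm1E -val_eqE /= ltn_eqF // expr0 alg_polyC.
by congr ('X_[_])%:P; apply/mnmP=> j; rewrite !mnmE.
Qed.

#[local] Opaque muni mmult mwiden.

Lemma mmult_muniX m : mmult (muni 'X_[m]) = 'X_[m].
Proof.
have E (i : 'I_n.+1) : mmult (muni 'X_i) = 'X_i.
  have [li|ge] := ltnP i n.
    have -> : i = widen (Ordinal li) by apply: val_inj.
    by rewrite muniX_widen mmultC mwidenX mnmwiden1.
  have -> : i = ord_max by apply/val_inj/eqP; rewrite eqn_leq ge -ltnS /= ltn_ord.
  by rewrite muniX_max mmultX.
rewrite mpolyXE_id (rmorph_prod (@muni n R)) (rmorph_prod mmult); apply: eq_bigr => i _.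
by rewrite (rmorphXn (@muni n R)) (rmorphXn mmult); congr (_ ^+ _); exact: E.
Qed.

Lemma mmultK p : mmult (muni p) = p.
Proof.
elim/mpolyind: p => [|c m p _ _ IH]; first by rewrite muni0 (rmorph0 mmult).
rewrite -mul_mpolyC muniD mmultD muniM muniC mmultM mmultC mwidenC.
exact: (f_equal2 +%R (f_equal (fun z => c%:MP * z) (mmult_muniX m)) IH).
Qed.

Lemma muni_surj q : exists p : {mpoly R[n.+1]}, muni p = q.
Proof.
elim/poly_ind: q => [|q c [p Ep]]; first by exists 0; rewrite muni0.
suff [p' Ep'] : exists p' : {mpoly R[n.+1]}, muni p' = c%:P.
  by exists (p * 'X_ord_max + p'); rewrite rmorphD rmorphM /= Ep muniX_max Ep'.
exists (mwiden c); elim/mpolyind: c => [|a m c _ _ IH]; first by rewrite mwiden0 muni0.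
have E : muni (mwiden ('X_[m] : {mpoly R[n]})) = ('X_[m] : {mpoly R[n]})%:P.
  rewrite mpolyXE_id.
  rewrite (rmorph_prod (@mwiden n R)) (rmorph_prod (@muni n R)) (rmorph_prod (@polyC _)).
  apply: eq_bigr => i _; rewrite (rmorphXn (@mwiden n R)) (rmorphXn (@muni n R)) (rmorphXn (@polyC _)).
  congr (_ ^+ _); transitivity (muni (mwiden ('X_i : {mpoly R[n]}))) => //.
  by rewrite mwidenX mnmwiden1 muniX_widen.
rewrite -mul_mpolyC mwidenD muniD polyCD mwidenM muniM mwidenC muniC polyCM.
exact: (f_equal2 +%R (f_equal (fun z => (a%:MP)%:P * z) E) IH).
Qed.

Lemma mmult_inj : injective mmult.
Proof.
move=> p q; have [p' <-] := muni_surj p; have [q' <-] := muni_surj q.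
move=> E; exact: (congr1 _ (etrans (esym (mmultK p')) (etrans E (mmultK q')))).
Qed.

Lemma muniK q : muni (mmult q) = q.
Proof. apply: mmult_inj; exact: mmultK. Qed.

Lemma meval_muni (p : {mpoly R[n.+1]}) (v : 'I_n.+1 -> R) :
  p.@[v] = (map_poly (meval (fun i => v (widen i))) (muni p)).[v ord_max].
Proof.
elim/mpolyind: p => [|c m p _ _ IH]; first by rewrite muni0 map_poly0 horner0 meval0.
rewrite muniD mevalD rmorphD /= hornerD IH; congr (_ + _).
rewrite -mul_mpolyC muniM muniC mevalM mevalC rmorphM /= map_polyC hornerM hornerC /= mevalC; congr (_ * _).
rewrite mpolyXE_id !rmorph_prod /= horner_prod; apply: eq_bigr => i _.
rewrite !rmorphXn /= horner_exp mevalXU; congr (_ ^+ _) => /=.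
have [li|ge] := ltnP i n.
  have -> : i = widen (Ordinal li) by apply: val_inj.
  by rewrite muniX_widen map_polyC hornerC /= mevalXU.
have -> : i = ord_max by apply/val_inj/eqP; rewrite eqn_leq ge -ltnS /= ltn_ord.
by rewrite muniX_max map_polyX hornerX.
Qed.

End MpolyInduction.

Lemma ufd_iso (R S : idomainType) (f : {rmorphism R -> S}) (g : {rmorphism S -> R}) :
  cancel f g -> cancel g f -> ufd R -> ufd S.
Proof.
move=> fK gK uR a a0; have [|u [s [uu ps E]]] := uR (g a).
  by apply: contraNneq a0 => ga0; rewrite -[a]gK ga0 rmorph0.
have rd x y : rdvd (f x) y -> rdvd x (g y).
  by case=> c ->; exists (g c); rewrite rmorphM fK.
exists (f u), (map f s); split; first exact: rmorph_unit.
  move=> _ /mapP[p /ps[p0 p1 pp] ->]; split.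
  - by apply: contraNneq p0 => fp0; rewrite -[p]fK fp0 rmorph0.
  - by move/rd; rewrite rmorph1.
  - move=> b c /rd; rewrite rmorphM => /pp[[d E']|[d E']]; [left|right]; exists (f d);
    by rewrite -rmorphM -E' gK.
by rewrite -[a]gK E rmorphM rmorph_prod big_map.
Qed.

Lemma mpoly0E (R : idomainType) (p : {mpoly R[0]}) : p = (p@_0%MM)%:MP.
Proof.
apply/mpolyP=> m; rewrite mcoeffC (_ : m = 0%MM) ?eqxx ?mulr1 //.
by apply/mnmP=> -[].
Qed.

Definition snocv (R : Type) n (v : 'I_n -> R) (x : R) (i : 'I_n.+1) :=
  if (insub (i : nat) : option 'I_n) is Some j then v j else x.

Lemma mpoly_iso (R : idomainType) n :
  exists (f : {rmorphism {mpoly R[n.+1]} -> {poly {mpoly R[n]}}})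
         (g : {rmorphism {poly {mpoly R[n]}} -> {mpoly R[n.+1]}}),
    [/\ cancel f g, cancel g f
      & forall p v x, p.@[snocv v x] = (map_poly (meval v) (f p)).[x]].
Proof.
exists (@muni n R), (@mmult n R); split; [exact: mmultK|exact: muniK|move=> p v x].
have wv i : snocv v x (widen i) = v i by rewrite /snocv /= valK.
have wx : snocv v x ord_max = x by rewrite /snocv insubN //= ltnn.
rewrite meval_muni wx; congr (_.[_]); apply: eq_map_poly => q; exact: meval_eq.
Qed.

Lemma ufd_mpoly (F : fieldType) n : ufd {mpoly F[n]}.
Proof.
elim: n => [|n IH].
  move=> p; rewrite (mpoly0E p) mpolyC_eq0 => c0.
  exists (p@_0%MM)%:MP, [::]; split=> //; last by rewrite big_nil mulr1.
  by apply: (rmorph_unit (@mpolyC 0 F)); rewrite unitfE.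
have [f [g [fK gK _]]] := mpoly_iso F n.
exact: (ufd_iso gK fK (ufd_poly IH)).
Qed.

Section Infinite.
Variable L : closedFieldType.

Lemma exists_notin (s : seq L) : exists x : L, x \notin s.
Proof.
have [x] := closed_nonrootP (\prod_(a <- s) ('X - a%:P)) (monic_neq0 (monic_prod_XsubC _ _ _)).
by rewrite root_prod_XsubC; exists x.
Qed.

Lemma poly_nonroot (p : {poly L}) : p != 0 -> exists x, p.[x] != 0.
Proof. by move=> /closed_nonrootP[x]; exists x. Qed.

Lemma poly_eq0_horner (p : {poly L}) : (forall x, p.[x] = 0) -> p = 0.
Proof. by move=> H; apply/eqP/negP => /negP/poly_nonroot[x]; rewrite H eqxx. Qed.

Lemma mpoly_nonroot n (p : {mpoly L[n]}) : p != 0 -> exists v : 'I_n -> L, p.@[v] != 0.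
Proof.
elim: n p => [|n IH] p p0.
  by exists (fun=> 0); rewrite (mpoly0E p) mevalC; rewrite (mpoly0E p) mpolyC_eq0 in p0.
have [f [g [fK _ fE]]] := mpoly_iso L n.
have q0 : f p != 0 by apply: contraNneq p0 => q0; rewrite -[p]fK q0 rmorph0.
have l0 : lead_coef (f p) != 0 by rewrite lead_coef_eq0.
have [v Hv] := IH _ l0.
have : map_poly (meval v) (f p) != 0.
  apply: contraNneq Hv => E; apply/eqP.
  by have := congr1 (fun q : {poly L} => q`_(size (f p)).-1) E; rewrite coef_map coef0.
by move=> /poly_nonroot[x Hx]; exists (snocv v x); rewrite fE.
Qed.

End Infinite.

Lemma rprime_iso (R S : idomainType) (f : {rmorphism R -> S}) (g : {rmorphism S -> R}) p :
  cancel f g -> cancel g f -> rprime p -> rprime (f p).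
Proof.
move=> fK gK [p0 p1 pp]; have rd y : rdvd (f p) y -> rdvd p (g y).
  by case=> c ->; exists (g c); rewrite rmorphM fK.
split.
- by apply: contraNneq p0 => fp0; rewrite -[p]fK fp0 rmorph0.
- by move/rd; rewrite rmorph1.
- move=> b c /rd; rewrite rmorphM => /pp[[d E']|[d E']]; [left|right]; exists (f d);
  by rewrite -rmorphM -E' gK.
Qed.

Lemma rdvd_size1 (A : idomainType) (p : {poly A}) c : (1 < size p)%N -> c != 0 -> ~ rdvd p c%:P.
Proof.
move=> s1 c0 [e E]; have e0 : e != 0 by apply: contraNneq c0 => e0; rewrite -polyC_eq0 E e0 mul0r.
have := @size_mul _ e p e0; rewrite -E size_polyC c0 -size_poly_gt0; rewrite -size_poly_gt0 in e0.
by move=> /(_ (ltnW s1)); move: s1 e0; lia.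
Qed.

(** The constant is the resultant, or [r] itself when [r] has degree zero. A vanishing resultant
    would give a nonconstant common factor, and primality of [p] would then make [p] divide a
    nonzero constant or [r]. *)
Lemma bezout_const (A : idomainType) (p r : {poly A}) : rprime p -> (1 < size p)%N -> ~ rdvd p r ->
  exists (U V : {poly A}) (d : A), d != 0 /\ d%:P = U * p + V * r.
Proof.
move=> pp s1 nr; have [p0 _ ppr] := pp.
have [sr|sr] := leqP (size r) 1.
  have [c Ec] : exists c, r = c%:P by exists r`_0; apply: size1_polyC.
  exists 0, 1, c; rewrite mul0r mul1r add0r Ec; split=> //; apply: contra_notN nr => /eqP c0.
  by rewrite Ec c0; exists 0; rewrite mul0r.
have [[U V] /= _ E] := resultant_in_ideal s1 sr; exists U, V, (resultant p r); split=> //.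
rewrite resultant_eq0 -leqNgt leqNgt; apply/negP => sd.
have /Pdiv.Idomain.dvdpP[[c k1] /= c0 E1] : gcdp p r %| p by apply: dvdp_gcdl.
have /Pdiv.Idomain.dvdpP[[c' k2] /= c'0 E2] : gcdp p r %| r by apply: dvdp_gcdr.
have : rdvd p (k1 * gcdp p r) by rewrite -E1 -mul_polyC; exists c%:P.
case/ppr=> [[m Em]|[m Em]].
  have: (c%:P - m * gcdp p r) * p = 0 by rewrite mulrBl mul_polyC E1 {1}Em; ring.
  by move/eqP; rewrite mulf_eq0 (negbTE p0) orbF subr_eq0 => /eqP Ec; case: (rdvd_size1 sd c0); exists m.
have : rdvd p (c'%:P * r) by exists (k2 * m); rewrite mul_polyC E2 Em mulrA.
by case/ppr=> //; apply: rdvd_size1.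
Qed.

(** * The Nullstellensatz for a principal prime ideal *)

Section Nullstellensatz.
Variable L : closedFieldType.

Lemma nullst n (p g : {mpoly L[n]}) :
  rprime p -> (forall v, p.@[v] = 0 -> g.@[v] = 0) -> rdvd p g.
Proof.
elim: n p g => [|n IH] p g pp H.
  case: (pp) => p0 p1 _; case: p1; exists (p@_0%MM)^-1%:MP.
  by rewrite {2}(mpoly0E p) -mpolyCM mulVf ?mpolyC1 //; rewrite -(mpolyC_eq0 0) -mpoly0E.
have [f [h [fK hK fE]]] := mpoly_iso L n.
have pP : rprime (f p) := rprime_iso fK hK pp.
suff: rdvd (f p) (f g).
  by case=> c E; exists (h c); rewrite -[g]fK E rmorphM /= fK.
have {}H v x : (map_poly (meval v) (f p)).[x] = 0 -> (map_poly (meval v) (f g)).[x] = 0.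
  by rewrite -!fE; apply: H.
move: (f p) (f g) pP H => {pp} {}p {}g pp H.
have [p0 p1 ppr] := pp.
(* If the last variable does not occur in [p], the induction hypothesis applies to each coefficient
   of [g]. *)
have [s1|s1] := leqP (size p) 1.
  have [c Ec] : exists c, p = c%:P by exists p`_0; apply: size1_polyC.
  rewrite Ec; apply/rdvd_polyC => i; apply: IH => [|v cv].
    split; first by rewrite -polyC_eq0 -Ec.
      by case=> d E; apply: p1; exists d%:P; rewrite Ec -polyCM -E.
    move=> a b [d E]; have D : rdvd p (a%:P * b%:P) by exists d%:P; rewrite Ec -!polyCM E.
    by have [[e Ee]|[e Ee]] := ppr _ _ D; [left|right]; exists e`_0;
      move/(congr1 (fun q : {poly _} => q`_0)): Ee; rewrite Ec coefMC coefC.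
  have : map_poly (meval v) g = 0.
    by apply: poly_eq0_horner => x; apply: H; rewrite Ec map_polyC hornerC.
  by move/(congr1 (fun q : {poly _} => q`_i)); rewrite coef_map coef0.
(* Otherwise a nonzero polynomial [d] in the remaining variables lies in the ideal of [p] and [g].
   Over a point where neither [d] nor the leading coefficient of [p] vanishes, [p] has a root; [g]
   vanishes there too, hence so does [d]. *)
apply: contrapT => /(bezout_const pp s1)[U [V [d [d0 E]]]].
have [|v] := mpoly_nonroot (p := d * lead_coef p); first by rewrite mulf_neq0 // lead_coef_eq0.
rewrite mevalM mulf_nz => /andP[dv lv].
have /closed_rootP[x /rootP px] : size (map_poly (meval v) p) != 1%N.
  by rewrite size_map_poly_id0 //; case: (size p) s1 => [|[]].
move/(congr1 (fun q => (map_poly (meval v) q).[x])): E.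
rewrite !(rmorphM, rmorphD) /= !map_polyC !hornerE px (H _ _ px) !mulr0 addr0 => e.
by rewrite e eqxx in dv.
Qed.

Lemma meval_row n (p : {mpoly L[n]}) (v : 'I_n -> L) : p.@[(\row_i v i) 0] = p.@[v].
Proof. by apply: meval_eq => i; rewrite mxE. Qed.

Lemma nonroot_row n (p : {mpoly L[n]}) : p != 0 -> exists o : 'rV[L]_n, p.@[o 0] != 0.
Proof. by move=> /mpoly_nonroot[v pv]; exists (\row_i v i); rewrite meval_row. Qed.

Lemma pev_neq0 n (p : {mpoly L[n]}) (o : 'rV[L]_n) : p.@[o 0] != 0 -> p != 0.
Proof. by apply: contraNneq => ->; rewrite meval0. Qed.

Lemma prime_point n (p g : {mpoly L[n]}) : rprime p -> ~ rdvd p g ->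
  exists2 o : 'rV[L]_n, p.@[o 0] = 0 & g.@[o 0] != 0.
Proof.
move=> pp ng; apply: contrapT => H; apply/ng/nullst => // v pv.
by apply/eqP/negP => /negP gv; apply: H; exists (\row_i v i); rewrite meval_row.
Qed.

End Nullstellensatz.

(** * Points of projective space and their normalized representatives *)

Section Points.
Variable L : fieldType.

Lemma normalized_neq0 n (v : 'rV[L]_n) : normalized v -> v != 0.
Proof.
case/existsP=> i /andP[/eqP vi _]; apply/eqP => v0; move/eqP: vi.
by rewrite v0 mxE eq_sym oner_eq0.
Qed.

Lemma proj_neq0 n (p : proj L n) : val p != 0.
Proof. exact/normalized_neq0/(valP p). Qed.

Lemma proj_eq n (p q : proj L n) c : val p = c *: val q -> p = q.
Proof.
move=> E; apply: val_inj => /=.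
case/existsP: (valP p) => i /andP[/eqP pi /forallP pj].
case/existsP: (valP q) => l /andP[/eqP ql /forallP qj].
have c0 : c != 0 by apply/eqP => c0; move/eqP: (proj_neq0 p); rewrite E c0 scale0r.
have pe m : val p 0 m = c * val q 0 m by rewrite E mxE.
have il : i = l.
  have [lt|lt|/val_inj //] := ltngtP (i : nat) l.
    have /implyP/(_ lt)/eqP qi := qj i; move/eqP: pi.
    by rewrite pe qi mulr0 eq_sym oner_eq0.
  have /implyP/(_ lt) := pj l; rewrite pe ql mulr1 => /eqP c00; by rewrite c00 eqxx in c0.
have c1 : c = 1 by have := pe l; rewrite ql mulr1 -il pi.
by rewrite [LHS]E c1 scale1r.
Qed.

Lemma proj_exists n (v : 'rV[L]_n.+1) : v != 0 ->
  exists (p : proj L n) c, c != 0 /\ v = c *: val p.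
Proof.
case/rV0Pn=> i0 Hi0; have ex : exists m : nat, [exists i : 'I_n.+1, (i == m :> nat) && (v 0 i != 0)].
  by exists i0; apply/existsP; exists i0; rewrite eqxx.
have [m /existsP[i /andP[/eqP im vi]] mmin] := ex_minnP ex.
have N : normalized ((v 0 i)^-1 *: v).
  apply/existsP; exists i; rewrite mxE mulVf // eqxx; apply/forallP => l; apply/implyP => li.
  rewrite mxE mulf_eq0 invr_eq0 (negbTE vi) /=; apply: contraTT li => vl.
  by rewrite -leqNgt im; apply: mmin; apply/existsP; exists l; rewrite eqxx.
by exists (exist (fun u : 'rV[L]_n.+1 => is_true (normalized u)) _ N), (v 0 i); split=> //=; rewrite scalerA mulfV // scale1r.
Qed.

Fact delta_normalized n : normalized (delta_mx 0 0 : 'rV[L]_n.+1).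
Proof. by apply/existsP; exists 0; rewrite mxE !eqxx; apply/forallP => l; rewrite ltn0. Qed.

(** Total on rows: the zero row, which represents no point, gets the first coordinate point as a
    default. *)
Definition mkp n (v : 'rV[L]_n.+1) : proj L n :=
  if pselect (exists (p : proj L n) c, c != 0 /\ v = c *: val p) is left H
  then projT1 (cid H) else exist (fun u : 'rV[L]_n.+1 => is_true (normalized u)) _ (delta_normalized n).

Lemma mkpP n (v : 'rV[L]_n.+1) : v != 0 -> exists2 c, c != 0 & v = c *: val (mkp v).
Proof.
move=> /proj_exists H; rewrite /mkp; case: pselect => // H'.
by case: (cid H') => p /= [c [c0 ->]]; exists c.
Qed.

Lemma mkp_eq n (v : 'rV[L]_n.+1) (p : proj L n) c : v != 0 -> v = c *: val p -> mkp v = p.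
Proof.
move=> v0 E; have [d d0 E'] := mkpP v0; apply: (@proj_eq _ _ _ (d^-1 * c)).
by rewrite -scalerA -E [in RHS]E' scalerA mulVf // scale1r.
Qed.

End Points.

(** * Forms, regular functions and morphisms *)

Section Germs.
Variables (k L : fieldType) (j : {rmorphism k -> L}).

(** Evaluation at arbitrary homogeneous coordinates, where [ev] uses the normalized ones;
    [evr_scale] compares the two on forms. *)
Definition evr n r (F : {mpoly k[n.+1 + r]}) (v : 'rV[L]_n.+1) (w : 'rV[L]_r) : L :=
  mmap j (row_mx v w 0) F.

Lemma evE n r (F : {mpoly k[n.+1 + r]}) (x : amb L n r) : ev j F x = evr F (val x.1) x.2.
Proof. by []. Qed.

Lemma evr_scale n r d (F : {mpoly k[n.+1 + r]}) c v w :
  form d F -> evr F (c *: v) w = c ^+ d * evr F v w.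
Proof.
move=> /dhomogP hF; rewrite /evr /mmap mulr_sumr !big_seq; apply: eq_bigr => m /hF /= md.
rewrite mulrCA; congr (_ * _); rewrite /mmap1 !big_split_ord /= mulrA; congr (_ * _); last first.
  by apply: eq_bigr => i _; rewrite !row_mxEr.
rewrite -md /pdeg /= expr_sum -big_split; apply: eq_bigr => i _.
by rewrite !row_mxEl mxE exprMn.
Qed.

Lemma evr_mmap n r (F : {mpoly k[n.+1 + r]}) (a : 'I_n.+1 -> L) (b : 'I_r -> L) :
  evr F (\row_i a i) (\row_i b i) =
  mmap j (fun i => match split i with inl l => a l | inr l => b l end) F.
Proof.
rewrite /evr /mmap; apply: eq_bigr => m _; congr (_ * _); apply: eq_bigr => i _.
by rewrite mxE; case: split => l; rewrite mxE.
Qed.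

Section FormAlg.
Variables (n r : nat).
Implicit Types F G : {mpoly k[n.+1 + r]}.
Lemma form0 d : form d (0 : {mpoly k[n.+1 + r]}). Proof. exact: dhomog0. Qed.
Lemma formD d F G : form d F -> form d G -> form d (F + G). Proof. exact: dhomogD. Qed.
Lemma formZ d c F : form d F -> form d (c *: F). Proof. exact: dhomogZ. Qed.
Lemma formN d F : form d F -> form d (- F). Proof. by rewrite -scaleN1r; apply: formZ. Qed.
Lemma formXA i : form 0 ('X_(rshift n.+1 i) : {mpoly k[n.+1 + r]}).
Proof.
rewrite /form dhomogX; apply/eqP; rewrite /= /pdeg big1 // => l _.
by rewrite mnm1E eq_rlshift.
Qed.
Lemma formXP i : form 1 ('X_(lshift r i) : {mpoly k[n.+1 + r]}).
Proof.
rewrite /form dhomogX; apply/eqP; rewrite /= /pdeg (bigD1 i) //= big1 => [|l li].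
  by rewrite mnm1E eqxx.
by rewrite mnm1E eq_lshift eq_sym (negbTE li).
Qed.
Lemma evX i (x : amb L n r) : ev j 'X_i x = coords x 0 i.
Proof. by rewrite /ev mmapX mmap1U. Qed.
Lemma evXA i (x : amb L n r) : ev j 'X_(rshift n.+1 i) x = x.2 0 i.
Proof. by rewrite evX /coords row_mxEr. Qed.
Lemma evXP i (x : amb L n r) : ev j 'X_(lshift r i) x = val x.1 0 i.
Proof. by rewrite evX /coords row_mxEl. Qed.
Lemma evC c (x : amb L n r) : ev j c%:MP x = j c. Proof. exact: mmapC. Qed.
Lemma evD F G (x : amb L n r) : ev j (F + G) x = ev j F x + ev j G x.
Proof. exact: rmorphD. Qed.
Lemma evN F (x : amb L n r) : ev j (- F) x = - ev j F x. Proof. exact: rmorphN. Qed.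
Lemma evZ c F (x : amb L n r) : ev j (c *: F) x = j c * ev j F x. Proof. exact: mmapZ. Qed.
Lemma ev_prod I (s : seq I) (P : pred I) (F : I -> {mpoly k[n.+1 + r]}) (x : amb L n r) :
  ev j (\prod_(i <- s | P i) F i) x = \prod_(i <- s | P i) ev j (F i) x.
Proof. exact: rmorph_prod. Qed.
Lemma ev_sum I (s : seq I) (P : pred I) (F : I -> {mpoly k[n.+1 + r]}) (x : amb L n r) :
  ev j (\sum_(i <- s | P i) F i) x = \sum_(i <- s | P i) ev j (F i) x.
Proof. exact: rmorph_sum. Qed.
Lemma form_prod I (s : seq I) (P : pred I) (d : I -> nat) (F : I -> {mpoly k[n.+1 + r]}) :
  (forall i, form (d i) (F i)) -> form (\sum_(i <- s | P i) d i) (\prod_(i <- s | P i) F i).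
Proof.
move=> H; elim: s => [|i s IH]; first by rewrite !big_nil; apply: form1.
by rewrite !big_cons; case: ifP => // _; apply: formM.
Qed.
Lemma form_sum d I (s : seq I) (P : pred I) (F : I -> {mpoly k[n.+1 + r]}) :
  (forall i, P i -> form d (F i)) -> form d (\sum_(i <- s | P i) F i).
Proof. by move=> H; elim/big_rec: _ => [|i F' Pi]; [apply: form0|apply/formD/H]. Qed.
End FormAlg.

Section Local.
Variables (n r : nat) (X : amb L n r -> Prop).
Implicit Types (x y : amb L n r) (g h : amb L n r -> L).

(** Neighbourhoods and regularity are localized at one point, so that algebra and composition
    require no bookkeeping of domains; [reg_fun] is [reg_at] at every point of [X]. *)
Definition near x (P : amb L n r -> Prop) :=
  exists d (G : {mpoly k[n.+1 + r]}),
    [/\ form d G, ev j G x != 0 & forall y, X y -> ev j G y != 0 -> P y].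

Definition reg_at g x := exists d (G H : {mpoly k[n.+1 + r]}),
  [/\ form d G, form d H, ev j H x != 0
    & forall y, X y -> ev j H y != 0 -> g y = ev j G y / ev j H y].

Lemma nearW x (P Q : amb L n r -> Prop) : (forall y, X y -> P y -> Q y) -> near x P -> near x Q.
Proof. by move=> PQ [d [G [fG Gx GP]]]; exists d, G; split=> // y Xy /(GP y Xy); apply: PQ. Qed.

Lemma near_self x P : X x -> near x P -> P x.
Proof. by move=> Xx [d [G [_ Gx]]]; apply. Qed.

Lemma nearA x (P : amb L n r -> Prop) : (forall y, X y -> P y) -> near x P.
Proof.
by move=> H; exists 0%N, 1; split; rewrite ?ev1 ?oner_eq0 //; [apply: form1|move=> y /H].
Qed.

Lemma near_and x (P Q : amb L n r -> Prop) :
  near x P -> near x Q -> near x (fun y => P y /\ Q y).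
Proof.
move=> [d [G [fG Gx GP]]] [e [H [fH Hx HQ]]]; exists (d + e)%N, (G * H); split.
- exact: formM.
- by rewrite evM mulf_neq0.
- by move=> y Xy; rewrite evM mulf_nz => /andP[/(GP y Xy) ? /(HQ y Xy)].
Qed.

Lemma near_form x d G : form d G -> ev j G x != 0 -> near x (fun y => ev j G y != 0).
Proof. by move=> fG Gx; exists d, G. Qed.

Lemma reg_at_near x g h : near x (fun y => g y = h y) -> reg_at g x -> reg_at h x.
Proof.
move=> [d [K [fK Kx KP]]] [e [G [H [fG fH Hx E]]]].
(* The factor [K] shrinks the nonvanishing locus of the denominator to the neighbourhood on which
   the two functions agree. *)
exists (d + e)%N, (K * G), (K * H); split; try exact: formM.
  by rewrite evM mulf_neq0.
move=> y Xy; rewrite !evM mulf_nz => /andP[Ky Hy].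
by rewrite -KP // E // -mulf_div divff // mul1r.
Qed.

Lemma reg_at_eq x g h : (forall y, X y -> g y = h y) -> reg_at g x -> reg_at h x.
Proof. by move=> E; apply: reg_at_near; apply: nearA. Qed.

Lemma reg_at_cst x c : reg_at (fun=> j c) x.
Proof.
exists 0%N, c%:MP, 1; split; rewrite ?ev1 ?oner_eq0 //; last by move=> y _ _; rewrite evC ev1 divr1.
  by rewrite -[c%:MP]mulr1 mul_mpolyC; apply/formZ/form1.
exact: form1.
Qed.

Lemma reg_at0 x : reg_at (fun=> 0) x.
Proof. by rewrite -(rmorph0 j); apply: reg_at_cst. Qed.
Lemma reg_at1 x : reg_at (fun=> 1) x.
Proof. by rewrite -(rmorph1 j); apply: reg_at_cst. Qed.

Lemma reg_atD x g h : reg_at g x -> reg_at h x -> reg_at (fun y => g y + h y) x.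
Proof.
move=> [d [G [H [fG fH Hx gE]]]] [e [G' [H' [fG' fH' Hx' hE]]]].
exists (d + e)%N, (G * H' + G' * H), (H * H'); split.
- by apply: formD; [apply: formM|rewrite addnC; apply: formM].
- exact: formM.
- by rewrite evM mulf_neq0.
- move=> y Xy; rewrite !(evM, evD) mulf_nz => /andP[Hy Hy'].
  by rewrite gE // hE // addf_div.
Qed.

Lemma reg_atM x g h : reg_at g x -> reg_at h x -> reg_at (fun y => g y * h y) x.
Proof.
move=> [d [G [H [fG fH Hx gE]]]] [e [G' [H' [fG' fH' Hx' hE]]]].
exists (d + e)%N, (G * G'), (H * H'); split; try exact: formM.
- by rewrite evM mulf_neq0.
- move=> y Xy; rewrite !evM mulf_nz => /andP[Hy Hy'].
  by rewrite gE // hE // mulf_div.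
Qed.

Lemma reg_atN x g : reg_at g x -> reg_at (fun y => - g y) x.
Proof.
move=> rg; apply: (@reg_at_eq _ (fun y => j (-1) * g y)).
  by move=> y _; rewrite rmorphN1 mulN1r.
exact/reg_atM/rg/reg_at_cst.
Qed.

Lemma reg_at_neq0 x g : X x -> reg_at g x -> g x != 0 -> near x (fun y => g y != 0).
Proof.
move=> Xx [d [G [H [fG fH Hx gE]]]]; rewrite gE // mulf_eq0 invr_eq0 negb_or => /andP[Gx _].
exists (d + d)%N, (G * H); split; first exact: formM.
  by rewrite evM mulf_neq0.
move=> y Xy; rewrite evM mulf_nz => /andP[Gy Hy].
by rewrite gE // mulf_neq0 ?invr_eq0.
Qed.

Lemma reg_atV x g : X x -> g x != 0 -> reg_at g x -> reg_at (fun y => (g y)^-1) x.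
Proof.
move=> Xx gx rg; have [d [G [H [fG fH Hx gE]]]] := rg.
have Gx : ev j G x != 0 by move: gx; rewrite gE // mulf_nz => /andP[].
exists (d + d)%N, (H * H), (G * H); split; try exact: formM.
  by rewrite evM mulf_neq0.
move=> y Xy; rewrite !evM mulf_nz => /andP[Gy Hy].
by rewrite gE // invf_div -mulf_div divff // mulr1.
Qed.

Lemma reg_at_div x g h : X x -> h x != 0 -> reg_at g x -> reg_at h x ->
  reg_at (fun y => g y / h y) x.
Proof. by move=> Xx hx rg rh; apply: reg_atM => //; apply: reg_atV. Qed.

Lemma reg_at_sum x I (s : seq I) (g : I -> amb L n r -> L) :
  (forall i, reg_at (g i) x) -> reg_at (fun y => \sum_(i <- s) g i y) x.
Proof.
move=> H; elim: s => [|i s IH].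
  by apply: (reg_at_eq _ (reg_at0 x)) => y _; rewrite big_nil.
by apply: (reg_at_eq _ (reg_atD (H i) IH)) => y _; rewrite big_cons.
Qed.

Lemma reg_at_prod x I (s : seq I) (g : I -> amb L n r -> L) :
  (forall i, reg_at (g i) x) -> reg_at (fun y => \prod_(i <- s) g i y) x.
Proof.
move=> H; elim: s => [|i s IH].
  by apply: (reg_at_eq _ (reg_at1 x)) => y _; rewrite big_nil.
by apply: (reg_at_eq _ (reg_atM (H i) IH)) => y _; rewrite big_cons.
Qed.

Lemma reg_atX x g m : reg_at g x -> reg_at (fun y => g y ^+ m) x.
Proof.
move=> H; elim: m => [|m IH]; first exact: reg_at_eq (reg_at1 x).
by apply: (reg_at_eq _ (reg_atM H IH)) => y _; rewrite exprS.
Qed.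

Lemma reg_at_mmap x m (g : 'I_m -> amb L n r -> L) (P : {mpoly k[m]}) :
  (forall i, reg_at (g i) x) -> reg_at (fun y => mmap j (g^~ y) P) x.
Proof.
move=> H; apply: reg_at_sum => a; apply: reg_atM; first exact: reg_at_cst.
by apply: reg_at_prod => i; apply: reg_atX.
Qed.

Lemma reg_at_form x d G H : form d G -> form d H -> ev j H x != 0 ->
  reg_at (fun y => ev j G y / ev j H y) x.
Proof. by move=> fG fH Hx; exists d, G, H. Qed.

Lemma reg_at_affine x i : reg_at (fun y => y.2 0 i) x.
Proof.
exists 0%N, 'X_(rshift n.+1 i), 1; split; rewrite ?ev1 ?oner_eq0 //; try exact: form1.
  exact: formXA.
by move=> y _ _; rewrite ev1 divr1 evXA.
Qed.

Lemma reg_at_proj x i l : val x.1 0 l != 0 -> reg_at (fun y => val y.1 0 i / val y.1 0 l) x.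
Proof.
move=> xl; have : reg_at (fun y => ev j 'X_(lshift r i) y / ev j 'X_(lshift r l) y) x.
  by apply: (@reg_at_form _ 1); rewrite ?evXP //; apply: formXP.
by apply: reg_at_eq => y _; rewrite !evXP.
Qed.

End Local.

Lemma reg_at_sub n r (X Y : amb L n r -> Prop) g x :
  (forall y, Y y -> X y) -> reg_at X g x -> reg_at Y g x.
Proof. by move=> YX [d [G [H [? ? ? E]]]]; exists d, G, H; split=> // y /YX; apply: E. Qed.

Lemma near_sub n r (X Y : amb L n r -> Prop) P x :
  (forall y, Y y -> X y) -> near X x P -> near Y x P.
Proof. by move=> YX [d [G [? ? E]]]; exists d, G; split=> // y /YX; apply: E. Qed.

Section Maps.
Variables (n r n' r' : nat) (X : amb L n r -> Prop).
Implicit Types (f : amb L n r -> amb L n' r').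

(** The projective coordinates are regular functions known up to a common factor, instead of forms
    of one degree: this version is stable under composition, and [reg_map_of] recovers forms by
    clearing denominators. *)
Definition regm_at f x :=
  (exists a : 'I_n'.+1 -> amb L n r -> L,
    [/\ forall i, reg_at X (a i) x, exists i, a i x != 0
      & near X x (fun y => exists2 c, c != 0 & forall i, a i y = c * val (f y).1 0 i)]) /\
  forall i, reg_at X (fun y => (f y).2 0 i) x.

Lemma regm_at_of Y f x : reg_map j X Y f -> X x -> regm_at f x.
Proof.
case=> [_ pf af] Xx; split; last by move=> i; apply: (af i x Xx).
have [d [F [fF [l Fl] E]]] := pf x Xx.
exists (fun i y => ev j (F i) y / ev j (F l) y); split.
- by move=> i; apply: reg_at_form.
- by exists l; rewrite divff ?oner_eq0.
apply: nearW (near_form X (fF l) Fl) => y Xy Fly.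
have [|c Ec] := E y Xy; first by exists l.
exists (c / ev j (F l) y); last by move=> i; rewrite Ec mulrAC.
by apply: contraNneq Fly => /eqP; rewrite mulf_eq0 invr_eq0 => /orP[/eqP c0|//]; rewrite Ec c0 mul0r.
Qed.

Lemma reg_map_of Y f : (forall x, X x -> Y (f x)) -> (forall x, X x -> regm_at f x) -> reg_map j X Y f.
Proof.
move=> XY H; split=> // [x Xx|i x Xx]; last by have [_] := H x Xx; apply.
have [[a [ra [l al] [d [K [fK Kx KP]]]]] _] := H x Xx.
have /choice[D /choice[G /choice[H' HD]]] := ra.
pose P := \prod_(i <- enum 'I_n'.+1) H' i.
pose Q (i : 'I_n'.+1) := \prod_(m <- enum 'I_n'.+1 | m != i) H' m.
have PE i : P = H' i * Q i by rewrite /P (bigD1_seq i) ?enum_uniq ?mem_enum.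
have fP : form (\sum_(i <- enum 'I_n'.+1) D i) P by apply: form_prod => i; case: (HD i).
have fQ i : form (\sum_(m <- enum 'I_n'.+1 | m != i) D m) (Q i).
  by apply: form_prod => m; case: (HD m).
have P0 y : (ev j P y != 0) -> forall i, ev j (H' i) y != 0.
  by move=> Py i; move: Py; rewrite (PE i) evM mulf_nz => /andP[].
have Px : ev j P x != 0.
  by rewrite ev_prod prodf_seq_neq0; apply/allP => i _; case: (HD i).
exists (d + (\sum_(i <- enum 'I_n'.+1) D i + \sum_(i <- enum 'I_n'.+1) D i))%N.
(* The extra factors [K] and [P] make all [F i] vanish outside the neighbourhood on which [a]
   represents [f]. *)
pose F i := K * (P * (G i * Q i)); exists F.
have FE y : X y -> ev j K y != 0 -> ev j P y != 0 -> forall i, ev j (F i) y = ev j K y * ev j P y ^+ 2 * a i y.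
  move=> Xy Ky Py i; rewrite !evM; case: (HD i) => _ _ _ -> //; last exact: P0.
  have Hy := P0 y Py i; rewrite [X in _ = _ * X ^+ 2 * _](_ : _ = ev j (H' i) y * ev j (Q i) y); last by rewrite -evM -PE.
  rewrite (_ : ev j P y = ev j (H' i) y * ev j (Q i) y); last by rewrite -evM -PE.
  by field.
split.
- move=> i; rewrite /F; apply: formM => //; apply: formM => //.
  rewrite (bigD1_seq i) ?enum_uniq ?mem_enum //=; apply: formM => //; by case: (HD i).
- by exists l; rewrite FE // !mulf_neq0 ?expf_neq0.
move=> y Xy [i]; rewrite /F !evM !mulf_eq0 !negb_or => /and3P[Ky Py _].
have [c _ Ec] := KP y Xy Ky; exists (ev j K y * ev j P y ^+ 2 * c) => m.
by rewrite FE // Ec mulrA.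
Qed.

Variable Y : amb L n' r' -> Prop.
Variables (f : amb L n r -> amb L n' r') (x : amb L n r).
Hypotheses (Xx : X x) (XY : forall y, X y -> Y (f y)) (rf : regm_at f x).

(** A form has no value at a point, but substituting the local coordinates of [f] represents it by a
    regular function up to the nonzero factor [c ^+ d]; this is enough to decide nonvanishing. *)
Lemma form_comp d (G : {mpoly k[n'.+1 + r']}) : form d G ->
  exists2 u : amb L n r -> L, reg_at X u x &
    near X x (fun y => exists2 c, c != 0 & u y = c ^+ d * ev j G (f y)).
Proof.
move=> fG; case: rf => -[a [ra _ na]] rb.
pose b i y := match split i with inl l => a l y | inr l => (f y).2 0 l end.
exists (fun y => mmap j (b^~ y) G); first by apply: reg_at_mmap => i; rewrite /b; case: split => l.
apply: nearW na => y Xy [c c0 Ec]; exists c => //.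
transitivity (evr G (\row_i a i y) (\row_i (f y).2 0 i)); first by rewrite evr_mmap.
rewrite evE -evr_scale //; congr evr; apply/rowP => i; rewrite !mxE //; by rewrite Ec.
Qed.

Lemma near_comp (P : amb L n' r' -> Prop) :
  near Y (f x) P -> near X x (fun y => P (f y)).
Proof.
move=> [d [G [fG Gx GP]]]; have [u ru nu] := form_comp fG.
have ux : u x != 0.
  by have [c c0 ->] := near_self Xx nu; rewrite mulf_neq0 // expf_neq0.
apply: nearW (near_and (reg_at_neq0 Xx ru ux) nu) => y Xy [uy [c c0 E]].
by apply: GP; [apply: XY|apply: contraNneq uy => Gy; rewrite E Gy mulr0].
Qed.

Lemma reg_at_comp g : reg_at Y g (f x) -> reg_at X (fun y => g (f y)) x.
Proof.
move=> [d [G [H [fG fH Hx E]]]].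
case: rf => -[a [ra _ na]] rb.
pose b i y := match split i with inl l => a l y | inr l => (f y).2 0 l end.
pose U (F : {mpoly k[n'.+1 + r']}) y := mmap j (b^~ y) F.
have rU F : reg_at X (U F) x by apply: reg_at_mmap => i; rewrite /b; case: split => l.
have UE y c F e : (forall i, a i y = c * val (f y).1 0 i) -> form e F -> U F y = c ^+ e * ev j F (f y).
  move=> Ec fF; transitivity (evr F (\row_i a i y) (\row_i (f y).2 0 i)); first by rewrite evr_mmap.
  by rewrite evE -evr_scale //; congr evr; apply/rowP => i; rewrite !mxE // Ec.
have Ux : U H x != 0.
  by have [c c0 Ec] := near_self Xx na; rewrite (UE _ _ _ _ Ec fH) mulf_neq0 // expf_neq0.
apply: (@reg_at_near _ _ X x (fun y => U G y / U H y)); last exact: reg_at_div.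
apply: nearW (near_and (reg_at_neq0 Xx (rU H) Ux) na) => y Xy [uy [c c0 Ec]].
move: uy; rewrite !(UE _ _ _ _ Ec fH) (UE _ _ _ _ Ec fG) mulf_nz => /andP[cd Hy].
rewrite (E _ (XY Xy) Hy); move: (ev j H (f y)) (ev j G (f y)) (c ^+ d) Hy cd => u v w u0 w0.
by field; apply/andP.
Qed.

End Maps.

Lemma regm_at_comp n r n' r' n2 r2 (X : amb L n r -> Prop) (Y : amb L n' r' -> Prop)
    (f : amb L n r -> amb L n' r') (g : amb L n' r' -> amb L n2 r2) x :
  X x -> (forall y, X y -> Y (f y)) -> regm_at X f x -> regm_at Y g (f x) ->
  regm_at X (fun y => g (f y)) x.
Proof.
move=> Xx XY rf [[a [ra ax na]] rb]; split; last by move=> i; apply: (reg_at_comp Xx XY rf (rb i)).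
exists (fun i y => a i (f y)); split=> //.
  by move=> i; apply: (reg_at_comp Xx XY rf).
exact: (near_comp Xx XY rf na).
Qed.

Lemma regm_at_sub n r n' r' (X Y : amb L n r -> Prop) (f : amb L n r -> amb L n' r') x :
  (forall y, Y y -> X y) -> regm_at X f x -> regm_at Y f x.
Proof.
move=> YX [[a [ra ax na]] rb]; split; last by move=> i; apply: reg_at_sub (rb i).
exists a; split=> //; first by move=> i; apply: reg_at_sub (ra i).
exact: near_sub na.
Qed.

Lemma regm_at_mkp n r n' r' (X : amb L n r -> Prop) (a : 'I_n'.+1 -> amb L n r -> L)
    (b : amb L n r -> 'rV[L]_r') x :
  X x -> (forall i, reg_at X (a i) x) -> (exists i, a i x != 0) ->
  (forall i, reg_at X (fun y => b y 0 i) x) ->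
  regm_at X (fun y => (mkp (\row_i a i y), b y)) x.
Proof.
move=> Xx ra [l al] rb; split=> //; exists a; split=> //; first by exists l.
apply: nearW (reg_at_neq0 Xx (ra l) al) => y Xy aly.
have [|c c0 E] := @mkpP _ _ (\row_i a i y).
  by apply/rV0Pn; exists l; rewrite mxE.
by exists c => // i; move/rowP/(_ i): E; rewrite !mxE.
Qed.

Lemma regm_at_eq n r n' r' (X : amb L n r -> Prop) (f g : amb L n r -> amb L n' r') x :
  near X x (fun y => f y = g y) -> regm_at X f x -> regm_at X g x.
Proof.
move=> E [[a [ra ax na]] rb]; split.
  exists a; split=> //; apply: nearW (near_and E na) => y _ [<-]; exact.
by move=> i; apply: reg_at_near (rb i); apply: nearW E => y _ ->.
Qed.

End Germs.

Section BaseChange.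
Variables (k L : fieldType) (j : {rmorphism k -> L}).

Lemma ev_map n r (F : {mpoly k[n.+1 + r]}) (x : amb L n r) :
  ev idfun (map_mpoly j F) x = ev j F x.
Proof.
rewrite /ev /mmap (perm_big _ (msupp_map_mpoly _ (fmorph_inj j))) /=.
by apply: eq_bigr => m _; rewrite mcoeff_map_mpoly.
Qed.

Lemma form_map n r d (F : {mpoly k[n.+1 + r]}) : form d F -> form d (map_mpoly j F).
Proof.
move=> /dhomogP fF; apply/dhomogP => m.
by rewrite (perm_mem (msupp_map_mpoly _ (fmorph_inj j))) => /fF.
Qed.

Lemma reg_at_map n r (X : amb L n r -> Prop) g x : reg_at j X g x -> reg_at idfun X g x.
Proof.
move=> [d [G [H [fG fH Hx E]]]]; exists d, (map_mpoly j G), (map_mpoly j H).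
by split; rewrite ?ev_map //; try exact: form_map; move=> y Xy; rewrite !ev_map; apply: E.
Qed.

Lemma near_map n r (X : amb L n r -> Prop) P x : near j X x P -> near idfun X x P.
Proof.
move=> [d [G [fG Gx E]]]; exists d, (map_mpoly j G).
by split; rewrite ?ev_map //; try exact: form_map; move=> y Xy; rewrite !ev_map; apply: E.
Qed.

Lemma regm_at_map n r n' r' (X : amb L n r -> Prop) (f : amb L n r -> amb L n' r') x :
  regm_at j X f x -> regm_at idfun X f x.
Proof.
move=> [[a [ra ax na]] rb]; split; last by move=> i; apply: reg_at_map.
exists a; split=> //; first by move=> i; apply: reg_at_map.
exact: near_map na.
Qed.

End BaseChange.

(** * Galois descent *)

Section Automorphisms.
Variables (K : fieldType) (L : closedFieldType) (iota : {rmorphism K -> L}).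
Hypothesis algL : forall x : L, algebraicOver iota x.

(** The graph of a homomorphism over K from a subring of [L] into [L]. With graphs, extension is
    inclusion and Zorn's lemma applies directly; closure under inverses follows from algebraicity
    ([ph_inv]). *)
Record partial_hom (G : L * L -> Prop) : Prop := PartialHom {
  ph_iota : forall a, G (iota a, iota a);
  ph_add : forall z w, G z -> G w -> G (z.1 + w.1, z.2 + w.2);
  ph_mul : forall z w, G z -> G w -> G (z.1 * w.1, z.2 * w.2);
  ph_fun : forall y, G (0, y) -> y = 0
}.

Section Extension.
Variables (G : L * L -> Prop) (HG : partial_hom G).

Lemma ph_opp z : G z -> G (- z.1, - z.2).
Proof.
move=> Gz; have := ph_mul HG (ph_iota HG (-1)) Gz.
by rewrite /= !rmorphN1 !mulN1r.
Qed.

Lemma ph_0 : G (0, 0). Proof. by rewrite -(rmorph0 iota); apply: ph_iota. Qed.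
Lemma ph_1 : G (1, 1). Proof. by rewrite -(rmorph1 iota); apply: ph_iota. Qed.

Lemma ph_uniq x y y' : G (x, y) -> G (x, y') -> y = y'.
Proof.
move=> Gy Gy'; have /= := ph_add HG Gy (ph_opp Gy'); rewrite subrr => /(ph_fun HG)/eqP.
by rewrite subr_eq0 => /eqP.
Qed.

(** A polynomial over the domain of the partial homomorphism, paired with its image. *)
Definition php (p q : {poly L}) := forall i, G (p`_i, q`_i).

Lemma phpD p q p' q' : php p q -> php p' q' -> php (p + p') (q + q').
Proof. by move=> H H' i; rewrite !coefD; apply: (ph_add HG (H i) (H' i)). Qed.
Lemma phpN p q : php p q -> php (- p) (- q).
Proof. by move=> H i; rewrite !coefN; apply: (ph_opp (H i)). Qed.
Lemma ph_sum n (f g : 'I_n -> L) : (forall i, G (f i, g i)) -> G (\sum_i f i, \sum_i g i).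
Proof.
elim: n f g => [|n IH] f g H; first by rewrite !big_ord0; apply: ph_0.
by rewrite !big_ord_recr /=; apply: (ph_add HG (IH _ _ _) (H ord_max)).
Qed.
Lemma phpM p q p' q' : php p q -> php p' q' -> php (p * p') (q * q').
Proof. by move=> H H' i; rewrite !coefM; apply: ph_sum => l; apply: (ph_mul HG (H l) (H' _)). Qed.
Lemma phpC a b : G (a, b) -> php a%:P b%:P.
Proof. by move=> H i; rewrite !coefC; case: eqP => // _; apply: ph_0. Qed.
Lemma phpXn n : php 'X^n 'X^n.
Proof. by move=> i; rewrite !coefXn; case: eqP => _; [apply: ph_1|apply: ph_0]. Qed.
Lemma php_horner p q a b : php p q -> G (a, b) -> G (p.[a], q.[b]).
Proof.
move=> H Gab; have [n [sp sq]] : exists n, (size p <= n)%N /\ (size q <= n)%N.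
  by exists (maxn (size p) (size q)); rewrite leq_maxl leq_maxr.
rewrite (horner_coef_wide _ sp) (horner_coef_wide _ sq); apply: ph_sum => i.
suff Gi m : G (a ^+ m, b ^+ m) by apply: (ph_mul HG (H i) (Gi i)).
elim: m => [|m IH]; first exact: ph_1.
by rewrite !exprS; apply: (ph_mul HG Gab IH).
Qed.
Lemma php_iota (p : {poly K}) : php (map_poly iota p) (map_poly iota p).
Proof. by move=> i; rewrite coef_map; apply: ph_iota. Qed.

(** The inverse of an algebraic element is a polynomial in it over K: an equation with nonzero
    constant term [c] reads [r(a) a = - c], and the same formula inverts the image [b]. *)
Lemma ph_inv a b : G (a, b) -> a != 0 -> G (a^-1, b^-1).
Proof.
move=> Gab a0; have [p p0 /rootP] := algL a.
elim/poly_ind: p p0 => [|p c IH]; first by rewrite eqxx.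
move=> p0 E; have [c0|c0] := eqVneq c 0.
  move: p0 E; rewrite c0 addr0 => p0; rewrite rmorphM /= map_polyX hornerM hornerX => /eqP.
  rewrite mulf_eq0 (negbTE a0) orbF => /eqP; apply: IH.
  by apply: contraNneq p0 => ->; rewrite mul0r.
have := php_horner (php_iota (p * 'X + c%:P)) Gab.
rewrite E => /(ph_fun HG) E'.
move: E E'; rewrite rmorphD rmorphM /= map_polyX map_polyC !hornerE /=.
set r := map_poly iota p => /eqP; rewrite addr_eq0 => /eqP E /eqP; rewrite addr_eq0 => /eqP E'.
have i0 : iota c != 0 by rewrite fmorph_eq0.
have -> : a^-1 = iota (- c^-1) * r.[a].
  apply: (mulfI a0); rewrite divff // mulrCA [a * _]mulrC E rmorphN fmorphV mulrNN mulVf //.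
have b0 : b != 0.
  by apply: contraNneq i0 => b0; move: E'; rewrite b0 mulr0 => /eqP; rewrite eq_sym oppr_eq0.
have -> : b^-1 = iota (- c^-1) * r.[b].
  apply: (mulfI b0); rewrite divff // mulrCA [b * _]mulrC E' rmorphN fmorphV mulrNN mulVf //.
exact: (ph_mul HG (ph_iota HG _) (php_horner (php_iota p) Gab)).
Qed.

Variable x : L.

Definition php_monic n := exists p q, [/\ php p q, p \is monic, root p x & size p = n].

Lemma php_monic_ex : exists n, php_monic n.
Proof.
have [p p0 px] := algL x; pose p1 := (lead_coef p)^-1 *: p.
exists (size p1), (map_poly iota p1), (map_poly iota p1); split; last by rewrite size_map_poly.
- exact: php_iota.
- by rewrite map_monic /p1 monicE lead_coefZ mulVf // lead_coef_eq0.
- by rewrite /p1 map_polyZ /= rootZ // fmorph_eq0 invr_eq0 lead_coef_eq0.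
Qed.

Variables (p0 q0 : {poly L}).
Hypotheses (P0 : php p0 q0) (mp0 : p0 \is monic) (rp0 : root p0 x).
Hypothesis min0 : forall n, php_monic n -> (size p0 <= n)%N.

Lemma php_size p q : php p q -> (size q <= size p)%N.
Proof.
move=> H; apply/leq_sizeP => i ip; apply: (ph_fun HG).
by have := H i; rewrite nth_default.
Qed.

Lemma php_small p q : php p q -> (size p < size p0)%N -> root p x -> p = 0 /\ q = 0.
Proof.
move=> H sp px; have [pz|pn] := eqVneq p 0.
  by split=> //; apply/polyP => i; rewrite coef0; apply: (ph_fun HG); have := H i; rewrite pz coef0.
have l0 : lead_coef p != 0 by rewrite lead_coef_eq0.
have Gl : G ((lead_coef p)^-1, (q`_(size p).-1)^-1) by apply: ph_inv (H _) l0.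
suff : (size p0 <= size p)%N by rewrite leqNgt sp.
apply: min0; exists ((lead_coef p)^-1%:P * p), ((q`_(size p).-1)^-1%:P * q); split.
- exact: phpM (phpC Gl) H.
- by rewrite mul_polyC monicE lead_coefZ mulVf.
- by rewrite mul_polyC rootZ // invr_eq0.
- by rewrite mul_polyC size_scale // invr_eq0.
Qed.

Lemma php_div p q : php p q -> exists r s d e,
  [/\ php r s, p = d * p0 + r, q = e * q0 + s & (size r < size p0)%N].
Proof.
elim: {p}(size p) {-2}p (leqnn (size p)) q => [|n IH] p sp q H.
  exists p, q, 0, 0; rewrite !mul0r !add0r; split=> //.
  by rewrite (leq_ltn_trans sp) // size_poly_gt0 monic_neq0.
have [lt|ge] := ltnP (size p) (size p0).
  by exists p, q, 0, 0; rewrite !mul0r !add0r.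
have [pz|pn] := eqVneq p 0.
  exists p, q, 0, 0; rewrite !mul0r !add0r; split=> //.
  by rewrite pz size_poly0 size_poly_gt0 monic_neq0.
pose m := (size p - size p0)%N; pose i := (size p).-1.
pose d := (p`_i)%:P * 'X^m; pose e := (q`_i)%:P * 'X^m.
have Hd : php d e by apply: phpM (phpXn m); apply: phpC.
have Hpq : php (p - d * p0) (q - e * q0) by apply: phpD H _; apply: phpN; apply: phpM.
have sz : (size (p - d * p0)%R <= n)%N.
  have sd : size (d * p0) = size p.
    have pi0 : p`_i != 0 by rewrite /i -lead_coefE lead_coef_eq0.
    have d0 : d != 0 by rewrite /d mulf_neq0 ?polyC_eq0 ?monic_neq0 ?monicXn.
    rewrite size_Mmonic // /d mul_polyC size_scale // size_polyXn /m addSn /=.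
    by rewrite subnK.
  rewrite -ltnS (leq_trans _ sp) //.
  have sle : (size (p - d * p0)%R <= size p)%N by rewrite (leq_trans (size_polyD _ _)) // size_polyN geq_max leqnn sd leqnn.
  rewrite ltn_neqAle sle andbT; apply/eqP => E.
  have : lead_coef (p - d * p0) = 0.
    rewrite lead_coefE E coefB [X in _ - X](_ : _ = lead_coef (d * p0)); last by rewrite lead_coefE sd.
    rewrite lead_coefM (monicP mp0) mulr1 /d lead_coefM lead_coefC (monicP (monicXn _ _)) mulr1.
    by rewrite subrr.
  move/eqP; rewrite lead_coef_eq0 => /eqP E0; move: E; rewrite E0 size_poly0 => /esym/eqP.
  by rewrite size_poly_eq0 (negbTE pn).
have [r [s [d' [e' [H1 H2 H3 H4]]]]] := IH _ sz _ Hpq.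
exists r, s, (d' + d), (e' + e); split=> //.
  by rewrite mulrDl addrAC -H2 subrK.
by rewrite mulrDl addrAC -H3 subrK.
Qed.

(** The extension sends [p.[x]] to [q.[y]]. It is well defined because a relation at [x] is a
    multiple of the minimal polynomial [p0], whose image [q0] vanishes at [y]. *)
Lemma php_extend y : root q0 y -> exists2 G', partial_hom G' & (forall z, G z -> G' z) /\ G' (x, y).
Proof.
move=> /rootP yq.
exists (fun z => exists p q, php p q /\ z = (p.[x], q.[y])); last split.
- split.
  + by move=> a; exists (iota a)%:P, (iota a)%:P; rewrite !hornerC; split=> //; apply: phpC (ph_iota HG a).
  + move=> _ _ [p [q [H ->]]] [p' [q' [H' ->]]]; exists (p + p'), (q + q').
    by rewrite !hornerD; split=> //; apply: phpD.
  + move=> _ _ [p [q [H ->]]] [p' [q' [H' ->]]]; exists (p * p'), (q * q').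
    by rewrite !hornerM; split=> //; apply: phpM.
  + move=> b [p [q [H [/esym px ->]]]]; have [r [s [d [e [H1 H2 H3 H4]]]]] := php_div H.
    have [] := php_small H1 H4.
      by apply/rootP; move: px; rewrite H2 hornerD hornerM (rootP rp0) mulr0 add0r.
    by move=> _ s0; rewrite H3 s0 addr0 hornerM yq mulr0.
- by move=> [a b] Gab; exists a%:P, b%:P; rewrite !hornerC; split=> //; apply: phpC.
- exists 'X, 'X; rewrite !hornerX; split=> //; have := phpXn 1; by rewrite !expr1.
Qed.

Lemma php_size0 : size q0 = size p0 /\ q0 \is monic.
Proof.
have l1 : q0`_(size p0).-1 = 1.
  by have := P0 (size p0).-1; rewrite -lead_coefE (monicP mp0) => /ph_uniq; apply; apply: ph_1.
have sE : size q0 = size p0.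
  apply/eqP; rewrite eqn_leq php_size //= leqNgt; apply/negP => lt; move/eqP: l1.
  rewrite nth_default ?[0 == 1]eq_sym ?oner_eq0 //; by case: (size p0) lt.
by split=> //; rewrite monicE lead_coefE sE l1.
Qed.

End Extension.

Lemma php_min (G : L * L -> Prop) (HG : partial_hom G) x : exists p0 q0,
  [/\ php G p0 q0, p0 \is monic, root p0 x & forall n, php_monic G x n -> (size p0 <= n)%N].
Proof.
have [n Hn] := php_monic_ex HG x.
have ex : exists n, `[< php_monic G x n >] by exists n; apply/asboolP.
have [m /asboolP[p [q [H1 H2 H3 sE]]] mmin] := ex_minnP ex.
by exists p, q; split=> // l /asboolP/mmin; rewrite sE.
Qed.

Lemma php_extend_root (G : L * L -> Prop) (HG : partial_hom G) x :
  exists2 G', partial_hom G' & (forall z, G z -> G' z) /\ exists y, G' (x, y).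
Proof.
have [p0 [q0 [P0 mp rp mn]]] := php_min HG x.
have [sE mq] := php_size0 HG P0 mp.
have /closed_rootP[y ry] : size q0 != 1%N.
  rewrite sE; apply/eqP => /eqP/size_poly1P[c c0 Ec].
  by move: rp; rewrite Ec rootC (negbTE c0).
have [G' HG' [GG' Gxy]] := php_extend HG P0 mp rp mn ry.
by exists G' => //; split=> //; exists y.
Qed.

(** Zorn's lemma: by [php_extend_root], a maximal graph is total. *)
Lemma partial_hom_total (G0 : L * L -> Prop) : partial_hom G0 ->
  exists2 G, partial_hom G & (forall z, G0 z -> G z) /\ forall x, exists y, G (x, y).
Proof.
move=> HG0; pose T := {G : L * L -> Prop | partial_hom G /\ forall z, G0 z -> G z}.
pose t0 : T := exist _ G0 (conj HG0 (fun z (h : G0 z) => h)).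
pose R (s t : T) := `[< forall z, sval s z -> sval t z >].
have [| | |t tmax] := @classical_sets.ZL_preorder T t0 R.
- by move=> t; apply/asboolP.
- by move=> r s t /asboolP rs /asboolP st; apply/asboolP => z /rs/st.
- move=> A tot; have [[a Aa]|nA] := pselect (exists a, A a); last first.
    by exists t0 => s As; case: nA; exists s.
  pose U z := exists2 t, A t & sval t z.
  have two z w : U z -> U w -> exists2 t, A t & sval t z /\ sval t w.
    move=> [s As sz] [t At tw]; case: (tot s t As At) => /asboolP H.
      by exists t => //; split=> //; apply: H.
    by exists s => //; split=> //; apply: H.
  have HU : partial_hom U.
    split.
    - by move=> b; exists a => //; case: (svalP a) => [[]].
    - move=> z w Uz Uw; have [t At [tz tw]] := two _ _ Uz Uw; exists t => //.
      by case: (svalP t) => [[_ H _ _] _]; apply: H.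
    - move=> z w Uz Uw; have [t At [tz tw]] := two _ _ Uz Uw; exists t => //.
      by case: (svalP t) => [[_ _ H _] _]; apply: H.
    - by move=> y [t At ty]; case: (svalP t) => [[_ _ _ H] _]; apply: H.
  have U0 z : G0 z -> U z by move=> Gz; exists a => //; case: (svalP a) => _; apply.
  by exists (exist _ U (conj HU U0)) => s As; apply/asboolP => z sz; exists s.
case: t tmax => G [HG GG0] tmax; exists G => //; split=> // x.
have [G' HG' [GG' [y Gy]]] := php_extend_root HG x.
exists y; have G0' z : G0 z -> G' z by move=> /GG0/GG'.
have /asboolP := tmax (exist _ G' (conj HG' G0')) (asboolT GG').
by apply.
Qed.

Section TotalGraph.
Variables (G : L * L -> Prop) (HG : partial_hom G) (tot : forall x, exists y, G (x, y)).

Definition gfun x := projT1 (cid (tot x)).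
Lemma gfunP x : G (x, gfun x). Proof. by rewrite /gfun; case: cid. Qed.
Lemma gfun_eq x y : G (x, y) -> gfun x = y. Proof. exact: (ph_uniq HG (gfunP x)). Qed.

Fact gfun_zmod : zmod_morphism gfun.
Proof. by move=> x y; apply: gfun_eq; apply: (ph_add HG (gfunP x) (ph_opp HG (gfunP y))). Qed.
Fact gfun_monoid : monoid_morphism gfun.
Proof.
split; first by apply: gfun_eq; apply: ph_1.
by move=> x y; apply: gfun_eq; apply: (ph_mul HG (gfunP x) (gfunP y)).
Qed.
HB.instance Definition _ := GRing.isZmodMorphism.Build L L gfun gfun_zmod.
HB.instance Definition _ := GRing.isMonoidMorphism.Build L L gfun gfun_monoid.

Lemma gfun_iota a : gfun (iota a) = iota a. Proof. by apply: gfun_eq; apply: ph_iota. Qed.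

(** An injective map over K permutes the finitely many roots in [L] of a polynomial over K, and [y]
    is such a root. *)
Lemma gfun_surj y : exists x, gfun x = y.
Proof.
have [p p0 py] := algL y; set q := map_poly iota p.
have q0 : q != 0 by rewrite map_poly_eq0.
have [s Es] := closed_field_poly_normal q; pose u := undup s.
have uP z : (z \in u) = root q z.
  by rewrite mem_undup Es rootZ ?lead_coef_eq0 // root_prod_XsubC.
have img : {subset map gfun u <= u}.
  move=> _ /mapP[z + ->]; rewrite !uP => /rootP qz; apply/rootP.
  rewrite -[q](_ : map_poly gfun q = q) ?horner_map ?qz ?rmorph0 //.
  by apply/polyP => i; rewrite !coef_map /= gfun_iota.
have um : uniq (map gfun u) by rewrite map_inj_uniq ?undup_uniq //; apply: fmorph_inj.
have le : (size u <= size (map gfun u))%N by rewrite size_map.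
have [sz /(_ y)] := uniq_min_size um img le.
rewrite uP py => H; have /mapP[x _ E] : y \in map gfun u by rewrite H.
by exists x.
Qed.

Definition ginv y := projT1 (cid (gfun_surj y)).
Lemma ginvK : cancel ginv gfun. Proof. by move=> y; rewrite /ginv; case: cid. Qed.
Lemma gfunK : cancel gfun ginv. Proof. by move=> x; apply: (fmorph_inj gfun); rewrite /= ginvK. Qed.
Fact ginv_zmod : zmod_morphism ginv.
Proof. by move=> x y; apply: (fmorph_inj gfun); rewrite rmorphB /= !ginvK. Qed.
Fact ginv_monoid : monoid_morphism ginv.
Proof. by split=> [|x y]; apply: (fmorph_inj gfun); rewrite ?rmorphM ?rmorph1 /= !ginvK. Qed.
HB.instance Definition _ := GRing.isZmodMorphism.Build L L ginv ginv_zmod.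
HB.instance Definition _ := GRing.isMonoidMorphism.Build L L ginv ginv_monoid.

Definition total_galois : galois iota := Galois gfunK ginvK gfun_iota.

End TotalGraph.

Hypothesis char0 : [pchar K] =i pred0.

(** Every root of the minimal polynomial of [x] is the image of [x] under an automorphism, hence
    equal to [x]. So this polynomial is [(X - x)^(n+1)], and its coefficient [- (n+1) x] in degree
    [n] lies in K; characteristic zero allows the division. *)
Theorem fixed_field x : (forall s : galois iota, s x = x) -> exists a, x = iota a.
Proof.
move=> fx; pose D (z : L * L) := exists a, z = (iota a, iota a).
have HD : partial_hom D.
  split.
  - by move=> a; exists a.
  - by move=> _ _ [a ->] [b ->]; exists (a + b); rewrite rmorphD.
  - by move=> _ _ [a ->] [b ->]; exists (a * b); rewrite rmorphM.
  - by move=> y [a [/esym/eqP]]; rewrite fmorph_eq0 => /eqP-> ->; rewrite rmorph0.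
have [p0 [q0 [P0 mp rp mn]]] := php_min HD x.
have pq : q0 = p0 by apply/polyP => i; have [a [-> ->]] := P0 i.
rewrite {}pq in P0.
have allx y : root p0 y -> y = x.
  move=> ry; have [G' HG' [DG' Gxy]] := php_extend HD P0 mp rp mn ry.
  have [G HG [GG' tot]] := partial_hom_total HG'.
  by rewrite -[RHS](fx (total_galois HG tot)); apply/esym/gfun_eq/GG'.
have [s Es] := closed_field_poly_normal p0; rewrite (monicP mp) scale1r in Es.
have sx : s = nseq (size s) x.
  apply/all_pred1P/allP => y ys /=; apply/eqP/allx.
  by rewrite Es root_prod_XsubC.
move: Es; rewrite sx; case: (size s) => [|n].
  rewrite /= big_nil => E; move: rp; by rewrite E rootE hornerC oner_eq0.
rewrite big_nseq => /(congr1 (fun p : {poly L} => p`_n)).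
have [a [Ea _]] := P0 n; rewrite {}Ea.
have -> : iter n.+1 ( *%R ('X - x%:P)) 1 = ('X - x%:P) ^+ n.+1.
  by elim: n {a} => [|n IH]; rewrite ?expr1 /= ?mulr1 // exprS -IH.
have -> : (('X - x%:P) ^+ n.+1)`_n = - x *+ n.+1.
  elim: n {a} => [|n IH]; first by rewrite expr1 coefB coefX coefC sub0r.
  rewrite exprS mulrBl coefB coefXM coefCM /= IH.
  have sz : size (('X - x%:P) ^+ n.+1) = n.+2 by rewrite size_exp_XsubC.
  have -> : (('X - x%:P) ^+ n.+1)`_n.+1 = 1.
    have /monicP := monic_exp n.+1 (monicXsubC x); by rewrite lead_coefE sz.
  by rewrite mulr1 -mulrSr.
move=> E; exists (- a / n.+1%:R).
have n0 : n.+1%:R != 0 :> K by have /pcharf0P -> := char0.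
rewrite rmorphM rmorphN fmorphV rmorph_nat E mulNrn opprK -[x *+ _]mulr_natr mulfK //.
by rewrite -(rmorph_nat iota) fmorph_eq0.
Qed.

(** * Artin's lemma, descent of finite families of polynomials, norms *)

Section GaloisGroup.
Implicit Types s : galois iota.

Fact gal1_iota a : idfun (iota a) = iota a. Proof. by []. Qed.
Definition gal1 : galois iota :=
  @Galois _ _ _ (idfun : {rmorphism L -> L}) idfun (fun=> erefl) (fun=> erefl) gal1_iota.

Fact galM_iota s (t : galois iota) a : s (t (iota a)) = iota a. Proof. by rewrite !gal_iota. Qed.
Definition galM s (t : galois iota) : galois iota :=
  @Galois _ _ _ (s \o t : {rmorphism L -> L}) (gal_inv t \o gal_inv s)
    (can_comp (galK s) (galK t)) (can_comp (gal_invK t) (gal_invK s)) (galM_iota s t).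

Definition lin_indep n (e : 'I_n -> L) :=
  forall a : 'I_n -> K, \sum_i iota (a i) * e i = 0 -> forall i, a i = 0.

(** Artin's argument, by induction on the support of the relation. Scale one coefficient to 1; the
    difference with a conjugate relation has smaller support, so all coefficients are Galois
    invariant and lie in K, which contradicts independence when [s] is the identity. *)
Lemma artin n (e : 'I_n -> L) (b : 'I_n -> L) : lin_indep e ->
  (forall s, \sum_i b i * s (e i) = 0) -> forall i, b i = 0.
Proof.
move=> ind; move: {2}#|[set i | b i != 0]| (leqnn #|[set i | b i != 0]|) => m.
elim: m b => [|m IH] b.
  rewrite leqn0 cards_eq0 => /eqP E _ i; apply/eqP; have := in_set0 i; rewrite -E inE.
  by move/negbFE.
move=> Hm Hb k; apply/eqP/negP => /negP bk.
pose c i := b i / b k.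
have Hc s : \sum_i c i * s (e i) = 0.
  transitivity ((\sum_i b i * s (e i)) * (b k)^-1); last by rewrite Hb mul0r.
  by rewrite mulr_suml; apply: eq_bigr => i _; rewrite /c; ring.
have ck : c k = 1 by rewrite /c divff.
have fixc i (t : galois iota) : t (c i) = c i.
  apply/eqP; rewrite -subr_eq0; apply/eqP; move: i.
  apply: (IH (fun i => t (c i) - c i)).
    rewrite -ltnS (leq_trans _ Hm) //; apply: proper_card; apply/properP; split.
      apply/subsetP => i; rewrite !inE; apply: contraNneq => bi.
      by rewrite /c bi mul0r rmorph0 subrr.
    by exists k; rewrite !inE // ck rmorph1 subrr eqxx.
  move=> s; rewrite (eq_bigr (fun i => t (c i) * s (e i) - c i * s (e i))); last by move=> i _; rewrite mulrBl.
  rewrite sumrB Hc subr0.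
  transitivity (t (\sum_i c i * galM (galV t) s (e i))); last by rewrite Hc rmorph0.
  by rewrite rmorph_sum; apply: eq_bigr => i _; rewrite rmorphM /= gal_invK.
have /choice[a Ea] : forall i, exists a, c i = iota a by move=> i; apply: fixed_field.
have a0 : forall i, a i = 0.
  by apply: ind; rewrite -[RHS](Hc gal1); apply: eq_bigr => i _; rewrite Ea.
by have := ck; rewrite Ea a0 rmorph0 => /eqP; rewrite eq_sym oner_eq0.
Qed.

(** Finitely many automorphisms suffice to make the matrix of conjugates of full row rank: as long
    as the rank is too small, [artin] supplies one that raises it. The right inverse [C] reads off
    K-components from conjugates. *)
Lemma dual_family n (e : 'I_n -> L) : lin_indep e ->
  exists N (s : 'I_N -> galois iota) (C : 'M[L]_(N, n)),
    (\matrix_(i, m) s m (e i)) *m C = 1%:M.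
Proof.
move=> ind; pose A N (s : 'I_N -> galois iota) : 'M[L]_(n, N) := \matrix_(i, m) s m (e i).
suff [N [s fs]] : exists N (s : 'I_N -> galois iota), row_free (A N s).
  by have /row_freeP[C EC] := fs; exists N, s, C.
have ex : exists r, `[< exists N (s : 'I_N -> galois iota), \rank (A N s) = r >].
  by exists (\rank (A 0%N (fun=> gal1))); apply/asboolP; exists 0%N, (fun=> gal1).
have [|r /asboolP[N [s rs]] rmax] := ex_maxnP ex (m := n).
  by move=> r /asboolP[N [s <-]]; apply: rank_leq_row.
exists N, s; rewrite /row_free; apply/negPn/negP => nfree.
have /rowV0Pn[b /sub_kermxP bA b0] : kermx (A N s) != 0.
  by rewrite -mxrank_eq0 mxrank_ker subn_eq0 -ltnNge ltn_neqAle nfree rank_leq_row.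
have [t Ht] : exists t : galois iota, \sum_i b 0 i * t (e i) != 0.
  apply: contrapT => H; move/rV0Pn: b0 => [i]; rewrite (artin (b := fun i => b 0 i) ind) ?eqxx //.
  by move=> t; apply/eqP/negP => /negP Ht; apply: H; exists t.
pose s' (m : 'I_(1 + N)) := if split m is inr l then s l else t.
have E : A (1 + N)%N s' = row_mx (\col_i t (e i)) (A N s).
  by apply/matrixP => i m; rewrite !mxE /s'; case: split => l; rewrite !mxE.
suff : (\rank (A N s) < \rank (A (1 + N)%N s'))%N.
  by rewrite ltnNge rs; case/negP; apply: rmax; apply/asboolP; exists (1 + N)%N, s'.
have lek : (kermx (A (1 + N)%N s') < kermx (A N s))%MS.
  rewrite ltmxE; apply/andP; split.
    by apply/sub_kermxP; have := mulmx_ker (A (1 + N)%N s'); rewrite {2}E mul_mx_row => /eqP; rewrite row_mx_eq0 => /andP[_ /eqP].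
  apply/negP => sub; have : (b <= kermx (A (1 + N)%N s'))%MS.
    by rewrite (submx_trans _ sub) //; apply/sub_kermxP.
  move/sub_kermxP; rewrite E mul_mx_row => /eqP; rewrite row_mx_eq0 => /andP[/eqP/matrixP/(_ 0 0) + _].
  rewrite !mxE => H; move/eqP: Ht; apply; rewrite -[RHS]H; apply: eq_bigr => i _; by rewrite mxE.
have := rank_ltmx lek; rewrite !mxrank_ker => H.
by rewrite ltnNge; apply: contraL H => le; rewrite -leqNgt leq_sub2l.
Qed.

Lemma map_mpolyZ (k1 k2 : fieldType) (f : {rmorphism k1 -> k2}) N c (p : {mpoly k1[N]}) :
  map_mpoly f (c *: p) = f c *: map_mpoly f p.
Proof. by apply/mpolyP => m; rewrite mcoeff_map_mpoly (mcoeffZ c p) (mcoeffZ (f c)) mcoeff_map_mpoly /= rmorphM. Qed.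

Section Descent.
Variables (N : nat) (T : finType) (G : T -> {mpoly L[N]}).

Definition decomp n := exists (e : 'I_n -> L) (F : T -> 'I_n -> {mpoly K[N]}),
  forall t : T, G t = \sum_i e i *: map_mpoly iota (F t i).

Lemma decomp_ex : exists n, decomp n.
Proof.
pose s : seq L := flatten [seq [seq (G t)@_m | m <- msupp (G t)] | t <- enum T].
(* Monomials are grouped by the value of their coefficient, whose first position in the list [s]
   serves as index. *)
pose F (t : T) (i : 'I_(size s)) : {mpoly K[N]} := \sum_(m <- msupp (G t) | index (G t)@_m s == i) 'X_[m].
exists (size s), (fun i => s`_i), F => t.
rewrite {1}[G t]mpolyE.
rewrite (eq_bigr (fun i : 'I_(size s) => \sum_(m <- msupp (G t) | index (G t)@_m s == i) (G t)@_m *: 'X_[m])).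
  rewrite (exchange_big_dep xpredT) //= big_seq [RHS]big_seq; apply: eq_bigr => m mG.
  have lt : (index (G t)@_m s < size s)%N.
    rewrite index_mem; apply/flattenP; exists [seq (G t)@_m | m <- msupp (G t)].
      by apply/mapP; exists t; rewrite ?mem_enum.
    exact: map_f.
  rewrite (bigD1 (Ordinal lt)) //= big1 ?addr0 // => i /andP[/eqP E].
  by case/eqP; apply: val_inj.
move=> i _; rewrite /F rmorph_sum scaler_sumr big_seq_cond [RHS]big_seq_cond.
apply: eq_bigr => m /andP[mG /eqP E]; rewrite -E nth_index; last first.
  apply/flattenP; exists [seq (G t)@_m | m <- msupp (G t)]; last exact: map_f.
  by apply/mapP; exists t; rewrite ?mem_enum.
by rewrite /= map_mpolyX.
Qed.

(** A decomposition with the least number of terms has independent [e], so [dual_family] applies: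
    the K-components of the family are combinations of its conjugates. Any property stable under
    conjugation and linear combination thus passes from [G] to polynomials over K. *)
Lemma descent : exists n (e : 'I_n -> L) (F : T -> 'I_n -> {mpoly K[N]})
    M (s : 'I_M -> galois iota) (C : 'M[L]_(M, n)),
  (forall t : T, G t = \sum_i e i *: map_mpoly iota (F t i)) /\
  (forall (t : T) i, map_mpoly iota (F t i) = \sum_m C m i *: map_mpoly (s m) (G t)).
Proof.
have [n0 Hn0] := decomp_ex.
have ex : exists n, `[< decomp n >] by exists n0; apply/asboolP.
have [n /asboolP[e [F E]] nmin] := ex_minnP ex.
have ind : lin_indep e.
  move=> a a0 k; apply/eqP/negP => /negP ak.
  case: n k e F E nmin a a0 ak => [[]//|n] k e F E nmin a a0 ak.
  suff /asboolP/nmin : decomp n by rewrite ltnn.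
  exists (fun i => e (lift k i)), (fun t i => F t (lift k i) - (a (lift k i) / a k) *: F t k) => t.
  have ek : e k = - \sum_i iota (a (lift k i) / a k) * e (lift k i).
    have ik : iota (a k) != 0 by rewrite fmorph_eq0.
    apply: (mulfI ik); rewrite mulrN mulr_sumr.
    move: a0; rewrite (bigD1_ord k) //= => /eqP; rewrite addr_eq0 => /eqP ->; congr (- _).
    by apply: eq_bigr => i _; rewrite rmorphM fmorphV mulrA [iota (a k) * _]mulrCA divff // mulr1.
  rewrite E (bigD1_ord k) //= ek scaleNr scaler_suml -sumrN -big_split; apply: eq_bigr => i _ /=.
  rewrite rmorphB /= map_mpolyZ scalerBr scalerA addrC; congr (_ - _ *: _).
  by rewrite mulrC.
have [M [s [C MC]]] := dual_family ind.
exists n, e, F, M, s, C; split=> // t i.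
transitivity (\sum_l (1%:M : 'M[L]_n) l i *: map_mpoly iota (F t l)).
  by rewrite (bigD1 i) //= big1 ?addr0 ?mxE ?eqxx ?scale1r // => l li; rewrite mxE (negbTE li) scale0r.
rewrite -MC; under eq_bigr do rewrite mxE scaler_suml.
rewrite exchange_big; apply: eq_bigr => m _ /=; rewrite [G t]E rmorph_sum scaler_sumr.
apply: eq_bigr => l _; rewrite /= map_mpolyZ mxE scalerA mulrC; congr (_ *: _).
by apply/mpolyP => u; rewrite !mcoeff_map_mpoly /= gal_iota.
Qed.

End Descent.

Section Norm.
Variables (N : nat) (H : {mpoly L[N]}).

Lemma conj_list (c : L) : exists l : seq L, forall s : galois iota, s c \in l.
Proof.
have [p p0 pc] := algL c; have [l El] := closed_field_poly_normal (map_poly iota p).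
exists l => s; have q0 : map_poly iota p != 0 by rewrite map_poly_eq0.
rewrite -root_prod_XsubC -(rootZ _ _ (_ : lead_coef (map_poly iota p) != 0)) ?lead_coef_eq0 // -El.
move/rootP: pc => pc; apply/rootP; rewrite -(rmorph0 s) -pc -horner_map.
by congr (_.[_]); apply/polyP => i; rewrite !coef_map /= gal_iota.
Qed.

Lemma finite_orbit : exists l : seq {mpoly L[N]}, forall s : galois iota, map_mpoly s H \in l.
Proof.
suff K1 (ms : seq 'X_{1..N}) : exists l : seq {mpoly L[N]}, forall s : galois iota,
    \sum_(m <- ms) s H@_m *: 'X_[m] \in l.
  have [l Hl] := K1 (msupp H); exists l => s; suff <- : \sum_(m <- msupp H) s H@_m *: 'X_[m] = map_mpoly s H by [].
  rewrite [in RHS](mpolyE H) rmorph_sum; apply: eq_bigr => m _; by rewrite /= map_mpolyZ map_mpolyX.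
elim: ms => [|m ms [l IH]]; first by exists [:: 0] => s; rewrite big_nil inE.
have [r Hr] := conj_list H@_m; exists [seq c *: 'X_[m] + q | c <- r, q <- l] => s.
by rewrite big_cons; apply: (allpairs_f (fun c q => c *: 'X_[m] + q)).
Qed.

Lemma map_mpoly_comp (s t : galois iota) (p : {mpoly L[N]}) :
  map_mpoly s (map_mpoly t p) = map_mpoly (galM s t) p.
Proof. by apply/mpolyP => m; rewrite !mcoeff_map_mpoly. Qed.

Lemma map_mpoly_gal1 (p : {mpoly L[N]}) : map_mpoly gal1 p = p.
Proof. by apply/mpolyP => m; rewrite !mcoeff_map_mpoly. Qed.

(** The product of the distinct conjugates of [H] is Galois invariant, so its coefficients lie in K.
    This serves to replace a denominator over [L] by a multiple defined over K. *)
Lemma norm_poly : exists (H0 : {mpoly K[N]}) (l : seq (galois iota)),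
  map_mpoly iota H0 = H * \prod_(s <- l) map_mpoly s H.
Proof.
have [l0 Hl0] := finite_orbit.
pose l := undup [seq q <- l0 | `[< exists s : galois iota, q = map_mpoly s H >]].
have lP q : (q \in l) <-> exists s : galois iota, q = map_mpoly s H.
  rewrite mem_undup mem_filter; split=> [/andP[/asboolP]//|[s Es]].
  by apply/andP; split; [apply/asboolP; exists s|rewrite Es].
have Hl : H \in l by apply/lP; exists gal1; rewrite map_mpoly_gal1.
pose Q := \prod_(q <- l) q.
have Qinv (s : galois iota) : map_mpoly s Q = Q.
  rewrite /Q rmorph_prod -(big_map (map_mpoly s) xpredT id) /=; apply: perm_big.
  have inj : injective (map_mpoly s : {mpoly L[N]} -> {mpoly L[N]}).
    move=> p q E; apply/mpolyP => m; apply: (fmorph_inj s); rewrite -!mcoeff_map_mpoly.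
    by rewrite E.
  have um : uniq (map (map_mpoly s) l) by rewrite map_inj_uniq // undup_uniq.
  have sub : {subset map (map_mpoly s) l <= l}.
    move=> _ /mapP[q /lP[t ->] ->]; apply/lP; exists (galM s t); exact: map_mpoly_comp.
  have le : (size l <= size (map (map_mpoly s) l))%N by rewrite size_map.
  have [_ E] := uniq_min_size um sub le.
  by apply: uniq_perm => //; apply: undup_uniq.
have /choice[f Ef] : forall m, exists a, Q@_m = iota a.
  by move=> m; apply: fixed_field => s; rewrite -mcoeff_map_mpoly Qinv.
have /choice[g Eg] : forall q, exists s : galois iota, q \in l -> q = map_mpoly s H.
  by move=> q; have [/lP[s E]|n] := boolP (q \in l); [exists s|exists gal1].
exists (\sum_(m <- msupp Q) f m *: 'X_[m]), [seq g q | q <- rem H l].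
transitivity Q.
  rewrite rmorph_sum [RHS]mpolyE; apply: eq_bigr => m _.
  by rewrite /= map_mpolyZ map_mpolyX -Ef.
rewrite /Q (perm_big _ (perm_to_rem Hl)) big_cons big_map; congr (_ * _).
by rewrite big_seq [RHS]big_seq; apply: eq_bigr => q /mem_rem/Eg.
Qed.

End Norm.

End GaloisGroup.

End Automorphisms.

(** * The Segre frame of a ten-nodal cubic *)

Section CubicPencil.
Variable L : closedFieldType.
Hypothesis char0 : [pchar L] =i pred0.
Implicit Types (a b c d : {poly L}) (s t : L).

Lemma natr_neq0 n : n.+1%:R != 0 :> L.
Proof. by have /pcharf0P -> := char0. Qed.

(* Hermite interpolation: a cubic with two double roots vanishes. *)
Lemma cubic_two_double (a b c d t u : L) : t != u ->
  a * t ^+ 3 + b * t ^+ 2 + c * t + d = 0 -> 3%:R * a * t ^+ 2 + 2%:R * b * t + c = 0 ->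
  a * u ^+ 3 + b * u ^+ 2 + c * u + d = 0 -> 3%:R * a * u ^+ 2 + 2%:R * b * u + c = 0 ->
  [/\ a = 0, b = 0, c = 0 & d = 0].
Proof.
rewrite -subr_eq0 => tu ft f't fu f'u.
have a0 : a = 0.
  have : a * (t - u) ^+ 3 = 0.
    transitivity ((t - u) * ((3%:R * a * t ^+ 2 + 2%:R * b * t + c) + (3%:R * a * u ^+ 2 + 2%:R * b * u + c))
      - 2%:R * ((a * t ^+ 3 + b * t ^+ 2 + c * t + d) - (a * u ^+ 3 + b * u ^+ 2 + c * u + d))); first by ring.
    by rewrite ft fu f't f'u; ring.
  by move/eqP; rewrite mulf_eq0 expf_eq0 (negbTE tu) orbF => /eqP.
subst a; have b0 : b = 0.
  have : 2%:R * b * (t - u) = 0.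
    transitivity ((3%:R * 0 * t ^+ 2 + 2%:R * b * t + c) - (3%:R * 0 * u ^+ 2 + 2%:R * b * u + c)); first by ring.
    by rewrite f't f'u subrr.
  by move/eqP; rewrite !mulf_eq0 (negbTE tu) orbF (negbTE (natr_neq0 1)) => /eqP.
subst b; have c0 : c = 0 by rewrite -f't; ring.
by subst c; split=> //; rewrite -ft; ring.
Qed.

(** The curve of bidegree (3,3) in an affine chart of the quadric, read as a cubic in [t] whose
    coefficients are polynomials in [s]; [pdisc] below is its discriminant with respect to [t]. *)
Definition cubic_ev a b c d s t := a.[s] * t ^+ 3 + b.[s] * t ^+ 2 + c.[s] * t + d.[s].
Definition pev_t a b c s t := 3%:R * a.[s] * t ^+ 2 + 2%:R * b.[s] * t + c.[s].
Definition psing a b c d (z : L * L) :=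
  [/\ cubic_ev a b c d z.1 z.2 = 0, cubic_ev a^`() b^`() c^`() d^`() z.1 z.2 = 0 & pev_t a b c z.1 z.2 = 0].

Definition pdisc a b c d :=
  b ^+ 2 * c ^+ 2 - 4%:R * a * c ^+ 3 - 4%:R * b ^+ 3 * d - 27%:R * a ^+ 2 * d ^+ 2 + 18%:R * a * b * c * d.

Lemma pdisc_shift a b c d (u : {poly L}) :
  pdisc a b c d = pdisc a (3%:R * a * u + b) (3%:R * a * u ^+ 2 + 2%:R * b * u + c)
    (a * u ^+ 3 + b * u ^+ 2 + c * u + d).
Proof. by rewrite /pdisc; ring. Qed.

Lemma dvdp_XsubC2 (p : {poly L}) s : p.[s] = 0 -> p^`().[s] = 0 -> exists q, p = q * ('X - s%:P) ^+ 2.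
Proof.
move=> /rootP/factor_theorem[q ->]; rewrite derivM derivXsubC mulr1 hornerD hornerM.
rewrite hornerXsubC subrr mulr0 add0r => /rootP/factor_theorem[r ->].
by exists r; rewrite expr2 mulrA.
Qed.

(** Translating [t] moves the singular point to [t = 0]. There the constant term has a double zero
    at [s] and the linear term a simple one, and every term of the discriminant contains at least
    two such factors. *)
Lemma pdisc_double a b c d s t : psing a b c d (s, t) -> exists q, pdisc a b c d = q * ('X - s%:P) ^+ 2.
Proof.
case=> /= f0 fs ft; rewrite (pdisc_shift a b c d t%:P).
set c' := 3%:R * a * _ + _ + _; set d' := a * _ + _ + _ + _; set b' := _ + b.
have [q1 E1] : exists q, c' = q * ('X - s%:P).
  by apply/factor_theorem/rootP; rewrite -[RHS]ft /c' /pev_t -!polyC_natr !hornerE.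
have [q2 E2] : exists q, d' = q * ('X - s%:P) ^+ 2.
  apply: dvdp_XsubC2; first by rewrite -[RHS]f0 /d' /cubic_ev !hornerE.
  by rewrite -[RHS]fs /d' /cubic_ev -!polyC_exp !derivE !mulr0 !addr0 !hornerE.
rewrite E1 E2 /pdisc.
exists (b' ^+ 2 * q1 ^+ 2 - 4%:R * a * q1 ^+ 3 * ('X - s%:P) - 4%:R * b' ^+ 3 * q2
  - 27%:R * a ^+ 2 * q2 ^+ 2 * ('X - s%:P) ^+ 2 + 18%:R * a * b' * q1 * q2 * ('X - s%:P)).
by ring.
Qed.

Lemma pdisc_size k a b c d : (size a <= k.+1)%N -> (size b <= k.+1)%N -> (size c <= k.+1)%N ->
  (size d <= k.+1)%N -> (size (pdisc a b c d) <= (4 * k).+1)%N.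
Proof.
move=> sa sb sc sd.
have sM (p q : {poly L}) n : (size p <= k.+1)%N -> (size q <= n.+1)%N -> (size (p * q)%R <= (k + n).+1)%N.
  move=> sp sq; rewrite (leq_trans (size_polyMleq _ _)) //.
  by move: sp sq; case: (size p) (size q) => [|u] [|v] /=; lia.
have sD (p q : {poly L}) n : (size p <= n)%N -> (size q <= n)%N -> (size (p + q)%R <= n)%N.
  by move=> sp sq; rewrite (leq_trans (size_polyD _ _)) // geq_max sp sq.
have sT n (p q r u : {poly L}) : (size p <= k.+1)%N -> (size q <= k.+1)%N -> (size r <= k.+1)%N -> (size u <= k.+1)%N ->
    (size (n%:R * (p * (q * (r * u))))%R <= (4 * k).+1)%N.
  move=> sp sq sr su; rewrite -polyC_natr mul_polyC (leq_trans (size_scale_leq _ _)) //.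
  by rewrite (_ : (4 * k = k + (k + (k + k)))%N); [do 3 apply: (sM) => //|lia].
have -> : pdisc a b c d = 1%:R * (b * (b * (c * c))) - 4%:R * (a * (c * (c * c))) - 4%:R * (b * (b * (b * d)))
    - 27%:R * (a * (a * (d * d))) + 18%:R * (a * (b * (c * d))) by rewrite /pdisc; ring.
by do ![apply: (sD)]; rewrite ?size_polyN; apply: sT.
Qed.

Section FiniteSing.
Variables (a b c d : {poly L}) (Z : seq (L * L)).
Hypothesis finZ : forall z, psing a b c d z -> z \in Z.

(* A repeated root t = N/M of f, as a rational function of s, is a curve of singular points. *)
Lemma no_double_curve (M N : {poly L}) : M != 0 ->
  a * N ^+ 3 + b * N ^+ 2 * M + c * N * M ^+ 2 + d * M ^+ 3 = 0 ->
  3%:R * a * N ^+ 2 + 2%:R * b * N * M + c * M ^+ 2 = 0 -> False.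
Proof.
move=> M0 E1 E2.
have E3 : b * N ^+ 2 + 2%:R * c * N * M + 3%:R * d * M ^+ 2 = 0.
  apply: (mulfI M0); rewrite mulr0.
  transitivity (3%:R * (a * N ^+ 3 + b * N ^+ 2 * M + c * N * M ^+ 2 + d * M ^+ 3)
     - N * (3%:R * a * N ^+ 2 + 2%:R * b * N * M + c * M ^+ 2)); first by ring.
  by rewrite E1 E2; ring.
have E4 : a^`() * N ^+ 3 + b^`() * N ^+ 2 * M + c^`() * N * M ^+ 2 + d^`() * M ^+ 3 = 0.
  have := congr1 (@deriv L) E1; rewrite deriv0 !derivE => E.
  transitivity ((a^`() * N ^+ 3 + b^`() * N ^+ 2 * M + c^`() * N * M ^+ 2 + d^`() * M ^+ 3)
    + (3%:R * a * N ^+ 2 + 2%:R * b * N * M + c * M ^+ 2) * N^`()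
    + (b * N ^+ 2 + 2%:R * c * N * M + 3%:R * d * M ^+ 2) * M^`()); first by rewrite E2 E3; ring.
  by rewrite -[RHS]E; ring.
have [x] := poly_nonroot (mulf_neq0 M0 (monic_neq0 (monic_prod_XsubC (map fst Z) predT id))).
rewrite hornerM mulf_nz => /andP[Mx]; rewrite -rootE root_prod_XsubC => /negP; apply.
apply/mapP; exists (x, N.[x] / M.[x]) => //; apply: finZ.
have H (p q r u : {poly L}) : p * N ^+ 3 + q * N ^+ 2 * M + r * N * M ^+ 2 + u * M ^+ 3 = 0 ->
    cubic_ev p q r u x (N.[x] / M.[x]) = 0.
  move=> /(congr1 (fun g : {poly L} => g.[x] / M.[x] ^+ 3)).
  rewrite horner0 mul0r => E; rewrite -[RHS]E /cubic_ev !(hornerD, hornerM, horner_exp).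
  by field.
split=> /=; [exact: H|exact: H|].
move/(congr1 (fun g : {poly L} => g.[x] / M.[x] ^+ 2)): E2.
by rewrite horner0 mul0r => E; rewrite -[RHS]E /pev_t -!polyC_natr !(hornerD, hornerM, horner_exp, hornerC); field.
Qed.

(** If two of the points have the same [s], the cubic there has two double roots and vanishes.
    Otherwise the discriminant, of degree at most [4 k], has at least [3 k] double zeros, so it is
    zero; the cubic then has a repeated root depending rationally on [s], hence infinitely many
    singular points, unless [a = b = 0]. *)
Lemma vertical_component k (S : seq (L * L)) : (0 < k)%N -> uniq S -> (3 * k <= size S)%N ->
  (forall z, z \in S -> psing a b c d z) ->
  (size a <= k.+1)%N -> (size b <= k.+1)%N -> (size c <= k.+1)%N -> (size d <= k.+1)%N ->
  exists s, [/\ a.[s] = 0, b.[s] = 0, c.[s] = 0 & d.[s] = 0].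
Proof.
move=> k0 uS sS singS sa sb sc sd.
have [us|nus] := boolP (uniq (map fst S)); last first.
  have /uniqPn := nus => /(_ 0)[i [j [ij jS]]]; rewrite size_map in jS.
  have iS : (i < size S)%N := ltn_trans ij jS.
  rewrite !(nth_map (0, 0)) // => E; pose z := nth (0, 0) S i; pose w := nth (0, 0) S j.
  have zw : z.2 != w.2.
    apply/eqP => E2; have : z = w by rewrite (surjective_pairing z) (surjective_pairing w) E2 -/z -/w in E *; rewrite E.
    by move/eqP; rewrite nth_uniq // => /eqP ij'; rewrite ij' ltnn in ij.
  have [/= f1 _ t1] := singS z (mem_nth _ iS); have [/= f2 _ t2] := singS w (mem_nth _ jS).
  exists z.1; apply: (cubic_two_double zw) => //; by rewrite -/z -/w in E; rewrite E.
have D0 : pdisc a b c d = 0.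
  apply/eqP/negP => /negP D0.
  have [q Eq] : exists q, pdisc a b c d = q * (\prod_(s <- map fst S) ('X - s%:P)) ^+ 2.
    have : {in S, forall z, exists q, pdisc a b c d = q * ('X - z.1%:P) ^+ 2}.
      by move=> [s t] /singS; apply: pdisc_double.
    elim: (S) us => [|[s t] S' IH] /=; first by exists (pdisc a b c d); rewrite big_nil expr1n mulr1.
    move=> /andP[sS' uS'] HH.
    have HH' : {in S', forall z, exists q, pdisc a b c d = q * ('X - z.1%:P) ^+ 2}.
      by move=> z zS; apply: HH; rewrite inE zS orbT.
    have [q Eq] := IH uS' HH'.
    have [r Er] := HH (s, t) (mem_head _ _); rewrite /= in Er.
    have cop : coprimep (('X - s%:P) ^+ 2) ((\prod_(s <- map fst S') ('X - s%:P)) ^+ 2).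
      by apply/coprimep_expl/coprimep_expr; rewrite coprimep_sym coprimep_XsubC root_prod_XsubC.
    have : ('X - s%:P) ^+ 2 %| q.
      by rewrite -(Gauss_dvdpl _ cop) -Eq Er dvdp_mull.
    by move=> /dvdpP[e Ee]; exists e; rewrite Eq Ee big_cons; ring.
  have q0 : q != 0 by apply: contraNneq D0 => q0; rewrite Eq q0 mul0r.
  have := pdisc_size sa sb sc sd; rewrite Eq size_Mmonic ?monic_exp ?monic_prod_XsubC //.
  have := size_exp (\prod_(s <- map fst S) ('X - s%:P)) 2.
  rewrite size_prod_XsubC size_map /=; rewrite -size_poly_gt0 in q0.
  move: q0; move: (size q) => v; set P2 := (_ ^+ 2); move: (size P2) => u; move: sS k0; lia.
have n20 : (2%:R : {poly L}) != 0 by rewrite -polyC_natr polyC_eq0 natr_neq0.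
have n30 : (3%:R : {poly L}) != 0 by rewrite -polyC_natr polyC_eq0 natr_neq0.
(* For [a = 0] the discriminant is [b ^+ 2 * (c ^+ 2 - 4 b d)]. If [b] is nonzero, the repeated root
   is [- c / (2 b)]. If [b] vanishes too, the equation is linear in [t], and at any singular point
   [c], then [d], vanishes. *)
have [a0|a0] := eqVneq a 0.
  have [b0|b0] := eqVneq b 0; last first.
    exfalso; apply: (@no_double_curve (2%:R * b) (- c)); first by rewrite mulf_neq0.
      by transitivity (- 2%:R * pdisc a b c d); [rewrite a0 /pdisc; ring|rewrite D0 mulr0].
    by rewrite a0; ring.
  have : (0 < size S)%N by move: sS k0; lia.
  case: (S) singS => // -[s t] S' singS _; have [/= f1 _ f2] := singS _ (mem_head _ _).
  exists s; move: f1 f2; rewrite /cubic_ev /pev_t a0 b0 !horner0 !mulr0 !mul0r !add0r => f1 f2.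
  by split=> //; move: f1; rewrite f2 mul0r add0r.
(* The repeated root is [(9 a d - b c) / (2 (b^2 - 3 a c))]; when this denominator is identically
   zero, the root is triple and equal to [- b / (3 a)]. *)
exfalso; have [M0|M0] := eqVneq (2%:R * (b ^+ 2 - 3%:R * a * c)) 0.
  have m0 : b ^+ 2 - 3%:R * a * c = 0 by move/eqP: M0; rewrite mulf_eq0 (negbTE n20) => /eqP.
  apply: (@no_double_curve (3%:R * a) (- b)); first by rewrite mulf_neq0.
    have g0 : 2%:R * b ^+ 3 - 9%:R * a * b * c + 27%:R * a ^+ 2 * d = 0.
      apply/eqP; rewrite -sqrf_eq0; apply/eqP.
      transitivity (4%:R * (b ^+ 2 - 3%:R * a * c) ^+ 3 - 27%:R * a ^+ 2 * pdisc a b c d).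
        by rewrite /pdisc; ring.
      by rewrite m0 D0; ring.
    by transitivity (a * (2%:R * b ^+ 3 - 9%:R * a * b * c + 27%:R * a ^+ 2 * d)); [ring|rewrite g0 mulr0].
  by transitivity (- 3%:R * a * (b ^+ 2 - 3%:R * a * c)); [ring|rewrite m0 mulr0].
apply: (no_double_curve M0 (N := 9%:R * a * d - b * c)).
  transitivity (- pdisc a b c d * (2%:R * b ^+ 3 - 9%:R * a * b * c + 27%:R * a ^+ 2 * d)).
    by rewrite /pdisc; ring.
  by rewrite D0 oppr0 mul0r.
by transitivity (- 9%:R * a * pdisc a b c d); [rewrite /pdisc; ring|rewrite D0 mulr0].
Qed.

End FiniteSing.

Lemma pev_mul a b c d l s t :
  cubic_ev (a * l) (b * l) (c * l) (d * l) s t = cubic_ev a b c d s t * l.[s].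
Proof. by rewrite /cubic_ev !hornerM; ring. Qed.

Lemma pevD a b c d a' b' c' d' s t :
  cubic_ev (a + a') (b + b') (c + c') (d + d') s t = cubic_ev a b c d s t + cubic_ev a' b' c' d' s t.
Proof. by rewrite /cubic_ev !hornerD; ring. Qed.

Lemma pev_t_mul a b c l s t : pev_t (a * l) (b * l) (c * l) s t = pev_t a b c s t * l.[s].
Proof. by rewrite /pev_t !hornerM; ring. Qed.

(** One vertical line is split off at a time. At most three of the singular points lie on it, since
    they are zeros of the residual cubic restricted to the line; that restriction is nonzero because
    a double line would be singular everywhere. *)
Lemma all_vertical k a b c d (Z S : seq (L * L)) : (forall z, psing a b c d z -> z \in Z) ->
  uniq S -> (3 * k <= size S)%N -> (forall z, z \in S -> psing a b c d z) ->
  (size a <= k.+1)%N -> (size b <= k.+1)%N -> (size c <= k.+1)%N -> (size d <= k.+1)%N ->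
  exists (r : seq L) (a0 b0 c0 d0 : L), size r = k /\
    let q := \prod_(x <- r) ('X - x%:P) in
    [/\ a = a0%:P * q, b = b0%:P * q, c = c0%:P * q & d = d0%:P * q].
Proof.
elim: k a b c d S => [|k IH] a b c d S finZ uS sS singS sa sb sc sd.
  exists [::], a`_0, b`_0, c`_0, d`_0; split=> //=.
  by rewrite big_nil !mulr1; split; apply: size1_polyC.
have [s [as0 bs0 cs0 ds0]] := vertical_component finZ (ltn0Sn k) uS sS singS sa sb sc sd.
have /factor_theorem[a1 Ea] : root a s by apply/rootP.
have /factor_theorem[b1 Eb] : root b s by apply/rootP.
have /factor_theorem[c1 Ec] : root c s by apply/rootP.
have /factor_theorem[d1 Ed] : root d s by apply/rootP.
have szE (p p1 : {poly L}) : p = p1 * ('X - s%:P) -> (size p <= k.+2)%N -> (size p1 <= k.+1)%N.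
  move=> ->; have [->|p10] := eqVneq p1 0; first by rewrite size_poly0.
  by rewrite size_Mmonic ?monicXsubC // size_XsubC addn2.
have dE u t : cubic_ev a^`() b^`() c^`() d^`() u t =
    cubic_ev a1^`() b1^`() c1^`() d1^`() u t * (u - s) + cubic_ev a1 b1 c1 d1 u t.
  rewrite Ea Eb Ec Ed !derivM !derivXsubC !mulr1 pevD pev_mul; congr (_ * _ + _).
  by rewrite hornerXsubC.
have fE u t : cubic_ev a b c d u t = cubic_ev a1 b1 c1 d1 u t * (u - s).
  by rewrite Ea Eb Ec Ed pev_mul hornerXsubC.
have tE u t : pev_t a b c u t = pev_t a1 b1 c1 u t * (u - s).
  by rewrite Ea Eb Ec pev_t_mul hornerXsubC.
have finZ1 z : psing a1 b1 c1 d1 z -> z \in Z.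
  case=> f0 fs ft; apply: finZ; split; first by rewrite fE f0 mul0r.
    by rewrite dE f0 fs mul0r addr0.
  by rewrite tE ft mul0r.
pose S1 := [seq z <- S | z.1 != s].
have singS1 z : z \in S1 -> psing a1 b1 c1 d1 z.
  rewrite mem_filter -subr_eq0 => /andP[zs /singS[]]; rewrite fE dE tE => /eqP.
  rewrite mulf_eq0 (negbTE zs) orbF => /eqP f0; rewrite f0 addr0 => /eqP.
  rewrite mulf_eq0 (negbTE zs) orbF => /eqP f1 /eqP.
  by rewrite mulf_eq0 (negbTE zs) orbF => /eqP f2.
pose p := Poly [:: d1.[s]; c1.[s]; b1.[s]; a1.[s]].
have pE t : p.[t] = cubic_ev a1 b1 c1 d1 s t by rewrite horner_Poly /cubic_ev /=; ring.
have p0 : p != 0.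
  apply/eqP => p0; have [t tZ] := exists_notin (map snd Z).
  case/negP: tZ; apply/mapP; exists (s, t) => //; apply: finZ; split=> /=.
  - by rewrite fE subrr mulr0.
  - by rewrite dE subrr mulr0 add0r -pE p0 horner0.
  - by rewrite tE subrr mulr0.
have sS1 : (3 * k <= size S1)%N.
  have : (size [seq z <- S | z.1 == s] <= 3)%N.
    rewrite -(size_map snd) -ltnS.
    apply: leq_trans (size_Poly [:: d1.[s]; c1.[s]; b1.[s]; a1.[s]]).
    apply: max_poly_roots => //.
      apply/allP => _ /mapP[[u t] + ->]; rewrite mem_filter /= => /andP[/eqP -> /singS[_ /= + _]].
      by rewrite dE subrr mulr0 add0r => H; apply/rootP; rewrite pE.
    rewrite map_inj_in_uniq ?filter_uniq // => -[u t] [u' t']; rewrite !mem_filter /=.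
    by move=> /andP[/eqP-> _] /andP[/eqP-> _] ->.
  have := count_predC (fun z : L * L => z.1 == s) S; rewrite -!size_filter.
  rewrite (_ : [seq x <- S | predC _ x] = S1) // => E H.
  move: (size _) (size S1) E H sS => u v; lia.
have [r [a0 [b0 [c0 [d0 [sr /= [E1 E2 E3 E4]]]]]]] :=
   IH a1 b1 c1 d1 S1 finZ1 (filter_uniq _ uS) sS1 singS1 (szE _ _ Ea sa) (szE _ _ Eb sb) (szE _ _ Ec sc) (szE _ _ Ed sd).
exists (s :: r), a0, b0, c0, d0; rewrite /= sr; split=> //; rewrite big_cons.
by split; rewrite ?Ea ?Eb ?Ec ?Ed ?E1 ?E2 ?E3 ?E4; ring.
Qed.

Lemma deriv_Poly4 (R : comNzRingType) (p0 p1 p2 p3 s : R) :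
  (Poly [:: p0; p1; p2; p3])^`().[s] = p1 + 2%:R * p2 * s + 3%:R * p3 * s ^+ 2.
Proof.
rewrite (_ : Poly _ = p3%:P * 'X^3 + p2%:P * 'X^2 + p1%:P * 'X + p0%:P).
  rewrite !(derivD, deriv_mulC, derivXn, derivX, derivC) !(hornerD, hornerM, hornerC, hornerMn, hornerXn, hornerX) /=.
  by ring.
by apply/polyP => i; rewrite coef_Poly !(coefD, coefCM, coefXn, coefX, coefC); case: i => [|[|[|[|i]]]] /=; rewrite ?nth_nil; ring.
Qed.

(** Once the equation is a product [p(t) q(s)] with simple roots in [s], a singular point is a root
    of each factor. Both have degree at most 3, so nine such points force three distinct roots on
    either side. *)
Lemma nine_singular_points a b c d (Z : seq (L * L)) : (forall z, z \in Z <-> psing a b c d z) ->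
  uniq Z -> size Z = 9%N ->
  (size a <= 4)%N -> (size b <= 4)%N -> (size c <= 4)%N -> (size d <= 4)%N ->
  exists (r t : seq L) (e : L), [/\ size r = 3%N, size t = 3%N, uniq r, uniq t & e != 0 /\
    forall u v, cubic_ev a b c d u v = e * (\prod_(x <- r) (u - x)) * (\prod_(y <- t) (v - y))].
Proof.
move=> ZP uZ sZ sa sb sc sd.
have ZP1 z : psing a b c d z -> z \in Z by move/ZP.
have ZP2 z : z \in Z -> psing a b c d z by move/ZP.
have sZ9 : (3 * 3 <= size Z)%N by rewrite sZ.
have [r [a0 [b0 [c0 [d0 [sr /= [Ea Eb Ec Ed]]]]]]] := all_vertical ZP1 uZ sZ9 ZP2 sa sb sc sd.
move: Ea Eb Ec Ed; set q := \prod_(x <- r) _ => Ea Eb Ec Ed.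
pose p := Poly [:: d0; c0; b0; a0].
have fE u v : cubic_ev a b c d u v = p.[v] * q.[u].
  by rewrite /cubic_ev Ea Eb Ec Ed !hornerM !hornerC horner_Poly /=; ring.
have dE u v : cubic_ev a^`() b^`() c^`() d^`() u v = p.[v] * q^`().[u].
  by rewrite /cubic_ev Ea Eb Ec Ed !derivM !derivC !mul0r !add0r !hornerM !hornerC horner_Poly /=; ring.
have tE u v : pev_t a b c u v = p^`().[v] * q.[u].
  rewrite /pev_t Ea Eb Ec !hornerM !hornerC.
  by rewrite deriv_Poly4; ring.
have infs s : ~ forall v, psing a b c d (s, v).
  move=> H; have [v vZ] := exists_notin (map snd Z).
  by case/negP: vZ; apply/mapP; exists (s, v) => //; apply/ZP.
have inft v : ~ forall u, psing a b c d (u, v).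
  move=> H; have [u uZ'] := exists_notin (map fst Z).
  by case/negP: uZ'; apply/mapP; exists (u, v) => //; apply/ZP.
have p0 : p != 0.
  by apply/eqP => p0; case: (infs 0) => v; split; rewrite ?fE ?dE ?tE p0 ?deriv0 horner0 mul0r.
have simple s : q.[s] = 0 -> q^`().[s] != 0.
  by move=> qs; apply/eqP => q's; case: (infs s) => v; split; rewrite ?fE ?dE ?tE /= ?qs ?q's mulr0.
have ur : uniq r.
  by rewrite -separable_prod_XsubC unlock; apply/Pdiv.ClosedField.coprimepP => x /rootP; apply: simple.
have ZA z : z \in Z -> z.1 \in r /\ root p z.2.
  move=> /ZP[]; rewrite fE dE tE => /eqP; rewrite mulf_eq0 => /orP[/eqP p2|/eqP q1] E1 E2.
    have [q1|q1] := eqVneq q.[z.1] 0; first by rewrite -root_prod_XsubC -/q; split; apply/rootP.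
    case: (inft z.2) => u; move/eqP: E2; rewrite mulf_eq0 (negbTE q1) orbF => /eqP p'2.
    by split; rewrite ?fE ?dE ?tE /= ?p2 ?p'2 mul0r.
  have q'1 := simple _ q1; rewrite -root_prod_XsubC -/q; split; apply/rootP => //.
  by move/eqP: E1; rewrite mulf_eq0 (negbTE q'1) orbF => /eqP.
pose t := undup (map snd Z).
have rt : all (root p) t.
  by apply/allP => v; rewrite mem_undup => /mapP[z /ZA[_ pz] ->].
have st1 : (size t < size p)%N by apply: max_poly_roots p0 rt (undup_uniq _).
have sp4 : (size p <= 4)%N by apply: leq_trans (size_Poly _) _.
have st2 : (3 <= size t)%N.
  have : (size Z <= size [seq (x, y) | x <- r, y <- t])%N.
    apply: uniq_leq_size => // -[u v] zZ; have [zr _] := ZA _ zZ.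
    by apply/allpairsP; exists (u, v); rewrite mem_undup; split=> //; apply/mapP; exists (u, v).
  by rewrite size_allpairs sZ sr; lia.
have st : size t = 3%N by move: st1 st2 sp4; lia.
have sp : size p = (size t).+1 by move: st1 st sp4; lia.
have Ep : p = lead_coef p *: \prod_(y <- t) ('X - y%:P).
  by apply: all_roots_prod_XsubC => //; rewrite uniq_rootsE undup_uniq.
exists r, t, (lead_coef p); split=> //; first exact: undup_uniq.
split; first by rewrite lead_coef_eq0.
move=> u v; rewrite fE Ep hornerZ !horner_prod lead_coefZ (monicP (monic_prod_XsubC _ _ _)) mulr1.
by rewrite /q mulrAC; congr (_ * _ * _); apply: eq_bigr => x _; rewrite hornerXsubC.
Qed.

End CubicPencil.

Definition c5 (R : nzRingType) (z : 'rV[R]_5) (i : nat) : R := z 0 (inord i).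

(** The Perazzo-Segre form in the coordinates X1, X2, Y1, Y2, Y3, where X3 is eliminated by the
    linear relation. *)
Definition segre_cubic (R : nzRingType) (z : 'rV[R]_5) : R :=
  c5 z 0 * c5 z 1 * (c5 z 2 + c5 z 3 + c5 z 4 - c5 z 0 - c5 z 1) - c5 z 2 * c5 z 3 * c5 z 4.

Lemma sum5 (R : nmodType) (F : 'I_5 -> R) :
  \sum_i F i = F (inord 0) + F (inord 1) + F (inord 2) + F (inord 3) + F (inord 4).
Proof.
rewrite !big_ord_recr big_ord0 /= add0r; do ![congr (_ + _)]; congr F; apply: val_inj;
by rewrite /= inordK.
Qed.

Lemma row5P (R : nzRingType) (z : 'rV[R]_5) : c5 z 0 = 0 -> c5 z 1 = 0 -> c5 z 2 = 0 ->
  c5 z 3 = 0 -> c5 z 4 = 0 -> z = 0.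
Proof.
move=> H0 H1 H2 H3 H4; apply/rowP => i; rewrite mxE -[i]inord_val.
by case: i => -[|[|[|[|[|]]]]] //= _.
Qed.

Lemma eq_forms_coef (L : closedFieldType) (k : 'I_4 -> 'I_4 -> L) :
  (forall s t, \sum_(i < 4) \sum_(j < 4) k i j * s ^+ i * t ^+ j = 0) -> forall i j, k i j = 0.
Proof.
move=> H i j.
have z1 (q : 'I_4 -> L) : (forall t, \sum_(j < 4) q j * t ^+ j = 0) -> forall j, q j = 0.
  move=> Hq l; pose p := \poly_(m < 4) q (inord m).
  have p0 : p = 0.
    apply: poly_eq0_horner => t; rewrite horner_poly -[RHS](Hq t); apply: eq_bigr => m _.
    by rewrite inord_val.
  by have := congr1 (fun p : {poly L} => p`_l) p0; rewrite coef_poly ltn_ord inord_val coef0.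
apply: (z1 (fun i => k i j)) => s; apply: (z1 (fun j => \sum_i k i j * s ^+ i)) => t.
rewrite -[RHS](H s t) exchange_big; apply: eq_bigr => l _ /=.
by rewrite mulr_suml.
Qed.

Section CubicForms.
Variable L : closedFieldType.

Definition cub20 (k : nat -> L) (x1 x2 y1 y2 : L) :=
  k 0%N * x1 ^+ 3 + k 1%N * x2 ^+ 3 + k 2%N * y1 ^+ 3 + k 3%N * y2 ^+ 3 + k 4%N * x1 ^+ 2 * x2
  + k 5%N * x1 ^+ 2 * y1 + k 6%N * x1 ^+ 2 * y2 + k 7%N * x2 ^+ 2 * x1 + k 8%N * x2 ^+ 2 * y1
  + k 9%N * x2 ^+ 2 * y2 + k 10%N * y1 ^+ 2 * x1 + k 11%N * y1 ^+ 2 * x2 + k 12%N * y1 ^+ 2 * y2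
  + k 13%N * y2 ^+ 2 * x1 + k 14%N * y2 ^+ 2 * x2 + k 15%N * y2 ^+ 2 * y1 + k 16%N * x1 * x2 * y1
  + k 17%N * x1 * x2 * y2 + k 18%N * x1 * y1 * y2 + k 19%N * x2 * y1 * y2.

Definition is_cub (K : L -> L -> L -> L -> L) :=
  exists k, forall x1 x2 y1 y2, K x1 x2 y1 y2 = cub20 k x1 x2 y1 y2.

Lemma is_cubB K K' : is_cub K -> is_cub K' ->
  is_cub (fun x1 x2 y1 y2 => K x1 x2 y1 y2 - K' x1 x2 y1 y2).
Proof.
by move=> [k E] [k' E']; exists (fun i => k i - k' i) => x1 x2 y1 y2; rewrite E E' /cub20; ring.
Qed.

Lemma is_cub_prod e p1 q1 r1 p2 q2 r2 p3 q3 r3 :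
  is_cub (fun x1 x2 y1 y2 => e * (x1 + p1 * x2 + q1 * y1 + r1 * y2) *
     (x1 + p2 * x2 + q2 * y1 + r2 * y2) * (x1 + p3 * x2 + q3 * y1 + r3 * y2)).
Proof.
exists (nth 0 [:: e; e * p1 * p2 * p3; e * q1 * q2 * q3; e * r1 * r2 * r3;
  e * (p1 + p2 + p3); e * (q1 + q2 + q3); e * (r1 + r2 + r3);
  e * (p1 * p2 + p1 * p3 + p2 * p3); e * (p1 * p2 * q3 + p1 * p3 * q2 + p2 * p3 * q1);
  e * (p1 * p2 * r3 + p1 * p3 * r2 + p2 * p3 * r1);
  e * (q1 * q2 + q1 * q3 + q2 * q3); e * (q1 * q2 * p3 + q1 * q3 * p2 + q2 * q3 * p1);
  e * (q1 * q2 * r3 + q1 * q3 * r2 + q2 * q3 * r1);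
  e * (r1 * r2 + r1 * r3 + r2 * r3); e * (r1 * r2 * p3 + r1 * r3 * p2 + r2 * r3 * p1);
  e * (r1 * r2 * q3 + r1 * r3 * q2 + r2 * r3 * q1);
  e * (p1 * q2 + p1 * q3 + p2 * q1 + p2 * q3 + p3 * q1 + p3 * q2);
  e * (p1 * r2 + p1 * r3 + p2 * r1 + p2 * r3 + p3 * r1 + p3 * r2);
  e * (q1 * r2 + q1 * r3 + q2 * r1 + q2 * r3 + q3 * r1 + q3 * r2);
  e * (p1 * q2 * r3 + p1 * q3 * r2 + p2 * q1 * r3 + p2 * q3 * r1 + p3 * q1 * r2 + p3 * q2 * r1)]).
by move=> x1 x2 y1 y2; rewrite /cub20 /=; ring.
Qed.

Lemma cub_on_quadric K : is_cub K -> (forall s t, K (s * t) 1 s t = 0) ->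
  exists l1 l2 m1 m2, forall x1 x2 y1 y2,
    K x1 x2 y1 y2 = (x1 * x2 - y1 * y2) * (l1 * x1 + l2 * x2 + m1 * y1 + m2 * y2).
Proof.
(* Row [i], column [j] of [T] is the coefficient of [s ^+ i * t ^+ j] after the substitution. Twelve
   of the sixteen entries kill a coefficient of [K]; the other four match the coefficients of a
   multiple of the quadric in pairs. *)
move=> [k E] K0; pose T := [:: [:: k 1%N; k 9%N; k 14%N; k 3%N];
  [:: k 8%N; k 7%N + k 19%N; k 15%N + k 17%N; k 13%N];
  [:: k 11%N; k 12%N + k 16%N; k 4%N + k 18%N; k 6%N]; [:: k 2%N; k 10%N; k 5%N; k 0%N]].
have T0 (i j : 'I_4) : nth 0 (nth [::] T i) j = 0.
  apply: (eq_forms_coef (k := fun i j : 'I_4 => nth 0 (nth [::] T i) j)) => s t.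
  rewrite -[RHS](K0 s t) E /cub20; rewrite !big_ord_recr !big_ord0 /=.
  by ring.
have c i j (i4 : (i < 4)%N) (j4 : (j < 4)%N) := T0 (Ordinal i4) (Ordinal j4).
have e0 (x y : L) : x + y = 0 -> y = - x by move/eqP; rewrite addrC addr_eq0 => /eqP.
have k1 := c 0 0 isT isT; have k9 := c 0 1 isT isT; have k14 := c 0 2 isT isT; have k3 := c 0 3 isT isT.
have k8 := c 1 0 isT isT; have k7 := e0 _ _ (c 1 1 isT isT).
have k15 : k 15%N = - k 17%N by apply: e0; rewrite addrC; apply: (c 1 2 isT isT).
have k13 := c 1 3 isT isT; have k11 := c 2 0 isT isT.
have k12 : k 12%N = - k 16%N by apply: e0; rewrite addrC; apply: (c 2 1 isT isT).
have k4 := e0 _ _ (c 2 2 isT isT); have k6 := c 2 3 isT isT.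
have k2 := c 3 0 isT isT; have k10 := c 3 1 isT isT; have k5 := c 3 2 isT isT; have k0 := c 3 3 isT isT.
exists (k 4%N), (k 7%N), (k 16%N), (k 17%N) => x1 x2 y1 y2.
rewrite /= in k1 k9 k14 k3 k8 k13 k11 k6 k2 k10 k5 k0.
by rewrite E /cub20 k1 k9 k14 k3 k8 k7 k15 k13 k11 k12 k4 k6 k2 k10 k5 k0; ring.
Qed.

End CubicForms.

(** * Projection of a ten-nodal cubic, given by a symmetric trilinear form, from a node *)

Section Trilinear.
Variable L : closedFieldType.
Hypothesis char0 : [pchar L] =i pred0.
Local Notation V := 'rV[L]_5.
Variable tri : V -> V -> V -> L.
Hypothesis triC : forall u v w, tri u v w = tri v u w.
Hypothesis triC' : forall u v w, tri u v w = tri u w v.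
Hypothesis triL : forall c u u' v w, tri (c *: u + u') v w = c * tri u v w + tri u' v w.

Lemma triD u u' v w : tri (u + u') v w = tri u v w + tri u' v w.
Proof. by rewrite -[u]scale1r triL mul1r scale1r. Qed.
Lemma tri0 v w : tri 0 v w = 0.
Proof. by have := triD 0 0 v w; rewrite addr0 => /eqP; rewrite -subr_eq0 opprD addNKr oppr_eq0 => /eqP. Qed.
Lemma triZ c u v w : tri (c *: u) v w = c * tri u v w.
Proof. by rewrite -[c *: u]addr0 triL tri0 addr0. Qed.
Lemma triD2 u v v' w : tri u (v + v') w = tri u v w + tri u v' w.
Proof. by rewrite ![tri u _ w]triC triD. Qed.
Lemma triZ2 c u v w : tri u (c *: v) w = c * tri u v w.
Proof. by rewrite ![tri u _ w]triC triZ. Qed.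
Lemma triD3 u v w w' : tri u v (w + w') = tri u v w + tri u v w'.
Proof. by rewrite ![tri u v _]triC' triD2. Qed.
Lemma triZ3 c u v w : tri u v (c *: w) = c * tri u v w.
Proof. by rewrite ![tri u v _]triC' triZ2. Qed.

Lemma tri_quad u v s w : tri (u + s *: v) (u + s *: v) w =
  tri u u w + 2%:R * s * tri u v w + s ^+ 2 * tri v v w.
Proof. by rewrite !(triD, triD2, triZ, triZ2) (triC v u w); ring. Qed.

Lemma tri_cube u v s : tri (u + s *: v) (u + s *: v) (u + s *: v) =
  tri u u u + 3%:R * s * tri u u v + 3%:R * s ^+ 2 * tri u v v + s ^+ 3 * tri v v v.
Proof.
rewrite tri_quad !(triD3, triZ3); rewrite (triC' u v u) (triC' v v u) (triC v u v).
by ring.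
Qed.

Definition tsing u := forall w, tri u u w = 0.
Variable nodes : seq V.
Hypothesis nodes_size : size nodes = 10%N.
Hypothesis nodes_neq0 : forall u, u \in nodes -> u != 0.
Hypothesis nodes_indep : forall i j c, (i < 10)%N -> (j < 10)%N ->
  nth 0 nodes i = c *: nth 0 nodes j -> i = j.
Hypothesis nodes_sing : forall u, u \in nodes -> tsing u.
Hypothesis sing_nodes : forall u, u != 0 -> tsing u -> exists2 v, v \in nodes & exists c, u = c *: v.
Hypothesis ordinary : forall u w, u \in nodes -> (forall v, tri u w v = 0) -> exists c, w = c *: u.

(** [P] is the centre of projection, and [B] is the quadratic form of its tangent cone; since [P] is
    an ordinary node, the radical of [B] is spanned by [P]. *)
Let P := nth 0 nodes 0.
Let B u v := tri P u v.

Lemma P_node : P \in nodes. Proof. by apply: mem_nth; rewrite nodes_size. Qed.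
Lemma P_neq0 : P != 0. Proof. exact: nodes_neq0 P_node. Qed.
Lemma BP u : B P u = 0. Proof. exact: nodes_sing P_node u. Qed.
Lemma Bsym u v : B u v = B v u. Proof. exact: triC'. Qed.
Lemma BPr u : B u P = 0. Proof. by rewrite Bsym BP. Qed.
Lemma BD u u' v : B (u + u') v = B u v + B u' v. Proof. exact: triD2. Qed.
Lemma BZ c u v : B (c *: u) v = c * B u v. Proof. exact: triZ2. Qed.
Lemma BDr u v v' : B u (v + v') = B u v + B u v'. Proof. exact: triD3. Qed.
Lemma BZr c u v : B u (c *: v) = c * B u v. Proof. exact: triZ3. Qed.
Lemma BN u v : B (- u) v = - B u v. Proof. by rewrite -scaleN1r BZ mulN1r. Qed.
Lemma BNr u v : B u (- v) = - B u v. Proof. by rewrite Bsym BN Bsym. Qed.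
Lemma Bnode R : tsing R -> B R R = 0. Proof. by move=> H; rewrite /B triC triC' H. Qed.

Definition BE := (BD, BZ, BDr, BZr, BN, BNr).

Lemma B_nondeg w : (forall v, B w v = 0) -> exists c, w = c *: P.
Proof. exact: ordinary P_node. Qed.

Record hyperbolic (a1 a2 b1 b2 : V) : Prop := Hyperbolic {
  ha1 : B a1 a1 = 0; ha2 : B a2 a2 = 0; hb1 : B b1 b1 = 0; hb2 : B b2 b2 = 0;
  ha12 : 2%:R * B a1 a2 = 1; hb12 : 2%:R * B b1 b2 = - 1;
  ha1b1 : B a1 b1 = 0; ha1b2 : B a1 b2 = 0; ha2b1 : B a2 b1 = 0; ha2b2 : B a2 b2 = 0
}.

Lemma two_neq0 : 2%:R != 0 :> L. Proof. exact: natr_neq0. Qed.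

(** Adding a multiple of [a] to [u] makes it isotropic, and rescaling adjusts its product with [a].
    The subspace [W] keeps the result orthogonal to vectors chosen before. *)
Lemma isotropic_dual a c (W : V -> Prop) : c != 0 -> B a a = 0 ->
  (forall u v x, W u -> W v -> W (u + x *: v)) -> W a -> (exists2 u, W u & B a u != 0) ->
  exists a', [/\ W a', B a' a' = 0 & 2%:R * B a a' = c].
Proof.
move=> c0 aa Wc Wa [u Wu au]; have n2 := two_neq0.
pose k := - B u u / (2%:R * B a u).
have W0 : W 0 by have := Wc a a (-1) Wa Wa; rewrite scaleN1r subrr.
exists (0 + (c / (2%:R * B a u)) *: (u + k *: a)); split.
- by apply: (Wc) => //; apply: (Wc).
- by rewrite add0r !BE aa (Bsym u a) /k; field; rewrite ?au ?n2.
- by rewrite add0r !BE aa; field; rewrite ?au ?n2.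
Qed.

Lemma kernel_vec k (A : 'M[L]_(5, k)) m (S : 'M[L]_(m, 5)) : (k + m < 5)%N ->
  exists w : V, w *m A = 0 /\ ~~ (w <= S)%MS.
Proof.
move=> lt; have /row_subPn[i Hi] : ~~ (kermx A <= S)%MS.
  apply/negP => /mxrankS; rewrite mxrank_ker; have := rank_leq_col A; have := rank_leq_row S.
  by move: lt; lia.
by exists (row i (kermx A)); split=> //; apply/sub_kermxP/row_sub.
Qed.

Lemma B_mul u v : B u v = (v *m \col_i B u (delta_mx 0 i)) 0 0.
Proof.
rewrite {1}[v]row_sum_delta mxE.
have BS (F : 'I_5 -> V) (s : seq 'I_5) : B u (\sum_(i <- s) F i) = \sum_(i <- s) B u (F i).
  elim: s => [|i s IH]; last by rewrite !big_cons BDr IH.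
  by rewrite !big_nil -(scale0r P) BZr mul0r.
by rewrite BS; apply: eq_bigr => i _; rewrite BZr mxE.
Qed.

(** A second node [R] is isotropic, because [B R R] is up to a factor the derivative of the cubic at
    [R] in the direction [P]. It is completed to a hyperbolic plane; in the orthogonal complement an
    isotropic vector comes from a quadratic equation, and the construction is repeated. *)
Lemma hyperbolic_exists : exists a1 a2 b1 b2, hyperbolic a1 a2 b1 b2.
Proof.
have n2 := two_neq0.
pose R := nth 0 nodes 1; have Rn : R \in nodes by apply: mem_nth; rewrite nodes_size.
have RR := Bnode (nodes_sing Rn).
have [u0 Bu0] : exists u, B R u != 0.
  apply: contrapT => H; have [|c Ec] := @B_nondeg R.
    by move=> v; apply/eqP/negP => /negP Hv; apply: H; exists v.
  by have := nodes_indep (i := 1) (j := 0) isT isT Ec.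
have [a2 [_ a22 a12]] : exists a2, [/\ True, B a2 a2 = 0 & 2%:R * B R a2 = 1].
  by apply: (isotropic_dual (W := fun=> True) (oner_neq0 L) RR) => //; exists u0.
pose A : 'M[L]_(5, 1 + 1) := row_mx (\col_i B R (delta_mx 0 i)) (\col_i B a2 (delta_mx 0 i)).
pose W w := B R w = 0 /\ B a2 w = 0.
have AW w : w *m A = 0 -> W w.
  rewrite mul_mx_row => /eqP; rewrite row_mx_eq0 => /andP[/eqP E1 /eqP E2].
  by split; rewrite B_mul ?E1 ?E2 mxE.
have [w1 [/AW W1 w1P]] := @kernel_vec _ A _ P isT.
have [w2 [/AW W2 w2P]] := @kernel_vec _ A _ (col_mx P w1) isT.
have Wc u v x : W u -> W v -> W (u + x *: v).
  by move=> [H1 H2] [H3 H4]; split; rewrite !BE ?H1 ?H2 ?H3 ?H4 mulr0 addr0.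
have [b1 [Wb1 b11 b1P]] : exists b1, [/\ W b1, B b1 b1 = 0 & forall c, b1 <> c *: P].
  have nP w c : ~~ (w <= P)%MS -> w <> c *: P by move=> H E; rewrite E scalemx_sub in H.
  have [E|ne] := eqVneq (B w2 w2) 0.
    exists w2; split=> // c E'; move: w2P; rewrite E' scalemx_sub //.
    by apply/submxP; exists (row_mx 1%:M 0); rewrite mul_row_col mul1mx mul0mx addr0.
  have [t Et] : exists t, B w2 w2 * t ^+ 2 + 2%:R * B w1 w2 * t + B w1 w1 = 0.
    have /closed_rootP[t /rootP Ht] : size (Poly [:: B w1 w1; 2%:R * B w1 w2; B w2 w2]) != 1%N.
      by rewrite (@PolyK _ 0).
    by exists t; rewrite -[RHS]Ht horner_Poly /=; ring.
  exists (w1 + t *: w2); split; first exact: Wc.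
    by rewrite !BE (Bsym w2 w1) -[RHS]Et; ring.
  move=> c E'; have [t0|t0] := eqVneq t 0.
    by move: w1P; rewrite (_ : w1 = c *: P) ?scalemx_sub //; rewrite -E' t0 scale0r addr0.
  move: w2P; rewrite (_ : w2 = t^-1 *: (c *: P - w1)); last by rewrite -E' addrC addKr scalerA mulVf // scale1r.
  case/negP; apply/submxP; exists (row_mx (t^-1 * c)%:M (- t^-1)%:M).
  by rewrite mul_row_col !mul_scalar_mx scalerBr scalerA scaleNr.
have [[x1 x2] Bx] : exists x : V * V, B b1 x.1 != 0.
  apply: contrapT => H; have [|c Ec] := @B_nondeg b1; last exact: (b1P c).
  by move=> v; apply/eqP/negP => /negP Hv; apply: H; exists (v, v).
pose u := x1 - (2%:R * B x1 a2) *: R - (2%:R * B x1 R) *: a2.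
have Bra2 : B R a2 = 2%:R^-1 by apply: (mulfI n2); rewrite a12 mulfV.
have Wu : W u.
  split; rewrite /u !BE ?RR ?a22 ?(Bsym a2 R) ?Bra2 ?(Bsym _ x1).
    by field.
  by field.
have Bu : B b1 u != 0.
  by rewrite /u !BE !(Bsym b1) (proj1 Wb1) (proj2 Wb1) !mulr0 !subr0 Bsym.
have [b2 [[Rb2 a2b2] b22 b12]] : exists b2, [/\ W b2, B b2 b2 = 0 & 2%:R * B b1 b2 = -1].
  by apply: (isotropic_dual _ b11 Wc Wb1); [rewrite oppr_eq0 oner_eq0|exists u].
by exists R, a2, b1, b2; split=> //; [case: Wb1|case: Wb1].
Qed.

(* [x1 x2 y1 y2] below are the coordinates dual to a hyperbolic basis: the quadric tangent cone at
   the node [P] becomes [x1 x2 = y1 y2], parametrized by [(s t, 1, s, t)]. *)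
Section Coordinates.
Variables a1 a2 b1 b2 : V.
Hypothesis H : hyperbolic a1 a2 b1 b2.

Definition hbasis : 'M[L]_5 := \matrix_(i < 5) nth 0 [:: P; a1; a2; b1; b2] i.

Lemma hbasis_mul z : z *m hbasis =
  c5 z 0 *: P + c5 z 1 *: a1 + c5 z 2 *: a2 + c5 z 3 *: b1 + c5 z 4 *: b2.
Proof. by rewrite mulmx_sum_row sum5 !rowK /= !inordK. Qed.

Lemma B_basis t x1 x2 y1 y2 (v := t *: P + x1 *: a1 + x2 *: a2 + y1 *: b1 + y2 *: b2) :
  [/\ 2%:R * B v a2 = x1, 2%:R * B v a1 = x2, 2%:R * B v b2 = - y1, 2%:R * B v b1 = - y2
    & B v v = x1 * x2 - y1 * y2].
Proof.
case: H => E1 E2 E3 E4 E5 E6 E7 E8 E9 E10; have n2 := two_neq0.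
have {}E5 : B a1 a2 = 2%:R^-1 by apply: (mulfI n2); rewrite E5 mulfV.
have {}E6 : B b1 b2 = - 2%:R^-1 by apply: (mulfI n2); rewrite E6 mulrN mulfV.
rewrite /v !BE !(BP, BPr) (Bsym a2 a1) (Bsym b1 a1) (Bsym b1 a2) (Bsym b2 a1) (Bsym b2 a2) (Bsym b2 b1).
by rewrite E1 E2 E3 E4 E5 E6 E7 E8 E9 E10; split; field.
Qed.

Lemma hbasis_unit : hbasis \in unitmx.
Proof.
rewrite -row_free_unit -kermx_eq0; apply/eqP/row_matrixP => i; rewrite row0.
set z := row i _; have : z *m hbasis = 0 by apply/sub_kermxP/row_sub.
clearbody z; rewrite hbasis_mul => z0.
have := B_basis (c5 z 0) (c5 z 1) (c5 z 2) (c5 z 3) (c5 z 4); rewrite z0.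
have B0 v : B 0 v = 0 by rewrite -(scale0r P) BZ mul0r.
rewrite /= !B0 mulr0 => -[E1 E2 E3 E4 _]; apply: row5P; rewrite -?E1 -?E2 //.
- move: z0; rewrite -E1 -E2 -[c5 z 3]opprK -[c5 z 4]opprK -E3 -E4 !oppr0 !scale0r !addr0 => /eqP.
  by rewrite scaler_eq0 (negbTE P_neq0) orbF => /eqP.
- by apply/eqP; rewrite -oppr_eq0 -E3.
- by apply/eqP; rewrite -oppr_eq0 -E4.
Qed.

Lemma hcoord v : exists t x1 x2 y1 y2, v = t *: P + x1 *: a1 + x2 *: a2 + y1 *: b1 + y2 *: b2.
Proof.
by do 5 eexists; rewrite -[LHS](mulmxKV hbasis_unit) hbasis_mul; reflexivity.
Qed.

Lemma hyperbolic_shift k m :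
  hyperbolic (a1 - m *: b1 - k *: b2 + (k * m) *: a2) a2 (b1 - k *: a2) (b2 - m *: a2).
Proof.
case: H => E1 E2 E3 E4 E5 E6 E7 E8 E9 E10; have n2 := two_neq0.
have {}E5 : B a1 a2 = 2%:R^-1 by apply: (mulfI n2); rewrite E5 mulfV.
have {}E6 : B b1 b2 = - 2%:R^-1 by apply: (mulfI n2); rewrite E6 mulrN mulfV.
split; rewrite ?BE ?(Bsym a2 a1, Bsym b1 a1, Bsym b1 a2, Bsym b2 a1, Bsym b2 a2, Bsym b2 b1);
by rewrite ?(E1, E2, E3, E4, E5, E6, E7, E8, E9, E10); field.
Qed.

End Coordinates.

Lemma tsing_scale c u : tsing u -> tsing (c *: u).
Proof. by move=> Hu w; rewrite triZ triZ2 Hu !mulr0. Qed.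

(** All other nodes must lie in the chart [x2 != 0]. Shifting with [k = l] and [m = l ^+ 2] turns
    the product of a node with [a1] into a polynomial in [l] whose four coefficients are, up to
    sign, its products with the basis; they are not all zero, as the node is not proportional to
    [P]. *)
Lemma generic_hyperbolic : exists a1 a2 b1 b2, hyperbolic a1 a2 b1 b2 /\
  forall i, (0 < i < 10)%N -> B (nth 0 nodes i) a1 != 0.
Proof.
have [a1 [a2 [b1 [b2 H]]]] := hyperbolic_exists.
pose p i : {poly L} := Poly [:: B (nth 0 nodes i) a1; - B (nth 0 nodes i) b2;
   - B (nth 0 nodes i) b1; B (nth 0 nodes i) a2].
have p0 i : (0 < i < 10)%N -> p i != 0.
  move=> /andP[i0 i10]; apply/eqP => pz.
  have c m : (p i)`_m = 0 by rewrite pz coef0.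
  have := c 0%N; have := c 1%N; have := c 2%N; have := c 3%N; rewrite !coef_Poly /=.
  move=> C3 /eqP; rewrite oppr_eq0 => /eqP C2 /eqP; rewrite oppr_eq0 => /eqP C1 C0.
  have [|e Ee] := @B_nondeg (nth 0 nodes i).
    by move=> v; have [t [x1 [x2 [y1 [y2 ->]]]]] := hcoord H v; rewrite !BE BPr C0 C1 C2 C3 !mulr0 !addr0.
  by have := nodes_indep i10 (isT : (0 < 10)%N) Ee => i00; rewrite i00 in i0.
have pp0 : \prod_(i < 9) p i.+1 != 0.
  by apply/prodf_neq0 => i _; apply: p0; rewrite /= ltnS.
have [l Hl] := poly_nonroot pp0.
exists (a1 - l ^+ 2 *: b1 - l *: b2 + (l * l ^+ 2) *: a2), a2, (b1 - l *: a2), (b2 - l ^+ 2 *: a2).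
split; first exact: hyperbolic_shift.
case=> // i /andP[_ i9]; apply: contraNneq Hl => E; rewrite horner_prod (bigD1 (Ordinal (i9 : (i < 9)%N))) //=.
rewrite (_ : (p i.+1).[l] = 0) ?mul0r // -[RHS]E horner_Poly !BE /=; ring.
Qed.

Section Grid.
Variables a1 a2 b1 b2 : V.
Hypothesis H : hyperbolic a1 a2 b1 b2.
Hypothesis gen : forall i, (0 < i < 10)%N -> B (nth 0 nodes i) a1 != 0.

(** [w] parametrizes the quadric of the tangent cone, and [ws], [wt] are its partial derivatives. *)
Let w s t : V := (a2 + s *: b1) + t *: (b2 + s *: a1).
Let ws t : V := b1 + t *: a1.
Let wt s : V := b2 + s *: a1.
Definition cubp u v := Poly [:: tri u u u; 3%:R * tri u u v; 3%:R * tri u v v; tri v v v].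
Definition mixp u v p q := Poly [:: 3%:R * tri u u p; 3%:R * (tri u u q + 2%:R * tri u v p);
  3%:R * (2%:R * tri u v q + tri v v p); 3%:R * tri v v q].
Let pa := cubp b2 a1.
Let pb := mixp b2 a1 a2 b1.
Let pc := mixp a2 b1 b2 a1.
Let pd := cubp a2 b1.

Lemma tri_s u : [/\ tri u b1 a1 = tri u a1 b1, tri u b2 a1 = tri u a1 b2, tri u b1 a2 = tri u a2 b1,
  tri u b2 a2 = tri u a2 b2 & tri u a2 a1 = tri u a1 a2 /\ tri u b2 b1 = tri u b1 b2].
Proof. by split; rewrite ?[tri u b1 _]triC' ?[tri u b2 _]triC' //; split; apply: triC'. Qed.

Ltac tsort := rewrite ?(triC b2 b1, triC b2 a2, triC b2 a1, triC b1 a2, triC b1 a1, triC a2 a1);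
  rewrite ?(fun u => let: And5 h _ _ _ _ := tri_s u in h, fun u => let: And5 _ h _ _ _ := tri_s u in h,
   fun u => let: And5 _ _ h _ _ := tri_s u in h, fun u => let: And5 _ _ _ h _ := tri_s u in h,
   fun u => let: And5 _ _ _ _ (conj h _) := tri_s u in h, fun u => let: And5 _ _ _ _ (conj _ h) := tri_s u in h);
  rewrite ?(triC b2 b1, triC b2 a2, triC b2 a1, triC b1 a2, triC b1 a1, triC a2 a1).

Lemma wE s t : w s t = 0 *: P + (s * t) *: a1 + 1 *: a2 + s *: b1 + t *: b2.
Proof. by rewrite /w; apply/rowP => i; rewrite !mxE; ring. Qed.

Lemma w_cubic_ev s t : cubic_ev pa pb pc pd s t = tri (w s t) (w s t) (w s t).
Proof.
rewrite /w tri_cube !tri_cube !tri_quad !(triD, triD2, triD3, triZ, triZ2, triZ3).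
rewrite /cubic_ev /pa /pb /pc /pd /cubp /mixp !horner_Poly /=.
by tsort; ring.
Qed.

Lemma w_pev_t s t : pev_t pa pb pc s t = 3%:R * tri (w s t) (w s t) (wt s).
Proof.
rewrite /w /wt tri_quad !tri_quad !(triD, triD2, triD3, triZ, triZ2, triZ3).
rewrite /pev_t /pa /pb /pc /pd /cubp /mixp !horner_Poly /=.
by tsort; ring.
Qed.

Lemma w_pev_s s t : cubic_ev pa^`() pb^`() pc^`() pd^`() s t = 3%:R * tri (w s t) (w s t) (ws t).
Proof.
rewrite /w /ws tri_quad !tri_quad !(triD, triD2, triD3, triZ, triZ2, triZ3).
rewrite /cubic_ev /pa /pb /pc /pd /cubp /mixp !deriv_Poly4.
by tsort; ring.
Qed.

Lemma three_neq0 : 3%:R != 0 :> L. Proof. exact: natr_neq0. Qed.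

Lemma psingE s t : psing pa pb pc pd (s, t) <->
  [/\ tri (w s t) (w s t) (w s t) = 0, tri (w s t) (w s t) (ws t) = 0 & tri (w s t) (w s t) (wt s) = 0].
Proof.
rewrite /psing /= w_cubic_ev w_pev_s w_pev_t; have n3 := three_neq0.
split=> [[-> /eqP + /eqP]|[-> -> ->]]; last by rewrite mulr0.
by rewrite !mulf_eq0 !(negbTE n3) => /eqP-> /eqP->.
Qed.

Lemma Bw s t : [/\ 2%:R * B (w s t) a2 = s * t, 2%:R * B (w s t) a1 = 1, 2%:R * B (w s t) b2 = - s,
  2%:R * B (w s t) b1 = - t & B (w s t) (w s t) = 0].
Proof.
rewrite wE; have := B_basis H 0 (s * t) 1 s t => /= -[-> -> -> -> ->]; split=> //.
by rewrite mulr1 subrr.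
Qed.

Lemma tsing_w tau s t : tsing (tau *: P + w s t) <-> forall u, 2%:R * tau * B (w s t) u + tri (w s t) (w s t) u = 0.
Proof.
have E u : tri (tau *: P + w s t) (tau *: P + w s t) u = 2%:R * tau * B (w s t) u + tri (w s t) (w s t) u.
  rewrite [tau *: P + w s t]addrC tri_quad (BP u : tri P P u = 0) mulr0 addr0 (triC (w s t) P u) -/(B (w s t) u).
  by ring.
by split=> HH u; rewrite ?E // -E; apply: HH.
Qed.

(** Singularity of [tau *: P + w s t] is the vanishing of a linear form [Lam]. It vanishes at [w],
    [ws], [wt] by hypothesis and at [P] because [w] is isotropic; together with [a1] these vectors
    span the space, and [tau] is chosen to kill the value at [a1]. *)
Lemma psing_lift s t : psing pa pb pc pd (s, t) -> exists tau, tsing (tau *: P + w s t).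
Proof.
move=> /psingE[E0 Es Et]; have [B1 B2 B3 B4 B5] := Bw s t; have n2 := two_neq0.
exists (- tri (w s t) (w s t) a1); apply/tsing_w => u.
pose Lam u := 2%:R * - tri (w s t) (w s t) a1 * B (w s t) u + tri (w s t) (w s t) u.
have LD c v v' : Lam (v + c *: v') = Lam v + c * Lam v'.
  by rewrite /Lam !BE triD3 triZ3; ring.
have L1 : Lam a1 = 0.
  rewrite /Lam; have -> : B (w s t) a1 = 2%:R^-1 by apply: (mulfI n2); rewrite B2 mulfV.
  by field.
have Lw : Lam (w s t) = 0 by rewrite /Lam B5 E0 mulr0 addr0.
have hB : (2%:R * B (w s t) (ws t) = 0) * (2%:R * B (w s t) (wt s) = 0).
  rewrite /ws /wt (BDr (w s t) b1) (BDr (w s t) b2) !(BZr _ (w s t) a1) !mulrDr B4 B3 !(mulrCA 2%:R) B2.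
  by rewrite !mulr1 !addNr.
have L2 : Lam (ws t) = 0.
  rewrite /Lam Es addr0 mulrAC hB mul0r //.
have L3 : Lam (wt s) = 0.
  rewrite /Lam Et addr0 mulrAC hB mul0r //.
have LP : Lam P = 0 by rewrite /Lam BPr mulr0 add0r triC' triC -/(B _ _) B5.
have Lb1 : Lam b1 = 0 by move: L2; rewrite LD L1 mulr0 addr0.
have Lb2 : Lam b2 = 0 by move: L3; rewrite LD L1 mulr0 addr0.
have La2 : Lam a2 = 0 by move: Lw; rewrite !LD Lb1 Lb2 L1 !(mulr0, addr0).
have [x0 [x1 [x2 [y1 [y2 ->]]]]] := hcoord H u.
rewrite -/(Lam _) !LD La2 Lb1 Lb2 L1 !mulr0 !addr0.
by rewrite /Lam BZr triZ3 mulrCA -mulrDr -/(Lam P) LP mulr0.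
Qed.

(** The parameters [(s, t)] of the image of [R] under projection from [P]. *)
Definition zof R := (- B R b2 / B R a1, - B R b1 / B R a1).

Lemma node_w R : tsing R -> B R a1 != 0 ->
  exists x2 tau, [/\ x2 != 0, R = x2 *: (tau *: P + w (zof R).1 (zof R).2) & tsing (tau *: P + w (zof R).1 (zof R).2)].
Proof.
move=> SR BR; have n2 := two_neq0.
have [x0 [x1 [x2 [y1 [y2 ER]]]]] := hcoord H R.
have := B_basis H x0 x1 x2 y1 y2; rewrite /= -ER => -[B1 B2 B3 B4 B5].
have x20 : x2 != 0 by rewrite -B2 mulf_neq0.
have zE : zof R = (y1 / x2, y2 / x2).
  by rewrite /zof -B2 -[y1]opprK -[y2]opprK -B3 -B4; congr pair; field; rewrite BR n2.
have x1E : x1 = y1 * y2 / x2.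
  by apply: (mulIf x20); rewrite mulfVK //; apply/eqP; rewrite -subr_eq0 -B5 (Bnode SR).
have E : R = x2 *: ((x0 / x2) *: P + w (zof R).1 (zof R).2).
  rewrite zE /= wE {1}ER x1E; apply/rowP => i; rewrite !mxE; field; exact: x20.
exists x2, (x0 / x2); split=> //.
have -> : (x0 / x2) *: P + w (zof R).1 (zof R).2 = x2^-1 *: R.
  by rewrite [in RHS]E scalerA mulVf // scale1r.
exact: tsing_scale.
Qed.

Lemma nodeI i : (i < 10)%N -> nth 0 nodes i \in nodes.
Proof. by move=> i10; apply: mem_nth; rewrite nodes_size. Qed.

Let Z := [seq zof (nth 0 nodes i.+1) | i <- iota 0 9].

Lemma Z_psing z : z \in Z <-> psing pa pb pc pd z.
Proof.
have n2 := two_neq0.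
split=> [/mapP[i]|].
  rewrite mem_iota add0n => /andP[_ i9] ->.
  have SR := nodes_sing (nodeI (i9 : (i.+1 < 10)%N)).
  have [x2 [tau [_ _ /tsing_w T]]] := node_w SR (gen (i9 : (0 < i.+1 < 10)%N)).
  case: (zof _) T => s t /= T; apply/psingE; have [B1 B2 B3 B4 B5] := Bw s t.
  have hB : (2%:R * B (w s t) (ws t) = 0) * (2%:R * B (w s t) (wt s) = 0).
    rewrite /ws /wt (BDr (w s t) b1) (BDr (w s t) b2) !(BZr _ (w s t) a1) !mulrDr B4 B3 !(mulrCA 2%:R) B2.
    by rewrite !mulr1 !addNr.
  split; first by rewrite -[RHS](T (w s t)) B5 mulr0 add0r.
    by rewrite -[RHS](T (ws t)) mulrAC hB mul0r add0r.
  by rewrite -[RHS](T (wt s)) mulrAC hB mul0r add0r.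
case: z => s t /psing_lift[tau T]; have [B1 B2 B3 B4 B5] := Bw s t.
have v0 : tau *: P + w s t != 0.
  apply/eqP => v0; have : 2%:R * B (tau *: P + w s t) a1 = 0 by rewrite v0 -(scale0r P) BZ mul0r mulr0.
  by rewrite BD BZ BP mulr0 add0r B2 => /eqP; rewrite oner_eq0.
have [R Rn [c Ec]] := sing_nodes v0 T.
have ER : B (tau *: P + w s t) a1 = c * B R a1 by rewrite Ec BZ.
have BRa : c * B R a1 = 2%:R^-1 by rewrite -ER BD BZ BP mulr0 add0r; apply: (mulfI n2); rewrite B2 mulfV.
have c0 : c != 0 by apply: contraTneq isT => c0; move/eqP: BRa; rewrite c0 mul0r eq_sym invr_eq0 (negbTE n2).
have Ra0 : B R a1 != 0 by apply: contraTneq isT => R0; move/eqP: BRa; rewrite R0 mulr0 eq_sym invr_eq0 (negbTE n2).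
have zR : zof R = (s, t).
  have e2 : 2%:R * (c * B R b2) = - s by rewrite -BZ -Ec BD BZ BP mulr0 add0r.
  have e1 : 2%:R * (c * B R b1) = - t by rewrite -BZ -Ec BD BZ BP mulr0 add0r.
  have e0 : 2%:R * (c * B R a1) = 1 by rewrite BRa mulfV.
  have aux y r : 2%:R * (c * y) = - r -> - y / B R a1 = r.
    move=> e; apply: (mulIf Ra0); rewrite divfK // -[r]opprK -e.
    by transitivity (- y * (2%:R * (c * B R a1))); [rewrite e0 mulr1|ring].
  by rewrite /zof (aux _ _ e1) (aux _ _ e2).
have iR : (index R nodes < 10)%N by rewrite -nodes_size index_mem.
have RE : nth 0 nodes (index R nodes) = R by rewrite nth_index.
case E: (index R nodes) iR RE => [|i] iR RE.
  by move: Ra0; rewrite -RE BP eqxx.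
by apply/mapP; exists i; rewrite ?mem_iota ?add0n ?RE ?zR.
Qed.

Lemma Z_uniq : uniq Z.
Proof.
rewrite map_inj_in_uniq ?iota_uniq // => i j; rewrite !mem_iota !add0n /= => i9 j9 E.
have n2 := two_neq0.
have Si := nodes_sing (nodeI (i9 : (i.+1 < 10)%N)); have Sj := nodes_sing (nodeI (j9 : (j.+1 < 10)%N)).
have [x [tau [x0 Ei /tsing_w Ti]]] := node_w Si (gen (i9 : (0 < i.+1 < 10)%N)).
have [y [rho [y0 Ej /tsing_w Tj]]] := node_w Sj (gen (j9 : (0 < j.+1 < 10)%N)).
rewrite -E in Ej Tj; case: (zof _) Ei Ti Ej Tj => s t /= Ei Ti Ej Tj.
have [_ B2 _ _ _] := Bw s t.
have tr : tau = rho.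
  apply/eqP; rewrite -subr_eq0 -[_ - _]mulr1 -B2 mulrA [_ * 2%:R]mulrC; apply/eqP.
  transitivity ((2%:R * tau * B (w s t) a1 + tri (w s t) (w s t) a1) -
     (2%:R * rho * B (w s t) a1 + tri (w s t) (w s t) a1)); first by ring.
  by rewrite Ti Tj subrr.
have : nth 0 nodes i.+1 = (x / y) *: nth 0 nodes j.+1.
  by rewrite Ei Ej tr scalerA divfK.
by move/(nodes_indep (i9 : (i.+1 < 10)%N) (j9 : (j.+1 < 10)%N)) => -[].
Qed.

Lemma tri_is_cub :
  is_cub (fun x1 x2 y1 y2 => let v := x1 *: a1 + x2 *: a2 + y1 *: b1 + y2 *: b2 in tri v v v).
Proof.
have E x1 x2 y1 y2 : let v := x1 *: a1 + x2 *: a2 + y1 *: b1 + y2 *: b2 in tri v v v =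
   (cub20 (nth 0 [:: tri a1 a1 a1; tri a2 a2 a2; tri b1 b1 b1; tri b2 b2 b2;
    3%:R * tri a1 a1 a2; 3%:R * tri a1 a1 b1; 3%:R * tri a1 a1 b2;
    3%:R * tri a1 a2 a2; 3%:R * tri a2 a2 b1; 3%:R * tri a2 a2 b2;
    3%:R * tri a1 b1 b1; 3%:R * tri a2 b1 b1; 3%:R * tri b1 b1 b2;
    3%:R * tri a1 b2 b2; 3%:R * tri a2 b2 b2; 3%:R * tri b1 b2 b2;
    6%:R * tri a1 a2 b1; 6%:R * tri a1 a2 b2; 6%:R * tri a1 b1 b2; 6%:R * tri a2 b1 b2]) x1 x2 y1 y2).
  rewrite /= /cub20 /= !(triD, triD2, triD3, triZ, triZ2, triZ3).
  by tsort; ring.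
by eexists=> x1 x2 y1 y2; apply: E.
Qed.

(** The linear form [lam] at [(si, tj)] restricts to [(s - si) (t - tj)] on the quadric. The weights
    satisfy [u1 + u2 = 1], [s3 = u1 s1 + u2 s2], and likewise for [t3], so the form at [(s3, t3)] is
    the weighted sum of the four listed. Moreover [lam11 lam22 - lam12 lam21] is
    [(s1 - s2) (t1 - t2)] times the quadric, whence the constant [c]. *)
Definition perazzo_coord (s1 s2 s3 t1 t2 t3 e l1 l2 m1 m2 : L) : 'M[L]_5 :=
  let u1 := (s3 - s2) / (s1 - s2) in let u2 := (s1 - s3) / (s1 - s2) in
  let v1 := (t3 - t2) / (t1 - t2) in let v2 := (t1 - t3) / (t1 - t2) in
  let lam k s t := [:: 0; k; k * (s * t); - k * t; - k * s] in
  let c := - ((s1 - s2) * (t1 - t2) * e)^-1 in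
  \matrix_(i, j) nth 0 (nth [::] [:: lam (u1 * v1) s1 t1; lam (u2 * v2) s2 t2;
    lam (- (u1 * v2)) s1 t2; lam (- (u2 * v1)) s2 t1;
    [:: c * 3%:R; c * l1; c * l2; c * m1; c * m2]] j) i.

Section Perazzo.
Variables s1 s2 s3 t1 t2 t3 e l1 l2 m1 m2 : L.
Hypotheses (s12 : s1 - s2 != 0) (s32 : s3 - s2 != 0) (s13 : s1 - s3 != 0).
Hypotheses (t12 : t1 - t2 != 0) (t32 : t3 - t2 != 0) (t13 : t1 - t3 != 0) (e0 : e != 0).
Let N := perazzo_coord s1 s2 s3 t1 t2 t3 e l1 l2 m1 m2.
Let lam x1 x2 y1 y2 s t := x1 - t * y1 - s * y2 + s * t * x2 : L.

Lemma perazzo_mul (z : V) (x0 := c5 z 0) (x1 := c5 z 1) (x2 := c5 z 2) (y1 := c5 z 3) (y2 := c5 z 4) :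
  [/\ c5 (z *m N) 0 = (s3 - s2) / (s1 - s2) * ((t3 - t2) / (t1 - t2)) * lam x1 x2 y1 y2 s1 t1,
      c5 (z *m N) 1 = (s1 - s3) / (s1 - s2) * ((t1 - t3) / (t1 - t2)) * lam x1 x2 y1 y2 s2 t2,
      c5 (z *m N) 2 = - ((s3 - s2) / (s1 - s2) * ((t1 - t3) / (t1 - t2))) * lam x1 x2 y1 y2 s1 t2,
      c5 (z *m N) 3 = - ((s1 - s3) / (s1 - s2) * ((t3 - t2) / (t1 - t2))) * lam x1 x2 y1 y2 s2 t1
    & c5 (z *m N) 4 = - ((s1 - s2) * (t1 - t2) * e)^-1 *
        (3%:R * x0 + (l1 * x1 + l2 * x2 + m1 * y1 + m2 * y2))].
Proof.
by split; rewrite /c5 mxE sum5 !mxE !inordK //= /lam -!/(c5 z _); rewrite -/x0 -/x1 -/x2 -/y1 -/y2; ring.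
Qed.

Lemma perazzo_unit : N \in unitmx.
Proof.
rewrite -row_free_unit -kermx_eq0; apply/eqP/row_matrixP => i; rewrite row0.
set z := row i _; have : z *m N = 0 by apply/sub_kermxP/row_sub.
clearbody z => z0; have := perazzo_mul z; rewrite z0 /= => -[].
have n3 := three_neq0; have n2 := two_neq0.
have c50 k : c5 (0 : V) k = 0 by rewrite /c5 mxE.
have nz (k l : L) : k != 0 -> 0 = k * l -> l = 0.
  by move=> k0 /esym/eqP; rewrite mulf_eq0 (negbTE k0) => /eqP.
rewrite !c50 => /nz E0 /nz E1 /nz E2 /nz E3 /nz E4.
have {E0} E0 : lam (c5 z 1) (c5 z 2) (c5 z 3) (c5 z 4) s1 t1 = 0 by apply: E0; rewrite !mulf_neq0 ?invr_eq0.
have {E1} E1 : lam (c5 z 1) (c5 z 2) (c5 z 3) (c5 z 4) s2 t2 = 0 by apply: E1; rewrite !mulf_neq0 ?invr_eq0.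
have {E2} E2 : lam (c5 z 1) (c5 z 2) (c5 z 3) (c5 z 4) s1 t2 = 0 by apply: E2; rewrite oppr_eq0 !mulf_neq0 ?invr_eq0.
have {E3} E3 : lam (c5 z 1) (c5 z 2) (c5 z 3) (c5 z 4) s2 t1 = 0 by apply: E3; rewrite oppr_eq0 !mulf_neq0 ?invr_eq0.
pose LL s t := lam (c5 z 1) (c5 z 2) (c5 z 3) (c5 z 4) s t.
have x2 : c5 z 2 = 0.
  apply: (mulfI (mulf_neq0 t12 s12)); rewrite mulr0.
  transitivity (LL s1 t1 - LL s1 t2 - LL s2 t1 + LL s2 t2); first by rewrite /LL /lam; ring.
  by rewrite /LL E0 E1 E2 E3 !subr0 addr0.
have y1 : c5 z 3 = 0.
  apply: (mulfI t12); rewrite mulr0.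
  transitivity (LL s1 t2 - LL s1 t1); first by rewrite /LL /lam x2; ring.
  by rewrite /LL E0 E2 subr0.
have y2 : c5 z 4 = 0.
  apply: (mulfI s12); rewrite mulr0.
  transitivity (LL s2 t1 - LL s1 t1); first by rewrite /LL /lam x2; ring.
  by rewrite /LL E0 E3 subr0.
have x1 : c5 z 1 = 0 by rewrite -E0 /lam x2 y1 y2; ring.
apply: row5P => //; rewrite x1 x2 y1 y2 !mulr0 !addr0 in E4.
have /eqP := E4 ltac:(by rewrite oppr_eq0 invr_eq0 !mulf_neq0).
by rewrite mulf_eq0 (negbTE n3) => /eqP.
Qed.

Lemma perazzo_segre (z : V) (x0 := c5 z 0) (x1 := c5 z 1) (x2 := c5 z 2) (y1 := c5 z 3) (y2 := c5 z 4) :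
  (x1 * x2 - y1 * y2) * (3%:R * x0 + (l1 * x1 + l2 * x2 + m1 * y1 + m2 * y2)) +
   e * (lam x1 x2 y1 y2 s1 t1 * lam x1 x2 y1 y2 s2 t2 * lam x1 x2 y1 y2 s3 t3) =
  - (e / ((s3 - s2) / (s1 - s2) * ((t3 - t2) / (t1 - t2)) * ((s1 - s3) / (s1 - s2) * ((t1 - t3) / (t1 - t2))))) * segre_cubic (z *m N).
Proof.
rewrite /segre_cubic; have := perazzo_mul z; rewrite /= -/x0 -/x1 -/x2 -/y1 -/y2 => -[-> -> -> -> ->].
by rewrite /lam; field; rewrite s12 s32 s13 t12 t32 t13 e0.
Qed.

End Perazzo.

(** On the span of the four isotropic vectors, the cubic minus [e] times the forms at [(s1, t1)],
    [(s2, t2)], [(s3, t3)] vanishes on the quadric, so it is the quadric times a linear form. In the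
    direction of the node [P] the cubic is linear, with coefficient three times the quadric, which
    completes that linear form. *)
Lemma tri_segre : exists (h : 'M[L]_5) (k : L), [/\ h \in unitmx, k != 0 &
  forall v, tri v v v = k * segre_cubic (v *m h)].
Proof.
have sz (p : {poly L}) a b c d : p = Poly [:: a; b; c; d] -> (size p <= 4)%N.
  by move=> ->; apply: size_Poly.
have Zs : size Z = 9%N by rewrite size_map size_iota.
have [r [t [e [sr st ur ut [e0 E]]]]] :=
  nine_singular_points char0 Z_psing Z_uniq Zs (sz pa _ _ _ _ erefl) (sz pb _ _ _ _ erefl)
    (sz pc _ _ _ _ erefl) (sz pd _ _ _ _ erefl).
case: r sr ur E => [|s1 [|s2 [|s3 []]]] // _ + E; case: t st ut E => [|t1 [|t2 [|t3 []]]] // _ + E.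
rewrite /= !inE !negb_or !andbT => /andP[/andP[t12 t13] t23] /andP[/andP[s12 s13] s23].
have C0 := is_cubB tri_is_cub (is_cub_prod e (s1 * t1) (- t1) (- s1) (s2 * t2) (- t2) (- s2) (s3 * t3) (- t3) (- s3)).
have [|l1 [l2 [m1 [m2 El]]]] := cub_on_quadric C0.
  move=> s t; have := E s t; rewrite w_cubic_ev !big_cons !big_nil.
  rewrite (_ : w s t = (s * t) *: a1 + 1 *: a2 + s *: b1 + t *: b2); last by rewrite wE scale0r add0r.
  by rewrite /= => ->; ring.
exists (invmx (hbasis a1 a2 b1 b2) *m perazzo_coord s1 s2 s3 t1 t2 t3 e l1 l2 m1 m2).
exists (- (e / ((s3 - s2) / (s1 - s2) * ((t3 - t2) / (t1 - t2)) * ((s1 - s3) / (s1 - s2) * ((t1 - t3) / (t1 - t2)))))).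
have nz (x y : L) : x != y -> x - y != 0 by rewrite subr_eq0.
move/nz: s12 => s12; move/nz: s13 => s13; move/nz: s23 => s23.
move/nz: t12 => t12; move/nz: t13 => t13; move/nz: t23 => t23.
have s32 : s3 - s2 != 0 by rewrite -oppr_eq0 opprB.
have t32 : t3 - t2 != 0 by rewrite -oppr_eq0 opprB.
split.
- by rewrite unitmx_mul unitmx_inv (hbasis_unit H) perazzo_unit.
- by rewrite oppr_eq0 !(mulf_neq0, invr_neq0).
move=> v; rewrite mulmxA -perazzo_segre //; set z := v *m _.
have -> : v = z *m hbasis a1 a2 b1 b2 by rewrite mulmxKV // (hbasis_unit H).
clearbody z; rewrite hbasis_mul; set x1 := c5 z 1; set x2 := c5 z 2; set y1 := c5 z 3; set y2 := c5 z 4.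
pose v0 := x1 *: a1 + x2 *: a2 + y1 *: b1 + y2 *: b2.
have -> : c5 z 0 *: P + x1 *: a1 + x2 *: a2 + y1 *: b1 + y2 *: b2 = v0 + c5 z 0 *: P.
  by rewrite /v0 [RHS]addrC !addrA.
have B0 : B v0 v0 = x1 * x2 - y1 * y2.
  by have [_ _ _ _] := B_basis H 0 x1 x2 y1 y2; rewrite scale0r add0r.
have := El x1 x2 y1 y2; rewrite /= -/v0 => /eqP; rewrite subr_eq => /eqP El'.
have T1 : tri v0 P P = 0 by rewrite triC triC' (BP v0 : tri P P v0 = 0).
have T2 : tri v0 v0 P = x1 * x2 - y1 * y2 by rewrite -B0 /B triC' triC.
rewrite tri_cube El' T1 T2 (BP P : tri P P P = 0); ring.
Qed.

End Grid.

Theorem segre_form : exists (h : 'M[L]_5) (k : L), [/\ h \in unitmx, k != 0 &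
  forall v, tri v v v = k * segre_cubic (v *m h)].
Proof.
by have [a1 [a2 [b1 [b2 [H gen]]]]] := generic_hyperbolic; apply: tri_segre H gen.
Qed.

End Trilinear.

Lemma mpoly_euler (R : comNzRingType) n d (G : {mpoly R[n]}) : G \is d.-homog ->
  \sum_i 'X_i * G^`M(i) = d%:R *: G.
Proof.
move=> /dhomogP hG.
have E i : 'X_i * G^`M(i) = \sum_(m <- msupp G) (G@_m * (m i)%:R) *: 'X_[m].
  rewrite {1}[G]mpolyE raddf_sum mulr_sumr; apply: eq_bigr => m _ /=.
  rewrite mderivZ mderivX scalerA -scalerAr; have [->|mi] := eqVneq (m i) 0%N.
    by rewrite mulr0 !scale0r.
  congr (_ *: _); rewrite -mpolyXD; congr 'X_[_]; apply/mnmP => l.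
  rewrite mnmDE mnmBE mnm1E; case: eqP => [<-|_]; last by rewrite subn0.
  by rewrite subnKC // lt0n.
rewrite (eq_bigr _ (fun i _ => E i)) exchange_big /= [in RHS](mpolyE G) scaler_sumr.
rewrite [LHS]big_seq [RHS]big_seq; apply: eq_bigr => m /hG mG.
by rewrite -scaler_suml -mulr_sumr -natr_sum -mdegE mG scalerA mulrC.
Qed.

(** * From the cubic form over K to its polarization over L *)

Section Frame.
Variables (K : fieldType) (L : closedFieldType) (iota : {rmorphism K -> L}).
Hypothesis char0 : [pchar K] =i pred0.
Variable X : ten_nodal_cubic iota.
Let F := cubic_form X.
Local Notation V := 'rV[L]_5.

Lemma pchar0_ext : [pchar L] =i pred0.
Proof. by move=> q; rewrite (fmorph_pchar iota) char0. Qed.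

Definition peval (G : {mpoly K[5]}) (v : V) : L := mmap iota (v 0) G.

Lemma pevalE (G : {mpoly K[5]}) (x : amb L 4 0) : @ev K L iota 4 0 G x = peval G (val x.1).
Proof.
rewrite /ev /peval; apply: eq_bigr => m _; congr (_ * _); apply: mmap1_eq => i.
rewrite /coords (_ : i = lshift 0 i) ?row_mxEl; first by congr (_ 0 _); apply: val_inj.
exact: val_inj.
Qed.

Lemma peval_euler d (G : {mpoly K[5]}) (v : V) : G \is d.-homog ->
  \sum_i v 0 i * peval G^`M(i) v = d%:R * peval G v.
Proof.
move=> /mpoly_euler/(congr1 (peval^~ v)); rewrite /peval mmapZ rmorph_nat => <-.
by rewrite rmorph_sum; apply: eq_bigr => i _; rewrite rmorphM /= mmapX mmap1U.
Qed.

Let D i j l := iota (F^`M(i)^`M(j)^`M(l))@_0.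

(** The polarization written with the constant third derivatives, without any division; on the
    diagonal it is six times the cubic. *)
Definition tri6 (u v w : V) := \sum_i \sum_j \sum_l u 0 i * v 0 j * w 0 l * D i j l.

Lemma D_sym i j l : D i j l = D j i l. Proof. by rewrite /D (mderiv_comm i j). Qed.
Lemma D_sym' i j l : D i j l = D i l j. Proof. by rewrite /D (mderiv_comm j l). Qed.

Lemma D_const i j l v : peval (F^`M(i)^`M(j)^`M(l)) v = D i j l.
Proof.
have : F^`M(i)^`M(j)^`M(l) \is 0.-homog by do 3!apply: deriv_homog; apply: cubic_homog.
move/dhomogP => H; rewrite /D; set G := _^`M(l) in H *.
have -> : G = (G@_0)%:MP.
  apply/mpolyP => m; rewrite mcoeffC; have [->|m0] := eqVneq m 0%MM; first by rewrite mulr1.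
  rewrite mulr0; apply/eqP; rewrite mcoeff_eq0; apply/negP => /H; rewrite -/(mdeg m) => /eqP.
  by rewrite mdeg_eq0 (negbTE m0).
by rewrite mcoeffC eqxx mulr1 /peval mmapC.
Qed.

Lemma hess_tri i j v : peval (F^`M(i)^`M(j)) v = \sum_l v 0 l * D i j l.
Proof.
have h : F^`M(i)^`M(j) \is 1.-homog by do 2!apply: deriv_homog; apply: cubic_homog.
by have := peval_euler v h; rewrite mul1r => <-; apply: eq_bigr => l _; rewrite D_const.
Qed.

Lemma grad_tri i v : 2%:R * peval F^`M(i) v = \sum_j \sum_l v 0 j * v 0 l * D i j l.
Proof.
have h : F^`M(i) \is 2.-homog by apply: deriv_homog; apply: cubic_homog.
rewrite -(peval_euler v h); apply: eq_bigr => j _; rewrite hess_tri mulr_sumr.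
by apply: eq_bigr => l _; rewrite mulrA.
Qed.

Lemma tri6C u v w : tri6 u v w = tri6 v u w.
Proof.
rewrite /tri6 exchange_big; apply: eq_bigr => i _; apply: eq_bigr => j _; apply: eq_bigr => l _.
by rewrite D_sym (mulrC (v 0 i)).
Qed.
Lemma tri6C' u v w : tri6 u v w = tri6 u w v.
Proof.
apply: eq_bigr => i _; rewrite exchange_big; apply: eq_bigr => j _; apply: eq_bigr => l _.
by rewrite D_sym'; congr (_ * _); rewrite mulrAC.
Qed.
Lemma tri6L c u u' v w : tri6 (c *: u + u') v w = c * tri6 u v w + tri6 u' v w.
Proof.
rewrite /tri6 mulr_sumr -big_split; apply: eq_bigr => i _ /=.
rewrite mulr_sumr -big_split; apply: eq_bigr => j _ /=.
rewrite mulr_sumr -big_split; apply: eq_bigr => l _ /=.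
by rewrite !mxE; ring.
Qed.

Lemma tri6_grad v w : tri6 v v w = \sum_i w 0 i * (2%:R * peval F^`M(i) v).
Proof.
rewrite tri6C' tri6C; apply: eq_bigr => i _; rewrite grad_tri mulr_sumr; apply: eq_bigr => j _.
by rewrite mulr_sumr; apply: eq_bigr => l _; rewrite !mulrA.
Qed.

Lemma tri6_cube v : tri6 v v v = 6%:R * peval F v.
Proof.
rewrite tri6_grad (_ : 6%:R = 2%:R * 3%:R); last by rewrite -natrM.
rewrite -mulrA -(peval_euler v (cubic_homog X)) mulr_sumr.
by apply: eq_bigr => i _; rewrite mulrCA.
Qed.

Lemma tri6_delta v w i : tri6 v w (delta_mx 0 i) = \sum_l w 0 l * peval (F^`M(l)^`M(i)) v.
Proof.
rewrite /tri6 exchange_big; apply: eq_bigr => j _; rewrite hess_tri mulr_sumr; apply: eq_bigr => l _.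
rewrite (bigD1 i) //= big1 ?addr0 => [|m mi].
  by rewrite mxE !eqxx mulr1 D_sym D_sym'; ring.
by rewrite mxE eqxx (negbTE mi) mulr0 mul0r.
Qed.

Lemma tsingP v : tsing tri6 v <-> forall i, peval F^`M(i) v = 0.
Proof.
have n2 := natr_neq0 pchar0_ext 1.
split=> [H i|H w]; last by rewrite tri6_grad big1 // => i _; rewrite H !mulr0.
have := H (delta_mx 0 i); rewrite tri6_grad (bigD1 i) //= big1 ?addr0 => [|m mi].
  by rewrite mxE !eqxx mul1r => /eqP; rewrite mulf_eq0 (negbTE n2) => /eqP.
by rewrite mxE eqxx (negbTE mi) mul0r.
Qed.

Lemma singularP (x : amb L 4 0) : singular_pt iota F x <-> tsing tri6 (val x.1).
Proof.
rewrite tsingP; split=> [[_ /rowP H] i|H]; first by have := H i; rewrite !mxE pevalE.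
split; last by apply/rowP => i; rewrite !mxE pevalE.
have n3 := natr_neq0 pchar0_ext 2; apply: (mulfI n3).
rewrite mulr0 pevalE -(peval_euler _ (cubic_homog X)) big1 // => i _.
by rewrite H mulr0.
Qed.

(** Subtracting a multiple of the node gives a vector with zero [i]-th coordinate; the minor of the
    Hessian attached to this chart annihilates it, and the node is ordinary. *)
Lemma ordinary_radical (x : amb L 4 0) w : singular_pt iota F x ->
  (forall v, tri6 (val x.1) w v = 0) -> exists c, w = c *: val x.1.
Proof.
move=> Sx Hw; have [_ nd] := cubic_nodes Sx; set u := val x.1.
have [i ui] : exists i, u 0 i != 0.
  apply: contrapT => H; have := proj_neq0 x.1; case/eqP; apply/rowP => i; rewrite mxE.
  by apply/eqP/negP => /negP ui; apply: H; exists i.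
have D0 := nd i ui.
pose w' := w - (w 0 i / u 0 i) *: u.
have w'i : w' 0 i = 0 by rewrite !mxE divfK // subrr.
have Hu v : tri6 u u v = 0 by have /singularP := Sx; apply.
have Hw' v : tri6 u w' v = 0.
  by rewrite tri6C /w' addrC -scaleNr tri6L [tri6 w _ _]tri6C Hw Hu mulr0 addr0.
exists (w 0 i / u 0 i); apply/eqP; rewrite -subr_eq0 -/w'; apply/eqP.
have : col' i w' *m row' i (col' i (hess iota F x)) = 0.
  apply/rowP => m; rewrite !mxE.
  have := Hw' (delta_mx 0 (lift i m)); rewrite tri6_delta (bigD1_ord i) //= w'i mul0r add0r => E0.
  rewrite -[RHS]E0; apply: eq_bigr => l _; rewrite !mxE; congr (_ * _); apply: pevalE.
move/(congr1 (mulmx^~ (invmx (row' i (col' i (hess iota F x)))))).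
rewrite mulmxK ?mul0mx; last by rewrite unitmxE unitfE.
move=> /rowP c0; apply/rowP => m; rewrite [RHS]mxE.
case: (unliftP i m) => [l ->|-> //].
by have := c0 l; rewrite !mxE.
Qed.

Theorem frame_exists : exists (h : 'M[L]_5) (k : L), [/\ h \in unitmx, k != 0 &
  forall v, peval F v = k * segre_cubic (v *m h)].
Proof.
have [s [us ss sP]] := cubic_sing X.
pose nodes := [seq val x.1 | x : amb L 4 0 <- s].
have sn : size nodes = 10%N by rewrite size_map.
have x0 : amb L 4 0 by case: s ss {us sP nodes sn} => [|x ?] // _; exact: x.
have inj (x y : amb L 4 0) c : val x.1 = c *: val y.1 -> x = y.
  by case: x y => [x a] [y b] /= /proj_eq ->; congr pair; apply/rowP; case.
have n6 := natr_neq0 pchar0_ext 5.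
have Sf := @segre_form L pchar0_ext tri6 tri6C tri6C' tri6L nodes sn.
have [|||||h [k [uh k0 E]]] := @segre_form L pchar0_ext tri6 tri6C tri6C' tri6L nodes sn.
- by move=> u /mapP[x _ ->]; apply: proj_neq0.
- move=> i j c i10 j10; rewrite !(nth_map x0) ?ss // => /inj/eqP.
  by rewrite nth_uniq ?ss // => /eqP.
- by move=> u /mapP[x xs ->]; apply/singularP/sP.
- move=> u u0 Su; have [c c0 E] := mkpP u0.
  exists (val (mkp u)); last by exists c.
  apply/mapP; exists (mkp u, 0) => //; apply/sP/singularP => /=.
  rewrite (_ : val (mkp u) = c^-1 *: u); last by rewrite {2}E scalerA mulVf // scale1r.
  by apply: (tsing_scale tri6C tri6L).
- by move=> u w /mapP[x xs ->]; apply: ordinary_radical; apply/sP.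
exists h, (6%:R^-1 * k); split=> //; first by rewrite mulf_neq0 ?invr_eq0.
by move=> v; apply: (mulfI n6); rewrite -tri6_cube E !mulrA mulfV // mul1r.
Qed.

End Frame.

Lemma cancel_frac (F : fieldType) (a b n d : F) : a != 0 -> b != 0 ->
  a * n / (b * d) / (a / b) = n / d.
Proof.
move=> a0 b0; rewrite -[a * n / (b * d)]mulf_div [a / b * _]mulrC mulfK // mulf_neq0 ?invr_eq0 //.
Qed.

(** * Fractions, units and line bundles over a factorial ring *)

Section UfdFractions.
Variable A : idomainType.
Hypothesis uA : ufd A.
Implicit Types (p r a b N D : A) (q : {fraction A}).
Local Notation "x %:F" := (tofrac x).

Lemma fracP q : exists N D, D != 0 /\ q = N%:F / D%:F.
Proof.
elim/quotW: q => x; exists \n_x, \d_x; have d0 := denom_ratioP x; split=> //.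
have dF : (\d_x)%:F != 0 by rewrite tofrac_eq0.
apply: (mulIf dF); rewrite divfK //; unlock tofrac; rewrite -[LHS]FracField.pi_mul.
apply/eqmodP; rewrite /= FracField.equivfE /FracField.mulf.
by rewrite !numden_Ratio ?mulf_neq0 ?oner_eq0 // !mulr1 mulrC.
Qed.

Lemma prime_power_part p a : rprime p -> a != 0 ->
  exists k b, a = p ^+ k * b /\ ~ rdvd p b.
Proof.
move=> pp /uA[u [s [uu ps ->]]]; elim: s ps => [|r s IH].
  by move=> _; exists 0%N, u; rewrite big_nil mulr1 mul1r; split=> //; apply: rprime_unit.
case/primes_list_cons=> pr /IH[k [b [E nb]]]; rewrite big_cons.
have [d|nd] := pselect (rdvd p r).
  have [v vv Er] := rprime_assoc pp pr d; exists k.+1, (v * b); split.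
    by rewrite mulrCA E Er exprS; ring.
  by case: (pp) => _ _ H /H[/(rprime_unit pp vv)|/nb].
exists k, (r * b); split; first by rewrite mulrCA E mulrCA.
by case: (pp) => _ _ H /H[/nd|/nb].
Qed.

Definition coprime_pair a b := forall p, rprime p -> rdvd p a -> ~ rdvd p b.

Lemma coprime_part a b : a != 0 -> b != 0 ->
  exists a' b' c, [/\ c != 0, a = c * a', b = c * b' & coprime_pair a' b'].
Proof.
move=> /[dup] a0 /uA[u [s [uu ps ->]]]; elim: s b ps => [|p s IH] b.
  rewrite big_nil mulr1 => _ b0; exists u, b, 1; rewrite !mul1r oner_neq0; split=> // p pp.
  by move=> /(rprime_unit pp uu).
case/primes_list_cons=> pp ps b0; have p0 : p != 0 by case: pp.
have [[b' Eb]|nb] := pselect (rdvd p b).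
  have b'0 : b' != 0 by apply: contraNneq b0 => b'0; rewrite Eb b'0 mul0r.
  have [a1 [b1 [c [c0 Ea Eb' cop]]]] := IH b' ps b'0.
  exists a1, b1, (p * c); split=> //; first by rewrite mulf_neq0.
    by rewrite big_cons mulrCA Ea mulrA.
  by rewrite Eb Eb'; ring.
have [a1 [b1 [c [c0 Ea Eb cop]]]] := IH b ps b0.
exists (p * a1), b1, c; split=> //; first by rewrite big_cons mulrCA Ea mulrCA.
move=> r pr; have [_ _ H] := pr; case/H=> [d|/(cop _ pr)//] d'.
have [v vv Er] := rprime_assoc pr pp d; apply: nb; rewrite Er Eb.
case: d' => e ->; exists (c * e * v^-1); rewrite mulrA -(mulrA _ v^-1) mulrA (mulrC _ r).
by rewrite -!mulrA (mulrA v^-1) mulVr // mul1r [r * _]mulrC !mulrA.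
Qed.

Lemma frac_coprime q : q != 0 -> exists ND : A * A,
  [/\ ND.1 != 0, ND.2 != 0, q = ND.1%:F / ND.2%:F & coprime_pair ND.1 ND.2].
Proof.
have [N [D [D0 ->]]] := fracP q; rewrite mulf_eq0 negb_or tofrac_eq0 => /andP[N0 _].
have [N' [D' [c [c0 EN ED cop]]]] := coprime_part N0 D0; exists (N', D') => /=.
have [N'0 D'0] : N' != 0 /\ D' != 0.
  by split; [apply: contraNneq N0 => z|apply: contraNneq D0 => z]; rewrite ?EN ?ED z mulr0.
split=> //; rewrite EN ED !tofracM; set x := N'%:F; set y := D'%:F; set z := c%:F.
have [z0 y0] : z != 0 /\ y != 0 by rewrite !tofrac_eq0.
by rewrite -mulf_div divff // mul1r.
Qed.

(** A chosen reduced fraction for each nonzero [q]; the values 0 and 1 at [q = 0] are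
    placeholders. *)
Definition fnum q : A := if pselect (q != 0) is left H then (projT1 (cid (frac_coprime H))).1 else 0.
Definition fden q : A := if pselect (q != 0) is left H then (projT1 (cid (frac_coprime H))).2 else 1.

Lemma fnumdenP q : q != 0 ->
  [/\ fnum q != 0, fden q != 0, q = (fnum q)%:F / (fden q)%:F & coprime_pair (fnum q) (fden q)].
Proof. by move=> q0; rewrite /fnum /fden; case: pselect => // H; case: cid. Qed.

(** [q] is a unit of the local ring at the prime [p]. *)
Definition unitp q p := exists N D, [/\ q = N%:F / D%:F, ~ rdvd p N & ~ rdvd p D].

Lemma not_rdvd_neq0 p a : ~ rdvd p a -> a != 0.
Proof. by move=> H; apply/eqP => a0; apply: H; rewrite a0; apply: rdvd0. Qed.

Lemma unitp_neq0 q p : unitp q p -> q != 0.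
Proof.
move=> [N [D [-> /not_rdvd_neq0 N0 /not_rdvd_neq0 D0]]].
by rewrite mulf_neq0 ?invr_eq0 ?tofrac_eq0.
Qed.

Lemma not_rdvdM p a b : rprime p -> ~ rdvd p a -> ~ rdvd p b -> ~ rdvd p (a * b).
Proof. by case=> _ _ H na nb /H[]. Qed.

Lemma unitpM q q' p : rprime p -> unitp q p -> unitp q' p -> unitp (q * q') p.
Proof.
move=> pp [N [D [-> nN nD]]] [N' [D' [-> nN' nD']]]; exists (N * N'), (D * D').
by rewrite !tofracM mulf_div; split=> //; apply: not_rdvdM.
Qed.

Lemma unitpV q p : unitp q p -> unitp q^-1 p.
Proof. by move=> [N [D [-> nN nD]]]; exists D, N; rewrite invf_div. Qed.

Lemma unitpXz q p (e : int) : rprime p -> unitp q p -> unitp (q ^ e) p.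
Proof.
move=> pp uq; have H n : unitp (q ^+ n) p.
  elim: n => [|n IH]; last by rewrite exprS; apply: unitpM.
  have [_ p1 _] := pp; exists 1, 1; split=> //; by rewrite expr0 divff // tofrac1 oner_neq0.
by case: e => n; [apply: H|apply/unitpV/H].
Qed.

Lemma unitp_val q p : rprime p -> q != 0 -> exists e : int, unitp (q / p%:F ^ e) p.
Proof.
move=> pp; have [N [D [D0 ->]]] := fracP q; rewrite mulf_eq0 negb_or tofrac_eq0 => /andP[N0 _].
have [k [N' [EN nN]]] := prime_power_part pp N0; have [l [D' [ED nD]]] := prime_power_part pp D0.
have p0 : p%:F != 0 by rewrite tofrac_eq0; case: pp.
have D'0 : D'%:F != 0 by rewrite tofrac_eq0 (not_rdvd_neq0 nD).
exists (k%:Z - l%:Z), N', D'; split=> //; rewrite EN ED !tofracM !tofracXn expfzDr // -invr_expz -!exprnP.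
by rewrite (cancel_frac _ _ (expf_neq0 k p0) (expf_neq0 l p0)).
Qed.

Lemma unitp_prime p r : rprime p -> rprime r -> ~ rdvd p r -> unitp r%:F p.
Proof. by move=> [_ p1 _] pr nd; exists r, 1; split=> //; rewrite tofrac1 divr1. Qed.

Lemma frac_eqP N D N' D' : D != 0 -> D' != 0 -> N%:F / D%:F = N'%:F / D'%:F -> N * D' = N' * D.
Proof.
move=> D0 D'0 /eqP; rewrite eqr_div ?tofrac_eq0 // -!tofracM tofrac_eq => /eqP.
by [].
Qed.

Lemma unitp_coprime N D p : rprime p -> coprime_pair N D -> D != 0 -> unitp (N%:F / D%:F) p ->
  ~ rdvd p N /\ ~ rdvd p D.
Proof.
move=> pp cop D0 [N' [D' [E nN' nD']]]; have D'0 := not_rdvd_neq0 nD'.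
have {}E := frac_eqP D0 D'0 E; have [_ _ H] := pp; split=> d.
  have : rdvd p (N' * D) by rewrite -E; apply: rdvd_mulr.
  by case/H=> // /(cop _ pp d).
have : rdvd p (N * D') by rewrite E; apply: rdvd_mull.
by case/H=> // d'; apply: (cop _ pp d' d).
Qed.

(** Dividing by the right power of [f] makes the fraction a unit at every prime; its reduced
    numerator and denominator then have no prime factor left. *)
Lemma unit_off_prime f q : rprime f -> q != 0 ->
  (forall p, rprime p -> ~ rdvd p f -> unitp q p) ->
  exists u v (e : int), [/\ u \is a GRing.unit, v \is a GRing.unit & q = u%:F / v%:F * f%:F ^ e].
Proof.
move=> pf q0 H; have [e ue] := unitp_val pf q0; set g := q / f%:F ^ e in ue.
have up p : rprime p -> unitp g p.
  move=> pp; have [d|nd] := pselect (rdvd p f); last first.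
    by apply: unitpM (H p pp nd) _ => //; apply/unitpV/unitpXz => //; apply: unitp_prime.
  have [v vv Ef] := rprime_assoc pp pf d; have [N [D [E nN nD]]] := ue.
  exists N, D; split=> // -[c Ec]; [apply: nN|apply: nD];
  by rewrite Ec Ef; exists (c * v^-1); rewrite mulrA mulrVK.
have [N0 D0 Eg cop] := fnumdenP (unitp_neq0 ue).
have np p : rprime p -> ~ rdvd p (fnum g) /\ ~ rdvd p (fden g).
  by move=> pp; apply: (unitp_coprime pp cop D0); rewrite -Eg; apply: up.
have unit a : a != 0 -> (forall p, rprime p -> ~ rdvd p a) -> a \is a GRing.unit.
  move=> /uA[u [[|p s] [uu ps ->]]] na; first by rewrite big_nil mulr1.
  have pp : rprime p by apply: ps; rewrite inE eqxx.
  by case: (na p pp); rewrite big_cons mulrCA; apply/rdvd_mulr/rdvd_refl.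
exists (fnum g), (fden g), e; split.
- by apply: unit => // p /np[].
- by apply: unit => // p /np[].
by rewrite -Eg /g divfK // expfz_neq0 // tofrac_eq0; case: pf.
Qed.

End UfdFractions.

Local Notation "x %:F" := (tofrac x).

(** * Values of fractions at points, and line bundles off codimension two *)

Section PolyFractions.
Variables (A : idomainType) (L : fieldType) (pt : Type) (e : pt -> {rmorphism A -> L}).
Hypothesis uA : ufd A.
Implicit Types (o : pt) (p : A) (q : {fraction A}).

Lemma root_prime p o : p != 0 -> e o p = 0 -> exists r, [/\ rprime r, rdvd r p & e o r = 0].
Proof.
move=> /uA[u [s [uu ps ->]]]; elim: s ps => [|r s IH].
  rewrite big_nil mulr1 => _ u0; have := rmorph_unit (e o) uu.
  by rewrite /= u0 unitr0.
case/primes_list_cons=> pr ps; rewrite big_cons mulrCA rmorphM => /eqP.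
rewrite mulf_eq0 => /orP[/eqP r0|/eqP/(IH ps)[r' [pr' d r0]]].
  by exists r; split=> //; apply/rdvd_mulr/rdvd_refl.
by exists r'; split=> //; apply: rdvd_mull.
Qed.

Lemma not_rdvd_root p r o : e o r = 0 -> e o p != 0 -> ~ rdvd r p.
Proof. by move=> r0 /eqP p0 [c E]; apply: p0; rewrite E rmorphM r0 mulr0. Qed.

Lemma meval_neq0 p o : e o p != 0 -> p != 0.
Proof. by apply: contraNneq => ->; rewrite rmorph0. Qed.

Definition unitf q o := exists N D : A, [/\ q = N%:F / D%:F, e o N != 0 & e o D != 0].

Lemma unitf_neq0 q o : unitf q o -> q != 0.
Proof.
move=> [N [D [-> /meval_neq0 N0 /meval_neq0 D0]]].
by rewrite mulf_neq0 ?invr_eq0 ?tofrac_eq0.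
Qed.

Lemma unitfM q q' o : unitf q o -> unitf q' o -> unitf (q * q') o.
Proof.
move=> [N [D [-> nN nD]]] [N' [D' [-> nN' nD']]]; exists (N * N'), (D * D').
by rewrite !tofracM mulf_div !rmorphM !mulf_neq0.
Qed.

Lemma unitf_unitp q o p : unitf q o -> rprime p -> e o p = 0 -> unitp q p.
Proof.
move=> [N [D [-> nN nD]]] pp p0; exists N, D; split=> //; exact: not_rdvd_root p0 _.
Qed.

(** If the reduced numerator or denominator vanished at [o], so would one of its prime factors, and
    the fraction is no unit at that prime. *)
Lemma unitf_of_primes q o : q != 0 ->
  (forall p, rprime p -> e o p = 0 -> unitp q p) -> unitf q o.
Proof.
move=> /(fnumdenP uA)[N0 D0 E cop] H; exists (fnum uA q), (fden uA q); split=> //.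
  apply/eqP => /(root_prime N0)[r [pr d r0]]; have := H r pr r0; rewrite {1}E.
  by case/(unitp_coprime pr cop D0) => /(_ d).
apply/eqP => /(root_prime D0)[r [pr d r0]]; have := H r pr r0; rewrite {1}E.
by case/(unitp_coprime pr cop D0) => _ /(_ d).
Qed.

Definition fev q o : L := e o (fnum uA q) / e o (fden uA q).

Lemma unitf_fev q o : unitf q o -> e o (fnum uA q) != 0 /\ e o (fden uA q) != 0.
Proof.
move=> uq; have [N0 D0 E cop] := fnumdenP uA (unitf_neq0 uq).
have U r : rprime r -> e o r = 0 -> ~ rdvd r (fnum uA q) /\ ~ rdvd r (fden uA q).
  move=> pr r0; apply: (unitp_coprime pr cop D0); rewrite -E; exact: unitf_unitp uq pr r0.
by split; apply/eqP => /root_prime[//|r [pr d r0]]; have [H1 H2] := U r pr r0.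
Qed.

Lemma fevE q o N D : unitf q o -> q = N%:F / D%:F -> e o D != 0 -> fev q o = e o N / e o D.
Proof.
move=> uq E nD; have [N0 D0 E' _] := fnumdenP uA (unitf_neq0 uq); have [N1 D1] := unitf_fev uq.
have := frac_eqP D0 (meval_neq0 nD) (etrans (esym E') E).
by move/(congr1 (e o)); rewrite !rmorphM => Em; apply/eqP; rewrite eqr_div // Em.
Qed.

Lemma fevM q q' o : unitf q o -> unitf q' o -> fev (q * q') o = fev q o * fev q' o.
Proof.
move=> uq uq'; have [N0 D0 E _] := fnumdenP uA (unitf_neq0 uq); have [N1 D1] := unitf_fev uq.
have [N0' D0' E' _] := fnumdenP uA (unitf_neq0 uq'); have [N1' D1'] := unitf_fev uq'.
rewrite (fevE (N := fnum uA q * fnum uA q') (D := fden uA q * fden uA q') (unitfM uq uq')).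
- by rewrite !rmorphM mulf_div.
- by rewrite !tofracM {1}E {1}E' mulf_div.
- by rewrite (rmorphM (e o)); apply: (mulf_neq0 D1 D1').
Qed.

Variable O : pt -> Prop.
(** [O] meets every prime divisor in a dense subset: its complement contains no hypersurface. *)
Definition codim2 := forall p g, rprime p -> ~ rdvd p g ->
  exists o, [/\ O o, e o p = 0 & e o g != 0].
Hypothesis Oc2 : codim2.

(** Line bundles on [O] are trivial: [q o] is a rational generator on the locus [G o != 0], and [R]
    is a global one. At primes not dividing [G o0] the generator [q o0] already serves; [R] corrects
    it at the finitely many primes that do. *)
Lemma picard_open (q : pt -> {fraction A}) (G : pt -> A) o0 :
  O o0 -> (forall o, q o != 0) -> (forall o, O o -> e o (G o) != 0) ->
  (forall o1 o2 o, O o1 -> O o2 -> O o -> e o (G o1) != 0 -> e o (G o2) != 0 ->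
     unitf (q o2 / q o1) o) ->
  exists2 R : {fraction A}, R != 0 & forall o, O o -> unitf (q o / R) o.
Proof.
move=> O0 q0 G0 H; have Gn := meval_neq0 (G0 o0 O0).
pose good p R := forall o, O o -> e o p = 0 -> unitp (q o / R) p.
suff [R R0 RH] : exists2 R, R != 0 & forall p, rprime p -> good p R.
  exists R => // o Oo; apply: unitf_of_primes; first by rewrite mulf_neq0 ?invr_eq0.
  by move=> p pp p0; apply: RH.
(* Codimension two gives a point of [O] on the divisor of [p] where both generators are valid, so
   their ratio is a unit at [p]. *)
have cmp p o1 o2 : O o1 -> O o2 -> rprime p -> e o2 p = 0 -> ~ rdvd p (G o1) -> unitp (q o2 / q o1) p.
  move=> O1 O2 pp p2 nd.
  have [o [Oo po]] := Oc2 pp (not_rdvdM pp nd (not_rdvd_root p2 (G0 o2 O2))).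
  rewrite rmorphM mulf_nz => /andP[g1 g2]; exact: unitf_unitp (H o1 o2 o O1 O2 Oo g1 g2) pp po.
have [u [s [uu ps Es]]] := uA Gn.
suff [R [R0 Rs RH]] : exists R, [/\ R != 0, forall p, rprime p -> (forall r, r \in s -> ~ rdvd p r) -> unitp R p
    & forall p, rprime p -> forall r, r \in s -> rdvd p r -> good p (R * q o0)].
  exists (R * q o0); first by rewrite mulf_neq0.
  move=> p pp; have [[r rs d]|nd] := pselect (exists2 r, r \in s & rdvd p r); first exact: RH pp r rs d.
  move=> o Oo po; have nG : ~ rdvd p (G o0).
    rewrite Es; case: (pp) => _ _ h /h[/(rprime_unit pp uu)//|/(rprime_prod pp)[r rs d]].
    by apply: nd; exists r.
  rewrite [R * _]mulrC invfM mulrA; apply: unitpM => //; first exact: cmp.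
  by apply/unitpV/Rs => // r rs d; apply: nd; exists r.
elim: s ps {Es} => [|r s IH].
  exists 1; split=> //; first exact: oner_neq0.
  move=> p pp _; exists 1, 1; have [_ p1 _] := pp; split=> //; by rewrite divff // tofrac1 oner_neq0.
case/primes_list_cons=> pr ps; have [R [R0 Rs RH]] := IH ps.
have [[[o1 O1 r1]|no] nr] : ((exists2 o1, O o1 & e o1 r = 0) \/ ~ (exists2 o1, O o1 & e o1 r = 0)) /\ True.
- by split=> //; case: (pselect (exists2 o1, O o1 & e o1 r = 0)); [left|right].
(* The exponent of [r] is read off at a point [o1] of [O] on its divisor, unless a prime associated
   with [r] has been treated already. *)
- have [z uz] := unitp_val uA pr (mulf_neq0 (q0 o1) (invr_neq0 (mulf_neq0 R0 (q0 o0)))).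
  have [[r' r's d]|nd] := pselect (exists2 r', r' \in s & rdvd r r').
    exists R; split=> //.
      by move=> p pp h; apply: Rs => // x xs; apply: h; rewrite inE xs orbT.
    move=> p pp x; rewrite inE => /orP[/eqP->|xs] dx; last exact: RH dx.
    have [v vv Er] := rprime_assoc pp pr dx; apply: (RH p pp r' r's).
    by have [c ->] := d; rewrite Er; exists (c * v); rewrite mulrA.
  exists (R * r%:F ^ z); split.
  + by rewrite mulf_neq0 // expfz_neq0 // tofrac_eq0; case: pr.
  + move=> p pp h; apply: unitpM => //; first by apply: Rs => // x xs; apply: h; rewrite inE xs orbT.
    by apply: unitpXz => //; apply: unitp_prime => //; apply: h; rewrite inE eqxx.
  move=> p pp x; have F (a b c d : {fraction A}) : a / (b * c * d) = a / (b * d) / c by rewrite !invfM; ring.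
  rewrite inE => /orP[/eqP->|xs] dx o Oo po; rewrite F.
    have [v vv Er] := rprime_assoc pp pr dx.
    have v0 : e o v != 0 /\ e o1 v != 0.
      by have U w := rmorph_unit (e w) vv; rewrite -!unitfE; split; apply: U.
    have p1 : e o1 p = 0.
      by move/eqP: r1; rewrite Er rmorphM mulf_eq0 (negbTE v0.2) => /eqP.
    have uz' : unitp (q o1 / (R * q o0) / r%:F ^ z) p.
      have [N [D [E nN nD]]] := uz; exists N, D; rewrite E; split=> // -[c Ec].
        by apply: nN; rewrite Ec Er; exists (c * v^-1); rewrite mulrA mulrVK.
      by apply: nD; rewrite Ec Er; exists (c * v^-1); rewrite mulrA mulrVK.
    have -> : q o / (R * q o0) / r%:F ^ z = q o / q o1 * (q o1 / (R * q o0) / r%:F ^ z).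
      by rewrite !mulrA divfK.
    apply: unitpM => //; apply: cmp => //; exact: not_rdvd_root p1 (G0 o1 O1).
  apply: unitpM => //; first exact: RH dx o Oo po.
  apply/unitpV/unitpXz => //; apply: unitp_prime => // d; apply: nd; exists x => //.
  have [v vv Er] := rprime_assoc pp pr d; have [c ->] := dx; rewrite Er; exists (c * v^-1).
  by rewrite mulrA mulrVK.
(* A prime without zeros in [O] imposes no condition. *)
exists R; split=> //.
  by move=> p pp h; apply: Rs => // x xs; apply: h; rewrite inE xs orbT.
move=> p pp x; rewrite inE => /orP[/eqP->|xs] dx; last exact: RH dx.
move=> o Oo po; case: no; exists o => //; have [c ->] := dx; by rewrite rmorphM po mulr0.
Qed.

End PolyFractions.

Section PolyEq.
Variables (L : closedFieldType) (n : nat).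
Lemma mpoly_eq_on (p1 p2 g : {mpoly L[n]}) : g != 0 -> (forall o : 'rV[L]_n, g.@[o 0] != 0 -> p1.@[o 0] = p2.@[o 0]) -> p1 = p2.
Proof.
move=> g0 H; apply/eqP; rewrite -subr_eq0; apply/eqP.
have [//|d0] := eqVneq (p1 - p2) 0.
have [o] := nonroot_row (mulf_neq0 g0 d0); rewrite mevalM mulf_nz => /andP[/H Eo]; rewrite mevalB Eo subrr eqxx //.
Qed.

End PolyEq.

(** * Functions that are rational etale-locally *)

Section Etale.
Variables (L : closedFieldType) (n : nat).
Local Notation A := {mpoly L[n]}.
Local Notation B := {poly {mpoly L[n]}}.
Local Notation pt := 'rV[L]_n.
Implicit Types (o : pt) (y : L).

Definition pev o : {rmorphism A -> L} := meval (o 0).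
Definition bev (z : pt * L) : {rmorphism B -> L} := horner_eval z.2 \o map_poly (pev z.1).

Arguments bev : simpl never.

Lemma bevC o y (c : A) : bev (o, y) c%:P = c.@[o 0].
Proof. by rewrite /bev /= map_polyC /horner_eval hornerC. Qed.

Lemma bevM z p q : bev z (p * q) = bev z p * bev z q. Proof. exact: rmorphM. Qed.
Lemma bevD z p q : bev z (p + q) = bev z p + bev z q. Proof. exact: rmorphD. Qed.
Lemma bevB z p q : bev z (p - q) = bev z p - bev z q. Proof. exact: rmorphB. Qed.
Lemma bev0 z : bev z 0 = 0. Proof. exact: rmorph0. Qed.
Lemma bevX z p k : bev z (p ^+ k) = bev z p ^+ k. Proof. exact: rmorphXn. Qed.
Lemma bevE o y p : bev (o, y) p = (map_poly (pev o) p).[y]. Proof. by []. Qed.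

Lemma bprime_point (p g : B) : rprime p -> ~ rdvd p g ->
  exists o y, bev (o, y) p = 0 /\ bev (o, y) g != 0.
Proof.
move=> pp ng; have [f [h [fK hK fE]]] := mpoly_iso L n.
have [|o op og] := prime_point (rprime_iso hK fK pp) (g := h g).
  by case=> c E; apply: ng; exists (f c); rewrite -[g]hK E rmorphM /= hK.
pose v i := o 0 (widen_ord (leqnSn n) i).
have Ev : o 0 = snocv v (o 0 ord_max).
  apply: functional_extensionality_dep => i; rewrite /snocv; case: insubP => [j _ E|].
    by congr (o 0 _); apply: val_inj; rewrite /= E.
  by rewrite -leqNgt => ni; congr (o 0 _); apply/val_inj/eqP; rewrite eqn_leq ni -ltnS ltn_ord.
have E (q : B) : (h q).@[o 0] = bev (\row_i v i, o 0 ord_max) q.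
  by rewrite {1}Ev fE hK bevE; congr (_.[_]); apply: eq_map_poly => a; rewrite /pev /= meval_row.
by exists (\row_i v i), (o 0 ord_max); rewrite -!E.
Qed.

Lemma bev_size (p : B) z : bev z p^`() != 0 -> (1 < size p)%N.
Proof.
apply: contraNT; rewrite -leqNgt => s1.
have -> : p^`() = 0 by rewrite [p]size1_polyC // derivC.
by rewrite rmorph0.
Qed.

(** A function of [o] alone that equals [g / h] at all admissible roots [y] of [p] is rational. With
    a denominator from [bezout_const], [g / h] is reduced modulo [p] to a remainder of smaller
    degree than [p]; for fixed [o] it takes the same value at all the distinct roots, so it is
    constant in [y], and its constant coefficient gives the fraction. *)
Lemma etale_rational (p r g h : B) z : rprime p -> bev z p = 0 -> bev z (p^`() * r * h) != 0 ->
  exists N D : A, D != 0 /\ forall o, D.@[o 0] != 0 ->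
    (exists2 y, bev (o, y) p = 0 & bev (o, y) (p^`() * r * h) != 0) /\
    (forall c, (forall y, bev (o, y) p = 0 -> bev (o, y) (p^`() * r * h) != 0 ->
       c * bev (o, y) h = bev (o, y) g) -> c = N.@[o 0] / D.@[o 0]).
Proof.
move=> pp p0 r0; have nd (q : B) : bev z q != 0 -> ~ rdvd p q.
  by move=> /eqP q0 [c E]; apply: q0; rewrite E bevM p0 mulr0.
have s1 : (1 < size p)%N.
  by apply: (@bev_size _ z); apply: contraNneq r0 => e; rewrite !bevM e !mul0r.
have [U1 [V1 [d1 [d10 E1]]]] := bezout_const pp s1 (nd _ r0).
have [|U3 [V3 [d3 [d30 E3]]]] := bezout_const pp s1 (r := h).
  by apply: nd; apply: contraNneq r0 => e; rewrite bevM e mulr0.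
have pn : p != 0 by case: pp.
pose k := scalp (V3 * g) p; pose s := (V3 * g) %% p.
have Es := Pdiv.Idomain.divp_eq (V3 * g) p; rewrite -/k -/s in Es.
have ss : (size s < size p)%N by rewrite ltn_modp.
have l0 : lead_coef p != 0 by rewrite lead_coef_eq0.
(* The common factors [lead_coef p] and [d1] leave the value unchanged; they confine [D != 0] to the
   locus where [p] keeps its degree and every root is simple and off [r] and [h]. *)
exists (s`_0 * (lead_coef p * d1)), (lead_coef p ^+ k * d3 * (lead_coef p * d1)).
split; first by rewrite !mulf_neq0 ?expf_neq0.
move=> o; rewrite !mevalM (rmorphXn (meval (o 0))) !mulf_eq0 !negb_or => /andP[/andP[nlk n3] /andP[nl n1]].
pose m (q : B) := map_poly (pev o) q.
have mE q y : bev (o, y) q = (m q).[y] by [].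
have sm : size (m p) = size p by apply: size_map_poly_id0.
have root_r y : bev (o, y) p = 0 -> bev (o, y) (p^`() * r * h) != 0.
  move=> py; have := congr1 (bev (o, y)) E1; rewrite bevC bevD [bev _ (U1 * p)]bevM py mulr0 add0r bevM => e.
  by apply: contraNneq n1 => r1; rewrite e r1 mulr0.
split.
  have /closed_rootP[y /rootP py] : size (m p) != 1%N by rewrite sm; case: (size p) s1 => [|[]].
  by exists y; [exact: py|apply: root_r; exact: py].
move=> c Hc.
have [rs Ers] := closed_field_poly_normal (m p).
have lm : lead_coef (m p) != 0 by rewrite lead_coef_eq0 -size_poly_gt0 sm (leq_trans _ s1).
have uniq_rs : uniq rs.
  rewrite -separable_prod_XsubC; have -> : \prod_(x <- rs) ('X - x%:P) = (lead_coef (m p))^-1 *: m p.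
    by rewrite {2}Ers scalerA mulVf // scale1r.
  rewrite unlock derivZ coprimepZl ?invr_eq0 // coprimepZr ?invr_eq0 //.
  apply: Pdiv.ClosedField.root_coprimep => y /rootP py; have := root_r y py.
  by rewrite !bevM !mulf_eq0 !negb_or => /andP[/andP[+ _] _]; rewrite bevE /m deriv_map.
have srs : size rs = (size p).-1.
  have : size (m p) = (size rs).+1 by rewrite Ers size_scale // size_prod_XsubC.
  by rewrite sm => ->.
pose t := m s - (c * ((lead_coef p).@[o 0] ^+ k * d3.@[o 0]))%:P.
have t0 : t = 0.
  apply/eqP; apply: contraLR (ltnSn (size rs)) => tn; rewrite -leqNgt.
  have rt : all (root t) rs.
    apply/allP => y yrs; have py : bev (o, y) p = 0.
      by rewrite bevE -/(m p) Ers hornerZ; apply/eqP; rewrite mulf_eq0 -rootE root_prod_XsubC yrs orbT.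
    have hg := Hc y py (root_r y py).
    have := congr1 (bev (o, y)) E3; rewrite bevC bevD !bevM py mulr0 add0r => e3.
    have := congr1 (bev (o, y)) Es; rewrite -mul_polyC bevD !bevM py mulr0 add0r bevC (rmorphXn (meval (o 0))) -hg => es.
    rewrite rootE /t hornerD hornerN hornerC subr_eq0 -bevE -es e3; apply/eqP.
    by move: (bev _ h) (bev _ V3) (_ ^+ k) => a1 a2 a3; ring.
  have := max_poly_roots tn rt uniq_rs.
  have : (size t <= size rs)%N.
    rewrite srs; apply: leq_trans (size_polyD _ _) _; rewrite geq_max size_polyN size_polyC.
    apply/andP; split; last by case: (size p) s1 => [|[|?]] //= _; apply: leq_trans (leq_b1 _) _.
    by apply: leq_trans (size_poly _ _) _; rewrite -ltnS prednK // (leq_trans _ s1).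
  by move=> h1 /leq_trans/(_ h1); rewrite ltnn.
have := congr1 (fun q : {poly L} => q`_0) t0; rewrite coefB coefC coef0 /= coef_map /= => /eqP.
rewrite subr_eq0 => /eqP; rewrite -[meval _ s`_0]/(s`_0).@[o 0] => Es0.
by rewrite Es0 -[c * _ * _]mulrA mulfK // (mulf_neq0 (mulf_neq0 nlk n3) (mulf_neq0 nl n1)).
Qed.

(** On a standard etale neighbourhood [p = 0] of [o1], the function is a fraction [g / h]. Taking
    [p] prime makes this neighbourhood accessible to divisibility arguments. *)
Definition etale_at (O : pt -> Prop) (u : pt -> L) o1 := exists (p r g h : B) y1,
  [/\ rprime p, bev (o1, y1) p = 0, bev (o1, y1) (p^`() * r * h) != 0
    & forall o y, O o -> bev (o, y) p = 0 -> bev (o, y) (p^`() * r * h) != 0 ->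
        u o * bev (o, y) h = bev (o, y) g].

(** Passage to a prime equation: one keeps the prime factor of [p] vanishing at the given point. Its
    cofactor, nonzero wherever the derivative of [p] is nonzero on this factor, is put into [r]. *)
Lemma etale_at_of (O : pt -> Prop) u o1 (p r g h : B) y1 : bev (o1, y1) p = 0 ->
  bev (o1, y1) p^`() != 0 -> bev (o1, y1) r != 0 -> bev (o1, y1) h != 0 ->
  (forall o y, O o -> bev (o, y) p = 0 -> bev (o, y) p^`() != 0 -> bev (o, y) r != 0 ->
     bev (o, y) h != 0 -> u o * bev (o, y) h = bev (o, y) g) -> etale_at O u o1.
Proof.
move=> p0 p1 r1 h1 H; have pn : p != 0.
  by apply: contraNneq p1 => ->; rewrite deriv0 rmorph0.
have [q [pq [s Es] q0]] := root_prime (e := bev) (ufd_poly (@ufd_mpoly L n)) pn p0.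
have D z : bev z q = 0 -> bev z p^`() = bev z (q^`() * s).
  by move=> qz; rewrite Es derivM bevD !bevM qz mulr0 add0r mulrC.
exists q, (s * r), g, h, y1; split=> //.
  by rewrite mulrA bevM bevM -(D _ q0) !mulf_neq0.
move=> o y Oo qz; rewrite mulrA bevM bevM -(D _ qz) !mulf_eq0 !negb_or => /andP[/andP[n1 n2] n3].
by apply: H => //; rewrite Es bevM qz mulr0.
Qed.

(** A generic identity extends to [o1]: if [N h - g D] were not a multiple of [p], the hypersurface
    [p = 0] would contain a point over the locus [E != 0] at which it is nonzero. *)
Lemma etale_cross (O : pt -> Prop) u o1 (N D E : A) : etale_at O u o1 -> O o1 -> E != 0 ->
  (forall o, E.@[o 0] != 0 -> O o /\ u o * D.@[o 0] = N.@[o 0]) ->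
  u o1 * D.@[o1 0] = N.@[o1 0].
Proof.
move=> [p [r [g [h [y1 [pp p0 r0 H]]]]]] O1 E0 HE.
have [] := pselect (rdvd p (N%:P * h - g * D%:P)); last first.
  move=> nd; have nr : ~ rdvd p (p^`() * r * h * E%:P).
    apply: not_rdvdM => //.
      by move=> [c Ec]; move: r0; rewrite Ec bevM p0 mulr0 eqxx.
    move=> [c Ec]; have s1 : (1 < size p)%N.
      by apply: (@bev_size _ (o1, y1)); apply: contraNneq r0 => e; rewrite !bevM e !mul0r.
    by case: (rdvd_size1 s1 E0); exists c.
  have [o [y [py]]] := bprime_point pp (not_rdvdM pp nd nr).
  rewrite bevM mulf_nz => /andP[/eqP n1]; rewrite bevM mulf_eq0 negb_or bevC => /andP[n2 nE].
  have [Oo Eu] := HE o nE; case: n1.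
  by rewrite bevB !bevM !bevC -(H o y) // -Eu; ring.
case=> c /(congr1 (bev (o1, y1))); rewrite bevB !bevM p0 mulr0 !bevC -(H o1 y1) // => /eqP.
rewrite subr_eq0 => /eqP e.
have h0 : bev (o1, y1) h != 0 by apply: contraNneq r0 => e'; rewrite bevM e' mulr0.
by apply: (mulIf h0); rewrite e; ring.
Qed.

Variable O : pt -> Prop.
Hypothesis Oc2 : codim2 pev O.
Variable E0 : A.
Hypotheses (E00 : E0 != 0) (OE : forall o, E0.@[o 0] != 0 -> O o).

Lemma open_point (g : A) : g != 0 -> exists o, O o /\ g.@[o 0] != 0.
Proof.
move=> g0; have [o] := nonroot_row (mulf_neq0 E00 g0).
by rewrite mevalM mulf_nz => /andP[/OE ? ?]; exists o.
Qed.

(** Extension across codimension two: a prime in the reduced denominator would have a zero in [O] at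
    which the numerator does not vanish. *)
Lemma etale_poly (u : pt -> L) : (forall o, O o -> etale_at O u o) ->
  exists N : A, forall o, O o -> u o = N.@[o 0].
Proof.
move=> H; have [o1 [O1 _]] := open_point (oner_neq0 A).
have [p [r [g [h [y1 [pp p0 r0 Hu]]]]]] := H o1 O1.
have [N [D [D0 HND]]] := etale_rational g pp p0 r0.
have HE o : (E0 * D).@[o 0] != 0 -> [/\ O o, D.@[o 0] != 0 & u o * D.@[o 0] = N.@[o 0]].
  rewrite mevalM mulf_nz => /andP[/OE Oo nD]; split=> //.
  by have [_ /(_ (u o))-> ] := HND o nD; [rewrite divfK|move=> y py ny; apply: Hu].
have ED : E0 * D != 0 by rewrite mulf_neq0.
have [N0|Nn] := eqVneq N 0.
  exists 0 => o Oo; have := etale_cross (H o Oo) Oo (N := 0) (D := 1) ED.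
  rewrite meval1 mulr1; apply=> o' /HE[Oo' nD e]; split=> //; rewrite meval1 mulr1 meval0.
  by move/eqP: e; rewrite N0 meval0 mulf_eq0 (negbTE nD) orbF => /eqP.
have [N' [D' [c [c0 EN ED' cop]]]] := coprime_part (@ufd_mpoly L n) Nn D0.
have HO o : O o -> u o * D'.@[o 0] = N'.@[o 0].
  move=> Oo; apply: (etale_cross (H o Oo) Oo ED) => o' /HE[Oo' nD e]; split=> //.
  have c1 : c.@[o' 0] != 0 by apply: contraNneq nD => e'; rewrite ED' mevalM e' mul0r.
  by apply: (mulfI c1); rewrite mulrCA -!mevalM -ED' -EN.
have D'0 : D' != 0 by apply: contraNneq D0 => e; rewrite ED' e mulr0.
have [v [s [uv ps Es]]] := @ufd_mpoly L n D' D'0.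
case: s ps Es => [|q s]; last first.
  case/primes_list_cons=> pq _; rewrite big_cons => Es.
  have dq : rdvd q D' by rewrite Es mulrCA; apply/rdvd_mulr/rdvd_refl.
  have [o [Oo qo no]] := Oc2 pq (fun d => cop q pq d dq).
  have [w Ew] := dq; move: no; rewrite -[(pev o) N'](HO o Oo) Ew mevalM.
  by rewrite -[q.@[_]]/(pev o q) qo !mulr0 eqxx.
rewrite big_nil mulr1 => _ Ev; exists (v^-1 * N') => o Oo.
rewrite mevalM -HO // Ev mulrCA -mevalM mulVr //; by rewrite meval1 mulr1.
Qed.

(** By [etale_poly] the function is a polynomial on [O], and any prime factor of it would vanish
    somewhere on [O]. *)
Lemma etale_const (u : pt -> L) : (forall o, O o -> etale_at O u o) -> (forall o, O o -> u o != 0) ->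
  exists2 c, c != 0 & forall o, O o -> u o = c.
Proof.
move=> /etale_poly[N HN] u0; have [o1 [O1 _]] := open_point (oner_neq0 A).
have Nn : N != 0 by apply: contraNneq (u0 o1 O1) => e; rewrite HN // e meval0.
have [v [s [uv ps Es]]] := @ufd_mpoly L n N Nn.
case: s ps Es => [|q s]; last first.
  case/primes_list_cons=> pq _; rewrite big_cons => Es.
  have [o [Oo qo no]] := Oc2 pq (let: And3 _ h _ := pq in h).
  by have := u0 o Oo; rewrite HN // Es !mevalM -[q.@[_]]/(pev o q) qo mul0r mulr0 eqxx.
rewrite big_nil mulr1 => _ Ev.
have [c Ec] : exists c, v = c%:MP.
  move: uv; rewrite unfold_in /= /mpoly_unit => /andP[/eqP e _]; by eexists; apply: e.
have E o : O o -> u o = c by move=> Oo; rewrite HN // Ev Ec mevalC.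
by exists c => //; rewrite -(E o1 O1) u0.
Qed.

End Etale.

(** * Primality of the variables and of the 2 x 2 minors *)

Section Primes.
Variables (L : closedFieldType) (n : nat).
Local Notation A := {mpoly L[n]}.
Implicit Types p q r : A.

Lemma mpolyC_unit (c : L) : c != 0 -> (c%:MP : A) \is a GRing.unit.
Proof. by move=> c0; apply: (rmorph_unit (@mpolyC n L)); rewrite unitfE. Qed.

Lemma msize_unit p : p != 0 -> (msize p <= 1)%N -> p \is a GRing.unit.
Proof.
move=> p0 /msize1_polyC E; rewrite E; apply: mpolyC_unit.
by apply: contraNneq p0 => e; rewrite E e.
Qed.

Lemma rprime_assoc_l p q u : u \is a GRing.unit -> p = u * q -> rprime q -> rprime p.
Proof.
move=> uu E [q0 q1 qq]; have D a : rdvd p a -> rdvd q a.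
  by case=> c ->; exists (c * u); rewrite E mulrA.
have D' a : rdvd q a -> rdvd p a.
  by case=> c ->; exists (c * u^-1); rewrite E mulrA mulrVK.
split; first by rewrite E mulf_neq0 //; apply: contraTneq uu => ->; rewrite unitr0.
  by move/D.
by move=> a b /D/qq[]/D'; [left|right].
Qed.

Lemma rprime_msize p : rprime p -> (1 < msize p)%N.
Proof.
by move=> pp; rewrite ltnNge; apply/negP => /msize_unit h; apply: (rprime_unit pp (h _) (rdvd_refl p)); case: pp.
Qed.

Lemma exists_prime_factor p : (1 < msize p)%N -> exists2 r, rprime r & rdvd r p.
Proof.
move=> sp; have p0 : p != 0 by rewrite -msize_poly_eq0 -lt0n (leq_trans _ sp).
have [u [[|r s] [uu ps Es]]] := @ufd_mpoly L n p p0.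
  move: sp; rewrite Es big_nil mulr1; move: uu; rewrite unfold_in /= /mpoly_unit => /andP[/eqP-> _].
  by rewrite ltnNge; case/negP; rewrite msizeC; case: (_ == _).
exists r; first by apply: ps; rewrite inE eqxx.
by rewrite Es big_cons mulrCA; apply/rdvd_mulr/rdvd_refl.
Qed.

Lemma rprime_X (i : 'I_n) : rprime ('X_i : A).
Proof.
have sX : msize ('X_i : A) = 2%N by rewrite msizeX mdeg1.
have [|r pr [c E]] := @exists_prime_factor 'X_i; first by rewrite sX.
have X0 : ('X_i : A) != 0 by rewrite -msize_poly_eq0 sX.
have c0 : c != 0 by apply: contraNneq X0 => e; rewrite E e mul0r.
apply: (rprime_assoc_l (u := c) _ E) => //; apply: msize_unit => //.
have := rprime_msize pr; have := msizeM c0 (let: And3 h _ _ := pr in h); rewrite -E sX.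
by move: (msize c) (msize r) => a b; lia.
Qed.

Lemma msize2_affine p : (msize p <= 2)%N -> p = (p@_0)%:MP + \sum_i p@_(U_(i)) *: 'X_i.
Proof.
move=> sp; apply/mpolyP => m; rewrite mcoeffD mcoeffC raddf_sum /=.
under eq_bigr => i _ do rewrite mcoeffZ mcoeffX.
have [->|m0] := eqVneq m 0%MM.
  rewrite mulr1 big1 ?addr0 // => i _; case: eqP => [E|]; last by rewrite mulr0.
  by have := congr1 (@mdeg n) E; rewrite mdeg1 mdeg0.
rewrite mulr0 add0r; have [/eqP/mdeg1P[i /eqP->]|d1] := eqVneq (mdeg m) 1%N.
  rewrite (bigD1 i) //= eqxx mulr1 big1 ?addr0 // => j ji; case: eqP => [E|]; last by rewrite mulr0.
  by have := congr1 (fun m : 'X_{1..n} => m j) E; rewrite !mnm1E eqxx eq_sym (negbTE ji).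
rewrite big1 => [|i _]; last first.
  by case: eqP => [E|]; [move: d1; rewrite -E mdeg1|rewrite mulr0].
apply: memN_msupp_eq0; apply: msize_mdeg_ge; apply: leq_trans sp _.
by move: d1 m0; rewrite -mdeg_eq0; case: (mdeg m) => [|[|]].
Qed.

Lemma affine_zero p (v : 'I_n -> L) : (msize p <= 2)%N -> (1 < msize p)%N ->
  exists i, p@_(U_(i)) != 0 /\ forall v : 'I_n -> L, exists x,
    p.@[fun j => if j == i then x else v j] = 0.
Proof.
move=> sp s1; have Ep := msize2_affine sp.
have [i ci] : exists i, p@_(U_(i)) != 0.
  apply: contrapT => H; move: s1; rewrite Ep big1 => [|i _]; last first.
    by rewrite (_ : p@_(U_(i)) = 0) ?scale0r //; apply/eqP/negP => /negP ci; apply: H; exists i.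
  by rewrite addr0 ltnNge msizeC; case: (_ == _).
exists i; split=> // w; set c := p@_(U_(i)) in ci.
pose s := p@_0 + \sum_(j | j != i) p@_(U_(j)) * w j; exists (- s / c).
rewrite Ep mevalD mevalC raddf_sum (bigD1 i) //= mevalZ mevalXU eqxx -/c.
under eq_bigr => j ji do rewrite mevalZ mevalXU (negbTE ji).
by rewrite addrCA -/s [c * _]mulrC divfK // addNr.
Qed.

(** A prime factor of degree one would vanish at points with all coordinates but one prescribed. At
    one of the test points [e1], [e2] the determinant is nonzero whatever the value of the
    exceptional coordinate, so a prime factor has degree two and its cofactor is constant. *)
Lemma rprime_det (i j k l : 'I_n) : uniq [:: i; j; k; l] ->
  rprime ('X_i * 'X_l - 'X_j * 'X_k : A).
Proof.
rewrite /= !inE !negb_or !andbT => /andP[/and3P[ij ik il] /andP[/andP[jk jl] kl]].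
have F : ((i == j = false) * (i == k = false) * (i == l = false) * (j == k = false) * (j == l = false) * (k == l = false) *
  ((j == i = false) * (k == i = false) * (l == i = false) * (k == j = false) * (l == j = false) * (l == k = false)))%type.
  by do !split; apply/negbTE => //; rewrite eq_sym.
set p := _ - _.
have pE v : p.@[v] = v i * v l - v j * v k by rewrite mevalB !mevalM !mevalXU.
have p0 : p != 0.
  apply/eqP => e; have := pE (fun m => ((m == i) || (m == l))%:R).
  by rewrite e meval0 !eqxx !F /= mul0r subr0 mulr1 => /esym/eqP; rewrite oner_eq0.
have sp : (msize p <= 3)%N.
  apply: leq_trans (msizeD_le _ _) _; rewrite geq_max msizeN -!mpolyXD !msizeX !mdegD !mdeg1 //.
have s1 : (1 < msize p)%N.
  rewrite ltnNge; apply/negP => /msize1_polyC e.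
  have := pE (fun m => ((m == i) || (m == l))%:R); have := pE (fun=> 0).
  rewrite e !mevalC => ->; rewrite !mul0r subr0.
  by rewrite !eqxx !F /= mul0r subr0 mulr1 => /eqP; rewrite eq_sym oner_eq0.
have [r pr [c E]] := exists_prime_factor s1.
have c0 : c != 0 by apply: contraNneq p0 => e; rewrite E e mul0r.
have s2 : (2 < msize r)%N.
  rewrite ltnNge; apply/negP => s2.
  have [m [_ Hm]] := affine_zero (fun=> 0) s2 (rprime_msize pr).
  have H v x : r.@[fun a => if a == m then x else v a] = 0 ->
     p.@[fun a => if a == m then x else v a] = 0 by move=> e; rewrite E mevalM e mulr0.
  pose e1 : 'I_n -> L := fun a => ((a == i) || (a == l))%:R.
  pose e2 : 'I_n -> L := fun a => ((a == j) || (a == k))%:R.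
  have [mi|mi] := eqVneq m i.
    have [x /H] := Hm e2; rewrite pE mi /e2 !F !eqxx /= mulr0 mulr1 sub0r => /eqP.
    by rewrite oppr_eq0 oner_eq0.
  have [ml|ml] := eqVneq m l.
    have [x /H] := Hm e2; rewrite pE ml /e2 !F !eqxx /= mul0r mulr1 sub0r => /eqP.
    by rewrite oppr_eq0 oner_eq0.
  have [mj|mj] := eqVneq m j.
    have [x /H] := Hm e1; rewrite pE mj /e1 !F !eqxx /= mulr0 mulr1 subr0 => /eqP.
    by rewrite oner_eq0.
  have [mk|mk] := eqVneq m k.
    have [x /H] := Hm e1; rewrite pE mk /e1 !F !eqxx /= mul0r mulr1 subr0 => /eqP.
    by rewrite oner_eq0.
  have [x /H] := Hm e1; rewrite pE ![_ == m]eq_sym !(negbTE mi, negbTE ml, negbTE mj, negbTE mk).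
  by rewrite /e1 !F !eqxx /= mul0r mulr1 subr0 => /eqP; rewrite oner_eq0.
apply: (rprime_assoc_l (u := c) _ E) => //; apply: msize_unit => //.
have := msizeM c0 (let: And3 h _ _ := pr in h); rewrite -E.
by move: sp s2; move: (msize c) (msize r) (msize p) => a b d; lia.
Qed.

Lemma mpoly_unitC p : p \is a GRing.unit -> exists c, c != 0 /\ p = c%:MP.
Proof.
rewrite unfold_in /= /mpoly_unit => /andP[/eqP e uc]; exists (p@_0); split=> //.
by rewrite -unitfE.
Qed.

End Primes.

(** * The map by monomials in the Pluecker coordinates *)

Section PluckerFrame.
Variable R : comNzRingType.
Variable x : nat -> R.

(** The minor of columns [a] and [b] of a 2 x 6 matrix: entries 0 to 5 of [x] are its first row,
    entries 6 to 11 its second. *)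
Definition pl a b := x a * x (6 + b)%N - x b * x (6 + a)%N.
Definition mm a b := pl a (3 + b).
(** The product of the [mm a b] with [a + b = i] modulo 3, and in [fY] with [b - a = j]: up to sign,
    the odd and the even terms in the determinant of the 3 x 3 matrix [mm]. *)
Definition fX i := nth 0 [:: mm 0 0 * mm 1 2 * mm 2 1; mm 0 1 * mm 1 0 * mm 2 2; mm 0 2 * mm 1 1 * mm 2 0] i.
Definition fY j := nth 0 [:: mm 0 0 * mm 1 1 * mm 2 2; mm 0 1 * mm 1 2 * mm 2 0; mm 0 2 * mm 1 0 * mm 2 1] j.
Definition pP a := nth 0 [:: pl 1 2; pl 2 0; pl 0 1] a.
Definition pQ b := nth 0 [:: pl 4 5; pl 5 3; pl 3 4] b.

(** The matrix [mm] has rank at most 2, so its determinant vanishes. *)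
Lemma frame_sum : fX 0 + fX 1 + fX 2 = fY 0 + fY 1 + fY 2.
Proof. by rewrite /fX /fY /mm /pl /=; ring. Qed.
Lemma frame_prod : fX 0 * fX 1 * fX 2 = fY 0 * fY 1 * fY 2.
Proof. by rewrite /fX /fY /=; ring. Qed.
(** The index [(b + 3 - a) %% 3] is [b - a] modulo 3. Each hyperplane where an X equals a Y cuts the
    cubic in three planes, which appear here as three minors. *)
Lemma frame_diff a b : (a < 3)%N -> (b < 3)%N ->
  fX ((a + b) %% 3) - fY ((b + 3 - a) %% 3) = - (mm a b * pP a * pQ b).
Proof.
by move: a b => [|[|[|]]] // [|[|[|]]] // _ _; rewrite /fX /fY /pP /pQ /mm /pl /=; ring.
Qed.

End PluckerFrame.

Section FrameGeometry.
Variable L : closedFieldType.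
Implicit Types (z : 'rV[L]_5) (o : 'rV[L]_12).

Definition Xc z i := nth 0 [:: c5 z 0; c5 z 1; c5 z 2 + c5 z 3 + c5 z 4 - c5 z 0 - c5 z 1] i.
Definition Yc z j := nth 0 [:: c5 z 2; c5 z 3; c5 z 4] j.
(** On the hyperplane where the sums agree, the differential of the cubic vanishes exactly when all
    products of two X and of two Y coincide; [qf] are the differences of these products. *)
Definition qf z i j :=
  Xc z ((i + 1) %% 3) * Xc z ((i + 2) %% 3) - Yc z ((j + 1) %% 3) * Yc z ((j + 2) %% 3).
Definition smooth z := segre_cubic z = 0 /\ exists i j, [/\ (i < 3)%N, (j < 3)%N & qf z i j != 0].

Definition co o (k : nat) : L := o 0 (inord k).
Definition mk12 (f : nat -> L) : 'rV[L]_12 := \row_k f k.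
Definition mk5 (f : nat -> L) : 'rV[L]_5 := \row_k f k.

Lemma co_mk f k : (k < 12)%N -> co (mk12 f) k = f k.
Proof. by move=> k12; rewrite /co mxE inordK. Qed.
Lemma c5_mk f k : (k < 5)%N -> c5 (mk5 f) k = f k.
Proof. by move=> k5; rewrite /c5 mxE inordK. Qed.
Lemma eq12 o o' : (forall k, (k < 12)%N -> co o k = co o' k) -> o = o'.
Proof. by move=> H; apply/rowP => i; rewrite -[i]inord_val; apply: H. Qed.
Lemma eq5 z z' : c5 z 0 = c5 z' 0 -> c5 z 1 = c5 z' 1 -> c5 z 2 = c5 z' 2 ->
  c5 z 3 = c5 z' 3 -> c5 z 4 = c5 z' 4 -> z = z'.
Proof.
move=> H0 H1 H2 H3 H4; apply/rowP => i; rewrite -[i]inord_val.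
by case: i => -[|[|[|[|[|]]]]].
Qed.

Definition tht o : 'rV[L]_5 := mk5 (nth 0 [:: fX (co o) 0; fX (co o) 1; fY (co o) 0; fY (co o) 1; fY (co o) 2]).

Lemma Xc_tht o i : (i < 3)%N -> Xc (tht o) i = fX (co o) i.
Proof.
rewrite /Xc /tht !c5_mk //; move: i => [|[|[|]]] // _.
by rewrite [LHS]/= -(frame_sum (co o)); ring.
Qed.
Lemma Yc_tht o j : (j < 3)%N -> Yc (tht o) j = fY (co o) j.
Proof. by rewrite /Yc /tht !c5_mk //; move: j => [|[|[|]]]. Qed.

Lemma segreE z : segre_cubic z = Xc z 0 * Xc z 1 * Xc z 2 - Yc z 0 * Yc z 1 * Yc z 2.
Proof. by rewrite /segre_cubic /Xc /Yc /=; ring. Qed.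

Lemma segre_tht o : segre_cubic (tht o) = 0.
Proof. by rewrite segreE !Xc_tht // !Yc_tht // frame_prod subrr. Qed.

Lemma c5Z c z k : c5 (c *: z) k = c * c5 z k. Proof. by rewrite /c5 mxE. Qed.
Lemma XcZ c z i : Xc (c *: z) i = c * Xc z i.
Proof. by rewrite /Xc !c5Z; case: i => [|[|[|i]]] /=; rewrite ?nth_nil; ring. Qed.
Lemma YcZ c z i : Yc (c *: z) i = c * Yc z i.
Proof. by rewrite /Yc !c5Z; case: i => [|[|[|i]]] /=; rewrite ?nth_nil; ring. Qed.
Lemma qfZ c z i j : qf (c *: z) i j = c ^+ 2 * qf z i j.
Proof. by rewrite /qf !XcZ !YcZ; ring. Qed.
Lemma segreZ c z : segre_cubic (c *: z) = c ^+ 3 * segre_cubic z.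
Proof. by rewrite !segreE !XcZ !YcZ; ring. Qed.
Lemma smoothZ c z : c != 0 -> smooth z -> smooth (c *: z).
Proof.
move=> c0 [s [i [j [i3 j3 q]]]]; split; first by rewrite segreZ s mulr0.
by exists i, j; split=> //; rewrite qfZ mulf_neq0 ?expf_neq0.
Qed.
Lemma smooth_neq0 z : smooth z -> z != 0.
Proof.
move=> [_ [i [j [_ _ q]]]]; apply: contraNneq q => ->.
by rewrite -(scale0r (0 : 'rV[L]_5)) qfZ expr0n mul0r.
Qed.

Definition Oo o := smooth (tht o).

(** The torus scaling the six columns and, below, [GL_2] acting on the rows; both change [tht] by a
    scalar only. *)
Definition sc (l : nat -> L) o := mk12 (fun k => l (k %% 6)%N * co o k).
Definition gl (a b c d : L) o := mk12 (fun k =>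
  if (k < 6)%N then a * co o k + b * co o (6 + k) else c * co o (k - 6) + d * co o k).

Lemma pl_sc l o a b : (a < 6)%N -> (b < 6)%N -> pl (co (sc l o)) a b = l a * l b * pl (co o) a b.
Proof.
by move: a b => [|[|[|[|[|[|]]]]]] // [|[|[|[|[|[|]]]]]] // _ _; rewrite /pl !co_mk //=; ring.
Qed.
Lemma pl_gl a b c d o i j : (i < 6)%N -> (j < 6)%N ->
  pl (co (gl a b c d o)) i j = (a * d - b * c) * pl (co o) i j.
Proof.
by move: i j => [|[|[|[|[|[|]]]]]] // [|[|[|[|[|[|]]]]]] // _ _; rewrite /pl !co_mk //=; ring.
Qed.

Definition prod6 (l : nat -> L) := l 0%N * l 1%N * l 2%N * l 3%N * l 4%N * l 5%N.

Lemma tht_pl o : tht o = mk5 (nth 0 [:: pl (co o) 0 3 * pl (co o) 1 5 * pl (co o) 2 4;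
  pl (co o) 0 4 * pl (co o) 1 3 * pl (co o) 2 5; pl (co o) 0 3 * pl (co o) 1 4 * pl (co o) 2 5;
  pl (co o) 0 4 * pl (co o) 1 5 * pl (co o) 2 3; pl (co o) 0 5 * pl (co o) 1 3 * pl (co o) 2 4]).
Proof. by []. Qed.

Lemma tht_sc l o : tht (sc l o) = prod6 l *: tht o.
Proof.
by rewrite !tht_pl !pl_sc //; apply: eq5; rewrite c5Z !c5_mk //= /prod6; ring.
Qed.
Lemma tht_gl a b c d o : tht (gl a b c d o) = (a * d - b * c) ^+ 3 *: tht o.
Proof.
by rewrite !tht_pl !pl_gl //; apply: eq5; rewrite c5Z !c5_mk //=; ring.
Qed.

Lemma Oo_sc l o : (forall a, (a < 6)%N -> l a != 0) -> Oo o -> Oo (sc l o).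
Proof. by move=> l0 Ho; rewrite /Oo tht_sc; apply: smoothZ => //; rewrite /prod6 !mulf_neq0 ?l0. Qed.
Lemma Oo_gl a b c d o : a * d - b * c != 0 -> Oo o -> Oo (gl a b c d o).
Proof. by move=> l0 Ho; rewrite /Oo tht_gl; apply: smoothZ => //; rewrite expf_neq0. Qed.

Definition Mz z a b := Xc z ((a + b) %% 3) - Yc z ((b + 3 - a) %% 3).
(** The difference of the second elementary symmetric functions of the Y and of the X. *)
Definition kap z := Yc z 0 * Yc z 1 + Yc z 0 * Yc z 2 + Yc z 1 * Yc z 2 -
  (Xc z 0 * Xc z 1 + Xc z 0 * Xc z 2 + Xc z 1 * Xc z 2).
(** Normal form of a matrix over [z]: columns 0, 1, 2 are [(1,0)], [(0,1)], [(-1,-1)], so that the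
    minors [pP] are 1, and the other columns are chosen to give the minors [mm] the values [Mz]. *)
Definition sig z := mk12 (nth 0 [:: 1; 0; -1; - Mz z 1 0; - Mz z 1 1; - Mz z 1 2;
  0; 1; -1; Mz z 0 0; Mz z 0 1; Mz z 0 2]).

Lemma tht_sig z : segre_cubic z = 0 -> tht (sig z) = kap z *: z.
Proof.
rewrite segreE => s0; have add0 (x y : L) s : s = 0 -> x = y + s \/ x = y - s -> x = y.
  by move=> ->; rewrite subr0 addr0 => -[].
apply: eq5; rewrite c5Z c5_mk // [LHS]/= /fX /fY /mm /pl !co_mk // /= /Mz /kap /=;
  apply: (add0 _ _ _ s0); rewrite /Xc /Yc /=; move: (c5 z) => y;
  by [left; ring|right; ring].
Qed.

(** Generically a fibre of [tht], up to scalars, is one orbit: the factors [l] make the minors of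
    the first three columns equal, and the row operation then produces the normal form. *)
Lemma sig_orbit o : (forall a, (a < 3)%N -> pP (co o) a != 0) -> (forall a, (a < 3)%N -> pQ (co o) a != 0) ->
  exists l a b c d, [/\ forall i, (i < 6)%N -> l i != 0, a * d - b * c != 0
    & sig (tht o) = gl a b c d (sc l o)].
Proof.
move=> P0 Q0; set x := co o; set pi := pP x 0 * pP x 1 * pP x 2.
have pi0 : pi != 0 by rewrite /pi !mulf_neq0 // P0.
exists (nth 1 [:: pP x 0; pP x 1; pP x 2; - pi * pQ x 0; - pi * pQ x 1; - pi * pQ x 2]).
exists (pP x 1 * x 7 / pi), (- pP x 1 * x 1 / pi), (- pP x 0 * x 6 / pi), (pP x 0 * x 0 / pi).
split.
- by move: (P0) (Q0) => P Q; case=> [|[|[|[|[|[|]]]]]] //= _; rewrite ?mulf_neq0 ?oppr_eq0 ?P ?Q.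
- have -> : pP x 1 * x 7 / pi * (pP x 0 * x 0 / pi) - - pP x 1 * x 1 / pi * (- pP x 0 * x 6 / pi) = pi^-1.
    have -> : pP x 1 * x 7 / pi * (pP x 0 * x 0 / pi) - - pP x 1 * x 1 / pi * (- pP x 0 * x 6 / pi) =
      (pP x 0 * pP x 1 * pl x 0 1) / pi / pi by rewrite /pl; field.
    by rewrite -[pP x 0 * pP x 1 * pl x 0 1]/pi mulfV // mul1r.
  by rewrite invr_eq0.
have M0 b : (b < 3)%N -> Mz (tht o) 0 b = - (mm x 0 b * pP x 0 * pQ x b).
  by move=> b3; rewrite /Mz Xc_tht ?ltn_mod // Yc_tht ?ltn_mod // frame_diff.
have M1 b : (b < 3)%N -> Mz (tht o) 1 b = - (mm x 1 b * pP x 1 * pQ x b).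
  by move=> b3; rewrite /Mz Xc_tht ?ltn_mod // Yc_tht ?ltn_mod // frame_diff.
have n0 : x 1%N * x 8 - x 2 * x 7 != 0 := P0 0%N isT.
have n1 : x 2 * x 6 - x 0%N * x 8 != 0 := P0 1%N isT.
have n2 : x 0%N * x 7 - x 1%N * x 6 != 0 := P0 2 isT.
rewrite /sig !M0 // !M1 //; apply: eq12 => k k12; rewrite co_mk // [RHS]co_mk //.
move: k k12; do 12!(case; first by move=> _; rewrite /= ?co_mk //= -/x /pi /pP /pQ /mm /pl /=; field; rewrite n0 n1 n2).
by [].
Qed.

(** X and Y have the same three elementary symmetric functions, hence agree up to a permutation. *)
Lemma perm_of_kap z : segre_cubic z = 0 -> kap z = 0 ->
  [\/ [/\ Xc z 0 = Yc z 0, Xc z 1 = Yc z 1 & Xc z 2 = Yc z 2],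
      [/\ Xc z 0 = Yc z 0, Xc z 1 = Yc z 2 & Xc z 2 = Yc z 1],
      [/\ Xc z 0 = Yc z 1, Xc z 1 = Yc z 0 & Xc z 2 = Yc z 2]
    | [\/ [/\ Xc z 0 = Yc z 1, Xc z 1 = Yc z 2 & Xc z 2 = Yc z 0],
          [/\ Xc z 0 = Yc z 2, Xc z 1 = Yc z 1 & Xc z 2 = Yc z 0]
        | [/\ Xc z 0 = Yc z 2, Xc z 1 = Yc z 0 & Xc z 2 = Yc z 1]]].
Proof.
rewrite segreE /kap; have: Xc z 0 + Xc z 1 + Xc z 2 = Yc z 0 + Yc z 1 + Yc z 2 by rewrite /Xc /Yc /=; ring.
move: (Xc z 0) (Xc z 1) (Xc z 2) (Yc z 0) (Yc z 1) (Yc z 2) => a b c x y w E1 E3 E2.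
have split3 p q r s : p + q = r + s -> p * q = r * s -> p = r /\ q = s \/ p = s /\ q = r :> L.
  move=> e1 e2; have : (p - r) * (p - s) = 0.
    by rewrite (_ : _ * _ = p * (p + q - (r + s)) - (p * q - r * s)); [rewrite e1 e2 !subrr mulr0 subr0|ring].
  move/eqP; rewrite mulf_eq0 !subr_eq0 => /orP[]/eqP e; [left|right]; split=> //.
    by apply: (addrI p); rewrite e1 e.
  by apply: (addrI p); rewrite e1 e addrC.
have sub p q r s t : p + q + r = p + s + t -> q + r = s + t :> L by rewrite -!addrA => /addrI.
have sub2 p q r s t : p * s + p * t + s * t - (p * q + p * r + q * r) = 0 -> q + r = s + t -> q * r = s * t :> L.
  move=> e1 e2; apply/esym/eqP; rewrite -subr_eq0 -e1; apply/eqP.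
  by rewrite (_ : p * s + p * t + s * t - _ = s * t - q * r + p * (s + t - (q + r))); [rewrite e2 subrr mulr0 addr0|ring].
have : (a - x) * (a - y) * (a - w) = 0.
  rewrite (_ : _ * _ = a * a * (a + b + c - (x + y + w)) + a * (x * y + x * w + y * w - (a * b + a * c + b * c))
     + (a * b * c - x * y * w)); last by ring.
  by rewrite E1 E2 E3 subrr !mulr0 !addr0.
move/eqP; rewrite !mulf_eq0 !subr_eq0 => /orP[/orP[]|] /eqP Ea; subst a.
- have e1 := sub _ _ _ _ _ E1; have := split3 _ _ _ _ e1 (sub2 _ _ _ _ _ E2 e1).
  by case=> -[-> ->]; [constructor 1|constructor 2].
- have e1 : b + c = x + w by apply: (sub y); rewrite E1; ring.
  have e2 : b * c = x * w by apply: (sub2 y) e1; rewrite -[RHS]E2; ring.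
  by case: (split3 _ _ _ _ e1 e2) => -[-> ->]; [constructor 3|constructor 4; constructor 1].
have e1 : b + c = x + y by apply: (sub w); rewrite E1; ring.
have e2 : b * c = x * y by apply: (sub2 w) e1; rewrite -[RHS]E2; ring.
by case: (split3 _ _ _ _ e1 e2) => -[-> ->]; constructor 4; [constructor 3|constructor 2].
Qed.

Lemma tht_surj z : smooth z -> exists2 o, Oo o & tht o = z.
Proof.
move=> Sz; have [s0 _] := Sz.
have [o [c c0 E]] : exists o, exists2 c, c != 0 & tht o = c *: z.
  have [k0|k0] := eqVneq (kap z) 0; last by exists (sig z), (kap z) => //; apply: tht_sig.
  have fin l (o := mk12 (nth 0 l)) : [/\ c5 (tht o) 0 = Xc z 0, c5 (tht o) 1 = Xc z 1, c5 (tht o) 2 = Yc z 0,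
     c5 (tht o) 3 = Yc z 1 & c5 (tht o) 4 = Yc z 2] -> exists o, exists2 c, c != 0 & tht o = c *: z.
    move=> [h0 h1 h2 h3 h4]; exists o, 1; rewrite ?oner_neq0 // scale1r.
    by apply: eq5; rewrite ?h0 ?h1 ?h2 ?h3 ?h4.
  have calc l k : (k < 5)%N -> c5 (tht (mk12 (nth 0 l))) k =
    nth 0 [:: fX (nth 0 l) 0; fX (nth 0 l) 1; fY (nth 0 l) 0; fY (nth 0 l) 1; fY (nth 0 l) 2] k.
    by move=> k5; rewrite c5_mk // /fX /fY /mm /pl !co_mk.
  (* Where [kap] vanishes the section [sig] is useless: each of the six planes of the cubic given by
     a permutation has its own explicit matrix. *)
  have [| | |[]] := perm_of_kap s0 k0; move=> [e0 e1 e2];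
    [apply: (fin [:: 0; 1; 1; - Xc z 0; - Xc z 1; - Xc z 2; 1; 0; 0; -1; -1; -1])
    |apply: (fin [:: 1; 1; 1; -1; 0; 0; Xc z 0; Xc z 1; Xc z 2; 0; 1; 1])
    |apply: (fin [:: 1; 1; 1; 0; 0; -1; Xc z 2; Xc z 0; Xc z 1; 1; 1; 0])
    |apply: (fin [:: 1; 0; 1; - Xc z 1; - Xc z 2; - Xc z 0; 0; 1; 0; 1; 1; 1])
    |apply: (fin [:: 1; 1; 1; 0; -1; 0; Xc z 1; Xc z 2; Xc z 0; 1; 0; 1])
    |apply: (fin [:: 1; 1; 0; - Xc z 2; - Xc z 0; - Xc z 1; 0; 0; 1; 1; 1; 1])];
  by rewrite !calc // /fX /fY /mm /pl /= e0 e1 e2; split; ring.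
pose l k := if k == 0%N then c^-1 else 1.
have lz : tht (sc l o) = z by rewrite tht_sc E scalerA /prod6 /l /= !mulr1 mulVf // scale1r.
by exists (sc l o) => //; rewrite /Oo lz.
Qed.

End FrameGeometry.

Section PolyFun.
Variable L : closedFieldType.
Variable n : nat.
Implicit Types (f g : 'rV[L]_n -> L).

Definition pfun f := exists p : {mpoly L[n]}, forall o, f o = p.@[o 0].

Lemma pfunC c : pfun (fun=> c). Proof. by exists c%:MP => o; rewrite mevalC. Qed.
Lemma pfunX i : pfun (fun o => o 0 i). Proof. by exists 'X_i => o; rewrite mevalXU. Qed.
Lemma pfunD f g : pfun f -> pfun g -> pfun (fun o => f o + g o).
Proof. by move=> [p Hp] [q Hq]; exists (p + q) => o; rewrite mevalD Hp Hq. Qed.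
Lemma pfunM f g : pfun f -> pfun g -> pfun (fun o => f o * g o).
Proof. by move=> [p Hp] [q Hq]; exists (p * q) => o; rewrite mevalM Hp Hq. Qed.
Lemma pfunN f : pfun f -> pfun (fun o => - f o).
Proof. by move=> [p Hp]; exists (- p) => o; rewrite mevalN Hp. Qed.
Lemma pfunB f g : pfun f -> pfun g -> pfun (fun o => f o - g o).
Proof. by move=> Hf Hg; apply/pfunD/pfunN. Qed.
Lemma pfun_exp f k : pfun f -> pfun (fun o => f o ^+ k).
Proof. by move=> [p Hp]; exists (p ^+ k) => o; rewrite (rmorphXn (meval (o 0))) Hp. Qed.
Lemma pfun_prod I (s : seq I) (F : I -> 'rV[L]_n -> L) : (forall i, pfun (F i)) ->
  pfun (fun o => \prod_(i <- s) F i o).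
Proof.
move=> H; elim: s => [|i s [p Hp]]; first by exists 1 => o; rewrite big_nil meval1.
by have [q Hq] := H i; exists (q * p) => o; rewrite big_cons mevalM Hp Hq.
Qed.
Lemma pfun_eq f g : (forall o, f o = g o) -> pfun f -> pfun g.
Proof. by move=> E [p Hp]; exists p => o; rewrite -E. Qed.
Lemma pfun_comp m (N : {mpoly L[m]}) (f : 'I_m -> 'rV[L]_n -> L) : (forall k, pfun (f k)) ->
  pfun (fun o => N.@[fun k => f k o]).
Proof.
move=> Hf; elim/mpolyind: N => [|c d N _ _ IH].
  by exists 0 => o; rewrite !meval0.
have Hm : pfun (fun o => ('X_[d] : {mpoly L[m]}).@[fun k => f k o]).
  apply: (pfun_eq (f := fun o => \prod_(i <- enum 'I_m) f i o ^+ d i)).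
    by move=> o; rewrite mevalX big_enum.
  by apply: pfun_prod => i; apply: pfun_exp.
apply: pfun_eq (pfunD (pfunM (pfunC c) Hm) IH) => o; by rewrite mevalD mevalZ.
Qed.

Lemma pfun_nonroot f : (exists o, f o != 0) -> pfun f -> exists2 p : {mpoly L[n]}, p != 0 & forall o, f o = p.@[o 0].
Proof. by move=> [o fo] [p Hp]; exists p => //; apply: (pev_neq0 (o := o)); rewrite -Hp. Qed.

End PolyFun.

(** * The complement of [Oo] has codimension at least two *)

Section Codim2.
Variable L : closedFieldType.
Local Notation A := {mpoly L[12]}.
Implicit Type o : 'rV[L]_12.

Definition px (k : nat) : A := 'X_(inord k).

Lemma meval_pl o a b : (pl px a b).@[o 0] = pl (co o) a b.
Proof. by rewrite /pl mevalB !mevalM !mevalXU. Qed.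

Definition pairs := [seq ab <- allpairs pair (iota 0 6) (iota 0 6) | (ab.1 < ab.2)%N].

Lemma pairsP a b : (a, b) \in pairs = (a < b < 6)%N.
Proof.
have -> : (a, b) \in pairs = (a < b)%N && ((a, b) \in allpairs pair (iota 0 6) (iota 0 6)).
  by rewrite mem_filter.
case ab: (a < b)%N; rewrite ?andFb // !andTb; apply/allpairsP/idP => [[[x y]]|b6].
  by rewrite !mem_iota !add0n => -[_ /andP[_ h] [_ ->]].
by exists (a, b); rewrite !mem_iota !add0n !leq0n (ltn_trans ab b6).
Qed.
#[local] Opaque pairs.

Lemma rprime_pl a b : (a, b) \in pairs -> rprime (pl px a b).
Proof.
rewrite pairsP => /andP[ab b6]; have a6 := ltn_trans ab b6; rewrite /pl /px.
have E := @rprime_det L 12 (inord a) (inord b) (inord (6 + a)) (inord (6 + b)).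
rewrite (_ : 'X_(inord a) * _ - _ = 'X_(inord a) * 'X_(inord (6 + b)) - 'X_(inord b) * 'X_(inord (6 + a))) //.
apply: E; rewrite /= !inE !negb_or -!val_eqE /= !inordK; by move: ab b6 a6; lia.
Qed.

(** The matrix with [(1,0)] in column [c], [(0,1)] in column [d] and zeros elsewhere has only one
    nonzero minor. *)
Lemma pl_distinct a b c d : (a, b) \in pairs -> (c, d) \in pairs -> (a, b) != (c, d) ->
  exists o, pl (co o) a b = 0 /\ pl (co o) c d = 1.
Proof.
rewrite !pairsP => /andP[ab b6] /andP[cd d6] ne.
pose f k : L := ((k == c) || (k == 6 + d)%N)%:R; exists (mk12 f).
have [a6 c6] : (a < 6)%N /\ (c < 6)%N by move: ab cd b6 d6; lia.
rewrite /pl !co_mk; try by move: a6 c6 b6 d6; lia.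
have F k : (k < 6)%N -> f k = (k == c)%:R.
  by move=> k6; rewrite /f (_ : (k == 6 + d)%N = false) ?orbF //; move: k6; lia.
have F6 k : f (6 + k)%N = (k == d)%:R.
  by rewrite /f eqn_add2l (_ : (6 + k == c)%N = false) //; move: c6; lia.
rewrite ![f (6 + _)%N]F6 !F // !eqxx mulr1 (_ : (d == c) = false) ?mul0r ?subr0; last by move: cd; lia.
split=> //; move: ne; rewrite xpair_eqE.
case: (a =P c) => [->|nac] /=; first by move=> /negbTE->; rewrite mulr0 sub0r (_ : (c == d) = false) ?mulr0 ?oppr0 //; move: cd; lia.
move=> _; rewrite mul0r sub0r; case: (b =P c) => [bc|_] /=; last by rewrite mul0r oppr0.
by case: (a =P d) => [ad|_]; rewrite ?mulr0 ?oppr0 //; subst; move: ab cd; lia.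
Qed.

Lemma prod_shift (q : nat -> L) i : (i < 3)%N -> q ((i + 1) %% 3)%N * q ((i + 2) %% 3)%N * q i = q 0%N * q 1%N * q 2%N.
Proof. by case: i => [|[|[|//]]] _ /=; ring. Qed.

Lemma qf_tht_eq0 o i j : (i < 3)%N -> (j < 3)%N -> (forall k, (k < 3)%N -> fX (co o) k != 0) ->
  qf (tht o) i j = 0 -> fX (co o) i = fY (co o) j.
Proof.
move=> i3 j3 X0 /eqP; rewrite /qf !Xc_tht ?ltn_mod // !Yc_tht ?ltn_mod // subr_eq0 => /eqP e.
have n0 : fX (co o) ((i + 1) %% 3) * fX (co o) ((i + 2) %% 3) != 0 by rewrite mulf_neq0 ?X0 ?ltn_mod.
by apply: (mulfI n0); rewrite prod_shift // frame_prod -(prod_shift (fY (co o)) j3) // e.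
Qed.

(** A single vanishing [mm] kills just one X and one Y, which leaves a nonzero [qf]. If no [mm]
    vanishes, some [pP] and some [pQ] are nonzero, and by [frame_diff] an X differs from a Y. *)
Lemma Oo_one_pair o ab : (forall cd, cd \in pairs -> cd != ab -> pl (co o) cd.1 cd.2 != 0) -> Oo o.
Proof.
move=> H; split; first exact: segre_tht.
have N a b : (a < b < 6)%N -> (a, b) != ab -> pl (co o) a b != 0 by move=> h; apply: (H (a, b)); rewrite pairsP.
have [[i [j [i3 j3 z]]]|nz] := pselect (exists i j, [/\ (i < 3)%N, (j < 3)%N & mm (co o) i j = 0]).
  have E : ab = (i, 3 + j)%N.
    by apply/eqP; apply: contraLR isT => ne; have := N i (3 + j)%N; rewrite -/(mm _ _ _) z eqxx eq_sym => /(_ _ ne); apply; move: i3 j3; lia.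
  have M a b : (a < 3)%N -> (b < 3)%N -> (a, b) != (i, j) -> mm (co o) a b != 0.
    move=> a3 b3 ne; apply: N; first by move: a3 b3; lia.
    by rewrite E; move: ne; rewrite !xpair_eqE eqn_add2l.
  (* The zeros are X at index [i + j] and Y at index [j - i]; the second witness is one further, so
     that its product of two Y contains the zero. *)
  exists ((i + j) %% 3)%N, ((j + 4 - i) %% 3)%N; rewrite !ltn_mod; split=> //.
  rewrite /qf !Xc_tht ?ltn_mod // !Yc_tht ?ltn_mod //.
  move: i j i3 j3 z M {E} => [|[|[|]]] // [|[|[|]]] // _ _ z M; rewrite /fX /fY /= z !(mul0r, mulr0) ?mul0r subr0;
  by rewrite !mulf_neq0 // M.
have M a b : (a < 3)%N -> (b < 3)%N -> mm (co o) a b != 0.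
  by move=> a3 b3; apply/eqP => z; apply: nz; exists a, b.
have [a a3 Pa] : exists2 a, (a < 3)%N & pP (co o) a != 0.
  have [e|ne] := eqVneq (1, 2) ab; last by exists 0%N => //; apply: N.
  by exists 2 => //; apply: N => //; rewrite -e.
have [b b3 Qb] : exists2 b, (b < 3)%N & pQ (co o) b != 0.
  have [e|ne] := eqVneq (4, 5) ab; last by exists 0%N => //; apply: N.
  by exists 2 => //; apply: N => //; rewrite -e.
exists ((a + b) %% 3)%N, ((b + 3 - a) %% 3)%N; rewrite !ltn_mod; split=> //.
have D := frame_diff (co o) a3 b3.
have i3 : ((a + b) %% 3 < 3)%N by rewrite ltn_mod.
have j3 : ((b + 3 - a) %% 3 < 3)%N by rewrite ltn_mod.
move: ((a + b) %% 3)%N ((b + 3 - a) %% 3)%N i3 j3 D => i j i3 j3 D; apply/eqP => q0.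
have X0 k : (k < 3)%N -> fX (co o) k != 0 by case: k => [|[|[|]]] // _; rewrite /fX /= !mulf_neq0 ?M.
move/eqP: D; rewrite (qf_tht_eq0 i3 j3 X0 q0) subrr eq_sym oppr_eq0 !mulf_eq0.
by rewrite (negbTE (M _ _ a3 b3)) (negbTE Pa) (negbTE Qb).
Qed.

(** The minors are pairwise non-associated primes, so a prime divides at most one of them; a general
    point of its divisor has all other minors nonzero. *)
Lemma Oo_codim2 : codim2 (@pev L 12) (@Oo L).
Proof.
move=> p g pp ng.
have D ab cd : ab \in pairs -> cd \in pairs -> rdvd p (pl px ab.1 ab.2) -> rdvd p (pl px cd.1 cd.2) -> ab = cd.
  case: ab cd => [a b] [c d] /= hab hcd d1 d2; apply/eqP/negPn/negP => ne.
  have [o [z1 z2]] := pl_distinct hab hcd ne.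
  have [u uu E] := rprime_assoc pp (rprime_pl hab) d1; have [w Ew] := d2.
  have u0 : u.@[o 0] != 0 by rewrite -unitfE; apply: (rmorph_unit (meval (o 0))).
  have : p.@[o 0] = 0.
    by apply: (mulfI u0); rewrite mulr0 -mevalM -E meval_pl.
  move=> p0; have := z2; rewrite -meval_pl Ew mevalM p0 mulr0 => /eqP.
  by rewrite eq_sym oner_eq0.
have [ab Hab] : exists ab, forall cd, cd \in pairs -> cd != ab -> ~ rdvd p (pl px cd.1 cd.2).
  have [[ab h d]|no] := pselect (exists2 ab, ab \in pairs & rdvd p (pl px ab.1 ab.2)).
    by exists ab => cd hc ne d'; move/eqP: ne; apply; apply: D.
  by exists (0, 1)%N => cd hc _ d; apply: no; exists cd.
pose G := g * \prod_(cd <- [seq cd <- pairs | cd != ab]) pl px cd.1 cd.2.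
have nG : ~ rdvd p G.
  apply: not_rdvdM => //; elim: pairs Hab => [|cd s IH] H /=.
    by rewrite big_nil; case: pp.
  have IHs : ~ rdvd p (\prod_(cd <- [seq cd <- s | cd != ab]) pl px cd.1 cd.2).
    by apply: IH => x xs; apply: H; rewrite inE xs orbT.
  case: ifP => // ne; rewrite big_cons; apply: not_rdvdM => //; apply: H => //.
  by rewrite inE eqxx.
have [o po] := prime_point pp nG; rewrite mevalM mulf_nz => /andP[go]; rewrite (rmorph_prod (meval (o 0))) => pr.
 exists o; split=> //.
apply: (@Oo_one_pair _ ab) => cd hcd ne.
have := pr; rewrite prodf_seq_neq0 => /allP/(_ cd); rewrite mem_filter ne hcd /= => /(_ isT).
by rewrite meval_pl.
Qed.

Definition Wp : A := \prod_(cd <- pairs) pl px cd.1 cd.2.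

Lemma WpP o : Wp.@[o 0] != 0 -> forall a b, (a < b < 6)%N -> pl (co o) a b != 0.
Proof.
rewrite (rmorph_prod (meval (o 0))) prodf_seq_neq0 => /allP H a b ab; have := H (a, b); rewrite pairsP => /(_ ab).
by move/implyP=> /(_ isT); rewrite -meval_pl.
Qed.

Lemma Wp_neq0 : Wp != 0.
Proof.
rewrite prodf_seq_neq0; apply/allP => -[a b] /rprime_pl[]; by [].
Qed.

Lemma Wp_Oo o : Wp.@[o 0] != 0 -> Oo o.
Proof. by move=> /WpP H; apply: (@Oo_one_pair _ (0, 1)%N) => -[a b] /=; rewrite pairsP => /H. Qed.

End Codim2.

(** * Rational charts of the Segre cubic, and descent of invariant fractions *)

Section Chart.
Variable L : closedFieldType.
Implicit Types (z : 'rV[L]_5) (o : 'rV[L]_12) (m : 'rV[L]_4).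

Definition cm m (k : nat) : L := m 0 (inord k).
Definition mk4 (f : nat -> L) : 'rV[L]_4 := \row_k f k.
Lemma cm_mk f k : (k < 4)%N -> cm (mk4 f) k = f k.
Proof. by move=> k4; rewrite /cm mxE inordK. Qed.

Variables i j : nat.
Hypotheses (i3 : (i < 3)%N) (j3 : (j < 3)%N).

Definition qm m := cm m 0 * cm m 1 - cm m 2 * cm m 3.
Definition Sm m := cm m 2 + cm m 3 - cm m 0 - cm m 1.
(** Let x, y be the products of the two X and the two Y kept in [m]. From X_i x = Y_j y and X_i -
    Y_j = S one gets X_i (x - y) = - y S; [al] is this solution with the denominator [qm] cleared,
    inverse to the projection [mz]. *)
Definition alX m k := if k == i then - (cm m 2 * cm m 3) * Sm m
  else if k == ((i + 1) %% 3)%N then qm m * cm m 0 else qm m * cm m 1.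
Definition alY m k := if k == j then - (cm m 0 * cm m 1) * Sm m
  else if k == ((j + 1) %% 3)%N then qm m * cm m 2 else qm m * cm m 3.
Definition al m : 'rV[L]_5 := mk5 (nth 0 [:: alX m 0; alX m 1; alY m 0; alY m 1; alY m 2]).
Definition mz z : 'rV[L]_4 := mk4 (nth 0 [:: Xc z ((i + 1) %% 3); Xc z ((i + 2) %% 3); Yc z ((j + 1) %% 3); Yc z ((j + 2) %% 3)]).

Lemma Xc_al m k : (k < 3)%N -> Xc (al m) k = alX m k.
Proof.
rewrite /Xc /al !c5_mk // !/(nth _ _ _); case: k => [|[|[|]]] // _ /=.
by rewrite /alX /alY /Sm /qm; case: i i3 => [|[|[|]]] // _; case: j j3 => [|[|[|]]] // _ /=; ring.
Qed.
Lemma Yc_al m k : (k < 3)%N -> Yc (al m) k = alY m k.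
Proof. by rewrite /Yc /al !c5_mk //; case: k => [|[|[|]]]. Qed.

Lemma qf_al m : qf (al m) i j = qm m ^+ 3.
Proof.
rewrite /qf !Xc_al ?ltn_mod // !Yc_al ?ltn_mod // /alX /alY.
by case: i i3 => [|[|[|]]] // _; case: j j3 => [|[|[|]]] // _ /=; rewrite /qm; ring.
Qed.

Lemma segre_al m : segre_cubic (al m) = 0.
Proof.
rewrite segreE !Xc_al // !Yc_al // /alX /alY.
by case: i i3 => [|[|[|]]] // _; case: j j3 => [|[|[|]]] // _ /=; ring.
Qed.

Lemma smooth_al m : qm m != 0 -> smooth (al m).
Proof. by move=> q0; split; [apply: segre_al|exists i, j; rewrite qf_al expf_neq0]. Qed.

Lemma mz_al m : mz (al m) = qm m *: m.
Proof.
have E k : (k < 4)%N -> cm (mz (al m)) k = cm (qm m *: m) k.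
  move=> k4; rewrite cm_mk // /cm mxE -/(cm m k).
  move: k k4 => [|[|[|[|]]]] // _; rewrite /= ?Xc_al ?Yc_al ?ltn_mod // /alX /alY;
  by case: i i3 => [|[|[|]]] //; case: j j3 => [|[|[|]]].
by apply/rowP => k; rewrite -[k]inord_val; apply: E.
Qed.

Lemma mzZ c z : mz (c *: z) = c *: mz z.
Proof.
apply/rowP => k; rewrite !mxE; case: k => -[|[|[|[|]]]] //= _; by rewrite ?XcZ ?YcZ.
Qed.

Lemma qm_mz z : qm (mz z) = qf z i j.
Proof. by rewrite /qm !cm_mk. Qed.

Lemma al_mz z : segre_cubic z = 0 -> al (mz z) = qf z i j *: z.
Proof.
move=> s0; have [sX sY] : [/\ Xc z 0 + Xc z 1 + Xc z 2 = Yc z 0 + Yc z 1 + Yc z 2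
    & Xc z 0 * Xc z 1 * Xc z 2 = Yc z 0 * Yc z 1 * Yc z 2].
  by split; [rewrite /Xc /Yc /=; ring|apply/eqP; rewrite -subr_eq0 -segreE s0].
have c5E : [/\ c5 z 0 = Xc z 0, c5 z 1 = Xc z 1, c5 z 2 = Yc z 0, c5 z 3 = Yc z 1 & c5 z 4 = Yc z 2] by [].
have [e0 e1 e2 e3 e4] := c5E.
have X2 : Xc z 2 = Yc z 0 + Yc z 1 + Yc z 2 - Xc z 0 - Xc z 1 by rewrite -sX; ring.
have fin (x y a b : L) : a - b = 0 -> x - y = a - b \/ x - y = b - a \/ x - y = 0 -> x = y.
  move=> e h; apply/eqP; rewrite -subr_eq0; apply/eqP; case: h => [->//|[->|//]].
  by rewrite -opprB e oppr0.
have e : Xc z 0 * Xc z 1 * Xc z 2 - Yc z 0 * Yc z 1 * Yc z 2 = 0 by rewrite sY subrr.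
rewrite X2 in e; clear s0 sX sY c5E.
apply: eq5; rewrite c5Z c5_mk // ?e0 ?e1 ?e2 ?e3 ?e4 /=; apply: (fin _ _ _ _ e);
  rewrite /alX /alY /qf /Sm /qm !cm_mk //; case: i i3 => [|[|[|]]] // _; case: j j3 => [|[|[|]]] // _ /=; rewrite ?X2;
  move: (Xc z 0) (Xc z 1) (Yc z 0) (Yc z 1) (Yc z 2) => a b c d f;
  solve [left; ring|right; left; ring|right; right; ring].
Qed.

Lemma pfun_cm k : pfun (fun m => cm m k). Proof. exact: pfunX. Qed.
Lemma pfun_qm : pfun qm.
Proof. by rewrite /qm; apply: pfunB; apply: pfunM; apply: pfun_cm. Qed.
Ltac pf := repeat first [exact: pfunC | exact: pfun_cm | exact: pfun_qm | apply: pfunB | apply: pfunD | apply: pfunM | apply: pfunN].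
Lemma pfun_al k : pfun (fun m => al m 0 k).
Proof.
have pX l : pfun (fun m => alX m l).
  by rewrite /alX /Sm; case: (l == i); last case: (l == _); pf.
have pY l : pfun (fun m => alY m l).
  by rewrite /alY /Sm; case: (l == j); last case: (l == _); pf.
have E m : al m 0 k = nth 0 [:: alX m 0; alX m 1; alY m 0; alY m 1; alY m 2] k by rewrite mxE.
apply: pfun_eq (fun m => esym (E m)) _.
by case: k {E} => -[|[|[|[|[|]]]]] //= _.
Qed.

End Chart.

Section ChartDescent.
Variable L : closedFieldType.
Implicit Types (z : 'rV[L]_5) (o : 'rV[L]_12) (m : 'rV[L]_4).

Lemma gl1 (o : 'rV[L]_12) : gl 1 0 0 1 o = o.
Proof.
by apply: eq12 => k k12; rewrite co_mk //; case: ltnP => k6; rewrite !mul1r !mul0r ?addr0 ?add0r.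
Qed.

Lemma pfun_co k : pfun (fun o => co o k). Proof. exact: pfunX. Qed.
Lemma pfun_pl a b : pfun (fun o => pl (co o) a b).
Proof. by apply: pfunB; apply: pfunM; apply: pfun_co. Qed.
Lemma pfun_fX k : pfun (fun o => fX (co o) k).
Proof.
by case: k => [|[|[|k]]]; [do !apply: pfunM; apply: pfun_pl..|apply: pfun_eq (pfunC _ 0) => o; rewrite /fX /= nth_nil].
Qed.
Lemma pfun_fY k : pfun (fun o => fY (co o) k).
Proof.
by case: k => [|[|[|k]]]; [do !apply: pfunM; apply: pfun_pl..|apply: pfun_eq (pfunC _ 0) => o; rewrite /fY /= nth_nil].
Qed.
Lemma pfun_tht k : pfun (fun o => tht o 0 k).
Proof.
have E o : tht o 0 k = nth 0 [:: fX (co o) 0; fX (co o) 1; fY (co o) 0; fY (co o) 1; fY (co o) 2] k by rewrite mxE.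
apply: pfun_eq (fun o => esym (E o)) _.
by case: k {E} => -[|[|[|[|[|]]]]] //= _; [apply: pfun_fX|apply: pfun_fX|apply: pfun_fY..].
Qed.
Lemma pfun_XY n (f : 'rV[L]_n -> 'rV[L]_5) k : (forall k, pfun (fun o : 'rV_n => f o 0 k)) ->
  pfun (fun o : 'rV_n => Xc (f o) k) /\ pfun (fun o : 'rV_n => Yc (f o) k).
Proof.
move=> Hf; have H l : pfun (fun o : 'rV_n => c5 (f o) l) by apply: Hf.
have Z (g : 'rV[L]_n -> L) : (forall o : 'rV_n, g o = 0) -> pfun g.
  by move=> e; apply: pfun_eq (pfunC _ 0) => o1; rewrite e.
split; case: k => [|[|[|k]]]; rewrite /Xc /Yc /=; try exact: H.
- by apply: pfunB => //; apply: pfunB => //; apply: pfunD => //; apply: pfunD.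
- by apply: Z => o; rewrite nth_nil.
- by apply: Z => o; rewrite nth_nil.
Qed.
Lemma pfun_sig n (f : 'rV[L]_n -> 'rV[L]_5) k : (forall k, pfun (fun o : 'rV_n => f o 0 k)) ->
  pfun (fun o : 'rV_n => sig (f o) 0 k).
Proof.
move=> Hf; have HM a b : pfun (fun o : 'rV_n => Mz (f o) a b).
  by apply: pfunB; [case: (pfun_XY ((a + b) %% 3) Hf)|case: (pfun_XY ((b + 3 - a) %% 3) Hf)].
apply: (pfun_eq (f := fun o : 'rV_n => nth 0 [:: 1; 0; -1; - Mz (f o) 1 0; - Mz (f o) 1 1; - Mz (f o) 1 2;
  0; 1; -1; Mz (f o) 0 0; Mz (f o) 0 1; Mz (f o) 0 2] k)); first by move=> o1; rewrite mxE.
by case: k => -[|[|[|[|[|[|[|[|[|[|[|[|]]]]]]]]]]]] //= _; first [apply: pfunC|apply/pfunN|idtac].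
Qed.

Lemma W_PQ o : Wp L != 0 -> (Wp L).@[o 0] != 0 ->
  (forall a, (a < 3)%N -> pP (co o) a != 0) /\ (forall a, (a < 3)%N -> pQ (co o) a != 0).
Proof.
move=> _ /WpP H; have N a b : pl (co o) b a = - pl (co o) a b by rewrite /pl; ring.
by split; case=> [|[|[|]]] // _; rewrite /pP /pQ /= ?(N 0%N 2) ?(N 3 5) ?oppr_eq0 H.
Qed.

Lemma W_qf o i j : (i < 3)%N -> (j < 3)%N -> (Wp L).@[o 0] != 0 -> qf (tht o) i j != 0.
Proof.
move=> i3 j3 Wo; have [P0 Q0] := W_PQ (Wp_neq0 L) Wo; have H := WpP Wo.
have M a b : (a < 3)%N -> (b < 3)%N -> mm (co o) a b != 0.
  by move=> a3 b3; apply: H; move: a3 b3; lia.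
have X0 k : (k < 3)%N -> fX (co o) k != 0 by case: k => [|[|[|]]] // _; rewrite /fX /= !mulf_neq0 ?M.
have Y0 k : (k < 3)%N -> fY (co o) k != 0 by case: k => [|[|[|]]] // _; rewrite /fY /= !mulf_neq0 ?M.
have ne : fX (co o) i != fY (co o) j.
  have [a [b [a3 b3 -> ->]]] : exists a b, [/\ (a < 3)%N, (b < 3)%N, i = ((a + b) %% 3)%N & j = ((b + 3 - a) %% 3)%N].
    exists ((i + 3 - ((i + j) * 2) %% 3) %% 3)%N, (((i + j) * 2) %% 3)%N.
    by move: i j i3 j3 {M X0 Y0} => [|[|[|]]] // [|[|[|]]].
  by rewrite -subr_eq0 frame_diff // oppr_eq0 !mulf_neq0 ?M ?P0 ?Q0.
by apply: contraNneq ne => /(qf_tht_eq0 i3 j3 X0)/eqP.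
Qed.

Lemma tht_scale c z : c != 0 -> smooth z -> exists2 o, Oo o & tht o = c *: z.
Proof. by move=> c0 Sz; apply/tht_surj/smoothZ. Qed.

(** An invariant fraction is a function on the cubic: evaluating it on the section [sig] of the
    chart gives [N' / D']. In reduced form [D'] cannot vanish at [z0], since a prime factor through
    [z0] has a zero at which [N'] is nonzero, and lifting that point to [Oo] contradicts the
    nonvanishing of [N] and [D]. *)
Lemma chart_descent (N D : {mpoly L[12]}) (nb : 'rV[L]_5 -> Prop) i j z0 (G : {mpoly L[5]}) :
  (i < 3)%N -> (j < 3)%N -> smooth z0 -> qf z0 i j != 0 ->
  (forall o, Oo o -> nb (tht o) -> N.@[o 0] != 0 /\ D.@[o 0] != 0) ->
  (forall o l a b c d, Oo o -> nb (tht o) -> (forall k, (k < 6)%N -> l k != 0) -> a * d - b * c != 0 ->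
     let o' := gl a b c d (sc l o) in N.@[o 0] * D.@[o' 0] = N.@[o' 0] * D.@[o 0]) ->
  (forall c z, c != 0 -> nb z -> nb (c *: z)) ->
  (forall c, c != 0 -> G.@[(c *: z0) 0] != 0) -> (forall z, smooth z -> G.@[z 0] != 0 -> nb z) ->
  exists N' D' : {mpoly L[4]}, [/\ D'.@[mz i j z0 0] != 0 &
    forall o, N.@[o 0] * D'.@[mz i j (tht o) 0] = D.@[o 0] * N'.@[mz i j (tht o) 0]].
Proof.
move=> i3 j3 S0 q0 ND inv nbZ G0 Gnb.
have pal := @pfun_al L i j.
have psig k : pfun (fun m => sig (al i j m) 0 k) by apply: pfun_sig.
have [f1 E1] := pfun_comp N psig; have [f2 E2] := pfun_comp D psig.
have pmz k : pfun (fun o => mz i j (tht o) 0 k).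
  have E o : mz i j (tht o) 0 k = nth 0 [:: Xc (tht o) ((i + 1) %% 3); Xc (tht o) ((i + 2) %% 3);
    Yc (tht o) ((j + 1) %% 3); Yc (tht o) ((j + 2) %% 3)] k by rewrite mxE.
  apply: pfun_eq (fun o => esym (E o)) _.
  by case: k {E} => -[|[|[|[|]]]] //= _; [case: (pfun_XY ((i + 1) %% 3) pfun_tht)|case: (pfun_XY ((i + 2) %% 3) pfun_tht)
    |case: (pfun_XY ((j + 1) %% 3) pfun_tht)|case: (pfun_XY ((j + 2) %% 3) pfun_tht)].
have lift m : qm m != 0 -> exists o, [/\ Oo o, mz i j (tht o) = m & tht o = (qm m)^-1 *: al i j m].
  move=> qm0; have [|o Oo Et] := tht_scale (c := (qm m)^-1) _ (smooth_al i3 j3 qm0); first by rewrite invr_eq0.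
  by exists o; split=> //; rewrite Et mzZ mz_al // scalerA mulVf // scale1r.
have [pq Epq] := pfun_qm L; have [gth Egth] := pfun_comp G pfun_tht; have [gal Egal] := pfun_comp G pal.
have G_al m : gal.@[m 0] != 0 -> qm m != 0 -> nb (al i j m).
  by move=> h q; apply: Gnb; [apply: smooth_al|move: h; rewrite -Egal].
have orbit o : Oo o -> (Wp L).@[o 0] != 0 -> nb (tht o) ->
    N.@[o 0] * f2.@[mz i j (tht o) 0] = D.@[o 0] * f1.@[mz i j (tht o) 0] /\ f1.@[mz i j (tht o) 0] != 0.
  move=> Ho Wo nbo; rewrite -E1 -E2 al_mz //; last exact: segre_tht.
  set q := qf (tht o) i j; have qn : q != 0 by apply: W_qf.
  (* Scaling column 0 by [q] replaces [tht o] by [al] of its chart coordinates, the point at which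
     the section is evaluated. *)
  pose l k := if k == 0%N then q else 1 : L.
  have l0 k : (k < 6)%N -> l k != 0 by rewrite /l; case: ifP => _ _ //; apply: oner_neq0.
  have Eq : q *: tht o = tht (sc l o) by rewrite tht_sc /prod6 /l /= !mulr1.
  have O1 : Oo (sc l o) by apply: Oo_sc.
  have nb1 : nb (tht (sc l o)) by rewrite -Eq; apply: nbZ.
  have [P0 Q0] := W_PQ (Wp_neq0 L) Wo.
  have [||l' [a [b [c [d [l'0 abcd Es]]]]]] := @sig_orbit L (sc l o).
  - by case=> [|[|[|]]] // _; rewrite /pP /= pl_sc // !mulf_neq0 ?l0 //; [exact: (P0 0%N)|exact: (P0 1%N)|exact: (P0 2)].
  - by case=> [|[|[|]]] // _; rewrite /pQ /= pl_sc // !mulf_neq0 ?l0 //; [exact: (Q0 0%N)|exact: (Q0 1%N)|exact: (Q0 2)].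
  have H1 := inv _ _ _ _ _ _ O1 nb1 l'0 abcd; rewrite /= -Es in H1.
  have H2 := inv o l 1 0 0 1 Ho nbo l0; rewrite /= gl1 mulr0 mulr1 subr0 in H2.
  have {}H2 := H2 (oner_neq0 L).
  have [N1 D1] := ND _ O1 nb1; have [No Do] := ND _ Ho nbo.
  have O2 : Oo (sig (tht (sc l o))) by rewrite Es; apply/Oo_gl/Oo_sc.
  have nb2 : nb (tht (sig (tht (sc l o)))).
    by rewrite Es tht_gl tht_sc scalerA; apply: nbZ => //; rewrite mulf_neq0 ?expf_neq0 // /prod6 !mulf_neq0 ?l'0.
  have [N2 D2] := ND _ O2 nb2.
  rewrite Eq; split; last by apply: contraNneq N2 => <-; apply/eqP/meval_eq => k.
  have e p : p.@[sig (tht (sc l o)) 0] = p.@[fun k => sig (tht (sc l o)) 0 k] by apply: meval_eq.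
  rewrite -!e; apply: (mulfI (mulf_neq0 N1 D1)).
  transitivity (N.@[o 0] * D.@[sc l o 0] * (N.@[sc l o 0] * D.@[sig (tht (sc l o)) 0])); first by ring.
  by rewrite H1 H2; ring.
have [z0s _] := S0; have mz0 : qm (mz i j z0) != 0 by rewrite qm_mz.
have galz0 : gal.@[mz i j z0 0] != 0 by rewrite -Egal al_mz //; apply: G0.
have [o0 O0 Eo0] := tht_surj S0.
have gth0 : gth != 0.
  by apply: (pev_neq0 (o := o0)); rewrite -Egth Eo0 -[z0]scale1r; apply: G0; apply: oner_neq0.
have good o : (Wp L * gth).@[o 0] != 0 -> [/\ Oo o, (Wp L).@[o 0] != 0 & nb (tht o)].
  rewrite mevalM mulf_nz => /andP[Wo go]; have Ho := Wp_Oo Wo; split=> //.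
  by apply: Gnb; [|move: go; rewrite -Egth].
have WG : Wp L * gth != 0 by rewrite mulf_neq0 ?Wp_neq0.
have [f10 f20] : f1 != 0 /\ f2 != 0.
  have [o /good] := nonroot_row WG; case=> Ho Wo nbo; have [e fn] := orbit o Ho Wo nbo; have [No Do] := ND o Ho nbo.
  split; first by apply: (pev_neq0 (o := (mz i j (tht o)))).
  apply: (pev_neq0 (o := (mz i j (tht o)))) => /=.
  by apply: contraTneq (mulf_neq0 Do fn) => f2z; rewrite -e f2z mulr0 eqxx.
have [N' [D' [c [c0 EN ED cop]]]] := coprime_part (@ufd_mpoly L 4) f10 f20.
have key o : N.@[o 0] * D'.@[mz i j (tht o) 0] = D.@[o 0] * N'.@[mz i j (tht o) 0].
  have [pD' ED'] := pfun_comp D' pmz; have [pN' EN'] := pfun_comp N' pmz; have [pc Ec] := pfun_comp c pmz.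
  have pc0 : pc != 0.
    have pq0 : pq != 0 by apply: (pev_neq0 (o := (mz i j z0))); rewrite -Epq.
    have [m] := nonroot_row (mulf_neq0 c0 pq0); rewrite mevalM -Epq mulf_nz => /andP[cm0 qm0]; have [o1 [_ Em _]] := lift m qm0.
    by apply: (pev_neq0 (o := o1)); rewrite -Ec Em.
  have : N * pD' = D * pN'.
    apply: (mpoly_eq_on (mulf_neq0 WG pc0)) => x; rewrite mevalM mulf_nz => /andP[/good[Hx Wx nbx] cx].
    have [e _] := orbit x Hx Wx nbx; rewrite -Ec in cx; rewrite !mevalM -ED' -EN'.
    by apply: (mulfI cx); move: e; rewrite EN ED !mevalM !(mulrCA _ c.@[_]).
  by move/(congr1 (meval (o 0))); rewrite !mevalM -ED' -EN'.
exists N', D'; split=> //; apply/eqP => Dz.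
have D'0 : D' != 0 by apply: contraNneq f20 => e; rewrite ED e mulr0.
have [r [pr dr rz]] := root_prime (e := @pev L 4) (@ufd_mpoly L 4) D'0 Dz.
have nr : ~ rdvd r (N' * pq * gal).
  have nd p : p.@[mz i j z0 0] != 0 -> ~ rdvd r p by move=> h; apply: (@not_rdvd_root _ _ _ (@pev L 4) _ _ (mz i j z0)).
  apply: not_rdvdM => //; last exact: nd.
  by apply: not_rdvdM => //; [move=> d; apply: cop d dr|apply: nd; rewrite -Epq].
have [m rm] := prime_point pr nr; rewrite !mevalM !mulf_eq0 !negb_or -Epq => /andP[/andP[Nm qm0] gm].
have [o [Ho Emo Et]] := lift m qm0.
have [No Do] : N.@[o 0] != 0 /\ D.@[o 0] != 0.
  by apply: ND => //; rewrite Et; apply: nbZ; [rewrite invr_eq0|apply: G_al].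
have Dm : D'.@[m 0] = 0 by have [w ->] := dr; rewrite mevalM rm mulr0.
have := key o; rewrite Emo Dm mulr0 => /esym/eqP.
by rewrite mulf_eq0 (negbTE Do) (negbTE Nm).
Qed.

End ChartDescent.

(** * Substitution into polynomials and the chain rule *)

Section ChainRule.
Variables (k R : comNzRingType) (c : {rmorphism k -> {poly R}}) (m : nat) (b : 'I_m -> {poly R}).
Hypothesis c0 : forall a, (c a)^`() = 0.

Definition chain_ok (G : {mpoly k[m]}) :=
  (mmap c b G)^`() = \sum_i mmap c b G^`M(i) * (b i)^`().

Lemma chain_okC a : chain_ok a%:MP.
Proof. by rewrite /chain_ok mmapC c0 big1 // => i _; rewrite mderivC mmap0 mul0r. Qed.
Lemma chain_okD G H : chain_ok G -> chain_ok H -> chain_ok (G + H).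
Proof.
rewrite /chain_ok mmapD derivD => -> ->; rewrite -big_split; apply: eq_bigr => i _ /=.
by rewrite mderivD mmapD mulrDl.
Qed.
Lemma chain_okM G H : chain_ok G -> chain_ok H -> chain_ok (G * H).
Proof.
rewrite /chain_ok rmorphM derivM => -> ->; rewrite mulr_suml mulr_sumr -big_split; apply: eq_bigr => i _.
rewrite mderivM mmapD !(rmorphM (mmap c b)) mulrDl; congr (_ + _); last by rewrite mulrA.
by rewrite mulrAC.
Qed.
Lemma chain_okX i : chain_ok 'X_i.
Proof.
rewrite /chain_ok mmapX mmap1U (bigD1 i) //= big1 ?addr0 => [|j ji]; rewrite mderivX mnm1E.
  rewrite eqxx scale1r (_ : (U_(i) - U_(i))%MM = 0%MM) ?mpolyX0 ?rmorph1 ?mul1r //.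
  by apply/mnmP => l; rewrite mnmBE subnn mnm0E.
by rewrite eq_sym (negbTE ji) scale0r rmorph0 mul0r.
Qed.

Lemma chain_rule G : chain_ok G.
Proof.
elim/mpolyind: G => [|a d G _ _ IH]; first by rewrite -mpolyC0; apply: chain_okC.
apply: chain_okD => //; rewrite -mul_mpolyC; apply: chain_okM; first exact: chain_okC.
rewrite mpolyXE_id; elim/big_ind: _ => [||i _].
- by rewrite -mpolyC1; apply: chain_okC.
- exact: chain_okM.
elim: (d i) => [|e IHe]; first by rewrite expr0 -mpolyC1; apply: chain_okC.
by rewrite exprS; apply: chain_okM => //; apply: chain_okX.
Qed.

End ChainRule.

Section BivariateFun.
Variables (L : closedFieldType) (n : nat).
Local Notation A := {mpoly L[n]}.
Local Notation B := {poly {mpoly L[n]}}.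

Definition bfun (u : 'rV[L]_n -> L -> L) := exists p : B, forall o y, u o y = bev (o, y) p.

Lemma bfun_pfun (f : 'rV[L]_n -> L) : pfun f -> bfun (fun o _ => f o).
Proof. by move=> [p Hp]; exists p%:P => o y; rewrite bevC Hp. Qed.
Lemma bfunY : bfun (fun _ y => y).
Proof. by exists 'X => o y; rewrite bevE map_polyX hornerX. Qed.
Lemma bfunM u w : bfun u -> bfun w -> bfun (fun o y => u o y * w o y).
Proof. by move=> [p Hp] [q Hq]; exists (p * q) => o y; rewrite bevM Hp Hq. Qed.
Lemma bfun_exp u k : bfun u -> bfun (fun o y => u o y ^+ k).
Proof. by move=> [p Hp]; exists (p ^+ k) => o y; rewrite bevX Hp. Qed.
Lemma bfun_sum I (s : seq I) (F : I -> 'rV[L]_n -> L -> L) : (forall i, bfun (F i)) ->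
  bfun (fun o y => \sum_(i <- s) F i o y).
Proof.
move=> H; elim: s => [|i s [p Hp]]; first by exists 0 => o y; rewrite big_nil bev0.
by have [q Hq] := H i; exists (q + p) => o y; rewrite big_cons bevD Hp Hq.
Qed.
Lemma bfun_prod I (s : seq I) (F : I -> 'rV[L]_n -> L -> L) : (forall i, bfun (F i)) ->
  bfun (fun o y => \prod_(i <- s) F i o y).
Proof.
move=> H; elim: s => [|i s [p Hp]].
  by exists 1 => o y; rewrite big_nil; apply/esym; exact: (rmorph1 (bev (o, y))).
by have [q Hq] := H i; exists (q * p) => o y; rewrite big_cons bevM Hp Hq.
Qed.
Lemma bfun_eq u w : (forall o y, u o y = w o y) -> bfun u -> bfun w.
Proof. by move=> E [p Hp]; exists p => o y; rewrite -E. Qed.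
Lemma bfun_mmap m (f : 'I_m -> 'rV[L]_n -> L -> L) (F : {mpoly L[m]}) : (forall k, bfun (f k)) ->
  bfun (fun o y => mmap idfun (fun k => f k o y) F).
Proof.
move=> Hf; rewrite /mmap; apply: bfun_sum => d; apply: bfunM; first exact: (bfun_pfun (pfunC _ _)).
apply: (bfun_eq (u := fun o y => \prod_(i <- enum 'I_m) f i o y ^+ d i)).
  by move=> o y; rewrite /mmap1 big_enum.
by apply: bfun_prod => i; apply: bfun_exp.
Qed.

Definition cB : {rmorphism L -> B} := polyC \o @mpolyC n L.
(** Substitution used to pull the equation of an etale neighbourhood of the cubic back to a
    polynomial in [y] over the coordinate ring of A^12. *)
Definition subB m (b : 'I_m -> B) (F : {mpoly L[m]}) : B := mmap cB b F.

Lemma subB_bev m (b : 'I_m -> B) F o y : bev (o, y) (subB b F) = mmap idfun (fun k => bev (o, y) (b k)) F.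
Proof.
rewrite /subB /mmap (big_morph (bev (o, y)) (fun p q => bevD (o, y) p q) (bev0 _)).
apply: eq_bigr => d _; rewrite bevM [cB _]/= bevC mevalC; congr (_ * _).
rewrite /mmap1 (big_morph (bev (o, y)) (fun p q => bevM (o, y) p q) (rmorph1 (bev (o, y)))).
by apply: eq_bigr => i _; rewrite bevX.
Qed.

Lemma deriv_subB m (b : 'I_m -> B) (F : {mpoly L[m]}) :
  (subB b F)^`() = \sum_i subB b F^`M(i) * (b i)^`().
Proof.
by apply: chain_rule => a; rewrite /= derivC.
Qed.

End BivariateFun.

(** * Etale neighbourhoods of the cubic pulled back to A^12 *)

Section Bridge.
Variables (L : closedFieldType) (h : 'M[L]_5).
Hypothesis uh : h \in unitmx.
Implicit Types (o : 'rV[L]_12) (y : L).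

(** Homogeneous coordinates in the original frame, polynomial in [o]; [Tht] is the corresponding
    point. *)
Definition th o : 'rV[L]_5 := tht o *m invmx h.
Definition Tht o : amb L 4 0 := (mkp (th o), 0).

Lemma th_neq0 o : Oo o -> th o != 0.
Proof.
move=> /smooth_neq0; apply: contraNneq => /(congr1 (mulmx^~ h)).
by rewrite /th mulmxKV // mul0mx => ->.
Qed.

Lemma th_scale o : Oo o -> exists2 c, c != 0 & th o = c *: val (Tht o).1.
Proof. by move=> /th_neq0/mkpP. Qed.

Definition fpt o y : amb L 4 (0 + 1 + 12) := ext (ext (Tht o) (const_mx y : 'rV_1)) o.

Lemma pfun_th k : pfun (fun o => th o 0 k).
Proof.
apply: (pfun_eq (f := fun o => \sum_l tht o 0 l * invmx h l k)); first by move=> o; rewrite mxE.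
elim: (index_enum _) => [|l s IH].
  by apply: pfun_eq (pfunC _ 0) => o; rewrite big_nil.
have H := pfunD (pfunM (pfun_tht L l) (pfunC _ (invmx h l k))) IH.
by apply: pfun_eq H => o; rewrite big_cons.
Qed.

Lemma bfun_row n1 n2 (f : 'rV[L]_12 -> L -> 'rV[L]_n1) (g : 'rV[L]_12 -> L -> 'rV[L]_n2) :
  (forall k, bfun (fun o y => f o y 0 k)) -> (forall k, bfun (fun o y => g o y 0 k)) ->
  forall k, bfun (fun o y => row_mx (f o y) (g o y) 0 k).
Proof.
move=> Hf Hg k; case: (splitP k) => l E.
  have -> : k = lshift n2 l by apply: val_inj.
  by apply: bfun_eq (Hf l) => o y; rewrite row_mxEl.
have -> : k = rshift n1 l by apply: val_inj.
by apply: bfun_eq (Hg l) => o y; rewrite row_mxEr.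
Qed.

Lemma form_hat d (F : {mpoly L[4.+1 + (0 + 1 + 12)]}) : form d F ->
  exists p : {poly {mpoly L[12]}}, forall o y c, th o = c *: val (Tht o).1 ->
    bev (o, y) p = c ^+ d * ev idfun F (fpt o y).
Proof.
move=> fF; have [|p Hp] := @bfun_mmap L 12 _ (fun k o y => row_mx (th o) (fpt o y).2 0 k) F.
  move=> k; apply: bfun_row; first by move=> l; apply: bfun_pfun; apply: pfun_th.
  apply: bfun_row; last by move=> l; apply: bfun_pfun; apply: pfunX.
  apply: bfun_row; first by case.
  by move=> l; apply: bfun_eq (bfunY _ _) => o y; rewrite mxE.
exists p => o y c Ec; rewrite -Hp evE -(evr_scale _ _ _ _ fF) -[c *: _]/(c *: val (Tht o).1) -Ec.
by [].
Qed.

Let yi : 'I_(4.+1 + (0 + 1)) := rshift 4.+1 (rshift 0 ord0).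

Lemma form_deriv_y d (P : {mpoly L[4.+1 + (0 + 1)]}) : form d P -> form d P^`M(yi).
Proof.
move=> /dhomogP hP; apply/dhomogP => m; rewrite mcoeff_msupp mcoeff_deriv => Pm.
have /hP <- : (m + U_(yi))%MM \in msupp P.
  by rewrite mcoeff_msupp; apply: contraNneq Pm => ->; rewrite mul0rn.
rewrite /= /pdeg; apply: eq_bigr => i _; rewrite mnmDE mnm1E -val_eqE /=.
by rewrite gtn_eqF ?addn0 //= (leq_trans (ltn_ord i)).
Qed.

Definition ytuple (k : 'I_(4.+1 + (0 + 1))) : {poly {mpoly L[12]}} :=
  match split k with inl l => (projT1 (cid (pfun_th l)))%:P | inr _ => 'X end.

Lemma ytuple_bev o y k : bev (o, y) (ytuple k) = row_mx (th o) (row_mx (0 : 'rV[L]_0) (const_mx y : 'rV_1)) 0 k.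
Proof.
rewrite /ytuple; case: splitP => l E.
  have -> : k = lshift _ l by apply: val_inj.
  by rewrite row_mxEl bevC; case: cid => p Hp /=; rewrite Hp.
have -> : k = rshift _ l by apply: val_inj.
rewrite row_mxEr; have -> : l = rshift 0 ord0 by apply: val_inj; case: l {E} => -[].
by rewrite row_mxEr mxE bevE map_polyX hornerX.
Qed.

Lemma std_etale_hat d (P : {mpoly L[4.+1 + (0 + 1)]}) o y : form d P -> Oo o ->
  exists2 c, c != 0 & bev (o, y) (subB ytuple P) = c * ev idfun P (ext (Tht o) (const_mx y : 'rV_1)).
Proof.
move=> fP Ho; have [c c0 Ec] := th_scale Ho; exists (c ^+ d); first by rewrite expf_neq0.
rewrite evE -(evr_scale _ _ _ _ fP) -[c *: _]/(c *: val (Tht o).1) -Ec subB_bev /evr.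
by rewrite /mmap; apply: eq_bigr => m _; congr (_ * _); apply: mmap1_eq => k; rewrite ytuple_bev.
Qed.

Lemma deriv_hat P : (subB ytuple P)^`() = subB ytuple P^`M(yi).
Proof.
rewrite deriv_subB (bigD1 yi) //= big1 ?addr0 => [|k ky].
  rewrite /ytuple; case: splitP => [l /= E|l _]; last by rewrite derivX mulr1.
  by have := ltn_ord l; rewrite -E.
rewrite /ytuple; case: splitP => [l _|l E]; first by rewrite derivC mulr0.
by case/negP: ky; apply/eqP/val_inj; rewrite -[val k]/(nat_of_ord k) E /=; case: l {E} => -[].
Qed.

Lemma std_etale_hat0 d (P : {mpoly L[4.+1 + (0 + 1)]}) o y : form d P -> Oo o ->
  bev (o, y) (subB ytuple P) = 0 <-> ev idfun P (ext (Tht o) (const_mx y : 'rV_1)) = 0.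
Proof.
move=> fP Ho; have [c c0 ->] := std_etale_hat y fP Ho; split=> [/eqP|->]; last by rewrite mulr0.
by rewrite mulf_eq0 (negbTE c0) => /eqP.
Qed.

Variable VV : amb L 4 0 -> Prop.

Lemma base_ext n r l (x : amb L n r) (a : 'rV[L]_l) : base (ext x a) = x.
Proof. by case: x => x b; rewrite /base /ext /= row_mxKl. Qed.

(** The fibre product of [Oo] and [W] over the cubic, inside one ambient product. *)
Definition FP (W : amb L 4 (0 + 1) -> Prop) : amb L 4 (0 + 1 + 12) -> Prop :=
  fun z => exists o y, [/\ Oo o, W (ext (Tht o) (const_mx y : 'rV_1)) & z = fpt o y].

(** A regular function on the fibre product that depends on [o] only is etale-locally rational on
    [Oo]: the equation of [W] becomes a polynomial in [y], and by [deriv_hat] its derivative is the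
    pullback of the derivative in the definition of [std_etale]. *)
Lemma etale_bridge d e (P Q : {mpoly L[4.+1 + (0 + 1)]}) (u : 'rV[L]_12 -> L) U o1 y1 :
  (forall o, Oo o -> VV (Tht o)) -> form d P -> form e Q ->
  let W := std_etale VV P Q in
  Oo o1 -> W (ext (Tht o1) (const_mx y1 : 'rV_1)) -> reg_at idfun (FP W) U (fpt o1 y1) ->
  (forall o y, Oo o -> W (ext (Tht o) (const_mx y : 'rV_1)) -> U (fpt o y) = u o) ->
  etale_at (@Oo L) u o1.
Proof.
move=> OV fP fQ W O1 W1 [d' [G [H [fG fH H1 HU]]]] UE.
have fP' := form_deriv_y fP.
have [Gh HG] := form_hat fG; have [Hh HH] := form_hat fH.
have WP o y : Oo o -> W (ext (Tht o) (const_mx y : 'rV_1)) <->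
  [/\ bev (o, y) (subB ytuple P) = 0, bev (o, y) (subB ytuple P)^`() != 0 & bev (o, y) (subB ytuple Q) != 0].
  move=> Ho; have h1 := std_etale_hat0 y fP Ho; have h2 := std_etale_hat0 y fP' Ho.
  have h3 := std_etale_hat0 y fQ Ho; rewrite deriv_hat; split.
    case=> _ p0 p1 q1; split; first exact/h1.
      by apply: contraNneq p1 => /h2 ->.
    by apply: contraNneq q1 => /h3 ->.
  case=> p0 p1 q1; split; [by rewrite base_ext; apply: OV|exact/h1| |].
    by apply: contraNneq p1 => e1; apply/eqP/h2.
  by apply: contraNneq q1 => e1; apply/eqP/h3.
have [p0 p1 q1] := (WP o1 y1 O1).1 W1.
pose N := subB ytuple P; pose R := subB ytuple Q.
have hh1 : bev (o1, y1) Hh != 0.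
  by have [c c0 Ec] := th_scale O1; rewrite (HH o1 y1 c Ec) mulf_neq0 ?expf_neq0.
apply: (etale_at_of (p := N) (r := R) (g := Gh) (h := Hh) (y1 := y1)) => //.
move=> o y Ho e1 e2 e3 e4; have Wo : W (ext (Tht o) (const_mx y : 'rV_1)) by apply/WP.
have [c c0 Ec] := th_scale Ho; rewrite (HG o y c Ec) (HH o y c Ec) in e4 *.
have Hn : ev idfun H (fpt o y) != 0 by apply: contraNneq e4 => ->; rewrite mulr0.
by rewrite -(UE o y Ho Wo) HU //; [rewrite mulrCA divfK|exists o, y].
Qed.

Lemma form_hat0 d (G : {mpoly L[4.+1 + 0]}) : form d G ->
  exists p : {mpoly L[12]}, forall o c, th o = c *: val (Tht o).1 ->
    p.@[o 0] = c ^+ d * ev idfun G (Tht o).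
Proof.
move=> fG; have [|p Hp] := @pfun_comp L 12 _ G (fun k o => row_mx (th o) (0 : 'rV_0) 0 k).
  move=> k; case: (splitP k) => [l E|[]] //; have -> : k = lshift 0 l by apply: val_inj.
  by apply: pfun_eq (pfun_th l) => o; rewrite row_mxEl.
exists p => o c Ec; rewrite -Hp evE -(evr_scale _ _ _ _ fG) -[c *: _]/(c *: val (Tht o).1) -Ec.
by [].
Qed.

Lemma near_hat (Y : amb L 4 0 -> Prop) (S : amb L 4 0 -> Prop) o1 : Oo o1 -> near idfun Y (Tht o1) S ->
  exists G : {mpoly L[12]}, G.@[o1 0] != 0 /\ forall o, Oo o -> Y (Tht o) -> G.@[o 0] != 0 -> S (Tht o).
Proof.
move=> O1 [d [G [fG G1 GS]]]; have [p Hp] := form_hat0 fG; exists p; split.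
  by have [c c0 Ec] := th_scale O1; rewrite (Hp _ _ Ec) mulf_neq0 ?expf_neq0.
move=> o Ho Yo po; apply: GS => //; have [c c0 Ec] := th_scale Ho.
by apply: contraNneq po => e; rewrite (Hp _ _ Ec) e mulr0.
Qed.

Lemma reg_hat (Y : amb L 4 0 -> Prop) g o1 : Oo o1 -> reg_at idfun Y g (Tht o1) ->
  exists N D : {mpoly L[12]}, D.@[o1 0] != 0 /\
    forall o, Oo o -> Y (Tht o) -> D.@[o 0] != 0 -> g (Tht o) = N.@[o 0] / D.@[o 0].
Proof.
move=> O1 [d [G [H [fG fH H1 E]]]]; have [N HN] := form_hat0 fG; have [D HD] := form_hat0 fH.
exists N, D; split; first by have [c c0 Ec] := th_scale O1; rewrite (HD _ _ Ec) mulf_neq0 ?expf_neq0.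
move=> o Ho Yo Do; have [c c0 Ec] := th_scale Ho.
have Hn : ev idfun H (Tht o) != 0 by apply: contraNneq Do => e; rewrite (HD _ _ Ec) e mulr0.
rewrite E // (HN _ _ Ec) (HD _ _ Ec) -mulf_div divff ?mul1r //; exact: expf_neq0.
Qed.

Lemma Tht_scale o o' c : Oo o -> c != 0 -> th o' = c *: th o -> Tht o' = Tht o.
Proof.
move=> Ho c0 E; congr pair; apply: (@proj_eq _ _ _ _ 1); rewrite scale1r.
have n0 := th_neq0 Ho; have [a a0 Ea] := mkpP n0.
by congr val; apply: (@mkp_eq _ _ _ _ (c * a)); rewrite E ?scaler_eq0 ?negb_or ?c0 // -scalerA -Ea.
Qed.

Lemma Tht_sc l o : Oo o -> (forall i, (i < 6)%N -> l i != 0) -> Tht (sc l o) = Tht o.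
Proof.
move=> Ho l0; apply: (@Tht_scale _ _ (prod6 l)) => //; first by rewrite /prod6 !mulf_neq0 ?l0.
by rewrite /th tht_sc scalemxAl.
Qed.

Lemma Tht_gl a b c d o : Oo o -> a * d - b * c != 0 -> Tht (gl a b c d o) = Tht o.
Proof.
move=> Ho l0; apply: (@Tht_scale _ _ ((a * d - b * c) ^+ 3)) => //; first by rewrite expf_neq0.
by rewrite /th tht_gl scalemxAl.
Qed.

Lemma Tht_lift (v : amb L 4 0) : smooth (val v.1 *m h) -> exists2 o, Oo o & th o = val v.1 /\ Tht o = v.
Proof.
move=> /tht_surj[o Ho E]; exists o => //; have Et : th o = val v.1 by rewrite /th E mulmxK.
split=> //; case: v {E} Et => v w /= Et; congr pair; last by apply/rowP => -[].
by apply: (@mkp_eq _ _ _ _ 1); rewrite ?scale1r //; apply: th_neq0.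
Qed.

Lemma smooth_Tht o : Oo o -> smooth (val (Tht o).1 *m h).
Proof.
move=> Ho; have [c c0 Ec] := th_scale Ho.
rewrite (_ : val _ *m h = c^-1 *: tht o); first by apply: smoothZ; rewrite ?invr_eq0.
by rewrite -[tht o](mulmxKV uh) -/(th o) Ec -scalemxAl scalerA mulVf ?scale1r.
Qed.

End Bridge.

Section MapClosure.
Variables (k L : fieldType) (j : {rmorphism k -> L}).

Lemma regm_at_base n r l (X : amb L n (r + l) -> Prop) x : regm_at j X (@base L n r l) x.
Proof.
have [m Hm] : exists m, val x.1 0 m != 0.
  by apply/rV0Pn; apply: proj_neq0.
split; last first.
  by move=> i; apply: reg_at_eq (reg_at_affine j X x (lshift l i)) => y _; rewrite mxE.
exists (fun i (y : amb L n (r + l)) => val y.1 0 i / val y.1 0 m); split.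
- by move=> i; apply: reg_at_proj.
- by exists m; rewrite divff ?oner_eq0.
have F : form 1 ('X_(lshift (r + l) m) : {mpoly k[n.+1 + (r + l)]}) by apply: formXP.
have := @near_form _ _ j _ _ X x _ _ F; rewrite evXP => /(_ Hm).
apply: nearW => y _; rewrite evXP => ym; exists (val y.1 0 m)^-1; rewrite ?invr_eq0 // => i.
by rewrite mulrC.
Qed.

Lemma regm_at_ext n r n' r' l (X : amb L n r -> Prop) (f : amb L n r -> amb L n' r') (b : amb L n r -> 'rV[L]_l) x :
  regm_at j X f x -> (forall i, reg_at j X (fun y => b y 0 i) x) ->
  regm_at j X (fun y => ext (f y) (b y)) x.
Proof.
move=> [[a [ra ax na]] rb] Hb; split; first by exists a.
move=> i; case: (splitP i) => m E.
  have -> : i = lshift l m by apply: val_inj.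
  by apply: reg_at_eq (rb m) => y _; rewrite row_mxEl.
have -> : i = rshift r' m by apply: val_inj.
by apply: reg_at_eq (Hb m) => y _; rewrite row_mxEr.
Qed.

Lemma reg_at_meval n r (X : amb L n r -> Prop) m (f : amb L n r -> 'rV[L]_m) (P : {mpoly k[m]}) x :
  (forall i, reg_at j X (fun y => f y 0 i) x) -> reg_at j X (fun y => mmap j (f y 0) P) x.
Proof. by move=> H; apply: (reg_at_mmap (g := fun i y => f y 0 i)). Qed.

End MapClosure.

Lemma frac_eqI (A : idomainType) (N D N' D' : A) : D != 0 -> D' != 0 -> N * D' = N' * D ->
  tofrac N / tofrac D = tofrac N' / tofrac D'.
Proof. by move=> D0 D'0 E; apply/eqP; rewrite eqr_div ?tofrac_eq0 // -!tofracM E. Qed.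

Lemma divf_cross (F : fieldType) (a b c d : F) : b != 0 -> d != 0 -> a / b = c / d -> a * d = c * b.
Proof. by move=> b0 d0 /eqP; rewrite eqr_div // => /eqP. Qed.

Lemma fev_cross (L : closedFieldType) (A : idomainType) (pt : Type) (e : pt -> {rmorphism A -> L}) (uA : ufd A)
    (q q' : {fraction A}) o : unitf e q o -> unitf e q' o -> fev e uA q o = fev e uA q' o ->
  e o (fnum uA q * fden uA q') = e o (fnum uA q' * fden uA q).
Proof.
move=> u u' E; have [_ d] := unitf_fev uA u; have [_ d'] := unitf_fev uA u'.
by rewrite !rmorphM; apply: divf_cross.
Qed.

Section FracOpen.
Variables (L : closedFieldType) (n : nat).
Local Notation A := {mpoly L[n]}.
Implicit Types (o : 'rV[L]_n) (q : {fraction A}).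
Local Notation unit_at := (unitf (@pev L n)).
Local Notation val_at := (fev (@pev L n) (@ufd_mpoly L n)).

Lemma frac_eq_open (g : A) q q' : g != 0 ->
  (forall o, g.@[o 0] != 0 -> [/\ unit_at q o, unit_at q' o & val_at q o = val_at q' o]) -> q = q'.
Proof.
move=> g0 H; have [o0 /H[uq uq' _]] := nonroot_row g0; have q0 := unitf_neq0 uq; have q'0 := unitf_neq0 uq'.
have [N0 D0 Eq _] := fnumdenP (@ufd_mpoly L n) q0; have [N0' D0' Eq' _] := fnumdenP (@ufd_mpoly L n) q'0.
move: H Eq Eq'; rewrite /fev; set N := fnum _ q; set D := fden _ q; set N' := fnum _ q'; set D' := fden _ q'.
move=> H Eq Eq'; have E : N * D' = N' * D; last by rewrite Eq Eq'; exact: (frac_eqI D0 D0' E).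
apply: (mpoly_eq_on g0) => o go; have [u u' e] := H o go.
move: (fev_cross u u' e); exact.
Qed.

(** The local fractions agree in the fraction field because nonempty open sets of affine space
    meet. *)
Lemma regular_fraction (S : 'rV[L]_n -> Prop) (f : 'rV[L]_n -> L) (G : A) : G != 0 ->
  (forall o, G.@[o 0] != 0 -> S o) ->
  (forall o1, S o1 -> f o1 != 0 /\ exists N D : A, D.@[o1 0] != 0 /\
     forall o, S o -> D.@[o 0] != 0 -> f o = N.@[o 0] / D.@[o 0]) ->
  exists q : {fraction A}, forall o, S o -> unit_at q o /\ val_at q o = f o.
Proof.
move=> G0 GS loc; have [o0 /GS S0] := nonroot_row G0; have [f0 [N [D [D0 E]]]] := loc o0 S0.
exists (tofrac N / tofrac D) => o So; have [fo [N1 [D1 [D10 E1]]]] := loc o So.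
have Dn := pev_neq0 D0; have D1n := pev_neq0 D10.
have Eq : N * D1 = N1 * D.
  apply: (mpoly_eq_on (mulf_neq0 G0 (mulf_neq0 Dn D1n))) => x.
  rewrite !mevalM !mulf_eq0 !negb_or => /and3P[/GS Sx Dx D1x].
  by apply/eqP; rewrite -eqr_div // -E // -E1.
have N10 : N1.@[o 0] != 0 by apply: contraNneq fo => e; rewrite E1 // e mul0r.
have Eq2 : tofrac N / tofrac D = tofrac N1 / tofrac D1.
  by apply/eqP; rewrite eqr_div ?tofrac_eq0 // -!tofracM Eq.
have u : unit_at (tofrac N / tofrac D) o by exists N1, D1.
split=> //; rewrite (fevE (@ufd_mpoly L n) u Eq2) // E1 //.
Qed.

End FracOpen.

(** * Trivialization on A^12 of the line bundles of the cubic *)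

Section Pullback.
Variables (L : closedFieldType) (h : 'M[L]_5).
Hypothesis uh : h \in unitmx.
Variable VV : amb L 4 0 -> Prop.
Hypothesis VP : forall v, VV v <-> smooth (val v.1 *m h).
Local Notation Tht := (@Tht L h).
Local Notation unit_at := (unitf (@pev L 12)).
Local Notation val_at := (fev (@pev L 12) (@ufd_mpoly L 12)).
Implicit Types (o : 'rV[L]_12).

Lemma V_Tht o : Oo o -> VV (Tht o). Proof. by move=> Ho; apply/VP/smooth_Tht. Qed.
Lemma V_lift v : VV v -> exists2 o, Oo o & Tht o = v.
Proof. by move=> /VP/(Tht_lift uh)[o Ho [_ E]]; exists o. Qed.

Definition Wopen := open_point (Wp_neq0 L) (@Wp_Oo L).

(** Pulled back to A^12, transition functions become elements of one fraction field and satisfy the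
    cocycle identity there. Those from a base point are local generators, which [picard_open]
    compares with a global one; [Z x] is the quotient. *)
Lemma zeta_exists (c : cocycle VV) : exists Z : amb L 4 0 -> {fraction {mpoly L[12]}},
  (forall x o, VV x -> Oo o -> nbh c x (Tht o) -> unit_at (Z x) o) /\
  (forall x y o, VV x -> VV y -> Oo o -> nbh c x (Tht o) -> nbh c y (Tht o) ->
     trf c x y (Tht o) * val_at (Z x) o = val_at (Z y) o).
Proof.
have G_ex x : exists G : {mpoly L[12]}, VV x -> G != 0 /\ (forall o, Oo o -> G.@[o 0] != 0 -> nbh c x (Tht o)) /\
    (forall o, Oo o -> Tht o = x -> G.@[o 0] != 0).
  have [Vx|nV] := pselect (VV x); last by exists 0 => /nV.
  have [d [F [fF Fx FG]]] := nbh_open Vx Vx (nbh_self c Vx).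
  have [G HG] := form_hat0 h fF; exists G => _.
  have nz o : Oo o -> Tht o = x -> G.@[o 0] != 0.
    by move=> Ho E; have [a a0 Ea] := th_scale uh Ho; rewrite (HG _ _ Ea) E mulf_neq0 ?expf_neq0.
  have [o Ho Eo] := V_lift Vx; split; first exact: (pev_neq0 (nz o Ho Eo)).
  split=> // o' Ho' Go'; apply: FG; first exact: V_Tht.
  by have [a a0 Ea] := th_scale uh Ho'; apply: contraNneq Go' => e; rewrite (HG _ _ Ea) e mulr0.
have [G HG] := choice G_ex.
have t_ex (xy : amb L 4 0 * amb L 4 0) : exists q, VV xy.1 -> VV xy.2 -> forall o,
    Oo o -> nbh c xy.1 (Tht o) -> nbh c xy.2 (Tht o) -> unit_at q o /\ val_at q o = trf c xy.1 xy.2 (Tht o).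
  case: xy => x y /=; have [[Vx Vy]|nV] := pselect (VV x /\ VV y); last by exists 0 => Vx Vy; case: nV.
  have [Gx0 [GxS _]] := HG x Vx; have [Gy0 [GyS _]] := HG y Vy.
  have := @regular_fraction L 12 (fun o => [/\ Oo o, nbh c x (Tht o) & nbh c y (Tht o)])
    (fun o => trf c x y (Tht o)) (Wp L * (G x * G y)).
  case=> [||o1 [O1 n1 n2]|q Hq].
  - by rewrite !mulf_neq0 ?Wp_neq0.
  - move=> o; rewrite !mevalM !mulf_eq0 !negb_or => /and3P[/Wp_Oo Ho gx gy].
    by split=> //; [apply: GxS|apply: GyS].
  - have V1 := V_Tht O1; split; first exact: trf_neq0.
    have [//|N [D [D1 E]]] := reg_hat uh O1 (@trf_reg _ _ _ _ c _ _ Vx Vy _ _); exists N, D; split=> // o [Ho na nb] Do.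
    by rewrite -E // ; split=> //; apply: V_Tht.
  by exists q => _ _ o Ho na nb; apply: Hq.
have [t Ht] := choice t_ex.
have tE x y o : VV x -> VV y -> Oo o -> nbh c x (Tht o) -> nbh c y (Tht o) ->
    unit_at (t (x, y)) o /\ val_at (t (x, y)) o = trf c x y (Tht o).
  by move=> Vx Vy; apply: (Ht (x, y)).
have t_mul x y w : VV x -> VV y -> VV w -> t (x, w) = t (y, w) * t (x, y).
  move=> Vx Vy Vw; have [Gx0 [GxS _]] := HG x Vx; have [Gy0 [GyS _]] := HG y Vy; have [Gw0 [GwS _]] := HG w Vw.
  apply: (@frac_eq_open _ _ (Wp L * (G x * (G y * G w)))).
    by rewrite !mulf_neq0 ?Wp_neq0.
  move=> o; rewrite !mevalM !mulf_eq0 !negb_or => /and4P[/Wp_Oo Ho gx gy gw].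
  have [nx ny nw] : [/\ nbh c x (Tht o), nbh c y (Tht o) & nbh c w (Tht o)].
    by split; [apply: GxS|apply: GyS|apply: GwS].
  have [u1 e1] := tE _ _ _ Vx Vw Ho nx nw; have [u2 e2] := tE _ _ _ Vx Vy Ho nx ny.
  have [u3 e3] := tE _ _ _ Vy Vw Ho ny nw; split; [exact: u1|exact: (unitfM u3 u2)|].
  by rewrite (fevM _ u3 u2) e1 e2 e3; apply: trf_cocycle => //; apply: V_Tht.
have [o0 [O0 _]] := Wopen (oner_neq0 _); set x0 := Tht o0; have V0 := V_Tht O0.
have t0 x y : VV x -> VV y -> t (x, y) != 0.
  move=> Vx Vy; have [Gx0 [GxS _]] := HG x Vx; have [Gy0 [GyS _]] := HG y Vy.
  have [o [Ho]] := Wopen (mulf_neq0 Gx0 Gy0); rewrite mevalM mulf_nz => /andP[gx gy].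
  have [u _] := tE _ _ _ Vx Vy Ho (GxS _ Ho gx) (GyS _ Ho gy); exact: (unitf_neq0 u).
(* The value 1 off [Oo] keeps [q] nonzero everywhere, as [picard_open] requires. *)
pose q o := if pselect (Oo o) then t (x0, Tht o) else 1.
have qE o : Oo o -> q o = t (x0, Tht o) by rewrite /q; case: pselect.
have q0 o : q o != 0.
  by rewrite /q; case: pselect => Ho; [apply: t0 => //; apply: V_Tht|apply: oner_neq0].
have [||R R0 HR] := @picard_open _ _ _ (@pev L 12) (@ufd_mpoly L 12) _ (@Oo_codim2 L) q (fun o => G (Tht o)) o0 O0 q0.
- by move=> o Ho; have [_ [_]] := HG _ (V_Tht Ho); apply.
- move=> o1 o2 o O1 O2 Ho g1 g2; rewrite !qE // (t_mul x0 (Tht o1) (Tht o2)) //; try exact: V_Tht.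
  rewrite mulfK; last by apply: t0 => //; apply: V_Tht.
  have [_ [S1 _]] := HG _ (V_Tht O1); have [_ [S2 _]] := HG _ (V_Tht O2).
  by case: (tE _ _ _ (V_Tht O1) (V_Tht O2) Ho (S1 _ Ho g1) (S2 _ Ho g2)).
exists (fun x => t (x0, x) / R); have uZ x o : VV x -> Oo o -> nbh c x (Tht o) -> unit_at (t (x0, x) / R) o.
  move=> Vx Ho nx; have Vo := V_Tht Ho; rewrite (t_mul x0 (Tht o) x) // -mulrA; apply: unitfM.
    by case: (tE _ _ _ Vo Vx Ho (nbh_self c Vo) nx).
  by rewrite -qE //; apply: HR.
split=> // x y o Vx Vy Ho nx ny; have [u e] := tE _ _ _ Vx Vy Ho nx ny.
by rewrite (t_mul x0 x y) // -mulrA -e -fevM //; apply: uZ.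
Qed.

End Pullback.

Lemma near_inter (k L : fieldType) (j : {rmorphism k -> L}) n r (X S : amb L n r -> Prop) x P :
  near j X x S -> near j (fun y => X y /\ S y) x P -> near j X x P.
Proof.
case=> d [E [fE Ex ES]] [e [G [fG Gx GP]]]; exists (d + e)%N, (E * G); split.
- exact: formM.
- by rewrite evM mulf_neq0.
by move=> y Xy; rewrite evM mulf_nz => /andP[/(ES _ Xy) Sy Gy]; apply: GP.
Qed.

Lemma reg_at_local (k L : fieldType) (j : {rmorphism k -> L}) n r (X S : amb L n r -> Prop) g x :
  near j X x S -> reg_at j (fun y => X y /\ S y) g x -> reg_at j X g x.
Proof.
case=> e [E [fE Ex ES]] [d [G [H [fG fH Hx gE]]]].
exists (e + d)%N, (E * G), (E * H); split; try exact: formM.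
  by rewrite evM mulf_neq0.
move=> y Xy; rewrite !evM mulf_nz => /andP[Ey Hy].
by rewrite gE // ?invfM ?mulrA; [field; rewrite Ey Hy|split=> //; apply: ES].
Qed.

Section EtaleGeneric.
Variables (L : closedFieldType) (n : nat) (O : 'rV[L]_n -> Prop).
Variable E0 : {mpoly L[n]}.
Hypotheses (E00 : E0 != 0) (OE : forall o : 'rV[L]_n, E0.@[o 0] != 0 -> O o).
Implicit Type o : 'rV[L]_n.

Lemma etale_fraction u o1 : etale_at O u o1 ->
  exists N D : {mpoly L[n]}, D != 0 /\ forall o, D.@[o 0] != 0 -> O o /\ u o = N.@[o 0] / D.@[o 0].
Proof.
case=> p [r [g [h [y1 [pp p1 nz E]]]]]; have [N [D [D0 HD]]] := etale_rational g pp p1 nz.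
exists (E0 * N), (E0 * D); split; first by rewrite mulf_neq0.
move=> o; rewrite !mevalM mulf_nz => /andP[e0 d0]; have Ho := OE e0; split=> //.
have [_ H] := HD o d0; rewrite -mulf_div divff // mul1r; apply: H => y py ny; exact: E.
Qed.

(** The indicator of [S] is generically rational and idempotent, hence generically 0 or 1; its value
    1 at [o1] decides. This transports open conditions along maps that are regular only etale
    locally. *)
Lemma etale_generic (S : 'rV[L]_n -> Prop) o1 : O o1 -> S o1 -> etale_at O (fun o => (`[< S o >])%:R) o1 ->
  exists D : {mpoly L[n]}, D != 0 /\ forall o, D.@[o 0] != 0 -> O o /\ S o.
Proof.
move=> O1 S1 et; have [N [D [D0 H]]] := etale_fraction et.
have : N * (N - D) = 0.
  apply: (mpoly_eq_on D0) => o Do; have [_] := H o Do; rewrite mevalM mevalB meval0.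
  move=> e; have -> : N.@[o 0] = (`[< S o >])%:R * D.@[o 0] by rewrite e divfK.
  by case: asboolP => _ /=; rewrite ?mul1r ?subrr ?mulr0 // !mul0r.
move/eqP; rewrite mulf_eq0 subr_eq0 => /orP[] /eqP e.
  have := etale_cross (N := 0) (D := 1) et O1 D0.
  rewrite meval0 meval1 mulr1 (asboolT S1) => H1; have : (1 : L) = 0.
    by apply: H1 => o Do; have [Ho ->] := H o Do; split=> //; rewrite e meval1 meval0 mul0r mulr1.
  by move/eqP; rewrite oner_eq0.
exists D; split=> // o Do; have [Ho] := H o Do; rewrite e divff // => E; split=> //.
by apply: contrapT => nS; move: E; rewrite (asboolF nS) => /esym/eqP; rewrite oner_eq0.
Qed.

End EtaleGeneric.

Lemma ratio_id (F : fieldType) (s a b s0 a0 b0 ta tb : F) : a != 0 -> b != 0 -> s0 != 0 -> a0 != 0 -> b0 != 0 ->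
  ta != 0 -> tb != 0 ->
  s / s0 / (a / a0 * (b / b0)) = s / (ta * tb) / s0 / (a / ta / a0 * (b / tb / b0)).
Proof. by move=> *; field; do !(apply/andP; split). Qed.

Lemma etale_at_rat (L : closedFieldType) n (O : 'rV[L]_n -> Prop) u (o1 : 'rV[L]_n) (N D G : {mpoly L[n]}) :
  D.@[o1 0] != 0 -> G.@[o1 0] != 0 ->
  (forall o : 'rV[L]_n, O o -> G.@[o 0] != 0 -> D.@[o 0] != 0 -> u o = N.@[o 0] / D.@[o 0]) -> etale_at O u o1.
Proof.
move=> D1 G1 E; apply: (@etale_at_of _ _ _ _ _ 'X G%:P N%:P D%:P 0).
- by rewrite bevE map_polyX hornerX.
- by rewrite derivX bevE rmorph1 hornerC oner_neq0.
- by rewrite bevC.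
- by rewrite bevC.
by move=> o y Ho _ _; rewrite !bevC => Go Do; rewrite E // divfK.
Qed.

(** In characteristic zero 2 is not a root of unity, so its powers determine exponents; weights are
    compared in this way. *)
Lemma pow2_inj (L : fieldType) (m n : int) : [pchar L] =i pred0 -> (2%:R : L) ^ m = 2%:R ^ n -> m = n.
Proof.
move=> c0; have [/(_ c0) cz _] := pcharf0P L; have t0 : (2%:R : L) != 0 by rewrite cz.
suff H k : (2%:R : L) ^ (k : int) = 1 -> k = 0.
  by move=> E; apply/eqP; rewrite -subr_eq0; apply/eqP/H; rewrite expfzDr // E -invr_expz mulfV // expfz_neq0.
have nat_case e : (2%:R : L) ^+ e.+1 = 1 -> False.
  rewrite -natrX => /eqP; rewrite -subr_eq0 -(@natrB _ _ 1) ?expn_gt0 //.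
  have e1 : (0 < 2 ^ e.+1 - 1)%N by rewrite subn_gt0 -{1}(expn0 2) ltn_exp2l.
  by rewrite cz; case: (2 ^ _ - 1)%N e1.
case: k => [[|e]|e] //.
  by move/nat_case.
rewrite NegzE -exprnN => E; case: (@nat_case e); by rewrite -[LHS]invrK E invr1.
Qed.

Lemma pfun_sum (L : closedFieldType) n I (s : seq I) (F : I -> 'rV[L]_n -> L) :
  (forall i, pfun (F i)) -> pfun (fun o => \sum_(i <- s) F i o).
Proof.
move=> HF; elim: s => [|i s IH].
  by apply: (@pfun_eq _ _ (fun=> 0)) (pfunC _ 0) => o; rewrite big_nil.
by apply: pfun_eq (pfunD (HF i) IH) => o; rewrite big_cons.
Qed.

Lemma pfun_mulmx (L : closedFieldType) n m (M : 'M[L]_(n, m)) k : pfun (fun v : 'rV[L]_n => (v *m M) 0 k).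
Proof.
apply: (@pfun_eq _ _ (fun v => \sum_i v 0 i * M i k)); first by move=> v; rewrite mxE.
by apply: pfun_sum => i; apply: pfunM; [apply: pfunX|apply: pfunC].
Qed.

Lemma inv_swap (F : fieldType) (s t u : F) : u * s = t -> s != 0 -> t != 0 -> 1 / s = t^-1 * u.
Proof. by move=> E s0 t0; apply: (mulfI t0); rewrite mulVKf // mul1r -E mulfK. Qed.

Lemma coord_neq0 (L : fieldType) n (v : proj L n) : exists l, val v 0 l != 0.
Proof. exact/rV0Pn/proj_neq0. Qed.

Definition nzc (L : fieldType) n (v : proj L n) := projT1 (cid (coord_neq0 v)).
Lemma nzcP (L : fieldType) n (v : proj L n) : val v 0 (nzc v) != 0.
Proof. by rewrite /nzc; case: cid. Qed.

Lemma ratio_sec (F : fieldType) (r e u w : F) : u != 0 -> r * e * w = r * (u * w) * (e / u).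
Proof. by move=> u0; field. Qed.
Lemma ratio_mul (F : fieldType) (r r' x y w : F) : y != 0 -> r' * r * (x * w) = r' * (y * w) * (r * (x / y)).
Proof. by move=> y0; field. Qed.

Lemma pen_cross (F : fieldType) (A B s t : F) : s * A = - (t * B) -> (s != 0) || (B != 0) -> (t != 0) || (A != 0) ->
  let r := if B != 0 then A / B else - t / s in let r' := if A != 0 then B / A else - s / t in
  [/\ r != 0, r' != 0, r * r' = 1, A = r * B & B = r' * A].
Proof.
move=> E; have [B0|/negbNE/eqP B0] := boolP (B != 0) => /=; have [A0|/negbNE/eqP A0] := boolP (A != 0) => /=.
- by move=> _ _; rewrite !mulf_neq0 ?invr_eq0 // !divfK //; split=> //; field; rewrite A0 B0.
- move=> _; rewrite orbF => t0; move/eqP: E; rewrite A0 mulr0 eq_sym oppr_eq0 mulf_eq0 (negPf B0) (negPf t0); by [].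
- rewrite orbF => s0; move/eqP: E; rewrite B0 mulr0 oppr0 mulf_eq0 (negPf A0) (negPf s0); by [].
rewrite !orbF => s0 t0; rewrite A0 B0 !mulr0 !mulf_neq0 ?invr_eq0 ?oppr_eq0 //.
by split=> //; field; rewrite s0 t0.
Qed.

Lemma rest_cross (F : fieldType) (k A B s t pD rA rB g : F) : k != 0 -> k * A = pD * rA -> k * B = pD * rB ->
  k ^+ 2 * s = rB * g -> k ^+ 2 * t = - (rA * g) -> rA != 0 -> rB != 0 ->
  (s != 0) || (B != 0) -> (t != 0) || (A != 0) ->
  rA = (if B != 0 then A / B else - t / s) * rB /\ rB = (if A != 0 then B / A else - s / t) * rA.
Proof.
move=> k0 EA EB Es Et a0 b0.
have {}EA : A = pD * rA / k by rewrite -EA mulrC mulKf.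
have {}EB : B = pD * rB / k by rewrite -EB mulrC mulKf.
have {}Es : s = rB * g / k ^+ 2 by rewrite -Es mulrC mulKf ?expf_neq0.
have {}Et : t = - (rA * g) / k ^+ 2 by rewrite -Et mulrC mulKf ?expf_neq0.
rewrite {}EA {}EB {}Es {}Et !mulf_eq0 !oppr_eq0 !mulf_eq0 !invr_eq0 (negPf a0) (negPf b0) (negPf k0) expf_eq0 (negPf k0) /= !orbF.
have [p0|/negbNE/eqP p0] := boolP (pD != 0) => /=.
  by move=> _ _; split; field; rewrite ?p0 ?a0 ?b0 ?k0.
rewrite !orbF => g0 _; have : k ^+ 2 != 0 by rewrite expf_neq0.
move: (k ^+ 2) => q q0; split; field; rewrite ?oppr_eq0 ?mulf_neq0 ?q0 ?g0 ?a0 ?b0 //.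
Qed.

Lemma cancel_const_pencil (F : fieldType) (k r l d q : F) : k != 0 -> r / l / d = k -> k^-1 * (q * r / l / d) = q.
Proof. by move=> k0 E; rewrite -!mulrA [r * _]mulrA E mulrCA mulVf ?mulr1. Qed.

Lemma rest_ratio (F : fieldType) (r q k x z d : F) : r != 0 -> k != 0 -> x != 0 -> z != 0 -> d != 0 ->
  r * q / (k * z) / (r * (x / z) * d) = q / (k * x) / d.
Proof. by move=> *; field; do !(apply/andP; split). Qed.

(** * The line bundle of a plane given by two equations *)

Section Pencil.
Variables (L : fieldType) (n : nat) (VV : amb L n 0 -> Prop).
Local Notation pt := (amb L n 0).
Variables (A B s t : {mpoly L[n.+1 + 0]}).
Hypotheses (fA : form 1 A) (fB : form 1 B) (fs : form 2 s) (ft : form 2 t).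
Local Notation "F @ z" := (ev (idfun : {rmorphism L -> L}) F z) (at level 10, z at next level).
Hypothesis rel : forall z, VV z -> s @ z * A @ z + t @ z * B @ z = 0.
Hypothesis cover : forall z, VV z -> (s @ z != 0) || (B @ z != 0) || ((t @ z != 0) || (A @ z != 0)).
Implicit Types (x y z w : pt) (b : bool).

(** The plane is [A = B = 0], with [s A + t B = 0] on the variety. Where [s] or [B] is nonzero, [A]
    is a multiple of [B] and the local equation is [B]; otherwise [cover] makes [t] or [A] nonzero
    and it is [A]. The boolean records which. *)
Definition pen_ty x := (s @ x != 0) || (B @ x != 0).
Definition pen_eq b : {mpoly L[n.+1 + 0]} := if b then B else A.
Definition pen_in b z := if b then (s @ z != 0) || (B @ z != 0) else (t @ z != 0) || (A @ z != 0).
Definition pen_rat b b' z := if b == b' then 1 else if b then (if B @ z != 0 then A @ z / B @ z else - t @ z / s @ z)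
  else if A @ z != 0 then B @ z / A @ z else - s @ z / t @ z.

Lemma pen_rel z : VV z -> s @ z * A @ z = - (t @ z * B @ z).
Proof. by move=> Vz; apply/eqP; rewrite -addr_eq0 rel. Qed.

Lemma pen_ratE b b' z : VV z -> pen_in b z -> pen_in b' z ->
  pen_rat b b' z != 0 /\ pen_rat b b' z * pen_rat b' b z = 1 /\ (pen_eq b') @ z = pen_rat b b' z * (pen_eq b) @ z.
Proof.
move=> Vz; have := pen_cross (pen_rel Vz); rewrite /pen_rat /pen_in /pen_eq.
case: b; case: b' => /= X i1 i2; rewrite ?mul1r ?oner_neq0 //.
  by have [? ? ? ? ?] := X i1 i2.
by have [? ? e ? ?] := X i2 i1; split=> //; split=> //; rewrite mulrC.
Qed.

Lemma pen_rat_mul b b' b2 z : VV z -> pen_in b z -> pen_in b' z -> pen_in b2 z ->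
  pen_rat b b2 z = pen_rat b' b2 z * pen_rat b b' z.
Proof.
move=> Vz i1 i2 i3; have [<-|n1] := eqVneq b b'; first by rewrite /pen_rat eqxx mulr1.
have [<-|n2] := eqVneq b' b2; first by rewrite [in RHS]/pen_rat eqxx mul1r.
have <- : b = b2 by case: b b' b2 n1 n2 {i1 i2 i3} => [] [] [].
by have [_ [-> _]] := pen_ratE Vz i2 i1; rewrite /pen_rat eqxx.
Qed.

Lemma pen_rat_reg b b' z : VV z -> pen_in b z -> pen_in b' z -> reg_at idfun VV (pen_rat b b') z.
Proof.
move=> Vz; rewrite /pen_rat /pen_in; case: b; case: b' => /=; try by move=> _ _; apply: reg_at1.
  have [B0 _ _|/negbNE/eqP B0] := boolP (B @ z != 0).
    by exists 1%N, A, B; split=> // y Vy ->.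
  rewrite orbF => s0 _; exists 2%N, (- t), s; split=> //; first exact: formN.
  move=> y Vy sy; rewrite evN; case: ifP => // By; apply/eqP; rewrite eqr_div // mulrC pen_rel //.
  by rewrite mulNr.
have [A0 _ _|/negbNE/eqP A0] := boolP (A @ z != 0).
  by exists 1%N, B, A; split=> // y Vy ->.
rewrite orbF => t0 _; exists 2%N, (- s), t; split=> //; first exact: formN.
move=> y Vy ty; rewrite evN; case: ifP => // Ay; apply/eqP; rewrite eqr_div // mulNr pen_rel //.
by rewrite opprK mulrC.
Qed.

Definition pen_nbh x z := pen_in (pen_ty x) z /\ val z.1 0 (nzc x.1) != 0.
(** The second factor compares the coordinates by which the linear forms are dehomogenized at [x]
    and [y]. *)
Definition pen_trf x y z := pen_rat (pen_ty x) (pen_ty y) z * (val z.1 0 (nzc x.1) / val z.1 0 (nzc y.1)).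

Lemma pen_ty_in x : VV x -> pen_in (pen_ty x) x.
Proof.
move=> Vx; rewrite /pen_ty /pen_in; by have := cover Vx; case: ((s @ x != 0) || (B @ x != 0)).
Qed.

Lemma formX0 l : form 1 ('X_(lshift 0 l) : {mpoly L[n.+1 + 0]}). Proof. exact: formXP. Qed.

Lemma pen_open x : open_in idfun VV (pen_nbh x).
Proof.
move=> z Vz [iz lz]; move: iz; rewrite /pen_in.
have go d (F : {mpoly L[n.+1 + 0]}) : form d F -> F @ z != 0 -> (forall y, F @ y != 0 -> pen_in (pen_ty x) y) ->
   exists d G, [/\ form d G, G @ z != 0 & forall y, VV y -> G @ y != 0 -> pen_nbh x y].
  move=> fF Fz HF; exists (d + 1)%N, (F * 'X_(lshift 0 (nzc x.1))); split; first exact: formM fF (formX0 _).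
    by rewrite evM evXP mulf_neq0.
  by move=> y _; rewrite evM evXP mulf_nz => /andP[Fy ly]; split=> //; apply: HF.
case E : (pen_ty x) go => go /orP[] nz.
- by apply: (go _ _ fs nz) => y Fy; rewrite /pen_in Fy.
- by apply: (go _ _ fB nz) => y Fy; rewrite /pen_in Fy orbT.
- by apply: (go _ _ ft nz) => y Fy; rewrite /pen_in Fy.
- by apply: (go _ _ fA nz) => y Fy; rewrite /pen_in Fy orbT.
Qed.

Program Definition pencil : cocycle VV := @Cocycle _ _ _ VV pen_nbh pen_trf _ _ _ _ _.
Next Obligation. exact: pen_open. Qed.
Next Obligation. by split; [apply: pen_ty_in|apply: nzcP]. Qed.
Next Obligation.
move=> z [Vz [i1 l1] [i2 l2]]; apply: (@reg_at_sub _ _ _ _ _ VV); first by move=> u [].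
by apply: reg_atM; [apply: pen_rat_reg|apply: reg_at_proj].
Qed.
Next Obligation.
by case: H2 H3 => i1 l1 [i2 l2]; have [? _] := pen_ratE H1 i1 i2; rewrite /pen_trf !mulf_neq0 ?invr_eq0.
Qed.
Next Obligation.
case: H3 H4 H5 => i1 l1 [i2 l2] [i3 l3]; rewrite /pen_trf (pen_rat_mul H2 i1 i2 i3); exact: ratio_mul.
Qed.

Definition pen_sec x z := (pen_eq (pen_ty x)) @ z / val z.1 0 (nzc x.1).

Lemma pen_sec_trf x y z : VV z -> pen_nbh x z -> pen_nbh y z -> pen_sec y z = pen_trf x y z * pen_sec x z.
Proof.
move=> Vz [i1 l1] [i2 l2]; rewrite /pen_sec /pen_trf; have [_ [_ ->]] := pen_ratE Vz i1 i2.
exact: ratio_sec.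
Qed.

Lemma pen_sec_reg x z : VV z -> pen_nbh x z -> reg_at idfun VV (pen_sec x) z.
Proof.
move=> Vz [i1 l1]; exists 1%N, (pen_eq (pen_ty x)), 'X_(lshift 0 (nzc x.1)); split.
- by rewrite /pen_eq; case: pen_ty.
- exact: formX0.
- by rewrite evXP.
by move=> y _; rewrite evXP.
Qed.

End Pencil.

Section Cofactors.
Variables (R : comNzRingType) (t : nat -> R).
Local Notation m3 k := (k %% 3)%N.

(** On A^12 the two equations of a plane are its minor times [rA] and [rB], and the coefficients of
    their relation are [rB g] and [- rA g]: the common factor is the pullback of the plane. The next
    two lemmas do the same for the minors [pP] and [pQ]. *)
Lemma cofactor_D a b : (a < 3)%N -> (b < 3)%N ->
  let i := m3 (a + b) in let j := m3 (b + 3 - a) in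
  let a1 := m3 (a + 1) in let a2 := m3 (a + 2) in let b1 := m3 (b + 1) in let b2 := m3 (b + 2) in
  let rA := mm t a1 b2 * mm t a2 b1 in let rB := mm t a1 b1 * mm t a2 b2 in
  let g := mm t a b1 * mm t a b2 * (mm t a1 b * mm t a2 b) in
  [/\ fX t i = mm t a b * rA, fY t j = mm t a b * rB, fX t (m3 (i + 1)) * fX t (m3 (i + 2)) = rB * g
    & - (fY t (m3 (j + 1)) * fY t (m3 (j + 2))) = - (rA * g)].
Proof. by case: a => [|[|[|//]]]; case: b => [|[|[|//]]] _ _ /=; rewrite /fX /fY /=; split; ring. Qed.

Lemma cofactor_P a : (a < 3)%N ->
  let x k := fX t (m3 (a + k)) in let y k := fY t (m3 (k + 3 - a)) in
  let a1 := m3 (a + 1) in let a2 := m3 (a + 2) in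
  let rA := - (mm t a 0 * pQ t 0) in let rB := - (mm t a 1 * pQ t 1) in
  let g := - (mm t a1 1 * mm t a2 2 * (mm t a2 0 * pP t a2)) in
  [/\ x 0%N - y 0%N = pP t a * rA, x 1%N - y 1%N = pP t a * rB, x 1%N * x 2%N - y 0%N * y 1%N = rB * g
    & y 0%N * (x 2%N - y 1%N) = - (rA * g)].
Proof.
by case: a => [|[|[|//]]] _ /=; rewrite /fX /fY /pP /pQ /= /mm /pl /=; split; ring.
Qed.

Lemma cofactor_Q b : (b < 3)%N ->
  let x k := fX t (m3 (k + b)) in let y k := fY t (m3 (b + 3 - k)) in
  let b1 := m3 (b + 1) in let b2 := m3 (b + 2) in
  let rA := - (mm t 0 b * pP t 0) in let rB := - (mm t 1 b * pP t 1) in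
  let g := - (mm t 1 b1 * mm t 2 b2 * (mm t 0 b2 * pQ t b2)) in
  [/\ x 0%N - y 0%N = pQ t b * rA, x 1%N - y 1%N = pQ t b * rB, x 1%N * x 2%N - y 0%N * y 1%N = rB * g
    & y 0%N * (x 2%N - y 1%N) = - (rA * g)].
Proof.
by case: b => [|[|[|//]]] _ /=; rewrite /fX /fY /pP /pQ /= /mm /pl /=; split; ring.
Qed.

End Cofactors.

Lemma det_frac (F : fieldType) (p a b c d : F) : p != 0 ->
  a / p * - (d / p) - (- (b / p)) * (c / p) = (b * c - a * d) / (p * p).
Proof. by move=> p0; field. Qed.

(** Cramer's rule with respect to columns [i] and [j] gives the matrix; equality of all minors makes
    it correct on every column and of determinant 1. *)
Lemma plucker_sl2 (L : closedFieldType) (o o' : 'rV[L]_12) i j : (i < 6)%N -> (j < 6)%N -> pl (co o) i j != 0 ->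
  (forall a b, (a < 6)%N -> (b < 6)%N -> pl (co o) a b = pl (co o') a b) ->
  exists A B C D, A * D - B * C = 1 /\ o' = gl A B C D o.
Proof.
move=> i6 j6 p0 E; have Eij := E i j i6 j6.
pose d x y x' y' : L := (x' * y - x * y') / pl (co o) i j.
exists (d (co o (6 + i)) (co o (6 + j)) (co o' i) (co o' j)), (- d (co o i) (co o j) (co o' i) (co o' j)),
       (d (co o (6 + i)) (co o (6 + j)) (co o' (6 + i)) (co o' (6 + j))),
       (- d (co o i) (co o j) (co o' (6 + i)) (co o' (6 + j))).
have cramer (y : nat -> L) k : (k < 6)%N -> 
    y k * pl (co o') i j = y i * pl (co o') k j + y j * pl (co o') i k ->
    y k = d (co o (6 + i)) (co o (6 + j)) (y i) (y j) * co o k - d (co o i) (co o j) (y i) (y j) * co o (6 + k).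
  move=> k6; rewrite -!E // => e; apply: (mulIf p0); rewrite e /d mulrBl ![_ / _ * _]mulrAC.
  by rewrite !mulfK // /pl; ring.
split.
  rewrite /d det_frac //; apply: (mulIf (mulf_neq0 p0 p0)); rewrite divfK ?mulf_neq0 // mul1r {2}Eij.
  by rewrite /pl; ring.
apply: eq12 => k k12; rewrite co_mk //; case: ltnP => k6.
  by rewrite (cramer (fun n => co o' n) k) //; [rewrite mulNr|rewrite /pl; ring].
have e : k = (6 + (k - 6))%N by lia.
rewrite {1}e (cramer (fun n => co o' (6 + n)) (k - 6)%N); first by rewrite mulNr -e.
  by lia.
by rewrite /pl; ring.
Qed.

Section LinearForms.
Variables (L : closedFieldType) (h : 'M[L]_5).
Implicit Types (x : amb L 4 0).
Local Notation "F @ x" := (ev (idfun : {rmorphism L -> L}) F x) (at level 10, x at next level).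

Definition zF k : {mpoly L[4.+1 + 0]} := \sum_m h m (inord k) *: 'X_(lshift 0 m).
Lemma form_zF k : form 1 (zF k).
Proof. by apply: form_sum => m _; apply/formZ/formXP. Qed.
Lemma zFE k x : zF k @ x = c5 (val x.1 *m h) k.
Proof.
rewrite /c5 [RHS]mxE /zF ev_sum; apply: eq_bigr => m _.
by rewrite evZ evXP mulrC.
Qed.

Definition XF i := nth 0 [:: zF 0; zF 1; zF 2 + zF 3 + zF 4 - zF 0 - zF 1] i.
Definition YF j := nth 0 [:: zF 2; zF 3; zF 4] j.
Lemma form_XF i : form 1 (XF i).
Proof.
case: i => [|[|[|i]]]; rewrite /XF /=; try exact: form_zF; last by rewrite nth_nil; apply: form0.
by do !apply: formD; try apply: formN; apply: form_zF.
Qed.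
Lemma form_YF j : form 1 (YF j).
Proof. by case: j => [|[|[|j]]]; rewrite /YF /=; try exact: form_zF; rewrite nth_nil; apply: form0. Qed.
Lemma XFE i x : (i < 3)%N -> XF i @ x = Xc (val x.1 *m h) i.
Proof. by case: i => [|[|[|//]]] _; rewrite /XF /Xc /= ?evD ?evN !zFE. Qed.
Lemma YFE j x : (j < 3)%N -> YF j @ x = Yc (val x.1 *m h) j.
Proof. by case: j => [|[|[|//]]] _; rewrite /YF /Yc /= zFE. Qed.

Lemma XF_Tht o i k : h \in unitmx -> (i < 3)%N -> th h o = k *: val (Tht h o).1 -> k * XF i @ (Tht h o) = fX (co o) i.
Proof. by move=> uh i3 E; rewrite XFE // -XcZ scalemxAl -E /th mulmxKV // Xc_tht. Qed.
Lemma YF_Tht o j k : h \in unitmx -> (j < 3)%N -> th h o = k *: val (Tht h o).1 -> k * YF j @ (Tht h o) = fY (co o) j.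
Proof. by move=> uh j3 E; rewrite YFE // -YcZ scalemxAl -E /th mulmxKV // Yc_tht. Qed.

End LinearForms.

Lemma not_smooth (L : closedFieldType) (z : 'rV[L]_5) w :
  (forall i, (i < 3)%N -> Xc z ((i + 1) %% 3) * Xc z ((i + 2) %% 3) = w) ->
  (forall j, (j < 3)%N -> Yc z ((j + 1) %% 3) * Yc z ((j + 2) %% 3) = w) -> ~ smooth z.
Proof. by move=> HX HY [_ [i [j [i3 j3 /eqP[]]]]]; rewrite /qf HX // HY // subrr. Qed.

Section Permutations.
Variable L : closedFieldType.

(** What is used about a permutation of three indices: it preserves the product and the sum of a
    triple, and the condition that all products of two agree. Index maps such as [(a + k) %% 3] can
    then be treated alike. *)
Definition perm3 (i : nat -> nat) := [/\ forall k, (i k < 3)%N,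
  forall f : nat -> L, f (i 0%N) * f (i 1%N) * f (i 2%N) = f 0%N * f 1%N * f 2%N,
  forall f : nat -> L, f (i 0%N) + f (i 1%N) + f (i 2%N) = f 0%N + f 1%N + f 2%N
  & forall (f : nat -> L) w, f (i 0%N) * f (i 1%N) = w -> f (i 0%N) * f (i 2%N) = w -> f (i 1%N) * f (i 2%N) = w ->
      forall k, (k < 3)%N -> f ((k + 1) %% 3)%N * f ((k + 2) %% 3)%N = w].

Lemma perm3_of i : (forall k, (i k < 3)%N) -> uniq [:: i 0%N; i 1%N; i 2%N] -> perm3 i.
Proof.
move=> i3; rewrite /perm3; move: (i3 0%N) (i3 1%N) (i3 2%N).
case: (i 0%N) => [|[|[|//]]] _; case: (i 1%N) => [|[|[|//]]] _; case: (i 2%N) => [|[|[|//]]] _ //= _.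
all: split=> [//|q|q|q w e1 e2 e3 [|[|[|//]]] _ /=]; try ring.
all: by rewrite ?e1 ?e2 ?e3 // mulrC ?e1 ?e2 ?e3.
Qed.

Lemma perm3_addl a : (a < 3)%N -> perm3 (fun k => (a + k) %% 3)%N.
Proof. by move=> a3; apply: perm3_of => [k|]; rewrite ?ltn_mod //; case: a a3 => [|[|[|]]]. Qed.
Lemma perm3_addr a : (a < 3)%N -> perm3 (fun k => (k + a) %% 3)%N.
Proof. by move=> a3; apply: perm3_of => [k|]; rewrite ?ltn_mod //; case: a a3 => [|[|[|]]]. Qed.
Lemma perm3_subr a : (a < 3)%N -> perm3 (fun k => (k + 3 - a) %% 3)%N.
Proof. by move=> a3; apply: perm3_of => [k|]; rewrite ?ltn_mod //; case: a a3 => [|[|[|]]]. Qed.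
Lemma perm3_subl a : (a < 3)%N -> perm3 (fun k => (a + 3 - k) %% 3)%N.
Proof. by move=> a3; apply: perm3_of => [k|]; rewrite ?ltn_mod //; case: a a3 => [|[|[|]]]. Qed.

Lemma perm_rel (R : comNzRingType) (x0 x1 x2 y0 y1 y2 : R) : x0 * x1 * x2 = y0 * y1 * y2 -> x0 + x1 + x2 = y0 + y1 + y2 ->
  (x1 * x2 - y0 * y1) * (x0 - y0) + y0 * (x2 - y1) * (x1 - y1) = 0.
Proof.
move=> Ep Es; have -> : (x1 * x2 - y0 * y1) * (x0 - y0) + y0 * (x2 - y1) * (x1 - y1) =
  x0 * x1 * x2 - y0 * y1 * y2 + y0 * y1 * (y0 + y1 + y2 - (x0 + x1 + x2)) by ring.
by rewrite Ep Es !subrr mulr0 addr0.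
Qed.

End Permutations.

Lemma frame_linear (L : closedFieldType) (z : 'rV[L]_5) : Xc z 0 + Xc z 1 + Xc z 2 = Yc z 0 + Yc z 1 + Yc z 2.
Proof. by rewrite /Xc /Yc /=; ring. Qed.

Lemma prod_other (L : closedFieldType) (q : nat -> L) i : (i < 3)%N -> q i = 0 -> q ((i + 1) %% 3)%N * q ((i + 2) %% 3)%N = 0 ->
  forall k, (k < 3)%N -> q ((k + 1) %% 3)%N * q ((k + 2) %% 3)%N = 0.
Proof.
by case: i => [|[|[|//]]] _ /= e1 e2 [|[|[|//]]] _ //=; rewrite e1 ?mul0r ?mulr0.
Qed.

(** Splits the fifteen minors into the nine [mm], three [pP] and three [pQ], the three shapes in
    which their planes are described, up to sign. *)
Lemma pl_ind (L : closedFieldType) (S : ('rV[L]_12 -> L) -> Prop) : (forall q, S q -> S (fun o => - q o)) ->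
  (forall a b, (a < 3)%N -> (b < 3)%N -> S (fun o => mm (co o) a b)) ->
  (forall a, (a < 3)%N -> S (fun o => pP (co o) a)) -> (forall b, (b < 3)%N -> S (fun o => pQ (co o) b)) ->
  forall a b, (a < 6)%N -> (b < 6)%N -> a != b -> S (fun o => pl (co o) a b).
Proof.
move=> SN SD SP SQ.
have sym a b : S (fun o => pl (co o) a b) -> S (fun o => pl (co o) b a).
  move/SN; rewrite (_ : (fun o => - _) = fun o => pl (co o) b a) //; apply: funext => o; rewrite /pl; ring.
have wl a b : (a < b)%N -> (b < 6)%N -> S (fun o => pl (co o) a b).
  move=> ab b6; have [b3|b3] := ltnP b 3.
    move: b3 ab; case: b b6 => [|[|[|//]]] //; case: a => [|[|//]] // _ _ _.
    - exact: (SP 2).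
    - exact: sym (SP 1%N _).
    - exact: (SP 0%N).
  have [a3|a3] := ltnP a 3; first by have := SD a (b - 3)%N a3; rewrite /mm subnKC //; apply; lia.
  move: a3 b3 ab b6; case: a => [|[|[|[|[|[|a]]]]]] //; case: b => [|[|[|[|[|[|b]]]]]] // _ _ _ _.
  - exact: (SQ 2).
  - exact: sym (SQ 1%N _).
  - exact: (SQ 0%N).
by move=> a b a6 b6; have [ab|ba|//] := ltngtP a b => _; [apply: wl|apply/sym/wl].
Qed.

Section Functionals.
Variables (L : closedFieldType) (n : nat).
Implicit Types (u v w : 'rV[L]_n) (f g : 'cV[L]_n).

Definition fn f u : L := (u *m f) 0 0.
Lemma fnD f t u v : fn f (t *: u + v) = t * fn f u + fn f v.
Proof. by rewrite /fn mulmxDl mxE -scalemxAl mxE. Qed.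

Lemma common_zero (N : 'M[L]_(n, 4)) : (4 < n)%N -> exists2 u : 'rV[L]_n, u != 0 & u *m N = 0.
Proof.
move=> n4; have k0 : kermx N != 0.
  by rewrite kermx_eq0 /row_free neq_ltn (leq_ltn_trans (rank_leq_col N)).
have /matrix0Pn[i [j kij]] := k0.
by exists (row i (kermx N)); [apply/rV0Pn; exists j; rewrite mxE|rewrite -row_mul mulmx_ker row0].
Qed.

Variable U : 'rV[L]_n -> Prop.
Hypotheses (U0 : U 0) (UD : forall t u v, U u -> U v -> U (t *: u + v)).

(** A linear space is not a finite union of proper hyperplanes: along the line from [u] in direction
    [w] each functional is a nonzero polynomial in [t]. *)
Lemma avoid_zeros (fs : seq 'cV[L]_n) : (forall f, f \in fs -> exists u, U u /\ fn f u != 0) ->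
  exists u, U u /\ forall f, f \in fs -> fn f u != 0.
Proof.
elim: fs => [|f fs IH] Hf; first by exists 0.
have [u [Uu Hu]] : exists u, U u /\ forall f, f \in fs -> fn f u != 0.
  by apply: IH => g gf; apply: Hf; rewrite inE gf orbT.
have [w [Uw fw]] := Hf f (mem_head _ _).
pose P g : {poly L} := (fn g w) *: 'X + (fn g u)%:P.
have PE g t : (P g).[t] = fn g (t *: w + u) by rewrite fnD !hornerE mulrC.
have P0 g : g \in f :: fs -> P g != 0.
  rewrite inE => /orP[/eqP ->|gf].
    apply/eqP => e; move/(congr1 (fun q : {poly L} => q`_1)): e; rewrite !coefE /= mulr1 addr0 => /eqP; exact/negP.
  apply/eqP => e; move/(congr1 (fun q : {poly L} => q`_0)): e; rewrite !coefE /= mulr0 add0r => /eqP; exact/negP/Hu.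
have /closed_nonrootP[t] : \prod_(g <- f :: fs) P g != 0 by rewrite prodf_seq_neq0; apply/allP => g /P0.
rewrite /root horner_prod prodf_seq_neq0 => /allP nz; exists (t *: w + u); split; first exact: UD.
by move=> g /nz; rewrite PE.
Qed.

Lemma nonzero_on f : ~ (forall u, U u -> fn f u = 0) -> exists u, U u /\ fn f u != 0.
Proof. by move=> nf; apply: contrapT => nx; apply: nf => u Uu; apply/eqP/negbNE/negP => fu; apply: nx; exists u. Qed.

Lemma prod3_zero f g k : (forall u, U u -> fn f u * fn g u * fn k u = 0) ->
  [\/ forall u, U u -> fn f u = 0, forall u, U u -> fn g u = 0 | forall u, U u -> fn k u = 0].
Proof.
move=> E; apply: contrapT => nE.
have [u [Uu Hu]] : exists u, U u /\ forall q, q \in [:: f; g; k] -> fn q u != 0.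
  apply: avoid_zeros => q; rewrite !inE => /or3P[] /eqP ->; apply: nonzero_on => e; apply: nE; [exact: Or31|exact: Or32|exact: Or33].
have /eqP := E u Uu; apply/negP; rewrite !mulf_neq0 // Hu // !inE eqxx ?orbT //.
Qed.

Lemma vanish_prop f g : (exists u, U u /\ fn f u != 0) -> (forall u, U u -> fn f u = 0 -> fn g u = 0) ->
  exists t, forall u, U u -> fn g u = t * fn f u.
Proof.
case=> w [Uw fw] E; exists (fn g w / fn f w) => u Uu.
have := E (- (fn f u / fn f w) *: w + u); rewrite !fnD mulNr divfK // addNr => /(_ (UD _ Uw Uu) erefl) /eqP.
by rewrite mulNr addrC subr_eq0 => /eqP ->; rewrite mulrC mulrA mulrAC.
Qed.

End Functionals.

(** * The fifteen planes *)

Section Planes.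
Variable L : closedFieldType.
Implicit Types (z u : 'rV[L]_5).

Definition ev5 k : 'cV[L]_5 := delta_mx (inord k) 0.
Lemma fn_ev5 k z : fn (ev5 k) z = c5 z k.
Proof.
rewrite /fn /ev5 /c5 mxE (bigD1 (inord k)) //= mxE !eqxx mulr1 big1 ?addr0 // => i ik.
by rewrite mxE (negPf ik) mulr0.
Qed.
Definition Xv i := nth 0 [:: ev5 0; ev5 1; ev5 2 + ev5 3 + ev5 4 - ev5 0 - ev5 1] i.
Definition Yv j := nth 0 [:: ev5 2; ev5 3; ev5 4] j.
Lemma fnDr f g z : fn (f + g) z = fn f z + fn g z :> L. Proof. by rewrite /fn mulmxDr mxE. Qed.
Lemma fnNr f z : fn (- f) z = - fn f z :> L. Proof. by rewrite /fn mulmxN mxE. Qed.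
Lemma fnX i z : (i < 3)%N -> fn (Xv i) z = Xc z i.
Proof. by case: i => [|[|[|//]]] _; rewrite /Xv /Xc /= ?fnDr ?fnNr !fn_ev5. Qed.
Lemma fnY j z : (j < 3)%N -> fn (Yv j) z = Yc z j.
Proof. by case: j => [|[|[|//]]] _; rewrite /Yv /Yc /= fn_ev5. Qed.

Lemma all_zero z : (forall i, (i < 3)%N -> Xc z i = 0) -> (forall j, (j < 3)%N -> Yc z j = 0) -> z = 0.
Proof.
move=> HX HY; apply: eq5.
- by rewrite -[LHS]/(Xc z 0) HX // /c5 mxE.
- by rewrite -[LHS]/(Xc z 1) HX // /c5 mxE.
- by rewrite -[LHS]/(Yc z 0) HY // /c5 mxE.
- by rewrite -[LHS]/(Yc z 1) HY // /c5 mxE.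
- by rewrite -[LHS]/(Yc z 2) HY // /c5 mxE.
Qed.

Variable U : 'rV[L]_5 -> Prop.
Hypotheses (U0 : U 0) (UD : forall t u v, U u -> U v -> U (t *: u + v)).
Hypothesis Ubig : forall f g : 'cV[L]_5, exists2 u, u != 0 & [/\ U u, fn f u = 0 & fn g u = 0].
Hypothesis Usegre : forall u, U u -> segre_cubic u = 0.

Lemma U_prod u : U u -> Xc u 0 * Xc u 1 * Xc u 2 = Yc u 0 * Yc u 1 * Yc u 2.
Proof. by move/Usegre; rewrite segreE => /eqP; rewrite subr_eq0 => /eqP. Qed.

Lemma U_sum u : Xc u 0 + Xc u 1 + Xc u 2 = Yc u 0 + Yc u 1 + Yc u 2.
Proof. by rewrite /Xc /Yc /=; ring. Qed.

Section Factors.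
Variables A B : nat -> 'cV[L]_5.

Lemma zero_factor (S : 'rV[L]_5 -> Prop) i : S 0 -> (forall t u v, S u -> S v -> S (t *: u + v)) ->
  (forall u, S u -> fn (A 0) u * fn (A 1) u * fn (A 2) u = fn (B 0) u * fn (B 1) u * fn (B 2) u) ->
  (i < 3)%N -> (forall u, S u -> fn (A i) u = 0) -> exists2 j, (j < 3)%N & forall u, S u -> fn (B j) u = 0.
Proof.
move=> S0 SD E i3 Ai; have [u Su|e|e|e] := @prod3_zero _ _ S S0 SD (B 0) (B 1) (B 2).
- by rewrite -E //; case: i i3 Ai => [|[|[|//]]] _ -> //; rewrite ?mul0r ?mulr0 ?mul0r.
- by exists 0%N.
- by exists 1%N.
by exists 2.
Qed.

Lemma proportional_factors :
  (forall u, U u -> fn (A 0) u * fn (A 1) u * fn (A 2) u = fn (B 0) u * fn (B 1) u * fn (B 2) u) ->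
  (forall i, (i < 3)%N -> exists u, U u /\ fn (A i) u != 0) -> (forall j, (j < 3)%N -> exists u, U u /\ fn (B j) u != 0) ->
  forall i, exists jc : nat * L, (i < 3)%N ->
    [/\ (jc.1 < 3)%N, jc.2 != 0 & forall u, U u -> fn (B jc.1) u = jc.2 * fn (A i) u].
Proof.
move=> E nA nB i; have [i3|_] := boolP (i < 3)%N; last by exists (0%N, 0).
have [|||||j j3 Bj] := @zero_factor (fun u => U u /\ fn (A i) u = 0) i.
- by rewrite /fn mul0mx mxE.
- by move=> t u v [Uu u0] [Uv v0]; split; [apply: UD|rewrite fnD u0 v0 mulr0 addr0].
- by move=> u [/E].
- by [].
- by move=> u [].
have [|c Ec] := vanish_prop UD (f := A i) (g := B j) (nA i i3); first by move=> u Uu u0; apply: Bj.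
exists (j, c) => _; split=> //=; have [u [Uu]] := nB j j3.
by rewrite Ec //; apply: contraNneq => ->; rewrite mul0r.
Qed.

End Factors.

(** [Ubig] says that [U] has dimension at least 3. On [U] two products of three linear forms
    coincide: if a factor vanishes identically, so does one on the other side; otherwise each X is
    proportional to a Y, and the linear relation forces the ratios to be 1. *)
Lemma plane_classification :
  (exists i j, [/\ (i < 3)%N, (j < 3)%N & forall u, U u -> Xc u i = 0 /\ Yc u j = 0]) \/
  (exists t : nat -> nat, [/\ forall i, (i < 3)%N -> (t i < 3)%N, uniq [:: t 0%N; t 1%N; t 2%N]
     & forall u i, U u -> (i < 3)%N -> Xc u i = Yc u (t i)]).
Proof.
have PXY u : U u -> fn (Xv 0) u * fn (Xv 1) u * fn (Xv 2) u = fn (Yv 0) u * fn (Yv 1) u * fn (Yv 2) u.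
  by move/U_prod; rewrite !fnX // !fnY.
have PYX u : U u -> fn (Yv 0) u * fn (Yv 1) u * fn (Yv 2) u = fn (Xv 0) u * fn (Xv 1) u * fn (Xv 2) u by move/PXY.
have [[i [i3 Xi]]|nX] := pselect (exists i, (i < 3)%N /\ forall u, U u -> fn (Xv i) u = 0).
  left; have [j j3 Yj] := zero_factor U0 UD PXY i3 Xi.
  by exists i, j; split=> // u Uu; rewrite -fnX // -fnY // Xi // Yj.
have [[j [j3 Yj]]|nY] := pselect (exists j, (j < 3)%N /\ forall u, U u -> fn (Yv j) u = 0).
  left; have [i i3 Xi] := zero_factor U0 UD PYX j3 Yj.
  by exists i, j; split=> // u Uu; rewrite -fnX // -fnY // Xi // Yj.
have exX i : (i < 3)%N -> exists u, U u /\ fn (Xv i) u != 0.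
  by move=> i3; apply: nonzero_on => e; apply: nX; exists i.
have exY j : (j < 3)%N -> exists u, U u /\ fn (Yv j) u != 0.
  by move=> j3; apply: nonzero_on => e; apply: nY; exists j.
have [tc Htc] := choice (proportional_factors PXY exX exY); have [rc Hrc] := choice (proportional_factors PYX exY exX).
have Ht i : (i < 3)%N -> ((tc i).1 < 3)%N /\ forall u, U u -> Yc u (tc i).1 = (tc i).2 * Xc u i.
  by move=> i3; have [t3 _ E] := Htc i i3; split=> // u Uu; rewrite -fnY // -fnX // E.
have tc0 i : (i < 3)%N -> (tc i).2 != 0 by case/Htc.
have Xzero u : U u -> (forall i, (i < 3)%N -> Xc u i = 0) -> u = 0.
  move=> Uu HX; apply: all_zero => // j j3; have [r3 c0 E] := Hrc j j3; have /eqP := E u Uu.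
  by rewrite fnX // fnY // HX // eq_sym mulf_eq0 (negPf c0) => /eqP.
(* If two X had the same partner they would be proportional, and a common zero in [U] of one of them
   and the third would be a zero of all coordinates. *)
have inj i i' k : [/\ (i < 3)%N, (i' < 3)%N & (k < 3)%N] -> (forall m, (m < 3)%N -> [|| m == i, m == i' | m == k]) ->
    (tc i).1 <> (tc i').1.
  move=> [i3 i'3 k3] cov e; have [u u0 [Uu ui uk]] := Ubig (Xv i) (Xv k); move/eqP: u0; apply.
  apply: Xzero => // m m3; have [t3 E] := Ht i i3; have [t'3 E'] := Ht i' i'3.
  move: ui uk; rewrite !fnX // => ui uk; have /or3P[] := cov m m3 => /eqP -> //.
  have /eqP := E' u Uu; rewrite -e E // ui mulr0 eq_sym mulf_eq0 (negPf (tc0 _ i'3)); by move/eqP.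
right; exists (fun i => (tc i).1).
have t3 i : (i < 3)%N -> ((tc i).1 < 3)%N by move=> /Ht[].
have un : uniq [:: (tc 0%N).1; (tc 1%N).1; (tc 2%N).1].
  rewrite /= !inE negb_or andbT; apply/andP; split; [apply/andP; split|]; apply/eqP.
  - by apply: (@inj _ _ 2) => // [[|[|[|]]]].
  - by apply: (@inj _ _ 1%N) => // [[|[|[|]]]].
  - by apply: (@inj _ _ 0%N) => // [[|[|[|]]]].
split=> // u i Uu i3; have [_ ->] := Ht i i3 => //.
have [_ _ s _] : perm3 L (fun i => if (i < 3)%N then (tc i).1 else 0%N).
  by apply: perm3_of => // k; case: ifP => // /t3.
have lin w : U w -> (1 - (tc 0%N).2) * Xc w 0 + (1 - (tc 1%N).2) * Xc w 1 + (1 - (tc 2%N).2) * Xc w 2 = 0.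
  move=> Uw; have := U_sum w; rewrite -(s (Yc w)) /=.
  have [_ ->] := Ht 0%N isT => //; have [_ ->] := Ht 1%N isT => //; have [_ ->] := Ht 2%N isT => //.
  by move/eqP; rewrite -subr_eq0 => /eqP <-; ring.
suff -> : (tc i).2 = 1 by rewrite mul1r.
have key k k1 k2 : [/\ (k < 3)%N, (k1 < 3)%N & (k2 < 3)%N] -> (forall m, (m < 3)%N -> [|| m == k, m == k1 | m == k2]) ->
   (forall w, U w -> Xc w k1 = 0 -> Xc w k2 = 0 -> (1 - (tc k).2) * Xc w k = 0) -> (tc k).2 = 1.
  move=> [k3 k13 k23] cov E; have [w w0 [Uw w1 w2]] := Ubig (Xv k1) (Xv k2); move: w1 w2; rewrite !fnX // => w1 w2.
  have /eqP := E w Uw w1 w2; rewrite mulf_eq0 subr_eq0 => /orP[/eqP <- //|/eqP wk].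
  case/eqP: w0; apply: Xzero => // m m3; by have /or3P[] := cov m m3 => /eqP ->.
case: i i3 => [|[|[|//]]] _.
- by apply: (key 0%N 1%N 2%N) => [//|[|[|[|]]]//|w Uw w1 w2]; have := lin w Uw; rewrite w1 w2 !mulr0 !addr0.
- by apply: (key 1%N 0%N 2%N) => [//|[|[|[|]]]//|w Uw w1 w2]; have := lin w Uw; rewrite w1 w2 !mulr0 addr0 add0r.
- by apply: (key 2%N 0%N 1%N) => [//|[|[|[|]]]//|w Uw w1 w2]; have := lin w Uw; rewrite w1 w2 !mulr0 !add0r.
Qed.

End Planes.

Section PlaneZeros.
Variable L : closedFieldType.
Implicit Types (o : 'rV[L]_12) (z : 'rV[L]_5).

Lemma perm_plane_segre z (i j : nat -> nat) : perm3 L i -> perm3 L j ->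
  Xc z (i 0%N) = Yc z (j 0%N) -> Xc z (i 1%N) = Yc z (j 1%N) -> Xc z (i 2%N) = Yc z (j 2%N).
Proof.
move=> [_ _ si _] [_ _ sj _] e0 e1; have := U_sum z; rewrite -(si (Xc z)) -(sj (Yc z)) e0 e1.
exact: addrI.
Qed.

Lemma not_smooth_perm z (i j : nat -> nat) : perm3 L i -> perm3 L j ->
  let x k := Xc z (i k) in let y k := Yc z (j k) in
  x 0%N = y 0%N -> x 1%N = y 1%N -> x 1%N * x 2%N - y 0%N * y 1%N = 0 -> y 0%N * (x 2%N - y 1%N) = 0 -> ~ smooth z.
Proof.
move=> pi pj x y e0 e1; have e2 : x 2%N = y 2%N := perm_plane_segre pi pj e0 e1.
move: pi pj => [_ _ _ ieq] [_ _ _ jeq]; rewrite -e0 -e1 => /eqP; rewrite subr_eq0 => /eqP s0.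
rewrite mulrBr => /eqP; rewrite subr_eq0 => /eqP t0; apply: (@not_smooth _ _ (x 0%N * x 1%N)).
  by move=> k k3; apply: ieq.
by move=> k k3; apply: jeq => //; rewrite -/(y 0%N) -/(y 1%N) -/(y 2%N) -?e0 -?e1 -?e2.
Qed.

Lemma zero_perm o (i j : nat -> nat) (pD rA rB g : L) : perm3 L i -> perm3 L j ->
  (let x k := fX (co o) (i k) in let y k := fY (co o) (j k) in
    [/\ x 0%N - y 0%N = pD * rA, x 1%N - y 1%N = pD * rB, x 1%N * x 2%N - y 0%N * y 1%N = rB * g
    & y 0%N * (x 2%N - y 1%N) = - (rA * g)]) -> Oo o ->
  pD = 0 <-> Xc (tht o) (i 0%N) = Yc (tht o) (j 0%N) /\ Xc (tht o) (i 1%N) = Yc (tht o) (j 1%N).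
Proof.
move=> pi pj [E0 E1 E2 E3] Ho; have [i3 _ _ _] := pi; have [j3 _ _ _] := pj.
rewrite !Xc_tht // !Yc_tht //; split=> [p0|[e0 e1]].
  by split; apply/eqP; rewrite -subr_eq0 ?E0 ?E1 p0 mul0r.
apply/eqP/negbNE/negP => p0.
have rA0 : rA = 0 by apply/eqP; move/eqP: E0; rewrite e0 subrr eq_sym mulf_eq0 (negPf p0).
have rB0 : rB = 0 by apply/eqP; move/eqP: E1; rewrite e1 subrr eq_sym mulf_eq0 (negPf p0).
apply: (@not_smooth_perm (tht o) i j pi pj) Ho; rewrite !Xc_tht // !Yc_tht //.
  by rewrite E2 rB0 mul0r.
by rewrite E3 rA0 mul0r oppr0.
Qed.

Lemma zero_D o a b : (a < 3)%N -> (b < 3)%N -> Oo o ->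
  mm (co o) a b = 0 <-> Xc (tht o) ((a + b) %% 3) = 0 /\ Yc (tht o) ((b + 3 - a) %% 3) = 0.
Proof.
move=> a3 b3 Ho; have [E0 E1 E2 E3] := cofactor_D (co o) a3 b3; have m3 k : (k %% 3 < 3)%N by rewrite ltn_mod.
rewrite Xc_tht // Yc_tht //; split=> [p0|[e0 e1]]; first by rewrite E0 E1 p0 !mul0r.
apply/eqP/negbNE/negP => p0; move/eqP: E0; move/eqP: E1; rewrite e0 e1 eq_sym mulf_eq0 (negPf p0) /= => /eqP rB.
rewrite eq_sym mulf_eq0 (negPf p0) /= => /eqP rA; move: E2 E3; rewrite rA rB !mul0r => sX /eqP; rewrite eqr_opp => /eqP sY.
apply: not_smooth Ho.
  apply: (@prod_other L (Xc (tht o)) ((a + b) %% 3)); rewrite ?Xc_tht //.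
apply: (@prod_other L (Yc (tht o)) ((b + 3 - a) %% 3)); rewrite ?Yc_tht //.
Qed.

Definition plane_pred (q : 'rV[L]_12 -> L) := exists A B : 'cV[L]_5,
  (forall z, fn A z = 0 -> fn B z = 0 -> segre_cubic z = 0) /\
  (forall o, Oo o -> q o = 0 <-> fn A (tht o) = 0 /\ fn B (tht o) = 0).

Lemma plane_predN q : plane_pred q -> plane_pred (fun o => - q o).
Proof.
case=> A [B [E1 E2]]; exists A, B; split=> // o Ho; rewrite -E2 //; split=> [/eqP|->]; last exact: oppr0.
by rewrite oppr_eq0 => /eqP.
Qed.

Lemma plane_perm (i j : nat -> nat) (pD rA rB g : 'rV[L]_12 -> L) : perm3 L i -> perm3 L j ->
  (forall o, let x k := fX (co o) (i k) in let y k := fY (co o) (j k) in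
    [/\ x 0%N - y 0%N = pD o * rA o, x 1%N - y 1%N = pD o * rB o, x 1%N * x 2%N - y 0%N * y 1%N = rB o * g o
    & y 0%N * (x 2%N - y 1%N) = - (rA o * g o)]) -> plane_pred pD.
Proof.
move=> pi pj E; have [i3 ip _ _] := pi; have [j3 jp _ _] := pj.
have eqE z k : fn (Xv L (i k) - Yv L (j k)) z = 0 <-> Xc z (i k) = Yc z (j k).
  by rewrite fnDr fnNr fnX // fnY //; split=> [/eqP|->]; [rewrite subr_eq0 => /eqP|rewrite subrr].
exists (Xv L (i 0%N) - Yv L (j 0%N)), (Xv L (i 1%N) - Yv L (j 1%N)); split.
  move=> z /eqE e0 /eqE e1; have e2 := perm_plane_segre pi pj e0 e1.
  by rewrite segreE -(ip (Xc z)) -(jp (Yc z)) e0 e1 e2 subrr.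
by move=> o Ho; rewrite (zero_perm pi pj (E o) Ho) !eqE.
Qed.

Lemma plane_D a b : (a < 3)%N -> (b < 3)%N -> plane_pred (fun o => mm (co o) a b).
Proof.
move=> a3 b3; have m3 k : (k %% 3 < 3)%N by rewrite ltn_mod.
exists (Xv L ((a + b) %% 3)), (Yv L ((b + 3 - a) %% 3)); split.
  move=> z; rewrite fnX // fnY // => e0 e1; rewrite segreE.
  by rewrite -(prod_shift (Xc z) (m3 (a + b)%N)) -(prod_shift (Yc z) (m3 (b + 3 - a)%N)) e0 e1 !mulr0 subrr.
by move=> o Ho; rewrite fnX // fnY //; apply: zero_D.
Qed.

Lemma plane_P a : (a < 3)%N -> plane_pred (fun o => pP (co o) a).
Proof. by move=> a3; apply: (plane_perm (perm3_addl L a3) (perm3_subr L a3) (fun o => cofactor_P (co o) a3)). Qed.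
Lemma plane_Q b : (b < 3)%N -> plane_pred (fun o => pQ (co o) b).
Proof. by move=> b3; apply: (plane_perm (perm3_addr L b3) (perm3_subl L b3) (fun o => cofactor_Q (co o) b3)). Qed.

Lemma plane_ab a b : (a < 6)%N -> (b < 6)%N -> a != b -> plane_pred (fun o => pl (co o) a b).
Proof. exact: (pl_ind plane_predN plane_D plane_P plane_Q). Qed.

(* The fifteen planes of the Segre frame are the images of the divisors [p_ab = 0]. *)
Lemma plane_pair (U : 'rV[L]_5 -> Prop) : U 0 -> (forall t u v, U u -> U v -> U (t *: u + v)) ->
  (forall f g : 'cV[L]_5, exists2 u, u != 0 & [/\ U u, fn f u = 0 & fn g u = 0]) ->
  (forall u, U u -> segre_cubic u = 0) ->
  exists a b, [/\ (a < 6)%N, (b < 6)%N, a != b & forall o, Oo o -> U (tht o) -> pl (co o) a b = 0].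
Proof.
move=> U0 UD Ub Us; case: (plane_classification U0 UD Ub Us) => [[i [j [i3 j3 E]]]|[t [t3 un E]]].
  have [a [b [a3 b3 ei ej]]] : exists a b, [/\ (a < 3)%N, (b < 3)%N, ((a + b) %% 3)%N = i & ((b + 3 - a) %% 3)%N = j].
    by move: i3 j3; case: i {E} => [|[|[|//]]] _; case: j => [|[|[|//]]] _;
      [exists 0%N, 0%N|exists 1%N, 2%N|exists 2%N, 1%N|exists 2%N, 2%N|exists 0%N, 1%N|exists 1%N, 0%N
      |exists 1%N, 1%N|exists 2%N, 0%N|exists 0%N, 2%N].
  exists a, (3 + b)%N; split; [lia|lia|lia|] => o Ho /E; rewrite -ei -ej => e.
  by have /(zero_D a3 b3 Ho) := e.
have t0 := E _ _ _ (isT : (0 < 3)%N); have t1 := E _ _ _ (isT : (1 < 3)%N); have t2 := E _ _ _ (isT : (2 < 3)%N).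
have fP a : (a < 3)%N -> (forall o, Oo o -> U (tht o) -> Xc (tht o) (a %% 3) = Yc (tht o) ((3 - a) %% 3) /\ 
    Xc (tht o) ((a + 1) %% 3) = Yc (tht o) ((4 - a) %% 3)) -> forall o, Oo o -> U (tht o) -> pP (co o) a = 0.
  move=> a3 F o Ho Uo; apply/(zero_perm (perm3_addl L a3) (perm3_subr L a3) (cofactor_P (co o) a3) Ho).
  by have := F o Ho Uo; rewrite addn0.
have fQ b : (b < 3)%N -> (forall o, Oo o -> U (tht o) -> Xc (tht o) (b %% 3) = Yc (tht o) ((b + 3) %% 3) /\ 
    Xc (tht o) ((1 + b) %% 3) = Yc (tht o) ((b + 2) %% 3)) -> forall o, Oo o -> U (tht o) -> pQ (co o) b = 0.
  move=> b3 F o Ho Uo; apply/(zero_perm (perm3_addr L b3) (perm3_subl L b3) (cofactor_Q (co o) b3) Ho).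
  by have := F o Ho Uo; rewrite add0n subn0 (_ : (b + 3 - 1)%N = (b + 2)%N) //; lia.
move: (t3 0%N isT) (t3 1%N isT) (t3 2%N isT) un t0 t1 t2.
case: (t 0%N) => [|[|[|//]]] _; case: (t 1%N) => [|[|[|//]]] _; case: (t 2%N) => [|[|[|//]]] _ //= _ t0 t1 t2;
  [exists 1%N, 2%N|exists 4%N, 5%N|exists 3%N, 4%N|exists 2%N, 0%N|exists 0%N, 1%N|exists 5%N, 3%N]; split=> //;
  [apply: (fP 0%N)|apply: (fQ 0%N)|apply: (fQ 2%N)|apply: (fP 1%N)|apply: (fP 2%N)|apply: (fQ 1%N)] => // o Ho Uo;
  split=> /=; auto.
Qed.

End PlaneZeros.

Lemma clear_negz (F : fieldType) (N a b x : F) e : b != 0 -> x != 0 -> N = a / b * x ^ Negz e -> N * b * x ^+ e.+1 = a.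
Proof. by move=> b0 x0 ->; rewrite NegzE -exprnN mulrAC divfK ?expf_neq0 // divfK. Qed.

Section PowerOfPrime.
Variables (L : closedFieldType) (n : nat) (O : 'rV[L]_n -> Prop).
Hypothesis Oc2 : codim2 (@pev L n) O.
Implicit Type o : 'rV[L]_n.

Lemma prime_power_of_zeros (N F : {mpoly L[n]}) : rprime F -> N != 0 ->
  (forall o, O o -> N.@[o 0] = 0 -> F.@[o 0] = 0) ->
  exists k (e : int), k != 0 /\ forall o, F.@[o 0] != 0 -> N.@[o 0] = k * F.@[o 0] ^ e.
Proof.
move=> pF N0 H; have [||u [v [e [uu vu E]]]] := unit_off_prime (@ufd_mpoly L n) (q := tofrac N) pF.
- by rewrite tofrac_eq0.
- move=> r pr nr; exists N, 1; split; first by rewrite tofrac1 divr1.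
    have [o [Ho ro Fo]] := Oc2 pr nr; apply: (not_rdvd_root (e := @pev L n) ro).
    by apply: contraNneq Fo => No; apply/eqP/H.
  by case: pr.
have [a [a0 Eu]] := mpoly_unitC uu; have [b [b0 Ev]] := mpoly_unitC vu.
exists (a / b), e; split; first by rewrite mulf_neq0 ?invr_eq0.
move=> o Fo; move: E; rewrite Eu Ev; case: e => e E.
  have {}E : N * b%:MP = a%:MP * F ^+ e.
    have bF : tofrac (b%:MP : {mpoly L[n]}) != 0 by rewrite tofrac_eq0 mpolyC_eq0.
    by apply/eqP; rewrite -tofrac_eq !tofracM tofracXn E mulrAC divfK.
  apply: (mulIf b0); rewrite mulrAC divfK // -{1}[b](mevalC (o 0)) -mevalM E mevalM mevalC.
  by rewrite (rmorphXn (meval (o 0))).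
have {}E : N * b%:MP * F ^+ e.+1 = a%:MP.
  have bF : tofrac (b%:MP : {mpoly L[n]}) != 0 by rewrite tofrac_eq0 mpolyC_eq0.
  have FF : tofrac F != 0 by rewrite tofrac_eq0; case: pF.
  apply/eqP; rewrite -tofrac_eq !tofracM tofracXn; apply/eqP; exact: (clear_negz bF FF E).
have Fe : F.@[o 0] ^+ e.+1 != 0 by rewrite expf_neq0.
apply: (mulIf b0); rewrite mulrAC divfK //; apply: (mulIf Fe); rewrite NegzE -exprnN divfK //.
by rewrite -{1}[b](mevalC (o 0)) -mevalM -(rmorphXn (meval (o 0))) -mevalM E mevalC.
Qed.

End PowerOfPrime.

Lemma nonvanish_power (L : closedFieldType) n (F N : {mpoly L[n]}) : rprime F ->
  (forall o : 'rV_n, F.@[o 0] != 0 -> N.@[o 0] != 0) ->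
  exists k (e : int), k != 0 /\ forall o : 'rV_n, F.@[o 0] != 0 -> N.@[o 0] = k * F.@[o 0] ^ e.
Proof.
move=> pF HN; apply: (@prime_power_of_zeros _ _ (fun=> True)) => //.
- by move=> p g pp ng; have [o] := prime_point pp ng; exists o.
- have [F0 _ _] := pF; have [o /HN No] := nonroot_row F0.
  by apply: contraNneq No => ->; rewrite meval0.
by move=> o _ No; apply: contra_eq No => /HN.
Qed.

(** * Descent of rational functions *)

Section RationalDescent.
Variables (K : fieldType) (L : closedFieldType) (iota : {rmorphism K -> L}).
Hypothesis char0 : [pchar K] =i pred0.
Hypothesis algL : forall x : L, algebraicOver iota x.
Implicit Type s : galois iota.

Lemma form_reflect n r d (F : {mpoly K[n.+1 + r]}) : form d (map_mpoly iota F) -> form d F.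
Proof.
move=> /dhomogP fF; apply/dhomogP => m mF; apply: fF.
by rewrite (perm_mem (msupp_map_mpoly _ (fmorph_inj iota))).
Qed.

Lemma reg_map_gal n r n' r' (X : amb L n r -> Prop) (Y : amb L n' r' -> Prop) f s :
  (forall x, X x -> X (gal_pt s x)) -> reg_map iota X Y f -> forall x, X x -> f (gal_pt s x) = gal_pt s (f x).
Proof.
move=> Xs [_ fp fa] x Xx; have Xsx := Xs _ Xx.
have E1 : (f (gal_pt s x)).1 = (gal_pt s (f x)).1.
  have [d [F [fF [i Fi] E]]] := fp x Xx.
  have [c Ec] := E x Xx (ex_intro _ i Fi).
  have Fsi : ev iota (F i) (gal_pt s x) != 0 by rewrite ev_gal fmorph_eq0.
  have [c' Ec'] := E _ Xsx (ex_intro _ i Fsi).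
  have c'0 : c' != 0 by move: Fsi; rewrite Ec' mulf_nz => /andP[].
  apply: (@proj_eq _ _ _ _ (s c / c')); apply/rowP => l; rewrite !mxE /=.
  by apply: (mulfI c'0); rewrite -Ec' ev_gal Ec rmorphM [RHS]mulrA [c' * _]mulrC divfK.
have E2 : (f (gal_pt s x)).2 = (gal_pt s (f x)).2.
  apply/rowP => i; rewrite [RHS]mxE; have [d [G [D [fG fD Dx E]]]] := fa i x Xx.
  by rewrite E ?E // ?ev_gal ?fmorph_eq0 // fmorph_div.
by case: (f _) E1 E2 => u v /= -> ->.
Qed.

(** Nonempty principal open subsets meet; since they are tested with forms over [L], this is
    geometric irreducibility. *)
Definition irreducible n r (X : amb L n r -> Prop) := forall d e (F G : {mpoly L[n.+1 + r]}),
  form d F -> form e G -> (exists2 x, X x & ev idfun F x != 0) -> (exists2 x, X x & ev idfun G x != 0) ->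
  exists2 x, X x & ev idfun F x != 0 /\ ev idfun G x != 0.

Section Family.
Variables (n r : nat) (X : amb L n r -> Prop).
Hypothesis Xs : forall s x, X x -> X (gal_pt s x).
Hypothesis Xirr : irreducible X.

Lemma reg_common (I : finType) (g : I -> amb L n r -> L) x : X x -> (forall i, reg_at idfun X (g i) x) ->
  exists d (H : {mpoly L[n.+1 + r]}) (G : I -> {mpoly L[n.+1 + r]}),
  [/\ form d H, forall i, form d (G i), ev idfun H x != 0 & forall y, X y -> ev idfun H y != 0 ->
     forall i, g i y = ev idfun (G i) y / ev idfun H y].
Proof.
move=> Xx rg; have ex i : exists dGH : nat * ({mpoly L[n.+1 + r]} * {mpoly L[n.+1 + r]}),
   [/\ form dGH.1 dGH.2.1, form dGH.1 dGH.2.2, ev idfun dGH.2.2 x != 0 &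
     forall y, X y -> ev idfun dGH.2.2 y != 0 -> g i y = ev idfun dGH.2.1 y / ev idfun dGH.2.2 y].
  by have [d [G [H [? ? ? ?]]]] := rg i; exists (d, (G, H)).
have [q Hq] := choice ex.
exists (\sum_i (q i).1)%N, (\prod_i (q i).2.2), (fun i => (q i).2.1 * \prod_(j | j != i) (q j).2.2); split.
- by apply: form_prod => i; case: (Hq i).
- move=> i; rewrite (bigD1 i) //=; apply: formM; first by case: (Hq i).
  by apply: form_prod => j; case: (Hq j).
- by rewrite ev_prod; apply/prodf_neq0 => i _; case: (Hq i).
move=> y Xy; rewrite ev_prod => /prodf_neq0 nz i; have [_ _ _ ->] := Hq i; rewrite ?nz //.
rewrite evM ev_prod [X in _ = _ / X](bigD1 i) //= -mulf_div divff ?mulr1 //.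
by apply/prodf_neq0 => j _; apply: nz.
Qed.

Lemma form_gal_prod d (H : {mpoly L[n.+1 + r]}) (l : seq (galois iota)) : form d H ->
  form (d * size l) (\prod_(s <- l) map_mpoly s H).
Proof.
move=> fH; elim: l => [|s l IH]; first by rewrite big_nil muln0; apply: form1.
by rewrite big_cons mulnS; apply: formM => //; apply: form_map_gal.
Qed.

Lemma irr_prod_gal d (H : {mpoly L[n.+1 + r]}) (l : seq (galois iota)) : form d H -> (exists2 x, X x & ev idfun H x != 0) ->
  form (d * (size l).+1) (H * \prod_(s <- l) map_mpoly s H) /\
  exists2 x, X x & ev idfun (H * \prod_(s <- l) map_mpoly s H) x != 0.
Proof.
move=> fH Hx; elim: l => [|s l [f1 x1]]; first by rewrite big_nil mulr1 muln1.
rewrite big_cons mulrCA /= mulnS; split; first by apply: formM => //; apply: form_map_gal.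
have [x Xx Hxx] := Hx.
have [|y Xy [y1 y2]] := Xirr (form_map_gal s fH) f1 _ x1.
  by exists (gal_pt s x); [apply: Xs|rewrite ev_map_gal fmorph_eq0].
by exists y => //; rewrite evM mulf_neq0.
Qed.

(** The common denominator over [L] is multiplied by its conjugates to lie over K; irreducibility
    keeps the product from vanishing identically on [X]. *)
Lemma K_common (I : finType) (g : I -> amb L n r -> L) x e (E : {mpoly L[n.+1 + r]}) : X x ->
  (forall i, reg_at idfun X (g i) x) -> form e E -> ev idfun E x != 0 ->
  exists d (H : {mpoly K[n.+1 + r]}) (G : I -> {mpoly L[n.+1 + r]}),
  [/\ form d H, forall i, form d (G i), exists2 y, X y & ev iota H y != 0,
     forall y, ev iota H y != 0 -> ev idfun E y != 0
   & forall y, X y -> ev iota H y != 0 -> forall i, g i y = ev idfun (G i) y / ev iota H y].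
Proof.
move=> Xx rg fE Ex; have [d [H1 [G1 [fH fG H1x H1E]]]] := reg_common Xx rg.
have [H0 [l EH]] := norm_poly algL char0 (H1 * E).
have [|f1 [y Xy y0]] := @irr_prod_gal (d + e) (H1 * E) l (formM fH fE).
  by exists x => //; rewrite evM mulf_neq0.
exists ((d + e) * (size l).+1)%N, H0, (fun i => G1 i * E * \prod_(s <- l) map_mpoly s (H1 * E)); split.
- by apply: form_reflect; rewrite EH.
- move=> i; rewrite mulnS; apply: formM; first exact: formM.
  exact/form_gal_prod/formM.
- by exists y => //; rewrite -ev_map EH.
- by move=> y'; rewrite -ev_map EH !evM !mulf_eq0 !negb_or => /andP[/andP[]].
move=> y' Xy'; rewrite -ev_map EH !evM !mulf_eq0 !negb_or => /andP[/andP[n1 n2] n3] i.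
rewrite (H1E _ Xy' n1) -!mulrA; field; by rewrite n1 n2 n3.
Qed.

Lemma rational_descent (I : finType) (g : I -> amb L n r -> L) d (H : {mpoly K[n.+1 + r]}) (G : I -> {mpoly L[n.+1 + r]}) :
  form d H -> (forall i, form d (G i)) ->
  (forall y, X y -> ev iota H y != 0 -> forall i, g i y = ev idfun (G i) y / ev iota H y) ->
  (forall s y i, X y -> ev iota H y != 0 -> g i (gal_pt s y) = s (g i y)) ->
  exists F : I -> {mpoly K[n.+1 + r]}, (forall i, form d (F i)) /\
    forall y, X y -> ev iota H y != 0 -> forall i, g i y = ev iota (F i) y / ev iota H y.
Proof.
move=> fH fG E eqv; have [m [e [F [M [s [C [EG EF]]]]]]] := descent algL char0 G.
have Gs s' y i : X y -> ev iota H y != 0 -> ev idfun (map_mpoly s' (G i)) y = ev idfun (G i) y.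
  move=> Xy Hy; have Xy' := Xs (galV s') Xy.
  have Hy' : ev iota H (gal_pt (galV s') y) != 0 by rewrite ev_gal fmorph_eq0.
  rewrite -{1}[y](gal_ptVK s') ev_map_gal.
  have G1 : ev idfun (G i) (gal_pt (galV s') y) = g i (gal_pt (galV s') y) * ev iota H (gal_pt (galV s') y).
    by rewrite E // divfK.
  by rewrite G1 rmorphM -ev_gal gal_ptVK eqv // /= gal_invK E // divfK.
pose kap i := \sum_m C m i.
have FE t i y : X y -> ev iota H y != 0 -> ev iota (F t i) y = kap i * ev idfun (G t) y.
  move=> Xy Hy; rewrite -ev_map EF ev_sum mulr_suml; apply: eq_bigr => k _.
  by rewrite evZ Gs.
have fF t i : form d (F t i).
  by apply: form_reflect; rewrite EF; apply: form_sum => k _; apply/formZ/form_map_gal.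
have ex t : exists F' : {mpoly K[n.+1 + r]}, form d F' /\ forall y, X y -> ev iota H y != 0 -> g t y = ev iota F' y / ev iota H y.
  have [[x [Xx [Hx Gx]]]|nx] := pselect (exists x, X x /\ (ev iota H x != 0 /\ ev idfun (G t) x != 0)); last first.
    exists 0; split; first exact: form0.
    move=> y Xy Hy; rewrite E //; congr (_ / _); rewrite [RHS]rmorph0; apply/eqP/negbNE/negP => Gy.
    by apply: nx; exists y.
  have [i ki] : exists i, kap i != 0.
    apply: contrapT => nk; move/eqP: Gx; apply; rewrite EG ev_sum big1 // => i _.
    rewrite evZ ev_map FE // (_ : kap i = 0) ?mul0r ?mulr0 //; apply/eqP/negbNE/negP => ki; apply: nk; by exists i.
  have [c Ec] : exists c, kap i = iota c.
    apply: (fixed_field algL char0) => s'.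
    have Hs : ev iota H (gal_pt s' x) != 0 by rewrite ev_gal fmorph_eq0.
    have := FE t i _ (Xs s' Xx) Hs; rewrite ev_gal FE // rmorphM.
    have -> : ev idfun (G t) (gal_pt s' x) = s' (ev idfun (G t) x).
      have G1 : ev idfun (G t) (gal_pt s' x) = g t (gal_pt s' x) * ev iota H (gal_pt s' x).
        by rewrite E ?divfK //; apply: Xs.
      by rewrite G1 eqv // ev_gal -rmorphM E // divfK.
    by apply: mulIf; rewrite fmorph_eq0.
  have c0 : iota c != 0 by rewrite -Ec.
  exists (c^-1 *: F t i); split; first exact: formZ.
  by move=> y Xy Hy; rewrite evZ FE // Ec fmorphV mulKf // E.
have [F' HF'] := choice ex; exists F'; split=> [i|y Xy Hy i]; first by case: (HF' i).
by case: (HF' i) => _; apply.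
Qed.

End Family.
End RationalDescent.

(** * Pluecker vectors of 2 x 6 matrices *)

Section PluckerVector.
Variable L : closedFieldType.
Implicit Types (o : 'rV[L]_12) (M : 'rV[L]_36) (a b c d : 'I_6).

Definition uo o : 'rV[L]_6 := \row_(a < 6) co o a.
Definition vo o : 'rV[L]_6 := \row_(a < 6) co o (6 + a)%N.
(** All 36 entries of the skew matrix of minors, to match the ambient space of [grass26]. *)
Definition pv o : 'rV[L]_36 := mxvec ((uo o)^T *m vo o - (vo o)^T *m uo o) : 'rV_(6 * 6).
Definition me M a b : L := (M : 'rV_(6 * 6)) 0 (mxvec_index a b).

Lemma pvE o a b : me (pv o) a b = pl (co o) a b.
Proof. by rewrite /me /pv mxvecE !mxE !big_ord1 !mxE /pl; ring. Qed.

Lemma me_eq M M' : (forall a b, me M a b = me M' a b) -> M = M'.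
Proof. by move=> E; apply/rowP => k; case/mxvec_indexP: (k : 'I_(6 * 6)) => a b; apply: E. Qed.

Lemma me_neq0 M : M != 0 -> exists a b, me M a b != 0.
Proof. by case/rV0Pn=> k; case/mxvec_indexP: (k : 'I_(6 * 6)) => a b m; exists a, b. Qed.

Definition ouv (u v : 'rV[L]_6) : 'rV[L]_12 :=
  mk12 (fun k => if (k < 6)%N then u 0 (inord k) else v 0 (inord (k - 6))).

Lemma pv_ouv (u v : 'rV[L]_6) : pv (ouv u v) = mxvec (u^T *m v - v^T *m u) :> 'rV_(6 * 6).
Proof.
congr mxvec; have -> : uo (ouv u v) = u.
  by apply/rowP => i; rewrite mxE co_mk ?ltn_ord ?inord_val //; apply: leq_trans (ltn_ord i) _.
have -> : vo (ouv u v) = v.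
  apply/rowP => i; rewrite mxE co_mk; last by have := ltn_ord i; lia.
  by rewrite ltnNge leq_addr /= addKn inord_val.
by [].
Qed.

Lemma pv_scale o k : pv (gl k 0 0 1 o) = k *: pv o.
Proof.
apply: me_eq => a b; rewrite pvE pl_gl // mulr1 mulr0 subr0 -pvE.
by rewrite /me mxE.
Qed.

Lemma pfun_pv k : pfun (fun o => pv o 0 k).
Proof.
by case/mxvec_indexP: (k : 'I_(6 * 6)) => a b; apply: (pfun_eq _ (pfun_pl L a b)) => o; rewrite -pvE.
Qed.

Definition plucker M := (forall a b, me M a b + me M b a = 0) /\
  forall a b c d, me M a b * me M c d - me M a c * me M b d + me M a d * me M b c = 0.

Lemma plucker_pv o : plucker (pv o).
Proof. by split=> [a b|a b c d]; rewrite !pvE /pl; ring. Qed.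

(** A matrix with Pluecker vector [M], regular on the chart where the entry of [M] at [a], [b] is
    nonzero. *)
Definition psec a b M := ouv (\row_c (- me M b c / me M a b)) (\row_c me M a c).

Lemma pv_psec M a b : plucker M -> me M a b != 0 -> pv (psec a b M) = M.
Proof.
move=> [sk rel] m0; apply: me_eq => c d; apply: (mulfI m0); rewrite /me pv_ouv mxvecE !mxE !big_ord1 !mxE.
have E : me M a b * me M c d = me M a c * me M b d - me M a d * me M b c.
  by apply: subr0_eq; rewrite -[RHS](rel a b c d); ring.
rewrite -/(me M a b) -/(me M c d) E; field; exact: m0.
Qed.

End PluckerVector.

(** * The cone over the descended Grassmannian *)

Section Cone.
Variables (K : fieldType) (L : closedFieldType) (iota : {rmorphism K -> L}).
Hypothesis char0 : [pchar K] =i pred0.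
Hypothesis algL : forall x : L, algebraicOver iota x.
Hypothesis c0L : [pchar L] =i pred0.
Variables (N : nat) (Q : 'M[L]_(36, N.+1)) (Em : 'M[L]_(N.+1, 36)).
Implicit Types (o : 'rV[L]_12) (s : galois iota).
Hypothesis QE : forall o, pv o *m Q *m Em = pv o.
Hypothesis conj : forall s, exists2 D : {mpoly L[12]}, D != 0 &
  forall o, D.@[o 0] != 0 -> exists o1, map_mx (galV s) (pv o *m Q) = pv o1 *m Q.

(** [Q] embeds the Pluecker vectors linearly, with left inverse [Em]. The affine coordinates of [y]
    are free: with none this is an embedded Grassmannian, with one its product with the affine
    line. *)
Definition cone r (y : amb L N r) := exists o, val y.1 = pv o *m Q.

Definition lin r n (A : 'M[L]_(N.+1, n)) k : {mpoly L[N.+1 + r]} := \sum_j A j k *: 'X_(lshift r j).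
Lemma form_lin r n (A : 'M[L]_(N.+1, n)) k : form 1 (lin r A k).
Proof. by apply: form_sum => j _; apply/formZ/formXP. Qed.

Lemma evr_lin r n (A : 'M[L]_(N.+1, n)) k v (w : 'rV[L]_r) : evr idfun (lin r A k) v w = (v *m A) 0 k.
Proof.
rewrite /evr /lin rmorph_sum mxE; apply: eq_bigr => j _.
by rewrite -mul_mpolyC rmorphM /= mmapC mmapX mmap1U row_mxEl mulrC.
Qed.

Definition ix a b : 'I_36 := (mxvec_index a b : 'I_(6 * 6)).
Definition eqn : finType := ('I_6 * 'I_6 * ('I_6 * 'I_6) + ('I_6 * 'I_6 + 'I_N.+1))%type.
Definition equation r (t : eqn) : {mpoly L[N.+1 + r]} :=
  match t with
  | inl (a, b, (c, d)) => lin r Em (ix a b) * lin r Em (ix c d) - lin r Em (ix a c) * lin r Em (ix b d)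
                          + lin r Em (ix a d) * lin r Em (ix b c)
  | inr (inl (a, b)) => lin r Em (ix a b) + lin r Em (ix b a)
  | inr (inr k) => lin r (Em *m Q - 1%:M) k
  end.
Definition eqdeg (t : eqn) := if t is inl _ then 2%N else 1%N.

Lemma form_equation r t : form (eqdeg t) (equation r t).
Proof.
case: t => [[[a b] [c d]]|[[a b]|k]] /=; last exact: form_lin.
  have f2 i j : form 2 (lin r Em i * lin r Em j) by apply: (formM (form_lin _ _ _) (form_lin _ _ _)).
  by apply: formD => //; apply: formD => //; apply: formN.
by apply: formD; apply: form_lin.
Qed.

Lemma evr_equation r t v (w : 'rV[L]_r) : evr idfun (equation r t) v w =
  match t with
  | inl (a, b, (c, d)) => me (v *m Em) a b * me (v *m Em) c d - me (v *m Em) a c * me (v *m Em) b d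
                          + me (v *m Em) a d * me (v *m Em) b c
  | inr (inl (a, b)) => me (v *m Em) a b + me (v *m Em) b a
  | inr (inr k) => (v *m Em *m Q - v) 0 k
  end.
Proof.
have E i : mmap idfun (row_mx v w 0) (lin r Em i) = (v *m Em) 0 i by apply: evr_lin.
case: t => [[[a b] [c d]]|[[a b]|k]] /=.
- by rewrite /evr rmorphD rmorphB !rmorphM /= !E.
- by rewrite /evr rmorphD /= !E.
by rewrite evr_lin mulmxBr mulmxA mulmx1.
Qed.

Lemma cone_equations r (y : amb L N r) : cone y <-> forall t, ev idfun (equation r t) y = 0.
Proof.
split=> [[o Eo] t|E].
  rewrite evE evr_equation Eo QE; have [P1 P2] := plucker_pv o.
  by case: t => [[[a b] [c d]]|[[a b]|k]] /=; rewrite ?P1 ?P2 // subrr mxE.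
set v := val y.1; have vE : v *m Em *m Q = v.
  apply/rowP => k; apply/eqP; rewrite -subr_eq0; have := E (inr (inr k)); rewrite evE evr_equation => <-.
  by rewrite !mxE.
have P : plucker (v *m Em).
  split=> [a b|a b c d]; first by have := E (inr (inl (a, b))); rewrite evE evr_equation.
  by have := E (inl (a, b, (c, d))); rewrite evE evr_equation.
have M0 : v *m Em != 0 by apply: contraNneq (proj_neq0 y.1) => e; rewrite -/v -vE e mul0mx.
have [a [b m0]] := me_neq0 M0.
by exists (psec a b (v *m Em)); rewrite pv_psec // vE.
Qed.

Lemma evr_map_gal s n r (F : {mpoly L[n.+1 + r]}) v (w : 'rV[L]_r) :
  evr idfun (map_mpoly s F) (map_mx s v) (map_mx s w) = s (evr idfun F v w).
Proof.
rewrite /evr /mmap rmorph_sum (perm_big _ (msupp_map_mpoly _ (fmorph_inj s))) /=.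
apply: eq_bigr => m _; rewrite rmorphM mcoeff_map_mpoly; congr (_ * _).
by rewrite /mmap1 rmorph_prod; apply: eq_bigr => i _; rewrite rmorphXn -map_row_mx mxE.
Qed.

Lemma pfun_evr r (F : {mpoly L[N.+1 + r]}) (w : 'rV[L]_r) : pfun (fun o => evr idfun F (pv o *m Q) w).
Proof.
have [k|P HP] := @pfun_comp _ _ _ F (fun k o => row_mx (pv o *m Q) w 0 k).
  rewrite -[k]splitK; case: (split k) => j /=.
    apply: (@pfun_eq _ _ (fun o => \sum_i pv o 0 i * Q i j)); first by move=> o; rewrite row_mxEl mxE.
    by apply: pfun_sum => i; apply: pfunM; [apply: pfun_pv|apply: pfunC].
  by apply: (@pfun_eq _ _ (fun=> w 0 j)) (pfunC _ _) => o; rewrite row_mxEr.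
by exists P => o; rewrite -HP.
Qed.

Lemma conj_equation r s t o (w : 'rV[L]_r) : evr idfun (map_mpoly s (equation r t)) (pv o *m Q) w = 0.
Proof.
have [D D0 HD] := conj s; have [P HP] := pfun_evr (map_mpoly s (equation r t)) w.
rewrite HP (_ : P = 0) ?meval0 //; apply: (mpoly_eq_on D0) => o' Do'; rewrite meval0 -HP.
have [o1 E1] := HD o' Do'; have mapK m n (M : 'M[L]_(m, n)) : map_mx s (map_mx (galV s) M) = M.
  by apply/matrixP => i j; rewrite !mxE /= gal_invK.
rewrite -[pv o' *m Q]mapK -[w]mapK evr_map_gal E1 evr_equation QE; have [P1 P2] := plucker_pv o1.
by case: t {P HP} => [[[a b] [c d]]|[[a b]|k]] /=; rewrite ?P1 ?P2 ?rmorph0 // subrr mxE rmorph0.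
Qed.

(** The equations have coefficients in [L]. Their K-components are combinations of conjugate
    equations, which vanish on the cone because Galois conjugation carries its generic points into
    it. *)
Lemma cone_closed r : loc_closed iota (@cone r).
Proof.
have [n [e [F [M [s [C [EG EF]]]]]]] := descent algL char0 (equation r).
exists [seq F t i | t <- enum eqn, i <- enum 'I_n], [:: 1]; split.
- move=> G /allpairsP[[t i] [_ _ ->]]; exists (eqdeg t); apply: (form_reflect (iota := iota)); rewrite EF.
  by apply: form_sum => k _; apply/formZ/form_map_gal/form_equation.
- by move=> G; rewrite inE => /eqP ->; exists 0%N; apply: form1.
move=> y; split=> [[o Eo]|[Z _]].
  split; last by exists 1; rewrite ?mem_head // ev1 oner_neq0.
  move=> G /allpairsP[[t i] [_ _ ->]]; rewrite -ev_map EF ev_sum big1 // => k _.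
  by rewrite evZ evE Eo conj_equation mulr0.
apply/cone_equations => t; rewrite EG ev_sum big1 // => i _; rewrite evZ ev_map Z ?mulr0 //.
by apply/allpairsP; exists (t, i); rewrite !mem_enum.
Qed.

Lemma reg_at_mulmx (k : fieldType) (j : {rmorphism k -> L}) n r m (X : amb L n r -> Prop) (x : amb L n r) (A : 'M[L]_(n.+1, m)) i l :
  (forall c : L, exists c' : k, c = j c') -> val x.1 0 l != 0 ->
  reg_at j X (fun y : amb L n r => (val y.1 *m A) 0 i / val y.1 0 l) x.
Proof.
move=> surj xl; apply: (reg_at_eq (g := fun y : amb L n r => \sum_t val y.1 0 t / val y.1 0 l * A t i)).
  by move=> y _; rewrite mxE mulr_suml; apply: eq_bigr => t _; rewrite mulrAC.
apply: reg_at_sum => t; apply: reg_atM; first exact: reg_at_proj.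
by have [c' ->] := surj (A t i); apply: reg_at_cst.
Qed.

Lemma regm_at_linear n r n' (X : amb L n r -> Prop) (x : amb L n r) (A : 'M[L]_(n.+1, n'.+1)) :
  X x -> (forall y : amb L n r, X y -> val y.1 *m A != 0) -> regm_at idfun X (fun y : amb L n r => (mkp (val y.1 *m A), 0 : 'rV_0)) x.
Proof.
move=> Xx nz; split=> [|[] //]; have [l xl] := coord_neq0 x.1.
exists (fun i (y : amb L n r) => (val y.1 *m A) 0 i / val y.1 0 l); split.
- by move=> i; apply: reg_at_mulmx => // c; exists c.
- have [k k0 E] := mkpP (nz x Xx); have /rV0Pn[i Ai] := nz x Xx.
  by exists i; rewrite mulf_neq0 ?invr_eq0.
exists 1%N, 'X_(lshift r l); split; [exact: formXP|by rewrite evXP|].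
move=> y Xy; rewrite evXP => yl; have [k k0 E] := mkpP (nz y Xy).
exists (k / val y.1 0 l); first by rewrite mulf_neq0 ?invr_eq0.
by move=> i; rewrite {1}E mxE mulrAC.
Qed.

Definition Ycone : variety iota := Variety (cone_closed 0).
Definition Econe : variety iota := Variety (cone_closed (0 + 1)).

Lemma cone_neq0 r (y : amb L N r) : cone y -> val y.1 *m Em != 0 /\ val y.1 *m Em *m Q = val y.1.
Proof.
case=> o Eo; have e : val y.1 *m Em *m Q = val y.1 by rewrite Eo QE.
by split=> //; apply: contraNneq (proj_neq0 y.1) => e0; rewrite -e e0 mul0mx.
Qed.

Lemma cone_mkp r (v : 'rV[L]_36) (w : 'rV[L]_r) o : v = pv o -> v *m Q != 0 -> cone (mkp (v *m Q), w).
Proof.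
move=> -> n0; have [k k0 E] := mkpP n0; exists (gl k^-1 0 0 1 o); rewrite pv_scale -scalemxAl /=.
by rewrite {2}E scalerA mulVf // scale1r.
Qed.

Lemma grass_cone : grass26_form Ycone.
Proof.
pose g (y : amb L N 0) : amb L 35 0 := (mkp (val y.1 *m Em), 0).
pose g' (x : amb L 35 0) : amb L N 0 := (mkp (val x.1 *m Q), 0).
have Gr x : grass26 x -> exists o, val x.1 = pv o.
  by case=> u [v E]; exists (ouv u v); rewrite pv_ouv.
have G0 x : grass26 x -> val x.1 *m Q != 0 /\ val x.1 *m Q *m Em = val x.1.
  case/Gr=> o Eo; have e : val x.1 *m Q *m Em = val x.1 by rewrite Eo QE.
  by split=> //; apply: contraNneq (proj_neq0 x.1) => e0; rewrite -e e0 mul0mx.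
have YG y : cone y -> grass26 (g y).
  move=> Yy; have [n0 _] := cone_neq0 Yy; have [o Eo] := Yy; have [k k0 E] := mkpP n0.
  exists (uo (gl k^-1 0 0 1 o)), (vo (gl k^-1 0 0 1 o)); rewrite -[RHS]/(pv (gl k^-1 0 0 1 o)) pv_scale -(QE o) -Eo.
  by rewrite /= {2}E scalerA mulVf // scale1r.
have GY x : grass26 x -> cone (g' x).
  by move=> Gx; have [n0 _] := G0 x Gx; have [o Eo] := Gr x Gx; apply: (cone_mkp 0 Eo).
exists g; split.
  apply: reg_map_of => // y Yy; apply: regm_at_linear => // y' Yy'; by have [] := cone_neq0 Yy'.
exists g'; split.
- apply: reg_map_of => // x Gx; apply: regm_at_linear => // x' Gx'; by have [] := G0 _ Gx'.
- move=> y Yy; have [n0 e] := cone_neq0 Yy; have [k k0 E] := mkpP n0.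
  have ki : k^-1 != 0 by rewrite invr_eq0.
  have e1 : val (mkp (val y.1 *m Em)) *m Q = k^-1 *: val y.1.
    by rewrite -[in RHS]e [in RHS]E -scalemxAl scalerA mulVf // scale1r.
  case: y {Yy n0 E} e e1 => y y0 e e1; rewrite /g' /g /=; congr pair; last by apply/rowP => -[].
  by apply: (mkp_eq _ e1); rewrite e1 scaler_eq0 negb_or ki proj_neq0.
move=> x Gx; have [n0 e] := G0 x Gx; have [k k0 E] := mkpP n0.
have ki : k^-1 != 0 by rewrite invr_eq0.
have e1 : val (mkp (val x.1 *m Q)) *m Em = k^-1 *: val x.1.
  by rewrite -[in RHS]e [in RHS]E -scalemxAl scalerA mulVf // scale1r.
case: x {Gx n0 E} e e1 => y y0 e e1; rewrite /g' /g /=; congr pair; last by apply/rowP => -[].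
by apply: (mkp_eq _ e1); rewrite e1 scaler_eq0 negb_or ki proj_neq0.
Qed.

Lemma regm_at_id n r (X : amb L n r -> Prop) (x : amb L n r) : X x -> regm_at iota X (fun y => y) x.
Proof.
move=> Xx; split=> [|i]; last exact: reg_at_affine.
have [l xl] := coord_neq0 x.1.
exists (fun i (y : amb L n r) => val y.1 0 i / val y.1 0 l); split.
- by move=> i; apply: reg_at_proj.
- by exists l; rewrite divff ?oner_neq0.
exists 1%N, 'X_(lshift r l); split; [exact: formXP|by rewrite evXP|].
move=> y Xy; rewrite evXP => yl; exists (val y.1 0 l)^-1; first by rewrite invr_eq0.
by move=> i; rewrite mulrC.
Qed.

(** The trivial bundle is enough, being birational to the affine cone. *)
Lemma line_cone : @line_bundle K L iota Ycone Econe (@base L N 0 1).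
Proof.
have fE (e : amb L N (0 + 1)) : ext (base e) (const_mx (e.2 0 (rshift 0 0)) : 'rV_1) = e.
  case: e => u w; congr pair; apply/rowP => i; rewrite -[i]splitK; case: (split i) => [[//]|k] /=.
  by rewrite row_mxEr mxE (ord1 k).
have bi m l (Z : amb L m (0 + l) -> Prop) x : regm_at iota Z (@base L m 0 l) x by apply: regm_at_base.
split; first by apply: reg_map_of => // x Ex; apply: bi.
exists unit, (fun _ _ => True), (fun _ (e : amb L N (0 + 1)) => e.2 0 (rshift 0 0)); split.
- by move=> _; apply: open_inT.
- by move=> y _; exists tt.
- move=> _; split.
    apply: reg_map_of => [x [Ex _]|x Ex]; first by rewrite fE; split.
    apply: (@regm_at_eq _ _ _ _ _ _ _ _ (fun y => y)); last exact: regm_at_id.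
    by apply: nearA => y _; rewrite fE.
  exists (fun y => y); split=> [|x _|y _]; rewrite ?fE //.
  by apply: reg_map_of => [x [Yx _]|x Yx]; [split|apply: regm_at_id].
by move=> _ _; exists (fun=> 1) => e _ _ _; rewrite mul1r.
Qed.

End Cone.

Lemma meval_neq0M (L : closedFieldType) n (D1 D2 : {mpoly L[n]}) (o : 'rV[L]_n) : (D1 * D2).@[o 0] != 0 -> D1.@[o 0] != 0 /\ D2.@[o 0] != 0.
Proof. by rewrite mevalM mulf_nz => /andP[]. Qed.

Section ConeIrreducible.
Variables (L : closedFieldType) (N : nat) (Q : 'M[L]_(36, N.+1)).

Lemma pfun_psi k : pfun (fun o : 'rV[L]_12 => (pv o *m Q) 0 k).
Proof.
apply: (@pfun_eq _ _ (fun o => \sum_i pv o 0 i * Q i k)); first by move=> o; rewrite mxE.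
by apply: pfun_sum => i; apply: pfunM; [apply: pfun_pv|apply: pfunC].
Qed.

Lemma pfun_line r (F : {mpoly L[N.+1 + r]}) :
  pfun (fun x : 'rV[L]_(12 + r) => evr idfun F (pv (lsubmx x) *m Q) (rsubmx x)).
Proof.
have [k|P HP] := @pfun_comp _ _ _ F (fun k (x : 'rV[L]_(12 + r)) => row_mx (pv (lsubmx x) *m Q) (rsubmx x) 0 k).
  rewrite -[k]splitK; case: (split k) => j /=.
    have [P HP] := pfun_psi j; have [i|P' HP'] := @pfun_comp _ _ _ P (fun i (x : 'rV[L]_(12 + r)) => lsubmx x 0 i).
      by exists 'X_(lshift r i) => x; rewrite mevalXU mxE.
    exists P' => x; rewrite row_mxEl HP -HP'; apply: eq_bigr => m _; congr (_ * _); exact: mmap1_eq.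
  by exists 'X_(rshift 12 j) => x; rewrite row_mxEr mevalXU mxE.
by exists P => x; rewrite -HP.
Qed.

Lemma ev_mkp r d (F : {mpoly L[N.+1 + r]}) (v : 'rV[L]_N.+1) (w : 'rV[L]_r) : form d F -> v != 0 ->
  (ev idfun F (mkp v, w) != 0) = (evr idfun F v w != 0).
Proof.
move=> fF v0; have [k k0 E] := mkpP v0.
by rewrite evE [in RHS]E (evr_scale _ _ _ _ fF) mulf_eq0 expf_eq0 (negPf k0) andbF.
Qed.

Lemma cone_irreducible r j0 : (exists o : 'rV[L]_12, (pv o *m Q) 0 j0 != 0) -> irreducible (@cone L N Q r).
Proof.
move=> [o1 H1] d e F G fF fG [x [ox Ex] Fx] [y [oy Ey] Gy].
have gen (F' : {mpoly L[N.+1 + r]}) o w : evr idfun F' (pv o *m Q) w != 0 -> exists2 P : {mpoly L[12 + r]}, P != 0 &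
   forall x : 'rV[L]_(12 + r), P.@[x 0] != 0 -> evr idfun F' (pv (lsubmx x) *m Q) (rsubmx x) != 0.
  move=> n0; have [P HP] := pfun_line F'; exists P; last by move=> x'; rewrite -HP.
  by apply: (pev_neq0 (o := row_mx o w)); rewrite -HP row_mxKl row_mxKr.
have [P P0 HP] : exists2 P : {mpoly L[12 + r]}, P != 0 & forall x : 'rV[L]_(12 + r), P.@[x 0] != 0 -> evr idfun F (pv (lsubmx x) *m Q) (rsubmx x) != 0.
  by apply: (@gen _ ox x.2); rewrite -Ex -evE.
have [P' P'0 HP'] : exists2 P : {mpoly L[12 + r]}, P != 0 & forall x : 'rV[L]_(12 + r), P.@[x 0] != 0 -> evr idfun G (pv (lsubmx x) *m Q) (rsubmx x) != 0.
  by apply: (@gen _ oy y.2); rewrite -Ey -evE.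
have [P2 P20 HP2] := gen 'X_(lshift r j0) o1 0 ltac:(by rewrite /evr mmapX mmap1U row_mxEl).
have [z] := nonroot_row (mulf_neq0 P0 (mulf_neq0 P'0 P20)).
move=> /meval_neq0M[/HP z1 /meval_neq0M[/HP' z2 /HP2]]; rewrite /evr mmapX mmap1U row_mxEl => z3.
have v0 : pv (lsubmx z) *m Q != 0 by apply: contraNneq z3 => ->; rewrite mxE.
by exists (mkp (pv (lsubmx z) *m Q), rsubmx z); rewrite ?(ev_mkp _ fF) ?(ev_mkp _ fG) //; apply: cone_mkp.
Qed.

End ConeIrreducible.

Lemma mkp_gal (K : fieldType) (L : closedFieldType) (iota : {rmorphism K -> L}) (s : galois iota) n (v : 'rV[L]_n.+1) r (w : 'rV[L]_r) :
  v != 0 -> (mkp (map_mx s v), map_mx s w) = gal_pt s (mkp v, w).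
Proof.
move=> v0; have [k k0 E] := mkpP v0; congr pair; apply: (@mkp_eq _ _ _ _ (s k)); first by rewrite map_mx_eq0.
by rewrite {1}E map_mxZ.
Qed.

Lemma dense_near (k' : fieldType) (L : closedFieldType) (j : {rmorphism k' -> L}) n r (X U : amb L n r -> Prop) x : irreducible X -> X x -> near j X x U -> dense_in X U.
Proof.
move=> Xirr Xx /near_map[e [E [fE Ex EU]]] d' G fG exG.
have [|y Xy [Ey Gy]] := Xirr _ _ _ _ fE fG _ exG; first by exists x.
by exists y; split=> //; apply: EU.
Qed.

(** The torsor over [L] with all choices made: [W], [yW] and [tau] are an etale neighbourhood of
    each point, a point of it, and a section of the torsor over it; [c] and [f] are a cocycle for
    each class and the equivariant functions provided by universality. *)
Record torsor_data (L : closedFieldType) (h : 'M[L]_5) (VV : amb L 4 0 -> Prop) (nT rT : nat)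
  (TT : amb L nT rT -> Prop) (p : amb L nT rT -> amb L 4 0)
  (act : (Pic VV -> L) -> amb L nT rT -> amb L nT rT)
  (W : amb L 4 0 -> amb L 4 (0 + 1) -> Prop) (yW : amb L 4 0 -> L) (tau : amb L 4 0 -> amb L 4 (0 + 1) -> amb L nT rT)
  (c : Pic VV -> cocycle VV) (f : Pic VV -> amb L 4 0 -> amb L nT rT -> L) : Prop := TorsorData {
  td_h : h \in unitmx;
  td_V : forall v, VV v <-> smooth (val v.1 *m h);
  td_p : reg_map idfun TT VV p;
  td_act : torus_reg_map TT TT act;
  td_over : forall t z, torus_point t -> TT z -> p (act t z) = p z;
  td_actM : forall t u x, torus_point t -> torus_point u -> TT x ->
    act (fun a => t a * u a) x = act t (act u x);
  td_trans : forall z z', TT z -> TT z' -> p z = p z' -> exists2 t, torus_point t & z' = act t z;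
  td_W : forall v, VV v -> exists d e P Q, [/\ form d P, form e Q & W v = std_etale VV P Q];
  td_yW : forall v, VV v -> W v (ext v (const_mx (yW v)));
  td_tau : forall v, VV v -> reg_map idfun (W v) TT (tau v);
  td_ptau : forall v w, VV v -> W v w -> p (tau v w) = base w;
  td_cl : forall a, cl (c a) = a;
  td_f_reg : forall a x, VV x -> reg_fun idfun (fun z => TT z /\ nbh (c a) x (p z)) (f a x);
  td_f_neq0 : forall a x z, VV x -> TT z -> nbh (c a) x (p z) -> f a x z != 0;
  td_f_act : forall a x t z, VV x -> torus_point t -> TT z -> nbh (c a) x (p z) -> f a x (act t z) = t a * f a x z;
  td_f_trf : forall a x y z, VV x -> VV y -> TT z -> nbh (c a) x (p z) -> nbh (c a) y (p z) ->
    f a y z = trf (c a) x y (p z) * f a x z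
}.

(** * The map to a universal torsor *)

Section Torsor.
Variables (L : closedFieldType) (h : 'M[L]_5) (VV : amb L 4 0 -> Prop) (nT rT : nat).
Variables (TT : amb L nT rT -> Prop) (p : amb L nT rT -> amb L 4 0).
Variables (act : (Pic VV -> L) -> amb L nT rT -> amb L nT rT).
Variables (W : amb L 4 0 -> amb L 4 (0 + 1) -> Prop) (yW : amb L 4 0 -> L) (tau : amb L 4 0 -> amb L 4 (0 + 1) -> amb L nT rT).
Variables (c : Pic VV -> cocycle VV) (f : Pic VV -> amb L 4 0 -> amb L nT rT -> L).
Hypothesis H : torsor_data h TT p act W yW tau c f.
Local Notation V12 := 'rV[L]_12.
Local Notation Tht := (@Tht L h).
Implicit Types (o : V12) (z : amb L nT rT) (x : amb L 4 0).

Let uh := td_h H.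
Let VP := td_V H.
Lemma Vo o : Oo o -> VV (Tht o). Proof. exact: V_Tht uh VV VP o. Qed.

Definition Z a := projT1 (cid (zeta_exists uh VP (c a))).
Definition zv a x o : L := fev (@pev L 12) (@ufd_mpoly L 12) (Z a x) o.
Definition zN a x : {mpoly L[12]} := fnum (@ufd_mpoly L 12) (Z a x).
Definition zD a x : {mpoly L[12]} := fden (@ufd_mpoly L 12) (Z a x).

Lemma zvE a x o : zv a x o = (zN a x).@[o 0] / (zD a x).@[o 0]. Proof. by []. Qed.

Lemma z_neq0 a x o : VV x -> Oo o -> nbh (c a) x (Tht o) -> (zN a x).@[o 0] != 0 /\ (zD a x).@[o 0] != 0.
Proof.
move=> Vx Ho n; rewrite /zN /zD /Z; case: (cid _) => Z' /= [u _].
exact: (unitf_fev (@ufd_mpoly L 12) (u x o Vx Ho n)).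
Qed.

Lemma zv_neq0 a x o : VV x -> Oo o -> nbh (c a) x (Tht o) -> zv a x o != 0.
Proof. by move=> Vx Ho n; have [n1 n2] := z_neq0 Vx Ho n; rewrite zvE mulf_neq0 ?invr_eq0. Qed.

Lemma zv_trf a x y o : VV x -> VV y -> Oo o -> nbh (c a) x (Tht o) -> nbh (c a) y (Tht o) ->
  trf (c a) x y (Tht o) * zv a x o = zv a y o.
Proof. by rewrite /zv /Z; case: (cid _) => Z' /= [_ t]; apply: t. Qed.

(** The ratio of two trivializations of the class [a], from [Oo] and from the torsor, over one point
    of the cubic. It does not depend on the chart ([rrE]), and the torus acts on it through the
    inverse of [t a]. *)
Definition rr a z o := zv a (Tht o) o / f a (Tht o) z.

Lemma rrE a x z o : VV x -> Oo o -> TT z -> p z = Tht o -> nbh (c a) x (Tht o) -> rr a z o = zv a x o / f a x z.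
Proof.
move=> Vx Ho Tz pz nx; have Vto := Vo Ho; have no := nbh_self (c a) Vto.
rewrite /rr -(zv_trf Vx Vto Ho nx no) (td_f_trf H (x := x) (y := Tht o)) ?pz //.
rewrite -mulf_div divff ?mul1r //; exact: trf_neq0.
Qed.

Lemma rr_neq0 a z o : Oo o -> TT z -> p z = Tht o -> rr a z o != 0.
Proof.
move=> Ho Tz pz; have Vto := Vo Ho; have no := nbh_self (c a) Vto.
by rewrite mulf_neq0 ?invr_eq0 ?zv_neq0 // (td_f_neq0 H) ?pz.
Qed.

Lemma rr_act a t z o : Oo o -> TT z -> p z = Tht o -> torus_point t -> rr a (act t z) o = rr a z o / t a.
Proof.
move=> Ho Tz pz Ht; have Vto := Vo Ho; have no := nbh_self (c a) Vto.
by rewrite /rr (td_f_act H) ?pz // invfM mulrA mulrAC.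
Qed.

Lemma act_T t z : torus_point t -> TT z -> TT (act t z).
Proof.
by move=> Ht Tz; have [l [a [g [[gT _ _] E]]]] := td_act H; rewrite -E //; apply: gT; exists t, z.
Qed.

Lemma V_point v : VV v -> exists2 z, TT z & p z = v.
Proof.
move=> Vv; have [tT _ _] := td_tau H Vv; exists (tau v (ext v (const_mx (yW v)))); first exact/tT/(td_yW H).
by rewrite (td_ptau H) ?base_ext //; apply: (td_yW H).
Qed.

Definition zl v : amb L nT rT := if pselect (VV v) is left Vv then projT1 (cid2 (V_point Vv)) else tau v (ext v 0).

Lemma zlP v : VV v -> TT (zl v) /\ p (zl v) = v.
Proof. by rewrite /zl; case: pselect => // Vv _; case: (cid2 _). Qed.

Definition o0 : V12 := projT1 (cid (Wopen (oner_neq0 _))).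
Lemma O0 : Oo o0. Proof. by rewrite /o0; case: (cid _) => x []. Qed.
Definition z0 := zl (Tht o0).

Definition rn z o a := rr a z o / rr a z0 o0.

(* The pullback to [Oo] of the chosen etale neighbourhood of the image of [o1]. *)
Definition FO o1 := FP h (W (Tht o1)).
Definition fO o1 := fpt h o1 (yW (Tht o1)).
Definition regO (u : V12 -> L) o1 := reg_at idfun (FO o1) (fun w => u (rsubmx w.2)) (fO o1).

Lemma FO_fO o1 : Oo o1 -> FO o1 (fO o1).
Proof. by move=> Ho; exists o1, (yW (Tht o1)); split=> //; apply: (td_yW H); apply: Vo. Qed.

Lemma rsub_fpt o y : rsubmx (fpt h o y).2 = o. Proof. by rewrite /fpt /= row_mxKr. Qed.
Lemma base_fpt o y : base (fpt h o y) = ext (Tht o) (const_mx y). Proof. by rewrite base_ext. Qed.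

Lemma regO_etale u o1 : Oo o1 -> regO u o1 -> etale_at (@Oo L) u o1.
Proof.
move=> Ho R; have [d [e [P [Q [fP fQ WE]]]]] := td_W H (Vo Ho).
have := @etale_bridge L h uh VV d e P Q u (fun w => u (rsubmx w.2)) o1 (yW (Tht o1)).
rewrite -WE; apply=> //; first exact: Vo.
  exact/(td_yW H)/Vo.
by move=> o y _ _; rewrite rsub_fpt.
Qed.

Lemma regO_eq u w o1 : (forall o, Oo o -> u o = w o) -> regO u o1 -> regO w o1.
Proof. by move=> E; apply: reg_at_eq => _ [o [y [Ho _ ->]]]; rewrite rsub_fpt; apply: E. Qed.

Lemma regO_co o1 i : regO (fun o => o 0 i) o1.
Proof.
have := @reg_at_affine _ _ idfun _ _ (FO o1) (fO o1) (rshift (0 + 1) i).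
by apply: reg_at_eq => y _; rewrite mxE.
Qed.

Lemma regO_pfun u o1 : pfun u -> regO u o1.
Proof.
case=> q E; apply: (@regO_eq (fun o => mmap idfun (o 0) q)); first by move=> o _; rewrite E.
by apply: reg_at_meval => i; apply: regO_co.
Qed.

Lemma base_T o1 : Oo o1 -> forall w, FO o1 w -> TT (tau (Tht o1) (base w)) /\ p (tau (Tht o1) (base w)) = Tht (rsubmx w.2).
Proof.
move=> Ho _ [o [y [Ho' Ww ->]]]; rewrite base_fpt rsub_fpt; have Vv := Vo Ho.
by have [tT _ _] := td_tau H Vv; split; [apply: tT|rewrite (td_ptau H) // base_ext].
Qed.

Lemma tau_regm o1 : Oo o1 -> regm_at idfun (FO o1) (fun w => tau (Tht o1) (base w)) (fO o1).
Proof.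
move=> Ho; have Vv := Vo Ho; have Wf : W (Tht o1) (base (fO o1)) by rewrite base_fpt; apply: (td_yW H).
apply: (regm_at_comp (Y := W (Tht o1))); first exact: FO_fO.
- by move=> _ [o [y [_ Ww ->]]]; rewrite base_fpt.
- exact: regm_at_base.
- exact: regm_at_of (td_tau H Vv) Wf.
Qed.

Lemma near_nbh a x z : VV x -> TT z -> nbh (c a) x (p z) -> near idfun TT z (fun z' => nbh (c a) x (p z')).
Proof.
move=> Vx Tz nz; have [pV _ _] := td_p H; apply: (near_comp Tz pV (regm_at_of (td_p H) Tz)).
exact: nbh_open Vx _ (pV _ Tz) nz.
Qed.

Lemma f_reg_at a x z : VV x -> TT z -> nbh (c a) x (p z) -> reg_at idfun TT (f a x) z.
Proof. by move=> Vx Tz nz; apply: reg_at_local (near_nbh Vx Tz nz) _; apply: (td_f_reg H). Qed.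

Lemma f_comp o1 g : Oo o1 -> reg_at idfun TT g (tau (Tht o1) (base (fO o1))) ->
  reg_at idfun (FO o1) (fun w => g (tau (Tht o1) (base w))) (fO o1).
Proof.
move=> Ho; apply: (@reg_at_comp _ _ _ _ _ _ _ (FO o1) TT (fun w => tau (Tht o1) (base w))).
- exact: FO_fO.
- by move=> w /(base_T Ho)[].
- exact: tau_regm.
Qed.

Lemma rr_reg a o1 : Oo o1 -> reg_at idfun (FO o1) (fun w => rr a (tau (Tht o1) (base w)) (rsubmx w.2)) (fO o1).
Proof.
move=> Ho; have Vv := Vo Ho; have Ff := FO_fO Ho; have [Tf pf] := base_T Ho Ff.
have nf : nbh (c a) (Tht o1) (p (tau (Tht o1) (base (fO o1)))).
  by rewrite pf rsub_fpt; apply: nbh_self.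
have nn : near idfun (FO o1) (fO o1) (fun w => nbh (c a) (Tht o1) (p (tau (Tht o1) (base w)))).
  apply: (@near_comp _ _ _ _ _ _ _ (FO o1) TT (fun w => tau (Tht o1) (base w)) (fO o1) Ff _ (tau_regm Ho)
    (fun z => nbh (c a) (Tht o1) (p z))); last exact: near_nbh.
  by move=> w /(base_T Ho)[].
apply: (@reg_at_near _ _ _ _ _ _ _ (fun w => zv a (Tht o1) (rsubmx w.2) / f a (Tht o1) (tau (Tht o1) (base w)))).
  apply: nearW nn => w Fw nw; have [Tw pw] := base_T Ho Fw; symmetry; apply: rrE => //; last by rewrite -pw.
  by case: Fw => o [y [Ho' _ ->]]; rewrite rsub_fpt.
have [n1 n2] : (zN a (Tht o1)).@[o1 0] != 0 /\ (zD a (Tht o1)).@[o1 0] != 0.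
  by apply: z_neq0 => //; apply: nbh_self.
apply: reg_at_div => //; first by apply: (td_f_neq0 H).
  apply: reg_at_div => //; first by rewrite rsub_fpt.
  - by apply: (@regO_pfun (fun o => (zN a (Tht o1)).@[o 0])); exists (zN a (Tht o1)).
  - by apply: (@regO_pfun (fun o => (zD a (Tht o1)).@[o 0])); exists (zD a (Tht o1)).
by apply: f_comp => //; apply: f_reg_at.
Qed.

Lemma rn_ratio a b z z' o : Oo o -> TT z -> TT z' -> p z = Tht o -> p z' = Tht o ->
  rn z o (a + b) / (rn z o a * rn z o b) = rn z' o (a + b) / (rn z' o a * rn z' o b).
Proof.
move=> Ho Tz Tz' pz pz'; have [t tt ->] := td_trans H Tz Tz' (etrans pz (esym pz')).
rewrite /rn !rr_act //; have [t0 tD] := tt; rewrite tD.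
have n a' := rr_neq0 a' Ho Tz pz; have n0 a' : rr a' z0 o0 != 0.
  by have [T0 p0] := zlP (Vo O0); apply: rr_neq0 O0 T0 p0.
exact: ratio_id.
Qed.

Lemma rn_neq0 z o a : Oo o -> TT z -> p z = Tht o -> rn z o a != 0.
Proof.
move=> Ho Tz pz; have [T0 p0] := zlP (Vo O0).
by rewrite mulf_neq0 ?invr_eq0 ?rr_neq0 //; apply: O0.
Qed.

(** The failure of multiplicativity in [a] does not depend on [z], so it is a nowhere vanishing
    function on [Oo], etale-locally regular thanks to the local sections [tau]; it is therefore
    constant, and it is 1 at the base point. *)
Lemma rn_torus z o : Oo o -> TT z -> p z = Tht o -> torus_point (rn z o).
Proof.
move=> Ho Tz pz; split=> [a|a b]; first exact: rn_neq0.
pose u o := rn (zl (Tht o)) o (a + b) / (rn (zl (Tht o)) o a * rn (zl (Tht o)) o b).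
have zo o' : Oo o' -> TT (zl (Tht o')) /\ p (zl (Tht o')) = Tht o' by move=> /Vo/zlP.
have [||k k0 E] := @etale_const _ _ _ (@Oo_codim2 L) _ (Wp_neq0 L) (@Wp_Oo L) u.
- move=> o1 H1; apply: regO_etale => //.
  pose U w := rn (tau (Tht o1) (base w)) (rsubmx w.2) (a + b) /
     (rn (tau (Tht o1) (base w)) (rsubmx w.2) a * rn (tau (Tht o1) (base w)) (rsubmx w.2) b).
  have R a' : reg_at idfun (FO o1) (fun w => rn (tau (Tht o1) (base w)) (rsubmx w.2) a') (fO o1).
    by apply: reg_atM; [apply: rr_reg|apply: reg_at_cst].
  have Ff := FO_fO H1; have [Tf pf] := base_T H1 Ff.
  apply: (@reg_at_eq _ _ _ _ _ _ _ U).
    move=> w Fw; have [Tw pw] := base_T H1 Fw; have [o' [y [Ho' _ Ew]]] := Fw.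
    have [T' p'] := zo _ Ho'; move: pw; rewrite Ew rsub_fpt => pw.
    by rewrite /U /u rsub_fpt; apply: rn_ratio => //; rewrite -Ew.
  apply: reg_at_div => //; last by apply: reg_atM.
  by rewrite mulf_neq0 ?rn_neq0 // ?rsub_fpt // pf rsub_fpt.
- move=> o1 H1; have [T1 p1] := zo _ H1.
  have n a' : rn (zl (Tht o1)) o1 a' != 0 by apply: rn_neq0.
  by apply: mulf_neq0; [apply: n|rewrite invr_eq0; apply: mulf_neq0; apply: n].
have [T1 p1] := zo _ Ho; have n a' := @rn_neq0 z o a' Ho Tz pz.
have k1 : k = 1.
  rewrite -(E _ O0) /u /rn; have [T0 p0] := zo _ O0.
  by rewrite !divff ?mulr1 ?divr1 //; apply: rr_neq0 O0 T0 p0.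
have := E _ Ho; rewrite /u (rn_ratio a b Ho T1 Tz p1 pz) k1 => e.
by rewrite -[LHS](divfK (mulf_neq0 (n a) (n b))) e mul1r.
Qed.

(** Acting by [rn z o] moves [z] to a point of its fibre independent of [z] ([PsiE]): the global
    section of the torsor pulled back to [Oo]. *)
Definition Psi o := act (rn (zl (Tht o)) o) (zl (Tht o)).

Lemma PsiE z o : Oo o -> TT z -> p z = Tht o -> Psi o = act (rn z o) z.
Proof.
move=> Ho Tz pz; have [T1 p1] := zlP (Vo Ho); have [t tt E] := td_trans H Tz T1 (etrans pz (esym p1)).
have t1 := rn_torus Ho T1 p1; have t2 := rn_torus Ho Tz pz; have e : Psi o = act (rn (zl (Tht o)) o) (act t z) by rewrite -E.
rewrite e -(td_actM H) //; congr act; apply: funext => a; rewrite E /rn rr_act // mulrAC divfK //; by case: tt.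
Qed.

Lemma Psi_T o : Oo o -> TT (Psi o).
Proof. by move=> Ho; have [T1 p1] := zlP (Vo Ho); apply: act_T => //; apply: rn_torus. Qed.

Lemma p_Psi o : Oo o -> p (Psi o) = Tht o.
Proof. by move=> Ho; have [T1 p1] := zlP (Vo Ho); rewrite (td_over H) //; apply: rn_torus. Qed.

Lemma FO_Psi o1 w : FO o1 w -> TT (Psi (rsubmx w.2)).
Proof. by case=> o [y [Ho _ ->]]; rewrite rsub_fpt; apply: Psi_T. Qed.

Lemma Psi_regm o1 : Oo o1 -> regm_at idfun (FO o1) (fun w => Psi (rsubmx w.2)) (fO o1).
Proof.
move=> Ho; have [l [a [g [rg gE]]]] := td_act H; have Ff := FO_fO Ho.
pose D := fun z : amb L nT (rT + l) => exists t w, [/\ torus_point t, TT w & z = ext w (\row_i t (a i))].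
pose q w : amb L nT (rT + l) := ext (tau (Tht o1) (base w)) (\row_i rn (tau (Tht o1) (base w)) (rsubmx w.2) (a i)).
have qD w : FO o1 w -> D (q w) /\ g (q w) = Psi (rsubmx w.2).
  move=> Fw; have [Tw pw] := base_T Ho Fw; have Ow : Oo (rsubmx w.2) by case: Fw => o [y [? _ ->]]; rewrite rsub_fpt.
  have tt := rn_torus Ow Tw pw; split; first by exists (rn (tau (Tht o1) (base w)) (rsubmx w.2)), (tau (Tht o1) (base w)).
  by rewrite gE // (PsiE Ow Tw pw).
apply: (@regm_at_eq _ _ _ _ _ _ _ _ (fun w => g (q w))).
  by apply: nearA => w /qD[].
apply: (@regm_at_comp _ _ _ _ _ _ _ _ _ _ D q g) => //.
- by move=> w /qD[].
- apply: regm_at_ext; first exact: tau_regm.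
  move=> i; apply: (reg_at_eq (g := fun w => rn (tau (Tht o1) (base w)) (rsubmx w.2) (a i))).
    by move=> y _; rewrite mxE.
  by apply: reg_atM; [apply: rr_reg|apply: reg_at_cst].
- by apply: (regm_at_of rg); have [] := qD _ Ff.
Qed.

Lemma regO_Psi g o1 : Oo o1 -> reg_at idfun TT g (Psi o1) -> regO (fun o => g (Psi o)) o1.
Proof.
move=> Ho R; apply: (@reg_at_comp _ _ _ _ _ _ _ (FO o1) TT (fun w => Psi (rsubmx w.2))).
- exact: FO_fO.
- exact: FO_Psi.
- exact: Psi_regm.
- by rewrite rsub_fpt.
Qed.

Lemma near_Psi S o1 : Oo o1 -> near idfun TT (Psi o1) S -> exists D : {mpoly L[12]}, D != 0 /\
  forall o, D.@[o 0] != 0 -> Oo o /\ S (Psi o).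
Proof.
move=> Ho nS; have nF : near idfun (FO o1) (fO o1) (fun w => S (Psi (rsubmx w.2))).
  apply: (@near_comp _ _ _ _ _ _ _ (FO o1) TT (fun w => Psi (rsubmx w.2)) (fO o1) (FO_fO Ho) (@FO_Psi o1) (Psi_regm Ho)).
  by rewrite rsub_fpt.
apply: (@etale_generic _ _ _ _ (Wp_neq0 L) (@Wp_Oo L) (fun o => S (Psi o)) o1) => //.
  exact: near_self (Psi_T Ho) nS.
apply: regO_etale => //; apply: (@reg_at_near _ _ _ _ _ _ _ (fun=> 1)); last exact: reg_at1.
by apply: nearW nF => w _ Sw; rewrite asboolT.
Qed.

(** * Weights of a class under column scalings and row operations *)

Hypothesis c0L : [pchar L] =i pred0.

(** A map of [Oo] to itself over the cubic multiplies the coordinates of a class by a nowhere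
    vanishing function, hence by a constant. *)
Lemma zv_move a (m : V12 -> V12) : (forall k, pfun (fun o => m o 0 k)) ->
  (forall o, Oo o -> Oo (m o) /\ Tht (m o) = Tht o) ->
  forall x o, VV x -> Oo o -> nbh (c a) x (Tht o) ->
    zv a x (m o) = zv a (Tht o0) (m o0) / zv a (Tht o0) o0 * zv a x o.
Proof.
move=> pm Om x o Vx Ho nx.
pose u o' := zv a (Tht o') (m o') / zv a (Tht o') o'.
have zm0 y o' : VV y -> Oo o' -> nbh (c a) y (Tht o') -> zv a y (m o') != 0.
  by move=> Vy Ho' ny; have [Om' Tm] := Om _ Ho'; apply: zv_neq0 => //; rewrite Tm.
have uE y o' : VV y -> Oo o' -> nbh (c a) y (Tht o') -> u o' = zv a y (m o') / zv a y o'.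
  move=> Vy Ho' ny; have V' := Vo Ho'; have n' := nbh_self (c a) V'; have [Om' Tm] := Om _ Ho'.
  have t0 : trf (c a) y (Tht o') (Tht o') != 0 by apply: trf_neq0.
  have := zv_trf Vy V' Om' (a := a); rewrite Tm => /(_ ny n') e1.
  by rewrite /u -(zv_trf Vy V' Ho' ny n') -e1 -mulf_div divff ?mul1r.
have [||k k0 E] := @etale_const _ _ _ (@Oo_codim2 L) _ (Wp_neq0 L) (@Wp_Oo L) u.
- move=> o1 H1; have V1 := Vo H1; have n1 := nbh_self (c a) V1.
  have [G [G1 HG]] := near_hat uh H1 (nbh_open (c := c a) V1 V1 n1).
  have pE (P : {mpoly L[12]}) : exists P' : {mpoly L[12]}, forall o', P.@[m o' 0] = P'.@[o' 0].
    have [P' HP] := pfun_comp P pm; exists P' => o'; rewrite -HP; exact: meval_eq.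
  have [N' HN] := pE (zN a (Tht o1)); have [D' HD] := pE (zD a (Tht o1)).
  have nz o' : Oo o' -> nbh (c a) (Tht o1) (Tht o') -> [/\ (zN a (Tht o1)).@[o' 0] != 0, (zD a (Tht o1)).@[o' 0] != 0,
     (zN a (Tht o1)).@[m o' 0] != 0 & (zD a (Tht o1)).@[m o' 0] != 0].
    move=> Ho' n'; have [Om' Tm] := Om _ Ho'; have [? ?] := z_neq0 V1 Ho' n'.
    by have [|? ?] := z_neq0 V1 Om' (a := a); rewrite ?Tm.
  apply: (@etale_at_rat _ _ _ _ _ (N' * zD a (Tht o1)) (D' * zN a (Tht o1)) G) => //.
    by rewrite mevalM -HD; have [? ? ? ?] := nz _ H1 n1; apply: mulf_neq0.
  move=> o' Ho' Go' _; have n' := HG _ Ho' (Vo Ho') Go'.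
  rewrite (uE _ _ V1 Ho' n') !zvE !mevalM -HN -HD; have [? ? ? ?] := nz _ Ho' n'.
  by rewrite invf_div mulf_div.
- by move=> o1 H1; have V1 := Vo H1; have n1 := nbh_self (c a) V1; rewrite mulf_neq0 ?invr_eq0 ?zm0 ?zv_neq0.
have -> : zv a (Tht o0) (m o0) / zv a (Tht o0) o0 = k by apply: (E o0); apply: O0.
by rewrite -(E _ Ho) (uE _ _ Vx Ho nx) divfK // zv_neq0.
Qed.

Lemma pfun_sc l k : pfun (fun o => sc l o 0 k).
Proof.
apply: (@pfun_eq _ _ (fun o => l (k %% 6)%N * co o k)); first by move=> o; rewrite mxE.
by apply: pfunM; [apply: pfunC|apply: pfun_co].
Qed.

Lemma pfun_gl A B C D k : pfun (fun o => gl A B C D o 0 k).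
Proof.
apply: (@pfun_eq _ _ (fun o => if (k < 6)%N then A * co o k + B * co o (6 + k) else C * co o (k - 6) + D * co o k)).
  by move=> o; rewrite mxE.
by case: (k < 6)%N; apply: pfunD; apply: pfunM; try exact: pfunC; apply: pfun_co.
Qed.

Definition nz6 (l : nat -> L) := forall i, (i < 6)%N -> l i != 0.
Definition chr (k : nat -> int) (l : nat -> L) := l 0%N ^ k 0%N * (l 1%N ^ k 1%N * (l 2%N ^ k 2%N * (l 3%N ^ k 3%N * (l 4%N ^ k 4%N * l 5%N ^ k 5%N)))).
Definition one_at (i : nat) (t : L) (j : nat) : L := if j == i then t else 1.

Lemma nz6_one i t : t != 0 -> nz6 (one_at i t).
Proof. by move=> t0 j _; rewrite /one_at; case: ifP; rewrite ?oner_neq0. Qed.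

(** The constant of [zv_move], as a function of the parameter, vanishes nowhere on [F != 0], so it
    is a multiple of a power of the prime [F]; the parameter [v0] of the identity fixes the
    factor. *)
Lemma zv_family n (F : {mpoly L[n]}) (g : 'rV[L]_n -> V12 -> V12) (v0 : 'rV_n) a : rprime F -> F.@[v0 0] = 1 ->
  g v0 o0 = o0 -> (forall v k, pfun (fun o => g v o 0 k)) -> (forall k, pfun (fun v => g v o0 0 k)) ->
  (forall (v : 'rV_n) o, F.@[v 0] != 0 -> Oo o -> Oo (g v o) /\ Tht (g v o) = Tht o) ->
  exists e : int, forall (v : 'rV_n) x o, F.@[v 0] != 0 -> VV x -> Oo o -> nbh (c a) x (Tht o) ->
    zv a x (g v o) = F.@[v 0] ^ e * zv a x o.
Proof.
move=> pF F1 g0 pm pg Om; have V0 := Vo O0; have n0 := nbh_self (c a) V0.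
have nz (v : 'rV_n) : F.@[v 0] != 0 -> (zN a (Tht o0)).@[g v o0 0] != 0 /\ (zD a (Tht o0)).@[g v o0 0] != 0.
  by move=> t0; have [Om' Tm] := Om _ _ t0 O0; apply: z_neq0 => //; rewrite Tm.
have pw (P : {mpoly L[12]}) : (forall v : 'rV_n, F.@[v 0] != 0 -> P.@[g v o0 0] != 0) ->
    exists k (e : int), k != 0 /\ forall v : 'rV_n, F.@[v 0] != 0 -> P.@[g v o0 0] = k * F.@[v 0] ^ e.
  move=> nP; have [P' HP] := pfun_comp P pg.
  have HP' (v : 'rV_n) : P.@[g v o0 0] = P'.@[v 0] by rewrite -HP; apply: meval_eq.
  have [|k [e [k0 E]]] := nonvanish_power (N := P') pF; first by move=> v; rewrite -HP'; apply: nP.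
  by exists k, e; split=> // v vn; rewrite HP' E.
have [|k1 [e1 [k10 E1]]] := pw (zN a (Tht o0)); first by move=> v /nz[].
have [|k2 [e2 [k20 E2]]] := pw (zD a (Tht o0)); first by move=> v /nz[].
have Ez (v : 'rV_n) : F.@[v 0] != 0 -> zv a (Tht o0) (g v o0) = k1 / k2 * F.@[v 0] ^ (e1 - e2).
  by move=> d0; rewrite zvE E1 // E2 // invfM mulrACA expfzDr // invr_expz.
exists (e1 - e2) => v x o d0 Vx Ho nx.
rewrite (zv_move (pm v) (fun o => @Om v o d0)) // Ez //; congr (_ * _).
have := Ez v0; rewrite F1 g0 exp1rz mulr1 => ->; last exact: oner_neq0.
by rewrite mulrAC divff ?mul1r // mulf_neq0 ?invr_eq0.
Qed.

Lemma zv_one a i : (i < 6)%N -> exists k : int, forall t x o, t != 0 -> VV x -> Oo o -> nbh (c a) x (Tht o) ->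
  zv a x (sc (one_at i t) o) = t ^ k * zv a x o.
Proof.
move=> i6; have FE (v : 'rV[L]_1) : ('X_0).@[v 0] = v 0 0 by rewrite mevalXU.
have [||| v k|k| v o|e E] := @zv_family 1 'X_0 (fun v : 'rV_1 => sc (one_at i (v 0 0))) (const_mx 1) a.
- exact: rprime_X.
- by rewrite FE mxE.
- by apply: eq12 => k k12; rewrite co_mk // /one_at mxE; case: (_ == i); rewrite mul1r.
- exact: pfun_sc.
- apply: (@pfun_eq _ _ (fun v : 'rV[L]_1 => (if (k %% 6 == i)%N then v 0 0 else 1) * co o0 k)).
    by move=> v; rewrite mxE.
  by apply: pfunM; [case: (_ == i); [apply: pfunX|apply: pfunC]|apply: pfunC].
- rewrite FE => t0 Ho; have n6 := nz6_one i t0; split; first exact: Oo_sc.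
  exact: (Tht_sc uh).
by exists e => t x o t0; have := E (const_mx t) x o; rewrite FE mxE; apply.
Qed.

Lemma sc_sc l l' o : sc l (sc l' o) = sc (fun i => l i * l' i) o.
Proof. by apply: eq12 => k k12; rewrite !co_mk // mulrA. Qed.

Lemma zv_sc a : exists k : nat -> int, forall l x o, nz6 l -> VV x -> Oo o -> nbh (c a) x (Tht o) ->
  zv a x (sc l o) = chr k l * zv a x o.
Proof.
have K i : exists k : int, (i < 6)%N -> forall t x o, t != 0 -> VV x -> Oo o -> nbh (c a) x (Tht o) ->
    zv a x (sc (one_at i t) o) = t ^ k * zv a x o.
  have [i6|] := boolP (i < 6)%N; last by exists 0.
  by have [k E] := zv_one a i6; exists k => _.
have [k E] := choice K; exists k => l x o nl Vx Ho nx.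
have step i o' : (i < 6)%N -> Oo o' -> nbh (c a) x (Tht o') -> [/\ Oo (sc (one_at i (l i)) o'),
    nbh (c a) x (Tht (sc (one_at i (l i)) o')) & zv a x (sc (one_at i (l i)) o') = l i ^ k i * zv a x o'].
  move=> i6 Ho' n'; have n1 := nz6_one i (nl i i6); split; first exact: Oo_sc.
    by rewrite (Tht_sc uh).
  by apply: E => //; apply: nl.
have -> : sc l o = sc (one_at 0 (l 0%N)) (sc (one_at 1 (l 1%N)) (sc (one_at 2 (l 2%N)) (sc (one_at 3 (l 3%N))
    (sc (one_at 4 (l 4%N)) (sc (one_at 5 (l 5%N)) o))))).
  rewrite !sc_sc; apply: eq12 => m m12; rewrite !co_mk //; congr (_ * _).
  have : (m %% 6 < 6)%N by rewrite ltn_mod.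
  by case: (m %% 6)%N => [|[|[|[|[|[|//]]]]]] _; rewrite /one_at /= ?mulr1 ?mul1r.
have [O5 n5 E5] := step 5%N _ isT Ho nx; have [O4 n4 E4] := step 4%N _ isT O5 n5.
have [O3 n3 E3] := step 3%N _ isT O4 n4; have [O2 n2 E2] := step 2%N _ isT O3 n3.
have [O1 n1 E1] := step 1%N _ isT O2 n2; have [_ _ E0] := step 0%N _ isT O1 n1.
by rewrite E0 E1 E2 E3 E4 E5 /chr !mulrA.
Qed.

Definition kk a := projT1 (cid (zv_sc a)).
Lemma zv_scE a l x o : nz6 l -> VV x -> Oo o -> nbh (c a) x (Tht o) -> zv a x (sc l o) = chr (kk a) l * zv a x o.
Proof. by rewrite /kk; case: cid => k /= E; apply: E. Qed.

Lemma glZ m o : gl m 0 0 m o = sc (fun=> m) o.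
Proof.
by apply: eq12 => k k12; rewrite !co_mk //; case: ltnP => k6; rewrite !mul0r ?addr0 ?add0r.
Qed.

Lemma zv_gl a : exists e : int, forall A B C D x o, A * D - B * C != 0 -> VV x -> Oo o -> nbh (c a) x (Tht o) ->
  zv a x (gl A B C D o) = (A * D - B * C) ^ e * zv a x o.
Proof.
pose i4 (k : nat) : 'I_4 := inord k.
pose F : {mpoly L[4]} := 'X_(i4 0) * 'X_(i4 3) - 'X_(i4 1) * 'X_(i4 2).
have FE (v : 'rV[L]_4) : F.@[v 0] = cm v 0 * cm v 3 - cm v 1 * cm v 2 by rewrite mevalB !mevalM !mevalXU.
pose v4 A B C D : 'rV[L]_4 := mk4 (nth 0 [:: A; B; C; D]).
have Fv A B C D : F.@[v4 A B C D 0] = A * D - B * C by rewrite FE !cm_mk.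
have [||| v k|k| v o|e E] := @zv_family _ F (fun v => gl (cm v 0) (cm v 1) (cm v 2) (cm v 3)) (v4 1 0 0 1) a.
- by apply: rprime_det; rewrite /= !inE -!val_eqE /= !inordK.
- by rewrite Fv mulr1 mulr0 subr0.
- by rewrite !cm_mk //= gl1.
- exact: pfun_gl.
- apply: (@pfun_eq _ _ (fun v : 'rV[L]_4 => if (k < 6)%N then cm v 0 * co o0 k + cm v 1 * co o0 (6 + k)
      else cm v 2 * co o0 (k - 6) + cm v 3 * co o0 k)); first by move=> v; rewrite mxE.
  by case: (k < 6)%N; apply: pfunD; apply: pfunM; try exact: pfunC; apply: pfun_cm.
- by rewrite FE => d0 Ho; split; [apply: Oo_gl|apply: (Tht_gl uh)].
by exists e => A B C D x o d0; have := E (v4 A B C D) x o; rewrite Fv !cm_mk //=; apply.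
Qed.

Definition nn a := projT1 (cid (zv_gl a)).
Lemma zv_glE a A B C D x o : A * D - B * C != 0 -> VV x -> Oo o -> nbh (c a) x (Tht o) ->
  zv a x (gl A B C D o) = (A * D - B * C) ^ nn a * zv a x o.
Proof. by rewrite /nn; case: cid => k /= E; apply: E. Qed.

Lemma Psi_move m o t : Oo o -> Oo (m o) -> Tht (m o) = Tht o ->
  (forall a, zv a (Tht o) (m o) = t a * zv a (Tht o) o) -> torus_point t /\ Psi (m o) = act t (Psi o).
Proof.
move=> Ho Hm Tm E; have [T1 p1] := zlP (Vo Ho); have p2 : p (zl (Tht o)) = Tht (m o) by rewrite Tm.
have rE a : rn (zl (Tht o)) (m o) a = t a * rn (zl (Tht o)) o a.
  by rewrite /rn /rr Tm E !mulrA.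
have t1 := rn_torus Ho T1 p1; have t2 := rn_torus Hm T1 p2.
have tE a : t a = rn (zl (Tht o)) (m o) a / rn (zl (Tht o)) o a by rewrite rE mulfK //; case: t1.
have tt : torus_point t.
  split=> [a|a b]; first by rewrite tE mulf_neq0 ?invr_eq0 //; [case: t2|case: t1].
  have [[_ D1] [_ D2]] := (t1, t2).
  have -> := tE (a + b); have -> := tE a; have -> := tE b.
  have -> := D1 a b; have -> := D2 a b.
  by rewrite [RHS]mulf_div.
split=> //; rewrite (PsiE Hm T1 p2) (PsiE Ho T1 p1) -(td_actM H) //.
by congr act; apply: funext.
Qed.

Lemma Psi_sc l o : nz6 l -> Oo o -> torus_point (fun a => chr (kk a) l) /\ Psi (sc l o) = act (fun a => chr (kk a) l) (Psi o).
Proof.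
move=> nl Ho; apply: (Psi_move (m := sc l)) => //; first exact: Oo_sc.
  exact: (Tht_sc uh).
move=> a; have Vv := Vo Ho; apply: zv_scE => //; exact: nbh_self.
Qed.

Lemma Psi_gl A B C D o : A * D - B * C = 1 -> Oo o -> Psi (gl A B C D o) = Psi o.
Proof.
move=> d1 Ho; have d0 : A * D - B * C != 0 by rewrite d1 oner_neq0.
have O1 := Oo_gl d0 Ho; have T1 := Tht_gl uh Ho d0; have Vv := Vo Ho.
have z1 a : zv a (Tht o) (gl A B C D o) = zv a (Tht o) o.
  by rewrite (zv_glE d0 Vv Ho (nbh_self (c a) Vv)) d1 exp1rz mul1r.
have [Tz pz] := zlP Vv; have p2 : p (zl (Tht o)) = Tht (gl A B C D o) by rewrite T1.
rewrite (PsiE O1 Tz p2) (PsiE Ho Tz pz); congr act; apply: funext => a.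
by rewrite /rn /rr T1 z1.
Qed.

Lemma chr_one k i t : (i < 6)%N -> chr k (one_at i t) = t ^ k i.
Proof.
by case: i => [|[|[|[|[|[|//]]]]]] _; rewrite /chr /one_at /= ?exp1rz ?mulr1 ?mul1r ?mulr1.
Qed.

Lemma nz2 : (2%:R : L) != 0.
Proof. by have [/(_ c0L) -> _] := pcharf0P L. Qed.

Lemma kkD a b i : (i < 6)%N -> kk (a + b) i = kk a i + kk b i.
Proof.
move=> i6; apply: (pow2_inj c0L); have [[_ E] _] := Psi_sc (nz6_one i nz2) O0.
by have := E a b; rewrite !chr_one // expfzDr ?nz2.
Qed.

Definition ksum (k : nat -> int) := k 0%N + k 1%N + k 2%N + k 3%N + k 4%N + k 5%N.

Lemma kk_nn a (m : L) : m != 0 -> (m ^+ 2) ^ nn a = m ^ ksum (kk a).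
Proof.
move=> m0; have Vv := Vo O0; have n0 := nbh_self (c a) Vv.
have d0 : m * m - 0 * 0 != 0 by rewrite mul0r subr0 mulf_neq0.
have nm : nz6 (fun=> m) by [].
have := zv_glE d0 Vv O0 n0; rewrite glZ (zv_scE nm Vv O0 n0) mul0r subr0 => /mulIf E.
by rewrite -E ?zv_neq0 //; last exact: O0; rewrite /chr /ksum !expfzDr // !mulrA.
Qed.

(** A scalar row operation is also a uniform column scaling, so a scalar [m] acts both by [m] to the
    sum of the weights and by its determinant [m ^+ 2] to the power [nn a]. *)
Lemma kk_even a : ksum (kk a) = nn a *+ 2.
Proof.
have sq (t : L) (e : int) : (t ^+ 2) ^ e = t ^ e * t ^ e by rewrite expr2 expfzMl.
apply: (pow2_inj c0L); rewrite -kk_nn ?nz2 // mulr2n expfzDr ?nz2 //.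
Qed.

Definition olift x : V12 := if pselect (VV x) is left Vx then projT1 (cid2 (Tht_lift uh (proj1 (VP x) Vx))) else o0.

Lemma oliftP x : VV x -> [/\ Oo (olift x), th h (olift x) = val x.1 & Tht (olift x) = x].
Proof. by rewrite /olift; case: pselect => // Vx _; case: (cid2 _) => o Ho [? ?]. Qed.

Lemma chr0 k l : (forall i, (i < 6)%N -> k i = 0) -> chr k l = 1.
Proof. by move=> k0; rewrite /chr !k0 // !expr0z !mul1r. Qed.

Lemma th_tht o : th h o *m h = tht o. Proof. by rewrite /th mulmxKV. Qed.

(** Zero weights force [nn a = 0]; the coordinate is then invariant under all column scalings and
    row operations, and [chart_descent] makes it a function on the cubic. *)
Lemma kk0_regular a x : (forall i, (i < 6)%N -> kk a i = 0) -> VV x ->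
  reg_at idfun VV (fun y => (zv a x (olift y))^-1) x.
Proof.
move=> k0 Vx; have n0 : nn a = 0.
  by have := kk_even a; rewrite /ksum !k0 // mulr2n; lia.
have inv o l A B C D : Oo o -> nbh (c a) x (Tht o) -> nz6 l -> A * D - B * C != 0 ->
    zv a x (gl A B C D (sc l o)) = zv a x o.
  move=> Ho nx nl d0; have Os := Oo_sc nl Ho; have Ts := Tht_sc uh Ho nl.
  by rewrite zv_glE ?Ts // n0 expr0z mul1r zv_scE // chr0 ?mul1r.
have [l xl] := coord_neq0 x.1.
pose z0 : 'rV[L]_5 := (val x.1 0 l)^-1 *: val x.1 *m h.
have z0E : z0 = (val x.1 0 l)^-1 *: (val x.1 *m h) by rewrite /z0 -scalemxAl.
have sx := proj1 (VP x) Vx; have xl' : (val x.1 0 l)^-1 != 0 by rewrite invr_eq0.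
have s0 : smooth z0 by rewrite z0E; apply: smoothZ.
have [_ [i [j [i3 j3 q0]]]] := s0.
have [d [F [fF Fx FG]]] := nbh_open (c := c a) Vx Vx (nbh_self (c a) Vx).
pose nb (zz : 'rV[L]_5) := nbh (c a) x (mkp (zz *m invmx h), 0).
pose Gf (v : 'rV[L]_5) := evr idfun F (v *m invmx h) (0 : 'rV_0).
have [G HG] : pfun Gf.
  have [k|P HP] := @pfun_comp _ _ _ F (fun k (v : 'rV[L]_5) => row_mx (v *m invmx h) (0 : 'rV_0) 0 k).
    rewrite -[k]splitK; case: (split k) => [k'|[//]] /=.
    by apply: (pfun_eq _ (pfun_mulmx (invmx h) k')) => v; rewrite row_mxEl.
  by exists P => v; rewrite -HP.
have smoothV zz : smooth zz -> zz *m invmx h != 0 /\ VV (mkp (zz *m invmx h), 0).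
  move=> sz; have v0 : zz *m invmx h != 0.
    by apply: contraNneq (smooth_neq0 sz) => e; rewrite -[zz](mulmxKV uh) e mul0mx.
  split=> //; apply/VP => /=; have [e e0 E] := mkpP v0.
  have -> : val (mkp (zz *m invmx h)) *m h = e^-1 *: zz.
    by apply: (scalerI e0); rewrite scalemxAl -E mulmxKV // scalerA mulfV // scale1r.
  by apply: smoothZ => //; rewrite invr_eq0.
have [|||||N' [D' [D0 E]]] := @chart_descent L (zN a x) (zD a x) nb i j z0 G i3 j3 s0 q0.
- by move=> o Ho nx; apply: z_neq0.
- move=> o lam A B C D Ho nx nl d0 /=; have nx' : nbh (c a) x (Tht o) := nx.
  have Os := Oo_sc nl Ho; have Og := Oo_gl d0 Os; have Tg : Tht (gl A B C D (sc lam o)) = Tht o.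
    by rewrite (Tht_gl uh) // (Tht_sc uh).
  have [n1 n2] := z_neq0 Vx Ho nx'; have [|n3 n4] := z_neq0 Vx Og (a := a); first by rewrite Tg.
  by apply: divf_cross => //; rewrite -!zvE inv.
- move=> e zz e0 nz; rewrite /nb -scalemxAl; move: nz; rewrite /nb; set v := zz *m invmx h.
  have [->|v0] := eqVneq v 0; first by rewrite scaler0.
  have [e' e'0 Ev] := mkpP v0; have ev0 : e *: v != 0 by rewrite scaler_eq0 negb_or e0.
  by rewrite (mkp_eq (p := mkp v) (c := e * e') ev0) // {1}Ev scalerA.
- move=> e e0; rewrite -HG /Gf z0E !scalerA -!scalemxAl mulmxK // (evr_scale _ _ _ _ fF).
  by rewrite mulf_neq0 ?expf_neq0 ?mulf_neq0 //; move: Fx; rewrite evE (_ : x.2 = 0) //; apply/rowP => -[].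
- move=> zz sz; rewrite -HG /Gf /nb => Fz; have [v0 Vv] := smoothV _ sz; apply: FG => //.
  have [e e0 Ev] := mkpP v0; move: Fz; rewrite {1}Ev (evr_scale _ _ _ _ fF) mulf_nz => /andP[_].
  by rewrite evE.
pose zz (y : amb L 4 0) : 'rV[L]_5 := (val y.1 0 l)^-1 *: val y.1 *m h.
have rz k : reg_at idfun VV (fun y => mz i j (zz y) 0 k) x.
  have [P HP] : pfun (fun w : 'rV[L]_5 => mz i j (w *m h) 0 k).
    have lin m : pfun (fun w : 'rV[L]_5 => (w *m h) 0 m) by apply: pfun_mulmx.
    have q m := pfun_XY m lin.
    rewrite /mz /mk4; case: k => [[|[|[|[|//]]]]] k4; apply: pfun_eq => [w|]; try by rewrite mxE.
    - exact: (q _).1.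
    - exact: (q _).1.
    - exact: (q _).2.
    - exact: (q _).2.
  apply: (reg_at_eq (g := fun y => mmap idfun (((val y.1 0 l)^-1 *: val y.1) 0) P)).
    by move=> y _; rewrite /zz HP.
  apply: reg_at_meval => m; apply: (reg_at_eq (g := fun y => val y.1 0 m / val y.1 0 l)).
    by move=> y _; rewrite [RHS]mxE mulrC.
  exact: reg_at_proj.
have rD (P : {mpoly L[4]}) : reg_at idfun VV (fun y => P.@[mz i j (zz y) 0]) x.
  by apply: (reg_at_eq (g := fun y => mmap idfun (mz i j (zz y) 0) P)) => //; apply: reg_at_meval.
have o2P y : VV y -> nbh (c a) x y -> val y.1 0 l != 0 -> exists o, [/\ Oo o, nbh (c a) x (Tht o), tht o = zz y &
    zv a x (olift y) = zv a x o].
  move=> Vy ny yl; have [Ho th1 T1] := oliftP Vy; have yl' : (val y.1 0 l)^-1 != 0 by rewrite invr_eq0.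
  have n1 := nz6_one 0 yl'; exists (sc (one_at 0 (val y.1 0 l)^-1) (olift y)); split.
  - exact: Oo_sc.
  - by rewrite (Tht_sc uh) // T1.
  - by rewrite tht_sc /prod6 /one_at /= !mulr1 -(th_tht (olift y)) th1 /zz scalemxAl.
  - by rewrite zv_scE ?T1 // chr0 // mul1r.
have key y : VV y -> nbh (c a) x y -> val y.1 0 l != 0 -> D'.@[mz i j (zz y) 0] != 0 ->
    N'.@[mz i j (zz y) 0] != 0 /\ zv a x (olift y) = N'.@[mz i j (zz y) 0] / D'.@[mz i j (zz y) 0].
  move=> Vy ny yl Dy; have [o [Ho no to ->]] := o2P y Vy ny yl.
  have [n1 n2] := z_neq0 Vx Ho no; have e := E o; rewrite to in e.
  have N0 : N'.@[mz i j (zz y) 0] != 0.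
    by have := mulf_neq0 n1 Dy; rewrite e mulf_nz => /andP[].
  by split=> //; apply/eqP; rewrite zvE eqr_div // e mulrC.
have [N0 _] := key x Vx (nbh_self (c a) Vx) xl D0.
apply: (@reg_at_near _ _ _ _ _ _ _ (fun y => D'.@[mz i j (zz y) 0] / N'.@[mz i j (zz y) 0])); last first.
  exact: reg_at_div.
have n1 : near idfun VV x (fun y => nbh (c a) x y) by exists d, F.
have n2 : near idfun VV x (fun y => val y.1 0 l != 0).
  exists 1%N, 'X_(lshift 0 l); split; first exact: formXP.
    by rewrite evXP.
  by move=> y _; rewrite evXP.
have n3 := reg_at_neq0 Vx (rD D') D0.
apply: nearW (near_and n1 (near_and n2 n3)) => y Vy [ny [yl Dy]].
by have [N0y ->] := key y Vy ny yl Dy; rewrite invf_div.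
Qed.

(** The coordinates of such a class descend to nowhere vanishing regular functions on the smooth
    locus, which exhibit its cocycle as a coboundary. *)
Lemma kk_inj0 a : (forall i, (i < 6)%N -> kk a i = 0) -> a = 0.
Proof.
move=> k0.
have E_ex x : exists dE : nat * {mpoly L[5 + 0]}, VV x -> exists G : {mpoly L[5 + 0]}, [/\ form dE.1 dE.2, form dE.1 G,
    ev idfun dE.2 x != 0 & forall y, VV y -> ev idfun dE.2 y != 0 ->
      nbh (c a) x y /\ (zv a x (olift y))^-1 = ev idfun G y / ev idfun dE.2 y].
  have [Vx|nV] := pselect (VV x); last by exists (0%N, 0) => /nV.
  have [d [F [fF Fx FG]]] := nbh_open (c := c a) Vx Vx (nbh_self (c a) Vx).
  have [e [G [P [fG fP Px E]]]] := kk0_regular k0 Vx.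
  exists ((d + e)%N, F * P) => _; exists (F * G); split; try exact: formM.
    by rewrite evM mulf_neq0.
  move=> y Vy; rewrite !evM mulf_nz => /andP[Fy Py]; split; first exact: FG.
  by rewrite E // -mulf_div divff // mul1r.
have [E HE] := choice E_ex.
rewrite -(td_cl H a); apply/clP.
exists (fun x y => ev idfun (E x).2 y != 0), (fun x y => (zv a x (olift y))^-1); split.
  move=> x Vx; have [G [fE fG Ex EG]] := HE x Vx; split=> //.
  - by move=> y Vy Ey; exists (E x).1, (E x).2.
  - by move=> y Vy Ey; split; last exact: I; case: (EG y Vy Ey).
  - move=> y [Vy Ey]; exists (E x).1, G, (E x).2; split=> // y' [Vy' _] Ey'; by case: (EG y' Vy' Ey').
  - by move=> y Vy Ey; have [ny _] := EG y Vy Ey; have [Ho _ Ty] := oliftP Vy; rewrite invr_eq0 zv_neq0 ?Ty.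
move=> x y v Vx Vy Vv Ex Ey /=; have [G1 [_ _ _ EG1]] := HE x Vx; have [G2 [_ _ _ EG2]] := HE y Vy.
have [nx _] := EG1 v Vv Ex; have [ny _] := EG2 v Vv Ey; have [Ho _ Tv] := oliftP Vv.
have zx : zv a x (olift v) != 0 by rewrite zv_neq0 ?Tv.
have zy : zv a y (olift v) != 0 by rewrite zv_neq0 ?Tv.
have := zv_trf Vx Vy Ho (a := a); rewrite Tv => /(_ nx ny) e.
by move: e zx zy; exact: inv_swap.
Qed.

(** * Functions on the torsor whose divisors are the planes *)

Let pV z : TT z -> VV (p z). Proof. by case: (td_p H) => pV _ _; apply: pV. Qed.

Lemma frame_of_cocycle (d : cocycle VV) : exists (U : amb L 4 0 -> amb L 4 0 -> Prop) (den : amb L 4 0 -> amb L nT rT -> L),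
  [/\ forall x, VV x -> open_in idfun VV (U x) /\ U x x,
      forall x v, VV x -> VV v -> U x v -> nbh d x v,
      forall x z, VV x -> TT z -> U x (p z) -> den x z != 0 /\ reg_at idfun TT (den x) z,
      forall x z t, VV x -> TT z -> U x (p z) -> torus_point t -> den x (act t z) = t (cl d) * den x z
    & forall x y z, VV x -> VV y -> TT z -> U x (p z) -> U y (p z) -> den y z = trf d x y (p z) * den x z].
Proof.
have /clP[U [hh [HU E]]] := td_cl H (cl d).
exists U, (fun x z => hh x (p z) * f (cl d) x z); split.
- by move=> x /HU[].
- by move=> x v Vx Vv Uv; have [_ _ /(_ v Vv Uv)[]] := HU x Vx.
- move=> x z Vx Tz Uz; have [oU Ux US rh h0] := HU x Vx; have Vz := pV Tz; have [n1 n2] := US _ Vz Uz; split.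
    by rewrite mulf_neq0 ?h0 // (td_f_neq0 H).
  apply: reg_atM; last exact: (f_reg_at Vx Tz n1).
  apply: (@reg_at_comp _ _ _ _ _ _ _ TT VV p z Tz pV (regm_at_of (td_p H) Tz)).
  by apply: (@reg_at_local _ _ _ _ _ _ (U x)); [exact: oU|apply: rh].
- move=> x z t Vx Tz Uz tt; have [_ _ US _ _] := HU x Vx; have [n1 _] := US _ (pV Tz) Uz.
  by rewrite (td_over H) // (td_f_act H) // mulrCA.
move=> x y z Vx Vy Tz Ux Uy; have Vz := pV Tz; have [_ _ US _ _] := HU x Vx; have [n1 _] := US _ Vz Ux.
have [_ _ US' _ _] := HU y Vy; have [n1' _] := US' _ Vz Uy.
by rewrite (td_f_trf H Vx Vy Tz n1 n1') [LHS]mulrA -E // mulrA.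
Qed.

Section PencilFunction.
Variables (A B s t : {mpoly L[4.+1 + 0]}).
Hypotheses (fA : form 1 A) (fB : form 1 B) (fs : form 2 s) (ft : form 2 t).
Local Notation "F @ x" := (ev (idfun : {rmorphism L -> L}) F x) (at level 10, x at next level).
Hypothesis rel : forall x, VV x -> s @ x * A @ x + t @ x * B @ x = 0.
Hypothesis cover : forall x, VV x -> (s @ x != 0) || (B @ x != 0) || ((t @ x != 0) || (A @ x != 0)).
Variables pD rA rB g : V12 -> L.
Hypotheses (qA : pfun rA) (qB : pfun rB).
Hypotheses (AE : forall o k, Oo o -> th h o = k *: val (Tht o).1 -> k * A @ (Tht o) = pD o * rA o)
 (BE : forall o k, Oo o -> th h o = k *: val (Tht o).1 -> k * B @ (Tht o) = pD o * rB o)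
 (sE : forall o k, Oo o -> th h o = k *: val (Tht o).1 -> k ^+ 2 * s @ (Tht o) = rB o * g o)
 (tE : forall o k, Oo o -> th h o = k *: val (Tht o).1 -> k ^+ 2 * t @ (Tht o) = - (rA o * g o)).

Let d := pencil fA fB fs ft rel cover.
Let rr b o := if b then rB o else rA o.
Let ty := pen_ty B s.

Lemma pen_rest_neq0 b o : Oo o -> pen_in A B s t b (Tht o) -> rr b o != 0.
Proof.
move=> Ho; have [k k0 Ek] := th_scale (td_h H) Ho; rewrite /pen_in /rr.
have nz e F (X Y Z : L) : k ^+ e * F @ (Tht o) = X -> F @ (Tht o) != 0 -> X != 0 by move=> <- ?; rewrite mulf_neq0 ?expf_neq0.
case: b => /orP[].
- by move/(nz _ _ _ 0 0 (sE Ho Ek)); rewrite mulf_nz => /andP[].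
- by move/(nz 1%N _ _ 0 0 (BE Ho Ek)); rewrite mulf_nz => /andP[].
- by move/(nz _ _ _ 0 0 (tE Ho Ek)); rewrite oppr_eq0 mulf_nz => /andP[].
- by move/(nz 1%N _ _ 0 0 (AE Ho Ek)); rewrite mulf_nz => /andP[].
Qed.

Lemma pen_rest_trf b b' o : Oo o -> pen_in A B s t b (Tht o) -> pen_in A B s t b' (Tht o) ->
  rr b' o = pen_rat A B s t b b' (Tht o) * rr b o.
Proof.
move=> Ho i1 i2; have r1 := pen_rest_neq0 Ho i1; have r2 := pen_rest_neq0 Ho i2.
have [k k0 Ek] := th_scale (td_h H) Ho.
have X := rest_cross k0 (AE Ho Ek) (BE Ho Ek) (sE Ho Ek) (tE Ho Ek).
rewrite /pen_rat; move: i1 i2 r1 r2; rewrite /pen_in /rr.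
case: b; case: b' => /= i1 i2 r1 r2; rewrite ?mul1r //.
  by have [? ?] := X r2 r1 i1 i2.
by have [? ?] := X r1 r2 i2 i1.
Qed.

Lemma pencil_function : exists phi : amb L nT rT -> L,
  [/\ forall z, TT z -> reg_at idfun TT phi z,
      forall z t, TT z -> torus_point t -> phi (act t z) = (t (cl d))^-1 * phi z
    & forall o, Oo o -> phi (Psi o) = pD o].
Proof.
have [U [den [HU HUn Hden Hact Htrf]]] := frame_of_cocycle d.
pose ph z := pen_sec A B s (p z) (p z) / den (p z) z.
have sec_indep x z : VV x -> TT z -> U x (p z) -> ph z = pen_sec A B s x (p z) / den x z.
  move=> Vx Tz Ux; have Vz := pV Tz; have [_ Uz] := HU _ Vz; have [d1 _] := Hden _ _ Vx Tz Ux.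
  have n1 := HUn _ _ Vx Vz Ux; have n2 := HUn _ _ Vz Vz Uz.
  rewrite /ph (pen_sec_trf (A := A) (t := t) rel Vz n1 n2) (Htrf _ _ _ Vx Vz Tz Ux Uz) -mulf_div divff ?mul1r //.
  exact: (trf_neq0 (c := d) Vx Vz Vz n1 n2).
have nearU x z : VV x -> TT z -> U x (p z) -> near idfun TT z (fun z' => U x (p z')).
  move=> Vx Tz Ux; apply: (near_comp Tz pV (regm_at_of (td_p H) Tz)).
  by have [oU _] := HU _ Vx; apply: oU => //; apply: pV.
have ph_reg z : TT z -> reg_at idfun TT ph z.
  move=> Tz; have Vz := pV Tz; have [_ Uz] := HU _ Vz; have [d1 rd] := Hden _ _ Vz Tz Uz.
  apply: (@reg_at_near _ _ _ _ _ _ _ (fun z' => pen_sec A B s (p z) (p z') / den (p z) z')).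
    by apply: nearW (nearU _ _ Vz Tz Uz) => z' Tz' Uz'; rewrite (sec_indep (p z)).
  apply: reg_at_div => //; apply: (reg_at_comp Tz pV (regm_at_of (td_p H) Tz)).
  by apply: pen_sec_reg => //; apply: HUn.
have ph_act z t' : TT z -> torus_point t' -> ph (act t' z) = (t' (cl d))^-1 * ph z.
  move=> Tz tt; have Vz := pV Tz; have [_ Uz] := HU _ Vz.
  by rewrite /ph (td_over H) // Hact // invfM mulrCA.
pose l x o : L := th h o 0 (nzc x.1).
pose u x o := rr (ty x) o / l x o / den x (Psi o).
have l0 x o : VV x -> Oo o -> U x (Tht o) -> l x o != 0.
  move=> Vx Ho Ux; have [_ n1] := HUn _ _ Vx (Vo Ho) Ux; have [k k0 Ek] := th_scale (td_h H) Ho.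
  by rewrite /l Ek mxE mulf_neq0.
have u_indep x o : VV x -> Oo o -> U x (Tht o) -> u (Tht o) o = u x o.
  move=> Vx Ho Ux; have Vz := Vo Ho; have [_ Uz] := HU _ Vz; have Tz := Psi_T Ho; have pz := p_Psi Ho.
  have Ux' : U x (p (Psi o)) by rewrite pz.
  have Uz' : U (Tht o) (p (Psi o)) by rewrite pz.
  have [i1 m1] := HUn _ _ Vx Vz Ux; have [i2 m2] := HUn _ _ Vz Vz Uz.
  have [d1 _] := Hden _ _ Vx Tz Ux'; have d2 : trf d x (Tht o) (Tht o) != 0 by apply: trf_neq0 => //; apply: HUn.
  rewrite /u (Htrf _ _ _ Vx Vz Tz Ux' Uz') pz (pen_rest_trf Ho i1 i2) /= /pen_trf.
  have [k k0 Ek] := th_scale (td_h H) Ho; rewrite /l Ek !mxE.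
  move: d2; rewrite /= /pen_trf mulf_nz => /andP[ra _]; rewrite -/(ty x) -/(ty (Tht o)) in ra *.
  exact: rest_ratio.
have [||kc kc0 E] := @etale_const _ _ _ (@Oo_codim2 L) _ (Wp_neq0 L) (@Wp_Oo L) (fun o => u (Tht o) o).
- move=> o1 H1; apply: (regO_etale) => //; have V1 := Vo H1; have [oU U1] := HU _ V1.
  have [U1' T1] : U (Tht o1) (p (Psi o1)) /\ TT (Psi o1) by rewrite p_Psi //; split=> //; apply: Psi_T.
  have [d1 rd] := Hden _ _ V1 T1 U1'.
  have [G [G1 HG]] := near_hat (td_h H) H1 (oU _ V1 U1).
  apply: (@reg_at_near _ _ _ _ _ _ _ (fun w => u (Tht o1) (rsubmx w.2))).
    have nG : near idfun (FO o1) (fO o1) (fun w => G.@[(rsubmx w.2) 0] != 0).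
      apply: reg_at_neq0; first exact: FO_fO.
        by apply: (@regO_pfun (fun o => G.@[o 0])); exists G.
      by rewrite rsub_fpt.
    apply: nearW nG => _ [o [y [Ho _ ->]]]; rewrite rsub_fpt => Go.
    by symmetry; apply: u_indep => //; apply: HG => //; apply: (Vo Ho).
  apply: reg_at_div; first exact: FO_fO.
  - by rewrite rsub_fpt.
  - apply: reg_at_div; first exact: FO_fO.
    + by rewrite rsub_fpt l0.
    + by apply: (@regO_pfun (rr (ty (Tht o1)))); rewrite /rr; case: ty.
    + by apply: (@regO_pfun (l (Tht o1))); apply: pfun_th.
  - exact: (regO_Psi H1 rd).
- move=> o1 H1; have V1 := Vo H1; have [oU U1] := HU _ V1.
  have [U1' T1] : U (Tht o1) (p (Psi o1)) /\ TT (Psi o1) by rewrite p_Psi //; split=> //; apply: Psi_T.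
  have [d1 _] := Hden _ _ V1 T1 U1'; have [i1 _] := HUn _ _ V1 V1 U1.
  by rewrite /u !mulf_neq0 ?invr_eq0 ?pen_rest_neq0 ?l0.
exists (fun z => kc^-1 * ph z); split.
- by move=> z Tz; apply: reg_atM; [apply: reg_at_cst|apply: ph_reg].
- by move=> z t' Tz tt; rewrite ph_act // mulrCA.
move=> o Ho; rewrite /ph p_Psi //; have [k k0 Ek] := th_scale (td_h H) Ho.
have lv : l (Tht o) o = k * val (Tht o).1 0 (nzc (Tht o).1) by rewrite /l Ek mxE.
have e1 : pen_sec A B s (Tht o) (Tht o) = pD o * rr (ty (Tht o)) o / l (Tht o) o.
  have n0 := nzcP (Tht o).1; rewrite /pen_sec lv /pen_eq -/(ty _) /rr.
  by case: (ty _); rewrite -?(AE Ho Ek) -?(BE Ho Ek) -mulf_div divff ?mul1r.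
have := E o Ho; rewrite /u e1 => {}E; exact: (cancel_const_pencil (pD o) kc0 E).
Qed.

End PencilFunction.

Local Notation XF := (XF h).
Local Notation YF := (YF h).
Local Notation "F @ x" := (ev (idfun : {rmorphism L -> L}) F x) (at level 10, x at next level).

Definition plucker_fun (q : V12 -> L) := exists (phi : amb L nT rT -> L) (a : Pic VV),
  [/\ forall z, TT z -> reg_at idfun TT phi z,
      forall z t, TT z -> torus_point t -> phi (act t z) = (t a)^-1 * phi z
    & forall o, Oo o -> phi (Psi o) = q o].

Lemma plucker_funN q : plucker_fun q -> plucker_fun (fun o => - q o).
Proof.
case=> phi [a [r1 r2 r3]]; exists (fun z => - phi z), a; split.
- by move=> z Tz; apply/reg_atN/r1.
- by move=> z t Tz tt; rewrite r2 // mulrN.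
by move=> o Ho; rewrite r3.
Qed.

Lemma segre_prod x : VV x -> let z := val x.1 *m h in Xc z 0 * Xc z 1 * Xc z 2 = Yc z 0 * Yc z 1 * Yc z 2.
Proof. by move=> /VP[+ _] /=; rewrite segreE => /eqP; rewrite subr_eq0 => /eqP. Qed.

Lemma perm_function (i j : nat -> nat) (pD rA rB g : V12 -> L) : perm3 L i -> perm3 L j -> pfun rA -> pfun rB ->
  (forall o, let x k := fX (co o) (i k) in let y k := fY (co o) (j k) in
    [/\ x 0%N - y 0%N = pD o * rA o, x 1%N - y 1%N = pD o * rB o, x 1%N * x 2%N - y 0%N * y 1%N = rB o * g o
    & y 0%N * (x 2%N - y 1%N) = - (rA o * g o)]) -> plucker_fun pD.
Proof.
move=> [i3 iprod isum ieq] [j3 jprod jsum jeq] qA qB E.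
pose x k := XF (i k); pose y k := YF (j k).
have fx k : form 1 (x k) by apply: form_XF.
have fy k : form 1 (y k) by apply: form_YF.
have xE v k : x k @ v = Xc (val v.1 *m h) (i k) by apply: XFE.
have yE v k : y k @ v = Yc (val v.1 *m h) (j k) by apply: YFE.
have fs : form 2 (x 1%N * x 2%N - y 0%N * y 1%N) by apply: formD; [|apply: formN]; [exact: (formM (fx _) (fx _))|exact: (formM (fy _) (fy _))].
have fd k k' : form 1 (x k - y k') by apply: formD => //; apply: formN.
have ft : form 2 (y 0%N * (x 2%N - y 1%N)) by exact: (formM (fy _) (fd _ _)).
have xT o k m : th h o = m *: val (Tht o).1 -> m * x k @ (Tht o) = fX (co o) (i k) by apply: XF_Tht.
have yT o k m : th h o = m *: val (Tht o).1 -> m * y k @ (Tht o) = fY (co o) (j k) by apply: YF_Tht.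
have rel v : VV v -> (x 1%N * x 2%N - y 0%N * y 1%N) @ v * (x 0%N - y 0%N) @ v +
    (y 0%N * (x 2%N - y 1%N)) @ v * (x 1%N - y 1%N) @ v = 0.
  move=> Vv; rewrite !(evM, evD, evN) !xE !yE; apply: (perm_rel (y2 := Yc (val v.1 *m h) (j 2%N))).
    by rewrite iprod jprod; apply: segre_prod.
  by rewrite isum jsum; apply: frame_linear.
have cover v : VV v -> ((x 1%N * x 2%N - y 0%N * y 1%N) @ v != 0) || ((x 1%N - y 1%N) @ v != 0) ||
    (((y 0%N * (x 2%N - y 1%N)) @ v != 0) || ((x 0%N - y 0%N) @ v != 0)).
  move=> Vv; apply: contraT; rewrite !negb_or !negbK !(evM, evD, evN) !xE !yE => /andP[/andP[/eqP s0 /eqP B0] /andP[/eqP t0 /eqP A0]].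
  exfalso; have := proj1 (VP v) Vv; move: s0 B0 t0 A0; set z := _ *m h; have := frame_linear z.
  rewrite -(isum (Xc z)) -(jsum (Yc z)) => es.
  move=> s0 /eqP; rewrite subr_eq0 => /eqP B0 t0 /eqP; rewrite subr_eq0 => /eqP A0.
  move: es; rewrite -A0 -B0 => /addrI C0; move: s0 t0; rewrite -A0 -B0 => /eqP; rewrite subr_eq0 => /eqP s0.
  rewrite mulrBr => /eqP; rewrite subr_eq0 => /eqP t0; apply: (@not_smooth _ _ (Xc z (i 0%N) * Xc z (i 1%N))).
    by move=> k k3; apply: ieq.
  by move=> k k3; apply: jeq => //; rewrite -?A0 -?B0 -?C0.
have [||||phi [r1 r2 r3]] := @pencil_function _ _ _ _ (fd _ _) (fd _ _) fs ft rel cover pD rA rB g qA qB.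
- by move=> o m Ho Em; rewrite evD evN mulrBr !xT // !yT //; have [] := E o.
- by move=> o m Ho Em; rewrite evD evN mulrBr !xT // !yT //; have [] := E o.
- move=> o m Ho Em; rewrite !(evM, evD, evN) mulrBr expr2 (mulrACA m m (x 1%N @ _)) (mulrACA m m (y 0%N @ _)) !xT // !yT //; by have [] := E o.
- move=> o m Ho Em; rewrite !(evM, evD, evN) expr2 mulrACA mulrBr !xT // !yT //; by have [] := E o.
by exists phi; eexists; split; first exact: r1; [exact: r2|].
Qed.

Lemma pfun_mm a b : pfun (fun o => mm (co o) a b). Proof. exact: pfun_pl. Qed.
Lemma pfun_pP a : (a < 3)%N -> pfun (fun o => pP (co o) a).
Proof. by case: a => [|[|[|//]]] _; apply: pfun_pl. Qed.
Lemma pfun_pQ a : (a < 3)%N -> pfun (fun o => pQ (co o) a).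
Proof. by case: a => [|[|[|//]]] _; apply: pfun_pl. Qed.

Lemma plucker_P a : (a < 3)%N -> plucker_fun (fun o => pP (co o) a).
Proof.
move=> a3; apply: (perm_function (perm3_addl L a3) (perm3_subr L a3) _ _ (fun o => cofactor_P (co o) a3));
apply: pfunN; apply: pfunM; first [exact: pfun_mm|exact: pfun_pQ].
Qed.

Lemma plucker_Q b : (b < 3)%N -> plucker_fun (fun o => pQ (co o) b).
Proof.
move=> b3; apply: (perm_function (perm3_addr L b3) (perm3_subl L b3) _ _ (fun o => cofactor_Q (co o) b3));
apply: pfunN; apply: pfunM; first [exact: pfun_mm|exact: pfun_pP].
Qed.

Lemma plucker_D a b : (a < 3)%N -> (b < 3)%N -> plucker_fun (fun o => mm (co o) a b).
Proof.
move=> a3 b3; pose i := ((a + b) %% 3)%N; pose j := ((b + 3 - a) %% 3)%N.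
have m3 k : (k %% 3 < 3)%N by rewrite ltn_mod.
have i3 : (i < 3)%N := m3 _; have j3 : (j < 3)%N := m3 _.
have rel v : VV v -> (XF ((i + 1) %% 3) * XF ((i + 2) %% 3)) @ v * XF i @ v +
    (- (YF ((j + 1) %% 3) * YF ((j + 2) %% 3))) @ v * YF j @ v = 0.
  move=> Vv; rewrite evN !evM !XFE // !YFE // mulNr; apply/eqP; rewrite subr_eq0; apply/eqP.
  by rewrite !prod_shift //; apply: segre_prod.
have cover v : VV v -> ((XF ((i + 1) %% 3) * XF ((i + 2) %% 3)) @ v != 0) || (YF j @ v != 0) ||
    (((- (YF ((j + 1) %% 3) * YF ((j + 2) %% 3))) @ v != 0) || (XF i @ v != 0)).
  move=> Vv; apply: contraT; rewrite !negb_or !negbK evN !evM !XFE // !YFE // oppr_eq0.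
  move=> /andP[/andP[/eqP s0 /eqP B0] /andP[/eqP t0 /eqP A0]].
  exfalso; apply: not_smooth (proj1 (VP v) Vv); first exact: prod_other s0.
  exact: prod_other t0.
have pmm a1 b1 a2 b2 : pfun (fun o => mm (co o) a1 b1 * mm (co o) a2 b2) by apply: pfunM; apply: pfun_mm.
have [||||phi [r1 r2 r3]] := @pencil_function (XF i) (YF j) _ _
  (form_XF _ _) (form_YF _ _) (formM (form_XF _ _) (form_XF _ _)) (formN (formM (form_YF _ _) (form_YF _ _))) rel cover
  (fun o => mm (co o) a b) (fun o => mm (co o) ((a + 1) %% 3) ((b + 2) %% 3) * mm (co o) ((a + 2) %% 3) ((b + 1) %% 3))
  (fun o => mm (co o) ((a + 1) %% 3) ((b + 1) %% 3) * mm (co o) ((a + 2) %% 3) ((b + 2) %% 3))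
  (fun o => mm (co o) a ((b + 1) %% 3) * mm (co o) a ((b + 2) %% 3) * (mm (co o) ((a + 1) %% 3) b * mm (co o) ((a + 2) %% 3) b))
  (pmm _ _ _ _) (pmm _ _ _ _).
- by move=> o m Ho Em; rewrite XF_Tht //; have [] := cofactor_D (co o) a3 b3.
- by move=> o m Ho Em; rewrite YF_Tht //; have [] := cofactor_D (co o) a3 b3.
- by move=> o m Ho Em; rewrite evM expr2 mulrACA !XF_Tht //; have [] := cofactor_D (co o) a3 b3.
- by move=> o m Ho Em; rewrite evN evM mulrN expr2 mulrACA !YF_Tht //; have [] := cofactor_D (co o) a3 b3.
by exists phi; eexists; split; first exact: r1; [exact: r2|].
Qed.

Lemma plucker_ab a b : (a < 6)%N -> (b < 6)%N -> plucker_fun (fun o => pl (co o) a b).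
Proof.
move=> a6 b6; have [->|ab] := eqVneq a b; last exact: (pl_ind plucker_funN plucker_D plucker_P plucker_Q).
exists (fun=> 0), 0; split=> [z _|z t _ _|o _]; [exact: reg_at0|by rewrite mulr0|by rewrite /pl; ring].
Qed.

Definition phi a b : amb L nT rT -> L :=
  if pselect ((a < 6)%N /\ (b < 6)%N) is left ab then projT1 (cid (plucker_ab (proj1 ab) (proj2 ab))) else fun=> 0.
Definition pcl a b : Pic VV :=
  if pselect ((a < 6)%N /\ (b < 6)%N) is left ab
  then projT1 (cid (projT2 (cid (plucker_ab (proj1 ab) (proj2 ab))))) else 0.

Lemma phiP a b : (a < 6)%N -> (b < 6)%N -> [/\ forall z, TT z -> reg_at idfun TT (phi a b) z,
      forall z t, TT z -> torus_point t -> phi a b (act t z) = (t (pcl a b))^-1 * phi a b z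
    & forall o, Oo o -> phi a b (Psi o) = pl (co o) a b].
Proof.
move=> a6 b6; rewrite /phi /pcl; case: pselect => [ab|[]//].
by case: (cid _) => ph /= E; case: (cid _).
Qed.

Lemma chr_pcl a b l : (a < 6)%N -> (b < 6)%N -> a != b -> nz6 l -> chr (kk (pcl a b)) l = (l a * l b)^-1.
Proof.
move=> a6 b6 ab nl; have [_ r2 r3] := phiP a6 b6.
have [o [Ho p0]] : exists o, Oo o /\ pl (co o) a b != 0.
  have [o [Ho Wo]] := Wopen (Wp_neq0 L); exists o; split=> //; have q := WpP Wo.
  have [lt|gt|e] := ltngtP a b; last by rewrite e eqxx in ab.
    by apply: q; rewrite lt b6.
  have : pl (co o) b a != 0 by apply: q; rewrite gt a6.
  by apply: contraNneq => e; rewrite -oppr_eq0 -e /pl; apply/eqP; ring.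
have Os := Oo_sc nl Ho; have [tt E] := Psi_sc nl Ho.
have := r2 _ _ (Psi_T Ho) tt; rewrite -E !r3 // pl_sc // => /(mulIf p0) ->.
by rewrite invrK.
Qed.

Lemma kk_pcl a b i : (a < 6)%N -> (b < 6)%N -> a != b -> (i < 6)%N -> kk (pcl a b) i = - ((i == a) + (i == b))%N%:Z.
Proof.
move=> a6 b6 ab i6; have n2 := nz2; have nz := @nz6_one i _ n2; apply: (pow2_inj c0L).
rewrite -(chr_one _ _ i6) (chr_pcl a6 b6 ab nz) /one_at [a == i]eq_sym [b == i]eq_sym -invr_expz; congr (_^-1).
by case: (i == a); case: (i == b); rewrite /= ?mulr1 ?mul1r ?expr2.
Qed.

Lemma torus_mulz (t : Pic VV -> L) a (n : int) : torus_point t -> t (a *~ n) = t a ^ n.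
Proof.
move=> [t0 tD].
have z : t 0 = 1 by apply: (mulfI (t0 0)); rewrite mulr1 -tD addr0.
have pos m : t (a *+ m) = t a ^+ m by elim: m => [|m IH]; rewrite ?mulr0n // mulrS exprS tD IH.
case: n => m; first exact: pos.
by rewrite NegzE mulrNz; apply: (mulfI (t0 (a *+ m.+1))); rewrite -tD addrN z pos -exprnN mulfV // expf_neq0.
Qed.

(** The weights of [pcl 0 b] and [pcl 1 2] generate the vectors of even sum, so a torus point is
    determined by its values there. These prescribe [l a * l b] for such pairs, which is solved
    after extracting one square root. *)
Lemma torus_surj (t : Pic VV -> L) : torus_point t -> exists2 l, nz6 l & forall a, t a = chr (kk a) l.
Proof.
move=> tt; have [t0 tD] := tt.
pose m a b := (t (pcl a b))^-1; have m0 a b : m a b != 0 by rewrite invr_eq0.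
(* The required products for the pairs among 0, 1, 2 determine [l 0 ^+ 2]. *)
have [s s2] : exists s, s ^+ 2 = m 0%N 1%N * m 0%N 2%N / m 1%N 2%N.
  have := @solve_monicpoly L 2%N (fun k => if k == 0%N then m 0%N 1%N * m 0%N 2%N / m 1%N 2%N else 0) isT.
  by case=> s E; exists s; apply: (etrans E); rewrite !big_ord_recl big_ord0 /= mul0r !addr0 mulr1.
have s0 : s != 0.
  by apply/negP => /eqP e; have /eqP := s2; rewrite e expr0n /= eq_sym mulf_eq0 invr_eq0 mulf_eq0 !(negPf (m0 _ _)).
pose l i := if i == 0%N then s else m 0%N i / s.
have nl : nz6 l by move=> i _; rewrite /l; case: ifP; rewrite // mulf_neq0 ?invr_eq0.
have [[u0 uD] _] := Psi_sc nl O0; pose u a := chr (kk a) l; exists l => // a.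
have ut : torus_point u by split.
have A0 b : (0 < b < 6)%N -> t (pcl 0 b) = u (pcl 0 b).
  move=> /andP[b0 b6]; rewrite /u chr_pcl //; last by rewrite neq_ltn b0.
  by rewrite /l eqxx (negPf (_ : b != 0%N)) -?lt0n // mulrCA divff // mulr1 invrK.
have A12 : t (pcl 1 2) = u (pcl 1 2).
  rewrite /u chr_pcl // /l /= mulf_div -expr2 s2 invf_div mulrAC divff ?mul1r ?invrK //.
  by rewrite mulf_neq0.
(* [S] is built so that [a + S] has zero weights. Positions 1 to 5 are right for any [M]; position 0
   then determines [M], which is an integer because the sum of the weights is even. *)
pose k := kk a; pose M := nn a - (k 1%N + k 2%N + k 3%N + k 4%N + k 5%N).
pose S := pcl 0 1 *~ (k 1%N + M) + pcl 0 2 *~ (k 2%N + M) + pcl 0 3 *~ k 3%N + pcl 0 4 *~ k 4%N + pcl 0 5 *~ k 5%N + pcl 1 2 *~ (- M).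
have kM b n i : (i < 6)%N -> kk (b *~ n) i = kk b i * n.
  move=> i6; apply: (pow2_inj c0L); rewrite -exprz_exp -(chr_one _ _ i6) -(chr_one (kk b) _ i6).
  have nz := @nz6_one i _ (nz2); have [tv _] := Psi_sc nz O0.
  have tw : torus_point (fun a : Pic VV => chr (kk a) (one_at i 2%:R)) := tv.
  exact: torus_mulz b n tw.
have kD b b' i : (i < 6)%N -> kk (b + b') i = kk b i + kk b' i by apply: kkD.
have aS : a + S = 0.
  apply: (kk_inj0) => i i6; rewrite /S !kD // !kM // !kk_pcl //.
  have := kk_even a; rewrite /ksum -/k => ev.
  have {}ev : k 0%N + k 1%N + k 2%N + k 3%N + k 4%N + k 5%N = nn a + nn a by rewrite ev mulr2n.
  rewrite -/k /M; case: i i6 => [|[|[|[|[|[|//]]]]]] _ /=; lia.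
have uD' b b' : u (b + b') = u b * u b' := uD b b'.
have tS : t S = u S by rewrite /S !tD !uD' !(torus_mulz _ _ tt, torus_mulz _ _ ut) !A0 // A12.
have one (v : Pic VV -> L) : torus_point v -> v 0 = 1.
  by move=> [v0 vD]; apply: (mulfI (v0 0)); rewrite mulr1 -vD addr0.
by apply: (mulIf (t0 S)); rewrite -tD aS -/(u a) tS -uD' aS !one.
Qed.

(** After lifting the image of [z] to [Oo], the remaining torus element is realized by a column
    scaling. *)
Lemma Psi_surj z : TT z -> exists2 o, Oo o & Psi o = z.
Proof.
move=> Tz; have pz := pV Tz.
have [o Ho Eo] := V_lift uh VP pz.
have [t tt ->] := td_trans H (Psi_T Ho) Tz (etrans (p_Psi Ho) Eo).
have [l nl E] := torus_surj tt; exists (sc l o); first exact: Oo_sc.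
by have [_ ->] := Psi_sc nl Ho; congr act; apply: funext => a; rewrite E.
Qed.

Lemma Psi_inj o o' i j : Oo o -> Oo o' -> (i < 6)%N -> (j < 6)%N -> pl (co o) i j != 0 ->
  (forall a b, (a < 6)%N -> (b < 6)%N -> pl (co o) a b = pl (co o') a b) -> Psi o = Psi o'.
Proof. by move=> Ho Ho' i6 j6 p0 /(plucker_sl2 i6 j6 p0)[A [B [C [D [d1 ->]]]]]; rewrite Psi_gl. Qed.

(** * The Galois action on the fifteen functions *)

Variables (K : fieldType) (iota : {rmorphism K -> L}).
Hypothesis char0 : [pchar K] =i pred0.
Hypothesis algL : forall x : L, algebraicOver iota x.
Hypothesis T_gal : forall (s : galois iota) z, TT z -> TT (gal_pt s z).
Hypothesis p_gal : forall (s : galois iota) z, TT z -> p (gal_pt s z) = gal_pt s (p z).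
Hypothesis segre_gal : forall (s : galois iota) (v : 'rV[L]_5), segre_cubic (v *m h) = 0 -> segre_cubic (map_mx s v *m h) = 0.
Implicit Types (s : galois iota).

Definition phis s a b z := s (phi a b (gal_pt (galV s) z)).

Lemma phis_reg s a b : (a < 6)%N -> (b < 6)%N -> forall z, TT z -> reg_at idfun TT (phis s a b) z.
Proof.
move=> a6 b6; have [r _ _] := phiP a6 b6; apply: (@reg_fun_gal _ _ _ s _ _ TT TT (phi a b)).
  by move=> z; apply: T_gal.
exact: r.
Qed.

Lemma phis_poly s a b : (a < 6)%N -> (b < 6)%N -> exists N : {mpoly L[12]}, forall o, Oo o -> phis s a b (Psi o) = N.@[o 0].
Proof.
move=> a6 b6; apply: (@etale_poly _ _ _ (@Oo_codim2 L) _ (Wp_neq0 L) (@Wp_Oo L) (fun o => phis s a b (Psi o))) => o Ho.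
by apply: (regO_etale) => //; apply: regO_Psi => //; apply: phis_reg => //; apply: Psi_T.
Qed.

Lemma gal_Psi s o : Oo o -> exists2 o1, Oo o1 & Psi o1 = gal_pt s (Psi o).
Proof. by move=> Ho; apply: (Psi_surj); apply: T_gal; apply: Psi_T. Qed.

Lemma map_mxVK s m n (M : 'M[L]_(m, n)) : map_mx s (map_mx (galV s) M) = M.
Proof. by apply/matrixP => i j; rewrite !mxE /= gal_invK. Qed.

Lemma gal_ptVV s n r (x : amb L n r) : gal_pt (galV (galV s)) x = gal_pt s x.
Proof. by congr pair; apply: val_inj. Qed.

(** The zeros lie over the conjugate of a plane of the cubic. As the cubic is Galois stable, this is
    again a plane in it, hence one of the fifteen. *)
Lemma conj_zero s a b : (a < 6)%N -> (b < 6)%N -> a != b ->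
  exists a' b', [/\ (a' < 6)%N, (b' < 6)%N, a' != b' & forall o, Oo o -> phis s a b (Psi o) = 0 -> pl (co o) a' b' = 0].
Proof.
move=> a6 b6 ab; have [A [B [AB0 ABq]]] := plane_ab L a6 b6 ab; have [_ _ phE] := phiP a6 b6.
pose w (z : 'rV[L]_5) := map_mx (galV s) (z *m invmx h).
pose U (z : 'rV[L]_5) := fn A (w z *m h) = 0 /\ fn B (w z *m h) = 0.
have wD t u v : w (t *: u + v) *m h = galV s t *: (w u *m h) + w v *m h.
  by rewrite /w mulmxDl map_mxD -scalemxAl map_mxZ mulmxDl -scalemxAl.
have fw F (z : 'rV[L]_5) : s (fn F (w z *m h)) = fn (invmx h *m map_mx s (h *m F)) z.
  rewrite /fn; transitivity (map_mx s (w z *m h *m F) 0 0); first by rewrite [RHS]mxE.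
  by rewrite -mulmxA map_mxM /w map_mxVK mulmxA.
have [||F1 F2|z [zA zB]|a' [b' [a'6 b'6 ab' E]]] := @plane_pair L U.
- by rewrite /U /fn /w mul0mx map_mx0 !mul0mx mxE.
- by move=> t u v [uA uB] [vA vB]; rewrite /U !wD !fnD uA uB vA vB mulr0 addr0.
- pose F i := nth 0 [:: invmx h *m map_mx s (h *m A); invmx h *m map_mx s (h *m B); F1; F2] i.
  have [u u0 E] := common_zero (\matrix_(i < 5, j < 4) F j i 0) isT; exists u => //.
  have FE (j : 'I_4) : fn (F j) u = 0.
    have := congr1 (fun M : 'rV[L]_4 => M 0 j) E; rewrite !mxE => <-; rewrite /fn mxE.
    by apply: eq_bigr => i _; rewrite mxE.
  split.
  + split; apply/eqP; rewrite -(fmorph_eq0 s) fw; apply/eqP.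
    * by have := FE (inord 0); rewrite /F inordK.
    * by have := FE (inord 1); rewrite /F inordK.
  + by have := FE (inord 2); rewrite /F inordK.
  + by have := FE (inord 3); rewrite /F inordK.
- have := segre_gal s (AB0 _ zA zB); rewrite /w map_mxVK -mulmxA mulVmx // mulmx1; exact.
exists a', b'; split=> // o Ho P0; apply: E => //.
have [o1 H1 E1] := gal_Psi (galV s) Ho.
have p0 : pl (co o1) a b = 0 by apply/eqP; rewrite -(phE _ H1) E1 -(fmorph_eq0 s); apply/eqP.
have [A1 B1] := proj1 (ABq _ H1) p0.
have Tq : Tht o1 = gal_pt (galV s) (Tht o) by rewrite -(p_Psi H1) E1 p_gal ?(p_Psi Ho) //; apply: Psi_T.
have [k1 k10 Ek1] := th_scale uh H1; have [k k0 Ek] := th_scale uh Ho.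
have t1 : tht o1 = (k1 / galV s k) *: (w (tht o) *m h).
  have -> : w (tht o) = galV s k *: val (Tht o1).1.
    rewrite Tq /w -[tht o *m invmx h]/(th h o) Ek map_mxZ; congr (_ *: _).
  by rewrite -(th_tht) Ek1 -!scalemxAl scalerA divfK // fmorph_eq0.
have q0 : k1 / galV s k != 0 by rewrite mulf_neq0 ?invr_eq0 ?fmorph_eq0.
have fZ F t u : fn F (t *: u) = t * fn F u :> L by rewrite /fn -scalemxAl mxE.
move: A1 B1; rewrite t1 !fZ => /eqP; rewrite mulf_eq0 (negPf q0) /= => /eqP A1.
by move/eqP; rewrite mulf_eq0 (negPf q0) /= => /eqP B1.
Qed.

Lemma rprime_pl' a b : (a < 6)%N -> (b < 6)%N -> a != b -> rprime (pl (px L) a b).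
Proof.
move=> a6 b6; rewrite neq_ltn => /orP[ab|ba].
  by apply: rprime_pl; rewrite pairsP ab b6.
have E : pl (px L) a b = (-1) * pl (px L) b a by rewrite /pl; ring.
by apply: (rprime_assoc_l _ E); [rewrite unitrN1|apply: rprime_pl; rewrite pairsP ba a6].
Qed.

Lemma pl_zero a b : (a < 6)%N -> (b < 6)%N -> a != b -> exists2 o : V12, Oo o & pl (co o) a b = 0.
Proof.
move=> a6 b6 ab; have pr := rprime_pl' a6 b6 ab.
have [|o [Ho E _]] := @Oo_codim2 L _ 1 pr.
  by case: pr.
by exists o => //; rewrite -meval_pl.
Qed.

Lemma pl_nonzero a b : (a < 6)%N -> (b < 6)%N -> a != b -> exists2 o : V12, Oo o & pl (co o) a b != 0.
Proof.
move=> a6 b6 ab; have [o [Ho W0]] := Wopen (Wp_neq0 L); exists o => //; have q := WpP W0.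
move: ab; rewrite neq_ltn => /orP[ab|ba]; first by apply: q; rewrite ab b6.
have : pl (co o) b a != 0 by apply: q; rewrite ba a6.
by apply: contraNneq => e; rewrite -oppr_eq0 -e /pl; apply/eqP; ring.
Qed.

(** On [Oo] the conjugate function is a polynomial whose zeros lie on one prime minor, so it is a
    multiple of a power of that minor; the exponent is positive because the function has a zero. *)
Lemma phis_power s a b : (a < 6)%N -> (b < 6)%N -> a != b ->
  exists a' b' k (e : nat), [/\ (a' < 6)%N, (b' < 6)%N, a' != b', k != 0 &
    forall z, TT z -> phis s a b z = k * phi a' b' z ^+ e.+1].
Proof.
move=> a6 b6 ab; have [a' [b' [a'6 b'6 ab' E0]]] := conj_zero s a6 b6 ab; have [N EN] := phis_poly s a6 b6.
have [_ _ phE] := phiP a6 b6; have [_ _ phE'] := phiP a'6 b'6.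
have move_pt o : Oo o -> exists2 o1, Oo o1 & phis s a b (Psi o1) = s (pl (co o) a b).
  move=> Ho; have [o1 H1 E1] := gal_Psi s Ho; exists o1 => //.
  by rewrite /phis E1 gal_ptK phE.
have N0 : N != 0.
  have [o Ho po] := pl_nonzero a6 b6 ab; have [o1 H1 E1] := move_pt o Ho.
  by apply: (pev_neq0 (o := o1)); rewrite -EN // E1 fmorph_eq0.
have [|k [e [k0 E]]] := prime_power_of_zeros (@Oo_codim2 L) (rprime_pl' a'6 b'6 ab') N0.
  by move=> o Ho; rewrite meval_pl -EN //; apply: E0.
have [o Ho po] := pl_zero a6 b6 ab; have [o1 H1 E1] := move_pt o Ho.
have {E1} N1 : N.@[o1 0] = 0 by rewrite -EN // E1 po rmorph0.
have pe : pl (px L) a' b' != 0 by case: (rprime_pl' a'6 b'6 ab').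
have {E} [m [m0 E]] : exists m : nat, (0 < m)%N /\ N = k%:MP * pl (px L) a' b' ^+ m.
  case: e E => e E.
    have E' : N = k%:MP * pl (px L) a' b' ^+ e.
      by apply: (mpoly_eq_on pe) => x /E ->; rewrite mevalM mevalC (rmorphXn (meval (x 0))).
    exists e; split=> //; case: e E E' => // _ E'; move: N1; rewrite E' expr0 mulr1 mevalC => e0.
    by rewrite e0 eqxx in k0.
  have E' : N * pl (px L) a' b' ^+ e.+1 = k%:MP.
    apply: (mpoly_eq_on pe) => x px0; rewrite mevalM mevalC (rmorphXn (meval (x 0))) E // NegzE -exprnN divfK //.
    exact: expf_neq0.
  have := congr1 (fun q : {mpoly L[12]} => q.@[o1 0]) E'; rewrite mevalM N1 mul0r mevalC => e0.
  by rewrite -e0 eqxx in k0.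
exists a', b', k, m.-1; split=> // z Tz; have [o2 H2 <-] := Psi_surj Tz.
rewrite prednK // EN // phE' // E mevalM mevalC; congr (_ * _).
rewrite (rmorphXn (meval (o2 0))); congr (_ ^+ _); exact: meval_pl.
Qed.

(** Conjugating back expresses a minor as a multiple of the power [(e + 1) (e2 + 1)] of another;
    comparing degrees, by scaling all columns by 2, forces the exponent 1. *)
Lemma phis_permutes s a b : (a < 6)%N -> (b < 6)%N ->
  exists a' b' k, [/\ (a' < 6)%N, (b' < 6)%N & forall z, TT z -> phis s a b z = k * phi a' b' z].
Proof.
move=> a6 b6; have [<-|ab] := eqVneq a b.
  exists a, a, 0; split=> // z Tz; have [_ _ phE] := phiP a6 a6.
  rewrite mul0r /phis; have [o Ho Eo] := Psi_surj (T_gal (galV s) Tz); rewrite -Eo phE //.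
  by rewrite (_ : pl _ _ _ = 0) ?rmorph0 // /pl; ring.
have [a' [b' [k [e [a'6 b'6 ab' k0 E]]]]] := phis_power s a6 b6 ab.
have [a2 [b2 [k2 [e2 [a26 b26 ab2 k20 E2]]]]] := phis_power (galV s) a'6 b'6 ab'.
exists a', b', k; split=> // z Tz; rewrite E //; suff -> : e = 0%N by rewrite expr1.
have [_ _ phE] := phiP a6 b6; have [_ _ phE2] := phiP a26 b26.
have key o : Oo o -> pl (co o) a b = galV s k * k2 ^+ e.+1 * pl (co o) a2 b2 ^+ (e2.+1 * e.+1).
  move=> Ho; rewrite -(phE _ Ho) -(phE2 _ Ho).
  have Ts : TT (gal_pt s (Psi o)) by apply: T_gal; apply: Psi_T.
  have := E _ Ts; rewrite /phis gal_ptK => /(congr1 (galV s)); rewrite /= galK => ->.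
  rewrite rmorphM rmorphXn -mulrA; congr (_ * _).
  have -> : gal_inv s (phi a' b' (gal_pt s (Psi o))) = phis (galV s) a' b' (Psi o).
    by rewrite /phis gal_ptVV.
  by rewrite E2 ?exprMn ?exprM //; apply: Psi_T.
have [o Ho po] := pl_nonzero a6 b6 ab; have n2 := nz2.
have nz : nz6 (fun=> 2%:R : L) by [].
have Os := Oo_sc nz Ho; have := key _ Os; rewrite !pl_sc // exprMn mulrCA -key // => /(mulIf po).
rewrite -!expr2 -exprM => /(pow2_inj (m := 2%N) (n := (2 * (e2.+1 * e.+1))%N) c0L) [].
by case: e {k0 E key} => // e; lia.
Qed.

Lemma form_Psi d (F : {mpoly L[nT.+1 + rT]}) o : form d F -> Oo o -> ev idfun F (Psi o) != 0 ->
  exists D : {mpoly L[12]}, D != 0 /\ forall o, D.@[o 0] != 0 -> Oo o /\ ev idfun F (Psi o) != 0.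
Proof. by move=> fF Ho Fo; apply: (near_Psi Ho (S := fun z => ev idfun F z != 0)); apply: near_form fF Fo. Qed.

Lemma T_irreducible : irreducible TT.
Proof.
move=> d e F G fF fG [x Tx Fx] [y Ty Gy]; have [o Ho Eo] := Psi_surj Tx; have [o' Ho' Eo'] := Psi_surj Ty.
rewrite -Eo in Fx; rewrite -Eo' in Gy.
have [D [D0 HD]] := form_Psi fF Ho Fx; have [D' [D'0 HD']] := form_Psi fG Ho' Gy.
have [o1 /meval_neq0M[/HD[H1 F1] /HD'[_ G1]]] := nonroot_row (mulf_neq0 D0 D'0).
by exists (Psi o1); [apply: Psi_T|].
Qed.

Definition phiv z : 'rV[L]_36 := mxvec (\matrix_(a < 6, b < 6) phi a b z) : 'rV_(6 * 6).

Lemma me_phiv z (a b : 'I_6) : me (phiv z) a b = phi a b z.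
Proof. by rewrite /me /phiv mxvecE mxE. Qed.

Lemma phiv_Psi o : Oo o -> phiv (Psi o) = pv o.
Proof.
move=> Ho; apply: me_eq => a b; rewrite me_phiv pvE.
by have [_ _ E] := phiP (ltn_ord a) (ltn_ord b); apply: E.
Qed.

Lemma phiv_reg k z : TT z -> reg_at idfun TT (fun z => phiv z 0 k) z.
Proof.
move=> Tz; case/mxvec_indexP: (k : 'I_(6 * 6)) => a b.
have [r _ _] := phiP (ltn_ord a) (ltn_ord b); apply: (@reg_at_eq _ _ _ _ _ _ _ (phi a b)); last exact: r.
by move=> y _; rewrite -me_phiv.
Qed.

Lemma phiv_gal s k : exists k' (x : L), forall z, TT z -> s (phiv (gal_pt (galV s) z) 0 k) = x * phiv z 0 k'.
Proof.
case/mxvec_indexP: (k : 'I_(6 * 6)) => a b.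
have [a' [b' [x [a6 b6 E]]]] := phis_permutes s (ltn_ord a) (ltn_ord b).
exists (mxvec_index (Ordinal a6) (Ordinal b6) : 'I_(6 * 6)), x => z Tz.
by have := E z Tz; rewrite /phis -!me_phiv -(me_phiv _ (Ordinal a6) (Ordinal b6)).
Qed.

(** The K-components of the numerators of [phiv] are combinations of conjugates, and each conjugate
    is a multiple of an entry of [phiv]; this yields [Q]. Expanding the numerators over their
    components yields [Em]. *)
Lemma descended_plucker : exists N (Q : 'M[L]_(36, N.+1)) (Em : 'M[L]_(N.+1, 36)) d (H0 : {mpoly K[nT.+1 + rT]}) F,
  [/\ form d H0 /\ forall j : 'I_N.+1, form d (F j : {mpoly K[nT.+1 + rT]}),
      exists2 o, Oo o & ev iota H0 (Psi o) != 0,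
      forall o, Oo o -> ev iota H0 (Psi o) != 0 -> forall j, (pv o *m Q) 0 j = ev iota (F j) (Psi o) / ev iota H0 (Psi o)
    & forall o, pv o *m Q *m Em = pv o].
Proof.
have Tirr := T_irreducible.
have E1 : ev idfun (1 : {mpoly L[nT.+1 + rT]}) (Psi o0) != 0 by rewrite ev1 oner_neq0.
have [d [H0 [G [fH fG [z1 T1 H1] _ E]]]] := @K_common _ _ iota char0 algL _ _ TT T_gal Tirr 'I_36 (fun k z => phiv z 0 k)
  (Psi o0) 0 1 (Psi_T O0) (fun k => phiv_reg k (Psi_T O0)) (form1 _ _ _) E1.
have [n [e [F [M [s [C [EG EF]]]]]]] := descent algL char0 G.
have fF k i : form d (F k i).
  by apply: (form_reflect (iota := iota)); rewrite EF; apply: form_sum => m _; apply/formZ/form_map_gal.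
have exq (ki : 'I_36 * 'I_n) : exists q : 'cV[L]_36, forall z, TT z -> ev iota H0 z != 0 ->
    ev iota (F ki.1 ki.2) z / ev iota H0 z = (phiv z *m q) 0 0.
  have exk (m : 'I_M) : exists kx : 'I_36 * L, forall z, TT z -> s m (phiv (gal_pt (galV (s m)) z) 0 ki.1) = kx.2 * phiv z 0 kx.1.
    by have [k' [x Ex]] := phiv_gal (s m) ki.1; exists (k', x).
  have [kx Hkx] := choice exk.
  exists (\sum_m (C m ki.2 * (kx m).2) *: delta_mx (kx m).1 0) => z Tz Hz.
  rewrite mulmx_sumr summxE -ev_map EF ev_sum mulr_suml; apply: eq_bigr => m _.
  rewrite evZ -scalemxAr -colE !mxE -mulrA -[RHS]mulrA -Hkx //; congr (_ * _).
  have Hs : ev iota H0 (gal_pt (galV (s m)) z) != 0 by rewrite ev_gal fmorph_eq0.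
  rewrite E //; last exact: T_gal.
  by rewrite fmorph_div -ev_map_gal gal_ptVK ev_gal /= gal_invK.
have [q Hq] := choice exq.
pose J : finType := ('I_36 * 'I_n)%type.
(* An additional coordinate, identically zero and placed first, brings the number of coordinates
   into the form [N.+1]. *)
pose pick T0 (u : J -> T0) (u0 : T0) (j : 'I_#|J|.+1) := if unlift ord0 j is Some j' then u (enum_val j') else u0.
have pickP T0 (u : J -> T0) u0 (P : T0 -> Prop) j : P u0 -> (forall t, P (u t)) -> P (pick T0 u u0 j).
  by rewrite /pick; case: unlift => [j'|].
pose Q := \matrix_(l < 36, j < #|J|.+1) pick L (fun t => q t l 0) 0 j.
pose Em := \matrix_(j < #|J|.+1, k < 36) pick L (fun t => (t.1 == k)%:R * e t.2) 0 j.
have pick0 T0 (u : J -> T0) u0 : pick T0 u u0 ord0 = u0 by rewrite /pick unlift_none.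
have pickL T0 (u : J -> T0) u0 j : pick T0 u u0 (lift ord0 j) = u (enum_val j) by rewrite /pick liftK.
have EmE j k : Em j k = pick L (fun t => (t.1 == k)%:R * e t.2) 0 j by rewrite mxE.
have psiE z : TT z -> ev iota H0 z != 0 -> forall j,
    (phiv z *m Q) 0 j = ev iota (pick _ (fun t => F t.1 t.2) 0 j) z / ev iota H0 z.
  move=> Tz Hz j; rewrite mxE /Q /pick; case Ej: (unlift ord0 j) => [j'|]; last first.
    rewrite [ev iota 0 z]rmorph0 mul0r big1 // => l _; by rewrite mxE Ej mulr0.
  by rewrite Hq // mxE; apply: eq_bigr => l _; rewrite mxE Ej.
have phiE z : TT z -> ev iota H0 z != 0 -> phiv z *m Q *m Em = phiv z.
  move=> Tz Hz; apply/rowP => k; rewrite mxE big_ord_recl EmE pick0 mulr0 add0r.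
  rewrite (eq_bigr (fun j' => ev iota (F (enum_val j').1 (enum_val j').2) z / ev iota H0 z * (((enum_val j').1 == k)%:R * e (enum_val j').2))).
    rewrite -(big_enum_val (A := {: J}) (fun t : J => ev iota (F t.1 t.2) z / ev iota H0 z * ((t.1 == k)%:R * e t.2))) /=.
    rewrite -(pair_bigA _ (fun k' i => ev iota (F k' i) z / ev iota H0 z * ((k' == k)%:R * e i))) /= (bigD1 k) //= [X in _ + X]big1 ?addr0.
      rewrite E // EG ev_sum mulr_suml; apply: eq_bigr => i _; rewrite eqxx mul1r evZ ev_map /=.
      by rewrite mulrC mulrA.
    by move=> k' nk; rewrite big1 // => i _; rewrite (negPf nk) mul0r mulr0.
  by move=> j' _; rewrite psiE // EmE !pickL.
have [o1 Ho1 Eo1] := Psi_surj T1; have H1o : ev iota H0 (Psi o1) != 0 by rewrite Eo1.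
have [|D [D0 HD]] := form_Psi (form_map iota fH) Ho1; first by rewrite ev_map.
have {}HD o : D.@[o 0] != 0 -> Oo o /\ ev iota H0 (Psi o) != 0 by move/HD; rewrite ev_map.
exists #|J|, Q, Em, d, H0, (pick _ (fun t => F t.1 t.2) 0); split.
- by split=> // j; apply: (pickP _ _ _ (fun G : {mpoly K[nT.+1 + rT]} => form d G)) => //; apply: form0.
- by exists o1.
- by move=> o Ho Hz j; rewrite -phiv_Psi // psiE //; apply: Psi_T.
move=> o; apply/rowP => k.
have [P EP] : pfun (fun o => (pv o *m Q *m Em) 0 k).
  apply: (@pfun_eq _ _ (fun o => \sum_l pv o 0 l * (Q *m Em) l k)); first by move=> x; rewrite -mulmxA mxE.
  by apply: pfun_sum => l; apply: pfunM; [apply: pfun_pv|apply: pfunC].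
have [P' EP'] := pfun_pv L k.
rewrite EP EP'; congr (_.@[_]); apply: (mpoly_eq_on D0) => x /HD[Hx Hz].
by rewrite -EP -EP' -phiv_Psi // phiE //; apply: Psi_T.
Qed.

(** * The birational map from the torsor to the cone *)

Variables (N : nat) (Q : 'M[L]_(36, N.+1)) (Em : 'M[L]_(N.+1, 36)).
Variables (d : nat) (H0 : {mpoly K[nT.+1 + rT]}) (F : 'I_N.+1 -> {mpoly K[nT.+1 + rT]}).
Implicit Types (w : amb L N (0 + 1)).
Hypotheses (fH0 : form d H0) (fF : forall j, form d (F j)).
Hypothesis H0P : exists2 o, Oo o & ev iota H0 (Psi o) != 0.
Hypothesis FE : forall o, Oo o -> ev iota H0 (Psi o) != 0 ->
  forall j, (pv o *m Q) 0 j = ev iota (F j) (Psi o) / ev iota H0 (Psi o).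
Hypothesis QE : forall o, pv o *m Q *m Em = pv o.
Variable j0 : 'I_N.+1.
Hypothesis j0P : exists o, (pv o *m Q) 0 j0 != 0.

Definition psi z : 'rV[L]_N.+1 := \row_j (ev iota (F j) z / ev iota H0 z).

Lemma psi_Psi o : Oo o -> ev iota H0 (Psi o) != 0 -> psi (Psi o) = pv o *m Q.
Proof. by move=> Ho Hz; apply/rowP => j; rewrite mxE FE. Qed.

Lemma psi_gal s z : psi (gal_pt s z) = map_mx s (psi z).
Proof. by apply/rowP => j; rewrite !mxE !ev_gal fmorph_div. Qed.

Lemma cone_conj s : exists2 D : {mpoly L[12]}, D != 0 &
  forall o, D.@[o 0] != 0 -> exists o1, map_mx (galV s) (pv o *m Q) = pv o1 *m Q.
Proof.
have [o1 Ho1 Hz1] := H0P; have [|D [D0 HD]] := form_Psi (form_map iota fH0) Ho1; first by rewrite ev_map.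
exists D => // o /HD[Ho]; rewrite ev_map => Hz.
have [o2 Ho2 E2] := Psi_surj (T_gal (galV s) (Psi_T Ho)).
exists o2; rewrite -psi_Psi // -psi_gal -E2 psi_Psi // E2.
by rewrite ev_gal fmorph_eq0.
Qed.

Definition U0 z := [/\ TT z, ev iota H0 z != 0 & ev iota (F j0) z != 0].
(** A vector of the affine cone is recorded by its class and its coordinate [j0], which restores the
    scale. *)
Definition ff z : amb L N (0 + 1) := (mkp (psi z), const_mx (psi z 0 j0)).

Lemma psi_j0 z : U0 z -> psi z 0 j0 != 0.
Proof. by case=> _ h1 h2; rewrite mxE mulf_neq0 ?invr_eq0. Qed.

Lemma psi_neq0 z : U0 z -> psi z != 0.
Proof. by move/psi_j0; apply: contraNneq => ->; rewrite mxE. Qed.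

Lemma U0_Psi z : U0 z -> exists o, [/\ Oo o, Psi o = z & psi z = pv o *m Q].
Proof.
case=> Tz Hz _; have [o Ho Eo] := Psi_surj Tz; exists o; split=> //.
by rewrite -Eo psi_Psi // Eo.
Qed.

Lemma ff_cone z : U0 z -> cone Q (ff z).
Proof.
move=> Uz; have [o [_ _ E]] := U0_Psi Uz; have := psi_neq0 Uz; rewrite /ff E => n0.
exact: cone_mkp.
Qed.

Lemma U0_gal s z : U0 z -> U0 (gal_pt s z).
Proof. by case=> Tz Hz Fz; split; rewrite ?ev_gal ?fmorph_eq0 //; apply: T_gal. Qed.

Lemma ff_gal s z : U0 z -> ff (gal_pt s z) = gal_pt s (ff z).
Proof.
move=> Uz; rewrite /ff psi_gal -mkp_gal ?psi_neq0 //; congr pair.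
by apply/rowP => i; rewrite !mxE.
Qed.

Lemma ff_inj z z' : U0 z -> U0 z' -> ff z = ff z' -> z = z'.
Proof.
move=> Uz Uz' E; have E1 : mkp (psi z) = mkp (psi z') by case: E.
have E2 : psi z 0 j0 = psi z' 0 j0.
  by have := congr1 (fun w : amb L N (0 + 1) => w.2 0 (rshift 0 0)) E; rewrite /= !mxE.
have [k k0 Ek] := mkpP (psi_neq0 Uz); have [k' k'0 Ek'] := mkpP (psi_neq0 Uz').
have n0 := psi_j0 Uz; have {}E : psi z = psi z'.
  move: E2 n0; rewrite Ek Ek' E1 !mxE mulf_eq0 negb_or => /mulIf kk /andP[_ n0].
  by rewrite kk.
have [o [Ho Ez Eo]] := U0_Psi Uz; have [o' [Ho' Ez' Eo']] := U0_Psi Uz'.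
have Ev : pv o = pv o' by rewrite -[LHS]QE -[RHS]QE -Eo -Eo' E.
have [|a [b]] := @me_neq0 L (pv o).
  by apply: contraNneq (psi_neq0 Uz) => e; rewrite Eo e mul0mx.
rewrite -Ez -Ez' pvE => n; apply: (Psi_inj Ho Ho' (ltn_ord a) (ltn_ord b) n) => i j i6 j6.
by have := congr1 (fun M => me M (Ordinal i6) (Ordinal j6)) Ev; rewrite !pvE.
Qed.

Definition wM w : 'rV[L]_36 := (w.2 0 (rshift 0 0) / val w.1 0 j0) *: (val w.1 *m Em).

Lemma wM_plucker w : cone Q w -> plucker (wM w).
Proof. by case=> o Eo; rewrite /wM Eo QE -pv_scale; apply: plucker_pv. Qed.

Lemma wM_Q w : cone Q w -> wM w *m Q = (w.2 0 (rshift 0 0) / val w.1 0 j0) *: val w.1.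
Proof. by move=> Cw; have [_ E] := cone_neq0 QE Cw; rewrite /wM -scalemxAl E. Qed.

Lemma wM_ff z o : U0 z -> psi z = pv o *m Q -> wM (ff z) = pv o.
Proof.
move=> Uz E; have [k k0 Ek] := mkpP (psi_neq0 Uz); have n0 := psi_j0 Uz.
have Ev : val (ff z).1 = k^-1 *: psi z by rewrite [in RHS]Ek scalerA mulVf // scale1r.
rewrite /wM Ev -scalemxAl E QE scalerA -E [(k^-1 *: psi z) 0 j0]mxE [(ff z).2 _ _]mxE.
by rewrite (_ : _ / _ / k = 1) ?scale1r //; field; rewrite k0 n0.
Qed.

Lemma ff_of_wM w o z : cone Q w -> val w.1 0 j0 != 0 -> w.2 0 (rshift 0 0) != 0 -> psi z = pv o *m Q -> wM w = pv o -> ff z = w.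
Proof.
move=> Cw y0 l0 E Ew; have E' : psi z = (w.2 0 (rshift 0 0) / val w.1 0 j0) *: val w.1 by rewrite E -Ew wM_Q.
have k0 : w.2 0 (rshift 0 0) / val w.1 0 j0 != 0 by rewrite mulf_neq0 ?invr_eq0.
case: w y0 l0 E' k0 {Cw Ew} => y l /= y0 l0 E' k0; rewrite /ff; congr pair.
  by apply: (mkp_eq _ E'); rewrite E' scaler_eq0 negb_or k0 proj_neq0.
apply/rowP => i; rewrite mxE E' mxE divfK //; congr (l 0 _).
by case: i => [[|//] i1]; apply: val_inj.
Qed.

Definition crd (l0 : 'I_nT.+1) (i : 'I_nT.+1 + 'I_rT) z : L :=
  match i with inl i => val z.1 0 i / val z.1 0 l0 | inr i => z.2 0 i end.

Lemma crd_reg l0 i z : val z.1 0 l0 != 0 -> reg_at idfun TT (crd l0 i) z.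
Proof. by case: i => i zl; [apply: reg_at_proj|apply: reg_at_affine]. Qed.

Lemma crd_fraction l0 o1 i : Oo o1 -> val (Psi o1).1 0 l0 != 0 -> exists ND : {mpoly L[12]} * {mpoly L[12]},
  ND.2 != 0 /\ forall o, ND.2.@[o 0] != 0 -> crd l0 i (Psi o) = ND.1.@[o 0] / ND.2.@[o 0].
Proof.
move=> Ho l1; have := regO_etale Ho (regO_Psi Ho (crd_reg i l1)).
move/(etale_fraction (Wp_neq0 L) (@Wp_Oo L)) => [Np [D [D0 HD]]]; exists (Np, D); split=> // o /HD[].
by [].
Qed.

Lemma pv_gl A B C D o : A * D - B * C = 1 -> pv (gl A B C D o) = pv o.
Proof. by move=> d1; apply: me_eq => a b; rewrite !pvE pl_gl // d1 mul1r. Qed.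

Lemma ff_j0 z : U0 z -> val (ff z).1 0 j0 != 0.
Proof.
move=> Uz; have [k k0 Ek] := mkpP (psi_neq0 Uz); have := psi_j0 Uz.
by rewrite {1}Ek mxE mulf_nz => /andP[].
Qed.

Lemma wM_reg k w1 : val w1.1 0 j0 != 0 -> reg_at idfun (@cone L N Q (0 + 1)) (fun w => wM w 0 k) w1.
Proof.
move=> n0; apply: (reg_at_eq (g := fun w : amb L N (0 + 1) => w.2 0 (rshift 0 0) * ((val w.1 *m Em) 0 k / val w.1 0 j0))).
  by move=> w _; rewrite [RHS]mxE mulrCA mulrC.
apply: reg_atM; first exact: reg_at_affine.
by apply: reg_at_mulmx => // x; exists x.
Qed.

(** The inverse sends [w] to its Pluecker vector [wM w], then to a matrix [ow w] with these minors,
    then to the coordinates of [Psi] there, which are the fractions [ND] of polynomials. *)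
Lemma local_inverse : exists (l0 : 'I_nT.+1) w1 e (Ef : {mpoly L[N.+1 + (0 + 1)]}) (rho : 'I_nT.+1 + 'I_rT -> amb L N (0 + 1) -> L),
  [/\ cone Q w1, form e Ef, ev idfun Ef w1 != 0, forall i, reg_at idfun (@cone L N Q (0 + 1)) (rho i) w1
    & forall w, cone Q w -> ev idfun Ef w != 0 ->
      exists z, [/\ U0 z, ff z = w, val z.1 0 l0 != 0 & forall i, rho i w = crd l0 i z]].
Proof.
have [o1 Ho1 Hz1] := H0P; have [l0 l00] := coord_neq0 (Psi o1).1.
have [ND HND] := choice (fun i => crd_fraction i Ho1 l00).
have [|D1 [D10 HD1]] := form_Psi (form_map iota fH0) Ho1; first by rewrite ev_map.
have [|D2 [D20 HD2]] := form_Psi (formXP L rT l0) Ho1; first by rewrite evXP.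
have [D3 D30 HD3] := pfun_nonroot j0P (pfun_psi Q j0).
have [op _ pl1] := @pl_nonzero 0 1 isT isT isT.
have [D4 D40 HD4] := pfun_nonroot (ex_intro _ op pl1) (pfun_pl L 0 1).
pose DD := D1 * (D2 * (D3 * (D4 * \prod_i (ND i).2))).
have DD0 : DD != 0.
  by rewrite !mulf_neq0 //; apply/prodf_neq0 => i _; case: (HND i).
have HDD o : DD.@[o 0] != 0 -> [/\ Oo o, U0 (Psi o), val (Psi o).1 0 l0 != 0, pl (co o) 0 1 != 0
    & forall i, (ND i).2.@[o 0] != 0 /\ crd l0 i (Psi o) = (ND i).1.@[o 0] / (ND i).2.@[o 0]].
  move=> /meval_neq0M[/HD1[Ho]]; rewrite ev_map => Hz /meval_neq0M[/HD2[_]]; rewrite evXP => ln /meval_neq0M[].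
  rewrite -HD3 => jn /meval_neq0M[]; rewrite -HD4 => pn; rewrite (rmorph_prod (meval (o 0))) => /prodf_neq0 nz.
  split=> // [|i]; last by have ni := nz i isT; split=> //; case: (HND i) => _; apply.
  split=> //; first exact: Psi_T.
  by apply: contraNneq jn => j00; rewrite FE // j00 mul0r.
have [os Dos] := nonroot_row DD0; have [Hos Us ls ps NDs] := HDD _ Dos.
have psis : psi (Psi os) = pv os *m Q by have [_ Hs _] := Us; apply: psi_Psi.
have wMs := wM_ff Us psis; have Cs := ff_cone Us; have js := ff_j0 Us.
pose i0 : 'I_6 := inord 0; pose i1 : 'I_6 := inord 1.
have meE o : me (pv o) i0 i1 = pl (co o) 0 1 by rewrite pvE !inordK.
pose s1 := psec i0 i1 (pv os); have ps1 : pv s1 = pv os by apply: pv_psec; [apply: plucker_pv|rewrite meE].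
(* The matrix produced by [psec] may lie where the fractions [ND] are undefined; an element of
   [SL_2], which changes no minor, moves it to the good point [os]. *)
have [||||A [B [C [D [d1 Eos]]]]] := @plucker_sl2 L s1 os 0 1 => //.
- by rewrite -meE ps1 meE.
- by move=> a b a6 b6; have := congr1 (fun M => me M (Ordinal a6) (Ordinal b6)) ps1; rewrite !pvE.
pose ow w := gl A B C D (psec i0 i1 (wM w)).
have ow1 : ow (ff (Psi os)) = os by rewrite /ow wMs.
have Mreg a b : reg_at idfun (@cone L N Q (0 + 1)) (fun w => me (wM w) a b) (ff (Psi os)) by apply: wM_reg.
have M01 : me (wM (ff (Psi os))) i0 i1 != 0 by rewrite wMs meE.
have sreg k : reg_at idfun (@cone L N Q (0 + 1)) (fun w => psec i0 i1 (wM w) 0 k) (ff (Psi os)).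
  have [k6|k6] := ltnP k 6.
    apply: (reg_at_eq (g := fun w => - me (wM w) i1 (inord k) / me (wM w) i0 i1)).
      by move=> w _; rewrite !mxE k6.
    by apply: reg_at_div => //; apply: reg_atN.
  apply: (reg_at_eq (g := fun w => me (wM w) i0 (inord (k - 6)))) => // w _.
  by rewrite !mxE ltnNge k6.
have oreg k : reg_at idfun (@cone L N Q (0 + 1)) (fun w => ow w 0 k) (ff (Psi os)).
  have [P HP] := @pfun_gl A B C D k.
  apply: (reg_at_eq (g := fun w => mmap idfun (psec i0 i1 (wM w) 0) P)); first by move=> w _; rewrite /ow HP.
  by apply: (@reg_at_meval _ _ _ _ _ _ _ (fun w => psec i0 i1 (wM w))).
have preg (P : {mpoly L[12]}) : reg_at idfun (@cone L N Q (0 + 1)) (fun w => P.@[ow w 0]) (ff (Psi os)).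
  exact: (@reg_at_meval _ _ _ _ _ _ _ ow).
have n1 : near idfun (@cone L N Q (0 + 1)) (ff (Psi os)) (fun w => DD.@[ow w 0] != 0).
  by apply: reg_at_neq0; rewrite ?ow1.
have n2 := reg_at_neq0 Cs (Mreg i0 i1) M01.
have n3 : near idfun (@cone L N Q (0 + 1)) (ff (Psi os)) (fun w => val w.1 0 j0 != 0).
  have := @near_form _ _ idfun _ _ (@cone L N Q (0 + 1)) (ff (Psi os)) 1 'X_(lshift (0 + 1) j0) (formXP _ _ _).
  by rewrite evXP => /(_ js); apply: nearW => w _; rewrite evXP.
have n4 : near idfun (@cone L N Q (0 + 1)) (ff (Psi os)) (fun w => w.2 0 (rshift 0 0) != 0).
  have := @near_form _ _ idfun _ _ (@cone L N Q (0 + 1)) (ff (Psi os)) 0 'X_(rshift N.+1 (rshift 0 0)) (formXA _ _ _).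
  rewrite evXA mxE => /(_ (psi_j0 Us)); apply: nearW => w _; by rewrite evXA.
have [e [Ef [fE Es HE]]] := near_and (near_and n1 n2) (near_and n3 n4).
exists l0, (ff (Psi os)), e, Ef, (fun i w => (ND i).1.@[ow w 0] / (ND i).2.@[ow w 0]); split=> //.
  by move=> i; apply: reg_at_div => //; rewrite ow1; case: (NDs i).
move=> w Cw /(HE w Cw)[[/HDD[Ho Uo lo po NDo] m0] [y0 lam0]].
exists (Psi (ow w)); split=> // [|i]; last by case: (NDo i).
have pvo : pv (ow w) = wM w by rewrite pv_gl // pv_psec //; apply: wM_plucker.
by apply: (@ff_of_wM w (ow w)) => //; have [_ Hz _] := Uo; apply: psi_Psi.
Qed.

Lemma crd_gal s l0 i z : crd l0 i (gal_pt s z) = s (crd l0 i z).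
Proof. by case: i => i /=; rewrite !mxE ?fmorph_div. Qed.

Hypothesis C_gal : forall s w, cone Q w -> cone Q (gal_pt s w).

(** The coordinates of the inverse commute with Galois because [ff] does and is injective, so
    [rational_descent] gives them over K. *)
Lemma cone_birational : exists (U : amb L nT rT -> Prop) (V : amb L N (0 + 1) -> Prop),
  [/\ open_in iota TT U, dense_in TT U, open_in iota (@cone L N Q (0 + 1)) V, dense_in (@cone L N Q (0 + 1)) V
    & is_iso iota (fun z => TT z /\ U z) (fun w => cone Q w /\ V w) ff].
Proof.
have [l0 [w1 [e [Ef [rho [C1 fE E1 rr key]]]]]] := local_inverse.
have Cirr := @cone_irreducible L N Q (0 + 1) j0 j0P.
have [d1 [H1 [G [fH1 fG [w2 C2 Hw2] HE GE]]]] := K_common char0 algL C_gal Cirr C1 rr fE E1.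
have [|FF [fFF FFE]] := rational_descent char0 algL C_gal fH1 fG GE.
  move=> s w i Cw Hw; have [z [Uz Ez zl rz]] := key w Cw (HE w Hw).
  have Hs : ev iota H1 (gal_pt s w) != 0 by rewrite ev_gal fmorph_eq0.
  have [z' [Uz' Ez' z'l rz']] := key _ (C_gal s Cw) (HE _ Hs).
  have zz : z' = gal_pt s z.
    by apply: ff_inj => //; [apply: U0_gal|rewrite Ez' ff_gal // Ez].
  by rewrite rz' zz crd_gal rz.
pose g w : amb L nT rT := (mkp (\row_i rho (inl i) w), \row_i rho (inr i) w).
have gP w : cone Q w -> ev iota H1 w != 0 -> [/\ U0 (g w), ff (g w) = w & exists l, rho (inl l) w != 0].
  move=> Cw Hw; have [z [Uz Ez zl rz]] := key w Cw (HE w Hw).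
  have E : \row_i rho (inl i) w = (val z.1 0 l0)^-1 *: val z.1.
    by apply/rowP => i; rewrite !mxE rz mulrC.
  have -> : g w = z.
    rewrite /g; case: z E rz {Uz Ez} zl => u v E rz /= zl; congr pair; last by apply/rowP => i; rewrite mxE rz.
    by apply: (mkp_eq _ E); rewrite E scaler_eq0 negb_or invr_eq0 zl proj_neq0.
  by split=> //; exists l0; rewrite rz /= divff ?oner_neq0.
pose S z := ev iota H0 z != 0 /\ ev iota (F j0) z != 0.
have US z : TT z /\ S z -> U0 z by case=> Tz [].
have rf z : TT z /\ S z -> regm_at iota (fun z => TT z /\ S z) ff z.
  move=> Xz; have [_ [Hz jz]] := Xz; apply: (@regm_at_mkp _ _ _ _ _ _ _ _ (fun j z => ev iota (F j) z / ev iota H0 z)) => //.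
  - by move=> j; apply: reg_at_form.
  - by exists j0; rewrite mulf_neq0 ?invr_eq0.
  move=> i; apply: (reg_at_eq (g := fun z => ev iota (F j0) z / ev iota H0 z)); first by move=> y _; rewrite !mxE.
  exact: reg_at_form.
pose U z := S z /\ ev iota H1 (ff z) != 0.
have nU z : TT z -> U z -> near iota TT z U.
  move=> Tz [Sz Hz]; have nS : near iota TT z S.
    by have [s1 s2] := Sz; apply: near_and; [apply: near_form fH0 s1|apply: near_form (fF j0) s2].
  have [nXS nH] : near iota TT z S /\ near iota (fun z => TT z /\ S z) z (fun z => ev iota H1 (ff z) != 0).
    split=> //; apply: (@near_comp _ _ _ _ _ _ _ (fun z => TT z /\ S z) (@cone L N Q (0 + 1)) ff z _ _ (rf z _) (fun w => ev iota H1 w != 0)) => //.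
      by move=> y /US/ff_cone.
    exact: near_form fH1 Hz.
  apply: near_inter nS _; apply: nearW nH => y [_ Sy] Hy; split=> //.
exists U, (fun w => ev iota H1 w != 0).
have gU w : cone Q w -> ev iota H1 w != 0 -> TT (g w) /\ U (g w).
  move=> Cw Hw; have [[Tg Hg jg] Eg _] := gP w Cw Hw; split=> //.
  by split; [split|rewrite Eg].
have [T2 U2] := gU w2 C2 Hw2; split.
- by move=> z Tz Uz; apply: nU.
- exact: (dense_near (T_irreducible) T2 (nU _ T2 U2)).
- by move=> w Cw Hw; exists d1, H1; split.
- exact: (dense_near Cirr C2 (near_form _ fH1 Hw2)).
split.
  apply: reg_map_of => [z [Tz [Sz Hz]]|z [Tz [Sz Hz]]]; first by split=> //; apply: ff_cone; apply: US.
  by apply: (@regm_at_sub _ _ _ _ _ _ _ (fun z => TT z /\ S z)) (rf z _) => // y [Ty [Sy _]].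
exists g; split.
- apply: reg_map_of => [w [Cw Hw]|w [Cw Hw]]; first exact: gU.
  have R i : reg_at iota (fun w => cone Q w /\ ev iota H1 w != 0) (rho i) w.
    apply: (reg_at_eq (g := fun w => ev iota (FF i) w / ev iota H1 w)).
      by move=> y [Cy Hy]; rewrite FFE.
    exact: reg_at_form.
  have [_ _ [l rl]] := gP w Cw Hw.
  apply: (@regm_at_mkp _ _ _ _ _ _ _ _ (fun i w => rho (inl i) w)) => //; first by exists l.
  move=> i; apply: (@reg_at_eq _ _ _ _ _ _ _ (rho (inr i))) => // y _; by rewrite mxE.
- move=> z [Tz [Sz Hz]]; have Uz : U0 z by apply: US.
  by have [Ug Eg _] := gP (ff z) (ff_cone Uz) Hz; apply: ff_inj.
by move=> w [Cw Hw]; have [_ ->] := gP w Cw Hw.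
Qed.

End Torsor.

(** * The differential of the Segre form and the smooth locus *)

Section SegreGradient.
Variable L : closedFieldType.
Implicit Types z y : 'rV[L]_5.

(** The derivative of the Segre form at [z] in the direction [y], in the redundant coordinates X and
    Y. *)
Definition dsegre z y := \sum_(i < 3) Xc y i * (Xc z ((i + 1) %% 3) * Xc z ((i + 2) %% 3))
  - \sum_(j < 3) Yc y j * (Yc z ((j + 1) %% 3) * Yc z ((j + 2) %% 3)).

Lemma c5D z y k : c5 (z + y) k = c5 z k + c5 y k. Proof. by rewrite /c5 mxE. Qed.

Lemma segre_quad z y s : segre_cubic (z + s *: y) =
  segre_cubic z + s * dsegre z y + s ^+ 2 * dsegre y z + s ^+ 3 * segre_cubic y.
Proof.
rewrite !segreE /dsegre !big_ord_recl !big_ord0 /= /Xc /Yc /= !c5D !c5Z; ring.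
Qed.

Lemma dsegre_smooth z : (forall y, dsegre z y = 0) <-> forall i j, (i < 3)%N -> (j < 3)%N -> qf z i j = 0.
Proof.
split=> [H i j i3 j3|H y].
  pose y : 'rV[L]_5 := mk5 (nth 0 [:: (i == 0%N)%:R; (i == 1%N)%:R; (j == 0%N)%:R; (j == 1%N)%:R; (j == 2%N)%:R]).
  have Xy n : (n < 3)%N -> Xc y n = (i == n)%:R.
    rewrite {}/y; case: n => [|[|[|//]]] _; rewrite /Xc /= !c5_mk //=.
    by case: i i3 => [|[|[|//]]] _; case: j j3 => [|[|[|//]]] _ /=; ring.
  have Yy n : (n < 3)%N -> Yc y n = (j == n)%:R.
    by rewrite /y; case: n => [|[|[|//]]] _; rewrite /Yc /= !c5_mk.
  rewrite -(H y) /dsegre !big_ord_recl !big_ord0 !Xy // !Yy // {Xy Yy y}.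
  by case: i i3 => [|[|[|//]]] _; case: j j3 => [|[|[|//]]] _; rewrite /qf /=; ring.
pose w := Xc z 1 * Xc z 2.
have Y j : (j < 3)%N -> Yc z ((j + 1) %% 3) * Yc z ((j + 2) %% 3) = w.
  by move=> j3; have /eqP := H 0%N j isT j3; rewrite subr_eq0 => /eqP /= <-.
have X i : (i < 3)%N -> Xc z ((i + 1) %% 3) * Xc z ((i + 2) %% 3) = w.
  by move=> i3; have /eqP := H i 0%N i3 isT; rewrite subr_eq0 => /eqP ->; apply: Y.
rewrite /dsegre !big_ord_recl !big_ord0 !X // !Y //.
rewrite !addr0 -!mulrDl -mulrBl; apply/eqP; rewrite mulf_eq0 subr_eq0; apply/orP; left; apply/eqP.
by have := frame_linear y; rewrite -!(addrA _ (Xc y 1)) -!(addrA _ (Yc y 1)).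
Qed.

End SegreGradient.

Section SmoothLocus.
Variables (K : fieldType) (L : closedFieldType) (iota : {rmorphism K -> L}).
Hypothesis char0 : [pchar K] =i pred0.
Variable X : ten_nodal_cubic iota.
Variables (h : 'M[L]_5) (k : L).
Hypotheses (uh : h \in unitmx) (k0 : k != 0).
Hypothesis E : forall v, peval iota (cubic_form X) v = k * segre_cubic (v *m h).
Let c0L := pchar0_ext iota char0.

(** Evaluating the cubic at [v + w] and [v - w] isolates the term linear in [w]. *)
Lemma tri6_segre v w : tri6 X v v w = 2%:R * k * dsegre (v *m h) (w *m h).
Proof.
have n2 := natr_neq0 c0L 1; have n3 := natr_neq0 c0L 2.
have C s : tri6 X (v + s *: w) (v + s *: w) (v + s *: w) = 6%:R * (k * segre_cubic (v *m h + s *: (w *m h))).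
  by rewrite tri6_cube E mulmxDl -scalemxAl.
have Cw : tri6 X w w w = 6%:R * (k * segre_cubic (w *m h)) by rewrite tri6_cube E.
have := C 1; have := C (-1).
rewrite !(tri_cube (@tri6C _ _ _ X) (@tri6C' _ _ _ X) (@tri6L _ _ _ X)) !segre_quad Cw.
move: (tri6 _ v v v) (tri6 _ v v w) (tri6 _ v w w) => a b c C2 C1.
apply: (mulfI (mulf_neq0 n2 n3)); apply/eqP; rewrite -subr_eq0; apply/eqP.
move/eqP: C1; rewrite -subr_eq0 => /eqP C1; move/eqP: C2; rewrite -subr_eq0 => /eqP C2.
by rewrite -[RHS](subr0 0) -{1}C1 -C2; ring.
Qed.

Lemma smooth_locusP x : smooth_locus X x <-> smooth (val x.1 *m h).
Proof.
have n2 := natr_neq0 c0L 1.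
have on : on_cubic iota (cubic_form X) x <-> segre_cubic (val x.1 *m h) = 0.
  rewrite /on_cubic pevalE E; split=> [/eqP|->]; last by rewrite mulr0.
  by rewrite mulf_eq0 (negPf k0) => /eqP.
have si : singular_pt iota (cubic_form X) x <-> forall i j, (i < 3)%N -> (j < 3)%N -> qf (val x.1 *m h) i j = 0.
  rewrite singularP // -dsegre_smooth; split=> [S y|S w].
    have := S (y *m invmx h); rewrite tri6_segre mulmxKV // => /eqP.
    by rewrite !mulf_eq0 (negPf n2) (negPf k0) => /eqP.
  by rewrite tri6_segre S mulr0.
split=> [[/on o1 n]|[/on o1 [i [j [i3 j3 q]]]]]; split=> //.
  apply: contrapT => nq; apply/n/si => i j i3 j3; apply/eqP/negbNE/negP => q; apply: nq; by exists i, j.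
by move/si/(_ i j i3 j3) => e; rewrite e eqxx in q.
Qed.

Lemma peval_gal (s : galois iota) (G : {mpoly K[5]}) (v : 'rV[L]_5) : peval iota G (map_mx s v) = s (peval iota G v).
Proof.
rewrite /peval /mmap rmorph_sum; apply: eq_bigr => m _.
rewrite rmorphM gal_iota; congr (_ * _).
by rewrite /mmap1 rmorph_prod; apply: eq_bigr => i _; rewrite rmorphXn mxE.
Qed.

Lemma segre_galois (s : galois iota) (v : 'rV[L]_5) : segre_cubic (v *m h) = 0 -> segre_cubic (map_mx s v *m h) = 0.
Proof. by move=> v0; apply: (mulfI k0); rewrite -E peval_gal E v0 !mulr0 rmorph0. Qed.

End SmoothLocus.

(** * Extraction of the data of a universal torsor, and conclusion *)

Section UniversalTorsor.
Variables (K : fieldType) (L : closedFieldType) (iota : {rmorphism K -> L}).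
Hypothesis char0 : [pchar K] =i pred0.
Variables (X : ten_nodal_cubic iota) (T : variety iota).
Variable p : amb L (vn T) (vr T) -> amb L 4 0.
Variable act : (Pic (smooth_locus X) -> L) -> amb L (vn T) (vr T) -> amb L (vn T) (vr T).
Local Notation VV := (smooth_locus X : amb L 4 0 -> Prop).

(** Over an etale neighbourhood of the common image, both points are translates of the same value of
    the section; the quotient of the two torus points carries one to the other. *)
Lemma torsor_transitive : is_torsor (V := smooth_locus X) p act -> forall z z', T z -> T z' -> p z = p z' ->
  exists2 t, torus_point t & z' = act t z.
Proof.
move=> H z z' Tz Tz' pz; have [pV _ _] := torsor_reg H.
have [d [e [P [Q [_ _ [y Wy] [tau [delta [[tT _ _] _ _ td _]]]]]]]] := torsor_loc_trivial H (pV _ Tz).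
have key x : T x -> p x = p z -> torus_point (delta (ext x y)) /\ act (delta (ext x y)) (tau (ext (p z) y)) = x.
  move=> Tx px; have E : pullback_pt (V := smooth_locus X) p (ext x y) = ext (p z) y.
    by rewrite /pullback_pt base_ext px /= row_mxKr.
  have := td (ext x y); rewrite E base_ext; apply; split; first by rewrite base_ext.
  by rewrite E.
have [[t0 tM] E1] := key z Tz erefl; have [[u0 uM] E2] := key z' Tz' (esym pz).
have tt : torus_point (fun a => delta (ext z' y) a / delta (ext z y) a).
  split=> [a|a b]; first by rewrite mulf_neq0 ?invr_eq0.
  by rewrite uM tM invfM mulrACA.
exists (fun a => delta (ext z' y) a / delta (ext z y) a) => //.
rewrite -[in X in act _ X]E1 -(torsor_actM H) //; last exact: tT.
by rewrite -{1}E2; congr (act _ _); apply: funext => a; rewrite divfK.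
Qed.

Lemma universal_torsor_data h : h \in unitmx -> (forall v, VV v <-> smooth (val v.1 *m h)) ->
  universal_torsor (V := smooth_locus X) p act ->
  exists W yW tau c f, @torsor_data L h VV (vn T) (vr T) T p act W yW tau c f.
Proof.
move=> uh VP [H U].
have exW (v : amb L 4 0) : exists q : (amb L 4 (0 + 1) -> Prop) * L * (amb L 4 (0 + 1) -> amb L (vn T) (vr T)),
  VV v -> [/\ exists d e P Q, [/\ form d P, form e Q & q.1.1 = std_etale VV P Q], q.1.1 (ext v (const_mx q.1.2)),
    reg_map idfun q.1.1 T q.2 & forall w, q.1.1 w -> p (q.2 w) = base w].
  have [Vv|nV] := pselect (VV v); last by exists (fun=> True, 0, fun=> (mkp (const_mx 1), 0)).
  have [d [e [P [Q [fP fQ [y Wy] [tau [delta [rt pt _ _ _]]]]]]]] := torsor_loc_trivial H Vv.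
  exists (std_etale VV P Q, y 0 0, tau) => _; split=> //; first by exists d, e, P, Q.
  by rewrite /= (_ : const_mx (y 0 0) = y) //; apply/rowP => i; rewrite mxE ord1.
have [q Hq] := choice exW.
have exc a : exists cf : cocycle VV * (amb L 4 0 -> amb L (vn T) (vr T) -> L), cl cf.1 = a /\
    (forall x, VV x -> let Tx := fun z => T z /\ nbh cf.1 x (p z) in
       [/\ reg_fun idfun Tx (cf.2 x), forall z, Tx z -> cf.2 x z != 0
         & forall t z, torus_point t -> Tx z -> cf.2 x (act t z) = t a * cf.2 x z]) /\
    (forall x y z, VV x -> VV y -> T z -> nbh cf.1 x (p z) -> nbh cf.1 y (p z) ->
       cf.2 y z = trf cf.1 x y (p z) * cf.2 x z).
  by have [c ca [f Hf]] := U a; exists (c, f); split.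
have [cf Hcf] := choice exc.
exists (fun v => (q v).1.1), (fun v => (q v).1.2), (fun v => (q v).2), (fun a => (cf a).1), (fun a => (cf a).2).
have rp := torsor_reg H; have [pV _ _] := rp.
split=> //.
- by apply: reg_map_of => // x Tx; apply: regm_at_map; apply: regm_at_of rp Tx.
- exact: (torsor_act_reg H).
- exact: (torsor_act_over H).
- exact: (torsor_actM H).
- exact: (torsor_transitive H).
- by move=> v /Hq[].
- by move=> v /Hq[].
- by move=> v /Hq[].
- by move=> v w /Hq[_ _ _ E]; apply: E.
- by move=> a; case: (Hcf a).
- by move=> a x Vx; case: (Hcf a) => _ [/(_ x Vx)[]].
- by move=> a x z Vx Tz nz; case: (Hcf a) => _ [/(_ x Vx)[_ f0 _] _]; apply: f0.
- by move=> a x t z Vx tt Tz nz; case: (Hcf a) => _ [/(_ x Vx)[_ _ fa] _]; apply: fa.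
by move=> a x y z Vx Vy Tz n1 n2; case: (Hcf a) => _ [_ E]; apply: E.
Qed.

End UniversalTorsor.

Theorem corollary7p3 (K : fieldType) (L : closedFieldType) (iota : {rmorphism K -> L})
    (char0 : [pchar K] =i pred0) (algL : forall x : L, algebraicOver iota x)
    (X : ten_nodal_cubic iota) (T : variety iota)
    (p : amb L (vn T) (vr T) -> amb L 4 0)
    (act : (Pic (smooth_locus X) -> L) -> amb L (vn T) (vr T) -> amb L (vn T) (vr T)) :
  universal_torsor (V := smooth_locus X) p act ->
  exists (Y E : variety iota) (pi : amb L (vn E) (vr E) -> amb L (vn Y) (vr Y)),
    [/\ grass26_form Y, line_bundle pi & birational T E].
Proof.
move=> UT; have c0L := pchar0_ext iota char0; have [h [k [uh k0 Eh]]] := frame_exists char0 X.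
have VP := smooth_locusP char0 uh k0 Eh.
have [W [yW [tau [c [f H]]]]] := universal_torsor_data uh VP UT.
have T_gal (s : galois iota) z : T z -> T (gal_pt s z) by apply: gal_stable.
have p_gal (s : galois iota) z : T z -> p (gal_pt s z) = gal_pt s (p z).
  by have [[rp _ _ _ _ _ _] _] := UT; apply: (reg_map_gal _ rp) => x; apply: gal_stable.
have [N [Q [Em [d [H0 [F [[fH0 fF] H0P FE QE]]]]]]] :=
  descended_plucker H c0L char0 algL T_gal p_gal (@segre_galois _ _ iota X h k k0 Eh).
have cj := cone_conj c0L T_gal fH0 H0P FE.
(* If all coordinates vanished identically, [QE] would make every Pluecker vector zero. *)
have [j0 j0P] : exists j0, exists o, (pv o *m Q) 0 j0 != 0.
  apply: contrapT => nj; have [op _ pn] := @pl_nonzero L 0 1 isT isT isT.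
  suff e : pv op = 0.
    move/eqP: pn; apply; have := congr1 (fun M => me M (inord 0) (inord 1)) e.
    by rewrite pvE !inordK // => ->; rewrite /me mxE.
  rewrite -(QE op) (_ : pv op *m Q = 0) ?mul0mx //; apply/rowP => j; rewrite [RHS]mxE.
  by apply/eqP/negbNE/negP => n; apply: nj; exists j, op.
have C_gal (s : galois iota) w : cone Q w -> cone Q (gal_pt s w) := @gal_stable _ _ _ s (Econe char0 algL QE cj) w.
exists (Ycone char0 algL QE cj), (Econe char0 algL QE cj), (@base L N 0 1); split.
- exact: grass_cone.
- exact: line_cone.
have [U [V [oU dU oV dV fi]]] := cone_birational c0L char0 algL T_gal fH0 fF H0P FE QE j0P C_gal.
by exists U, V, (ff iota H0 F j0).
Qed.
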